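(* For small $d>0$ let $\phi_d\in H^1_0(\Omega)$ be the unique solution of $$\Delta\phi_d=0\ \text{in }\mathcal F^d,\qquad \phi_d=1\ \text{on }\partial S^d,\qquad \phi_d=0\ \text{on }\partial\Omega,$$ extended to $\Omega$ by $\phi_d=1$ in $S^d$. Define $\widetilde\phi_d$ on $A^{\mathrm{tr}}=A^d(dr_0,1)$ by $$\widetilde\phi_d(x)=\begin{cases}\dfrac{\pi-\arg(x-x_L)}{\theta_L}&\text{in }A^{\mathrm{tr}}_L,\\[2mm] \dfrac{\arg(x-x_R)}{\theta_R}&\text{in }A^{\mathrm{tr}}_R.\end{cases}$$ Then, as $d\to0$, $$\|\widetilde\phi_d\|^2_{\dot H^1(A^{\mathrm{tr}})}=(\theta_L^{-1}+\theta_R^{-1})|\log(d)|+\mathcal O(1),$$ $$\|\phi_d-\widetilde\phi_d\|^2_{\dot H^1(A^{\mathrm{tr}})}=\mathcal O(1),\qquad \|\phi_d\|^2_{\dot H^1(\Omega\setminus A^{\mathrm{tr}})}=\mathcal O(1).$$ In particular $$\|\phi_d\|^2_{\dot H^1(\Omega)}=(\theta_L^{-1}+\theta_R^{-1})|\log(d)|+\mathcal O(1).$$ Additionally, $\|\phi_d\|^2_{L^2(\Omega)}=\mathcal O(1)$.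
   Context: Geometry. Points are $x=(x_1,x_2)\in\mathbb R^2$, $(e_1,e_2)$ is the canonical basis, $B(0,\rho)$ is the disc of radius $\rho$ centered at the origin $O$. $\Omega\subset\mathbb R^2$ is a smooth, bounded, connected domain with flat boundary near $O\in\partial\Omega$: $[-2,2]\times\{0\}\subset\partial\Omega$, with $\Omega$ locally lying in $\{x_2>0\}$. $S^0$ is a simply connected bounded inclusion (open set) with Lipschitz boundary, with a tip at its lowest extremity, located at $O$; near the tip its boundary consists of two straight segments of length at least two, given in polar coordinates by $\theta=\theta_R$ and $\theta=\pi-\theta_L$, with $S^0$ locally the region $\theta_R<\theta<\pi-\theta_L$, where $\theta_L,\theta_R\in(0,\pi)$ and $\theta_R<\pi-\theta_L$. For $d>0$ small, $S^d:=de_2+S^0$, whose closure is contained in $\Omega$, and $\mathcal F^d:=\Omega\setminus\overline{S^d}$. The closure of $S^0$ meets $\partial\Omega$ only at $O$. Let $\mathcal C$ be the closed infinite sector $\{\theta_R\le\theta\le\pi-\theta_L\}$ (vertex $O$), $G^d(\rho):=(B(0,\rho)\cap\{x_2>0\})\setminus(de_2+\mathcal C)$, and $A^d(\rho_1,\rho_2):=G^d(\rho_2)\setminus\overline{G^d(\rho_1)}$ for $0<\rho_1<\rho_2$. It is assumed that for $\rho\le2$ one has $G^d(\rho)\subset\mathcal F^d$ and the upper and lower boundaries of $G^d(\rho)$ coincide with those of $S^d$ and $\Omega$ respectively. Set $x_L=(d\cot\theta_L,0)$, $x_R=(-d\cot\theta_R,0)$, $r_0:=2\max(1,|\cot\theta_L|,|\cot\theta_R|)$.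 The set $A^{\mathrm{tr}}:=A^d(dr_0,1)$ has two connected components, the left one $A^{\mathrm{tr}}_L$ and the right one $A^{\mathrm{tr}}_R$. Conventions. $\arg\in[0,\pi]$ is the polar angle in the upper half-plane. $\|f\|_{\dot H^1(U)}=\|\nabla f\|_{L^2(U)}$. $\Omega$ and $S^0$ are fixed; $\mathcal O(1)$ denotes a quantity bounded uniformly in $d$ as $d\to0$. *)

(* Defs.v *)
From HB Require Import structures.
From mathcomp Require Import all_boot all_order all_algebra.
From mathcomp Require Import all_classical all_reals all_analysis.

Set Implicit Arguments.
Unset Strict Implicit.
Unset Printing Implicit Defensive.

Import Order.TTheory GRing.Theory Num.Theory.
Import numFieldNormedType.Exports.

Local Open Scope classical_set_scope.
Local Open Scope ring_scope.

Section PlaneGeometry.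
Context {R : realType}.
Implicit Types (x : R * R) (D S : set (R * R)).

(* The library norm on R * R is the sup norm (same topology). *)
Definition enorm x : R := Num.sqrt (x.1 ^+ 2 + x.2 ^+ 2).
Definition disc (rho : R) : set (R * R) := [set x | enorm x < rho].
Definition polar (r t : R) : R * R := (r * cos t, r * sin t).

(* The polar angle in [0, pi] of a nonzero point of the closed upper
   half-plane. *)
Definition arg x : R := acos (x.1 / enorm x).

Definition frontier D : set (R * R) := closure D `\` interior D.

(* Near each boundary point p, in orthonormal coordinates centered at p with
   axes (c, s) and (- s, c), D is the strict epigraph of a function g in the
   class P. *)
Definition graph_boundary (P : (R -> R) -> Prop) D : Prop :=
  forall p, frontier D p ->
  exists (c s a b : R) (g : R -> R),
    [/\ c ^+ 2 + s ^+ 2 = 1, 0 < a, 0 < b, P g &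
      forall u v : R, `|u| < a -> `|v| < b ->
        (D (p.1 + u * c - v * s, p.2 + u * s + v * c) <-> g u < v)].

Definition smooth_boundary D : Prop :=
  graph_boundary (fun g => forall n (t : R), derivable (derive1n n g) t 1) D.

Definition lipschitz_boundary D : Prop :=
  graph_boundary (fun g => lipschitz g) D.

Definition simply_connected S : Prop :=
  connected S /\
  forall gamma : R -> R * R,
    {within `[0, 1], continuous gamma} ->
    (forall t : R, 0 <= t <= 1 -> S (gamma t)) -> gamma 0 = gamma 1 ->
    exists H : R * R -> R * R,
      [/\ {within `[0, 1] `*` `[0, 1], continuous H},
          forall s t : R, 0 <= s <= 1 -> 0 <= t <= 1 -> S (H (s, t)),
          forall t : R, 0 <= t <= 1 -> H (0, t) = gamma t,
          forall t : R, 0 <= t <= 1 -> H (1, t) = gamma 0 &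
          forall s : R, 0 <= s <= 1 -> H (s, 0) = gamma 0 /\ H (s, 1) = gamma 0].

End PlaneGeometry.

Section Sobolev.
Context {R : realType}.
Implicit Types (u f : R * R -> R) (D U S : set (R * R)).

Definition leb2 := (@lebesgue_measure R \x @lebesgue_measure R)%E.

Definition e1 : R * R := (1, 0).
Definition e2 : R * R := (0, 1).

(* C^oo: every iterated directional derivative exists and is continuous. *)
Definition smooth f : Prop :=
  forall s : seq (R * R),
    let h := foldr (fun v k x => 'D_v k x) f s in
    continuous h /\ forall x v, derivable h x v.

(* C_c^oo(D), each function being extended by 0 to the whole plane. *)
Definition test_fun D f : Prop :=
  smooth f /\
  exists K, [/\ compact K, K `<=` D & forall x, ~ K x -> f x = 0].

Definition loc_integrable D f : Prop :=
  forall K, compact K -> K `<=` D -> leb2.-integrable K (EFin \o f).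

Definition weak_gradient D u (g1 g2 : R * R -> R) : Prop :=
  [/\ loc_integrable D u, loc_integrable D g1, loc_integrable D g2 &
   forall psi, test_fun D psi ->
     (\int[leb2]_(x in D) (u x * 'D_e1 psi x))
       = - (\int[leb2]_(x in D) (g1 x * psi x)) /\
     (\int[leb2]_(x in D) (u x * 'D_e2 psi x))
       = - (\int[leb2]_(x in D) (g2 x * psi x))].

(* The square of the L^2(U) norm of the weak gradient of u on the open set D,
   for U included in D. Weak gradients agree almost everywhere on D, so the set
   below has at most one element; its infimum is +oo if u has no weak gradient
   on D. *)
Definition grad_normsq D U u : \bar R :=
  ereal_inf [set e | exists g1 g2, weak_gradient D u g1 g2 /\
    e = (\int[leb2]_(x in U) (g1 x ^+ 2 + g2 x ^+ 2)%:E)%E].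

Definition L2_normsq U u : \bar R := (\int[leb2]_(x in U) (u x ^+ 2)%:E)%E.

Definition H1 D u : Prop :=
  [/\ measurable_fun D u,
      (L2_normsq D u < +oo)%E & (grad_normsq D D u < +oo)%E].

(* The closure of C_c^oo(D) in H^1(D). *)
Definition H10 D u : Prop :=
  H1 D u /\
  exists psi : nat -> R * R -> R,
    (forall n, test_fun D (psi n)) /\
    ((fun n => L2_normsq D (psi n \- u)%R + grad_normsq D D (psi n \- u)%R)%E
       @ \oo --> 0%E).

Definition weakly_harmonic D u : Prop :=
  forall psi, test_fun D psi ->
    (\int[leb2]_(x in D)
       (u x * ('D_e1 ('D_e1 psi) x + 'D_e2 ('D_e2 psi) x))) = 0.

(* Boundary values are taken in the Sobolev sense: u = 1 on the boundary of S
   and u = 0 on the boundary of Omega means that u - eta is in H^1_0 of the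
   fluid domain for a smooth eta equal to 1 near closure S and to 0 near the
   boundary of Omega. The extension by 1 is stated on closure S, whose boundary
   is Lebesgue-null. *)
Definition potential (Omega S : set (R * R)) u : Prop :=
  let F := Omega `\` closure S in
  [/\ H10 Omega u, weakly_harmonic F u,
      exists eta V, [/\ test_fun Omega eta, open V, closure S `<=` V,
        forall x, V x -> eta x = 1 & H10 F (u \- eta)] &
      {ae leb2, forall x, closure S x -> u x = 1}].

End Sobolev.

Section Setting.
Context {R : realType}.
Variables (thetaL thetaR : R).
Implicit Types (d rho : R) (D : set (R * R)).

Definition cot (t : R) : R := cos t / sin t.

Definition sector : set (R * R) :=
  [set x | exists r t, [/\ 0 <= r, thetaR <= t <= pi - thetaL & x = polar r t]].

Definition open_sector : set (R * R) :=
  [set x | exists r t, [/\ 0 < r, thetaR < t < pi - thetaL & x = polar r t]].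

(* d e_2 + D *)
Definition raise d D : set (R * R) := [set (x.1, x.2 + d) | x in D].

Definition gap d rho : set (R * R) :=
  (disc rho `&` [set x | 0 < x.2]) `\` raise d sector.

Definition annulus d rho1 rho2 : set (R * R) :=
  gap d rho2 `\` closure (gap d rho1).

Definition xL d : R * R := (d * cot thetaL, 0).
Definition xR d : R * R := (- (d * cot thetaR), 0).
Definition r0 : R := 2 * Num.max 1 (Num.max `|cot thetaL| `|cot thetaR|).

Definition Atr d : set (R * R) := annulus d (d * r0) 1.

(* The left (right) connected component of Atr is the one adherent to (-1, 0)
   (to (1, 0)). *)
Definition AtrL d : set (R * R) :=
  [set x | Atr d x /\ closure (connected_component (Atr d) x) (-1, 0)].
Definition AtrR d : set (R * R) :=
  [set x | Atr d x /\ closure (connected_component (Atr d) x) (1, 0)].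

(* Only the values on Atr matter. *)
Definition phit d (x : R * R) : R :=
  if `[< AtrL d x >] then (pi - arg (x - xL d)) / thetaL
  else if `[< AtrR d x >] then arg (x - xR d) / thetaR
  else 0.

(* The upper and lower parts of the boundary of gap d rho are only required to
   be contained in the boundaries of the raised inclusion and of Omega. *)
Record setting (Omega S0 : set (R * R)) : Prop := Setting {
  Omega_open : open Omega;
  Omega_connected : connected Omega;
  Omega_bounded : bounded_set Omega;
  Omega_smooth : smooth_boundary Omega;
  Omega_flat : forall t : R, -2 <= t <= 2 -> frontier Omega (t, 0);
  Omega_above : exists2 eps : R, 0 < eps &
    Omega `&` disc eps `<=` [set x | 0 < x.2];
  S0_open : open S0;
  S0_simply_connected : simply_connected S0;
  S0_bounded : bounded_set S0;
  S0_lipschitz : lipschitz_boundary S0;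
  thetaL_bounds : 0 < thetaL < pi;
  thetaR_bounds : 0 < thetaR < pi;
  tip_angle : thetaR < pi - thetaL;
  S0_lowest : forall x, S0 x -> 0 <= x.2;
  S0_sides : forall r : R, 0 <= r <= 2 ->
    frontier S0 (polar r thetaR) /\ frontier S0 (polar r (pi - thetaL));
  S0_tip : exists2 eps : R, 0 < eps &
    S0 `&` disc eps = open_sector `&` disc eps;
  S0_contact : closure S0 `&` frontier Omega = [set (0, 0)];
  Sd_inside : \forall d \near 0^'+, closure (raise d S0) `<=` Omega;
  gap_inside : \forall d \near 0^'+, forall rho, 0 < rho <= 2 ->
    [/\ gap d rho `<=` Omega `\` closure (raise d S0),
        frontier (gap d rho) `&` disc rho `&` [set x | 0 < x.2]
          `<=` frontier (raise d S0) &
        frontier (gap d rho) `&` disc rho `&` [set x | x.2 = 0]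
          `<=` frontier Omega] }.

End Setting.

(* An extended real-valued X d which is O(1) as d -> 0+; in particular X d is
   finite for small d. *)
Definition bigO1 {R : realType} (X : R -> \bar R) : Prop :=
  exists M : R, \forall d \near 0^'+, (`|X d| <= M%:E)%E.

(* Main.v *)
From HB Require Import structures.
Require Import Defs.
From mathcomp Require Import all_boot all_order all_algebra.
From mathcomp Require Import all_classical all_reals all_analysis.
From mathcomp Require Import measurable_realfun ring lra.

(** The gap under the raised inclusion is, on the left (s = 1) and on the right
    (s = -1), a wedge between the flat boundary and a side of the tip. Let theta_s be
    its opening. The angle at its vertex divided by theta_s is harmonic, 0 on the axis
    and 1 on the side of the tip: this is [phit], written [ang] with the arctangent.
    Its energy density is the inverse square of theta_s times the distance to the
    vertex, and integrates to 1 / (theta_s y) on the horizontal slice at height y. So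
    the energy between the heights d and 1 is exactly |ln d| / theta_s
    ([integral_band_energy]), and the theorem says that nothing else counts.

    The potential u is compared with two explicit objects.

    - A smooth competitor Phi ([competitor]), which is 1 near the raised inclusion and
      has a compact support in the domain. Near the tip it is the product of the two
      angles, each truncated near 0 and near 1 by a smooth ramp with a transition of
      width d ^+ 2; elsewhere it is a fixed cutoff function.

    - A field X ([tip_field]) which is divergence free in the fluid: in each wedge,
      the gradient of the angle weighted by a radial cutoff. This gradient is a
      rotation field around the vertex, hence a radial weight keeps it divergence free
      ([calibration]).

    The gradient of Phi and X are equal near the tip except on a bad set of area
    O(d ^+ 2), where both are O(1 / d): the part of the gap under the tip, of diameter
    O(d), and the layers where an angle is truncated, of width O(d ^+ 2). At a distance
    from the tip both are O(1). So Z = grad Phi - X is bounded in L^2, and so is the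
    integral of X.Z ([close_bounds], [int_le_majorant]).

    The function u - Phi is in H^1_0 of the fluid; let w be its gradient. Harmonicity
    of u makes w orthogonal to grad u = X + Z + w, and X is orthogonal to w, being
    divergence free. Hence |w|^2 is the integral of - Z.w, and w is bounded in L^2 by Z
    ([energy_comparison]).

    In sum grad u = X + O(1) in L^2. On the region of the statement X is the gradient
    of [phit] up to a difference of bounded energy, and outside of it X itself has a
    bounded energy. The energy of X is the announced main term up to O(1)
    ([energy_tip_field]). For that of u, the cross term of X with Z + w has to be O(1)
    too, which the Cauchy-Schwarz inequality does not give; but X.w has integral 0, and
    X.Z is only nonzero where it is harmless. The mean square of u is bounded by the
    Poincare inequality for u - Phi.

    The remaining work is geometric ([tip_geometry], [phit_ang]): near the origin the
    domain is the half-plane and the inclusion a sector, and the two components of the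
    region, told apart by the points adherent to them, are the two wedges. *)

Set Implicit Arguments.
Unset Strict Implicit.
Unset Printing Implicit Defensive.

Import Order.TTheory GRing.Theory Num.Theory.
Import numFieldNormedType.Exports.

Local Open Scope classical_set_scope.
Local Open Scope ring_scope.

(** * Smooth functions on the plane *)

Section DeriveProjections.
Context {R : realType} {V : normedModType R}.
Implicit Types (f : V -> R) (x v : V).

Lemma is_derive_ex f x v (a : R) : is_derive x v f a -> derivable f x v.
Proof. by case. Qed.

Lemma is_derive_val f x v (a : R) : is_derive x v f a -> 'D_v f x = a.
Proof. by case. Qed.

(** Along a line, a function on a normed space is a function of one variable:
    this is how the chain rule below reduces to the one on the line. *)
Lemma derive_line f x v : 'D_v f x = 'D_1 (fun t : R => f (t *: v + x)) 0.
Proof.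
rewrite /derive; set g1 := fun h => _; set g2 := fun h => _.
suff -> : g1 = g2 by [].
by apply/funext => t; rewrite /g1 /g2/= addr0 scale0r add0r [_%:A]mulr1.
Qed.

End DeriveProjections.

Section SmoothCalculus.
Context {R : realType}.
Implicit Types (f g : R * R -> R) (U V : set (R * R)) (v x : R * R).

(** Directional derivatives are taken in all directions, as in [smooth], but only
    at the points of a set: the angular functions are singular on the axis. *)
Fixpoint Ck (n : nat) U f : Prop :=
  (forall x, U x -> {for x, continuous f}) /\
  (if n is m.+1 then (forall x v, U x -> derivable f x v) /\
                     forall v, Ck m U ('D_v f)
   else True).

Definition Cinf U f := forall n, Ck n U f.

Lemma CkSP n U f : Ck n.+1 U f <->
  [/\ (forall x, U x -> {for x, continuous f}),
      (forall x v, U x -> derivable f x v) & forall v, Ck n U ('D_v f)].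
Proof. by split=> [[cf [df Df]]|[cf df Df]]; split. Qed.

Lemma Ck_continuous n U f : Ck n U f -> forall x, U x -> {for x, continuous f}.
Proof. by case: n => [|n] []. Qed.

Lemma Ck_derivable n U f : Ck n.+1 U f -> forall x v, U x -> derivable f x v.
Proof. by move=> /CkSP[]. Qed.

Lemma Ck_derive n U f v : Ck n.+1 U f -> Ck n U ('D_v f).
Proof. by move=> /CkSP[_ _]; apply. Qed.

Lemma CkS n U f : Ck n.+1 U f -> Ck n U f.
Proof.
elim: n f => [|n IH] f /CkSP[cf df Df]; first by split.
by apply/CkSP; split=> // v; apply: IH.
Qed.

Lemma Ck_sub n U V f : V `<=` U -> Ck n U f -> Ck n V f.
Proof.
move=> VU; elim: n f => [|n IH] f; first by move=> [cf _]; split=> // x /VU /cf.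
move=> /CkSP[cf df Df]; apply/CkSP; split=> [x /VU /cf //|x v /VU|v].
  exact: df.
exact: IH.
Qed.

Lemma eq_derive_open U f g v : open U -> (forall x, U x -> f x = g x) ->
  forall x, U x -> 'D_v f x = 'D_v g x.
Proof.
move=> oU fg x Ux; apply: near_eq_derive.
by near=> y; apply: fg; near: y; exact: open_nbhs_nbhs.
Unshelve. all: by end_near. Qed.

Lemma Ck_eq n U f g : open U -> (forall x, U x -> f x = g x) ->
  Ck n U f -> Ck n U g.
Proof.
move=> oU; have cE f' g' : (forall x, U x -> f' x = g' x) ->
    (forall x, U x -> {for x, continuous f'}) ->
    forall x, U x -> {for x, continuous g'}.
  move=> fg cf x Ux; rewrite /prop_for /continuous_at -(fg _ Ux).
  apply: cvg_trans (cf _ Ux); apply: near_eq_cvg.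
  have oUx : \forall y \near x, U y by exact: open_nbhs_nbhs.
  by near=> y; apply/fg; near: y.
elim: n f g => [|n IH] f g fg; first by move=> [cf _]; split=> //; exact: cE cf.
move=> /CkSP[cf df Df]; apply/CkSP; split=> [||v]; first exact: cE cf.
  move=> x v Ux; apply: (near_eq_derivable _ (df x v Ux)).
  by near=> y; apply: fg; near: y; exact: open_nbhs_nbhs.
by apply: IH (Df v); exact: eq_derive_open.
Unshelve. all: by end_near. Qed.

Lemma Ck_local n U f :
  (forall x, U x -> exists V, [/\ open V, V x & Ck n V f]) -> Ck n U f.
Proof.
elim: n f => [|n IH] f loc.
  by split=> // x /loc[V [_ Vx []]] + _; apply.
apply/CkSP; split=> [x /loc[V [_ Vx /Ck_continuous]]|
  x v /loc[V [_ Vx /Ck_derivable]]|v]; [exact|exact|].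
by apply: IH => x /loc[V [oV Vx /Ck_derive]]; exists V; split.
Qed.

Lemma Ck_cst n U (c : R) : Ck n U (fun=> c).
Proof.
elim: n c => [|n IH] c; first by split=> // x _; exact: cst_continuous.
apply/CkSP; split=> [x _|x v _|v]; [exact: cst_continuous|exact: derivable_cst|].
rewrite (_ : 'D_v _ = fun=> 0) //.
by apply/funext => x; rewrite derive_cst.
Qed.

Lemma is_derive_fst (x v : R * R) : is_derive x v (@fst R R) v.1.
Proof.
suff H : (fun h : R => h^-1 *: ((@fst R R \o shift x) (h *: v) - x.1)) y @[y --> 0^']
   --> (v.1 : R).
  by split; [apply/cvg_ex; exists v.1|apply/cvg_lim].
apply: (@cvg_trans _ (cst v.1 y @[y --> (0:R)^'])); last exact: cvg_cst.
apply: near_eq_cvg; near=> h => /=.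
rewrite addrK scalerA mulVf ?scale1r//; near: h; exact: nbhs_dnbhs_neq.
Unshelve. all: by end_near. Qed.

Lemma is_derive_snd (x v : R * R) : is_derive x v (@snd R R) v.2.
Proof.
suff H : (fun h : R => h^-1 *: ((@snd R R \o shift x) (h *: v) - x.2)) y @[y --> 0^']
   --> (v.2 : R).
  by split; [apply/cvg_ex; exists v.2|apply/cvg_lim].
apply: (@cvg_trans _ (cst v.2 y @[y --> (0:R)^'])); last exact: cvg_cst.
apply: near_eq_cvg; near=> h => /=.
rewrite addrK scalerA mulVf ?scale1r//; near: h; exact: nbhs_dnbhs_neq.
Unshelve. all: by end_near. Qed.

Lemma Ck_fst n U : Ck n U fst.
Proof.
have cfst (x : R * R) : {for x, continuous (@fst R R)} by case: x => a b; exact: cvg_fst.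
case: n => [|n]; first by split=> // x _; exact: cfst.
apply/CkSP; split=> [x _|x v _|v]; [exact: cfst|exact: (is_derive_ex (is_derive_fst x v))|].
rewrite (_ : 'D_v _ = fun=> v.1); first exact: Ck_cst.
by apply/funext => x; exact: (is_derive_val (is_derive_fst x v)).
Qed.

Lemma Ck_snd n U : Ck n U snd.
Proof.
have csnd (x : R * R) : {for x, continuous (@snd R R)} by case: x => a b; exact: cvg_snd.
case: n => [|n]; first by split=> // x _; exact: csnd.
apply/CkSP; split=> [x _|x v _|v]; [exact: csnd|exact: (is_derive_ex (is_derive_snd x v))|].
rewrite (_ : 'D_v _ = fun=> v.2); first exact: Ck_cst.
by apply/funext => x; exact: (is_derive_val (is_derive_snd x v)).
Qed.

Lemma Ck_add n U f g : open U -> Ck n U f -> Ck n U g ->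
  Ck n U (fun x => f x + g x).
Proof.
move=> oU; elim: n f g => [|n IH] f g.
  move=> [cf _] [cg _].
  by split=> // x Ux; apply: continuousD; [exact: cf|exact: cg].
move=> /CkSP[cf df Df] /CkSP[cg dg Dg]; apply/CkSP; split=> [x Ux|x v Ux|v].
- by apply: continuousD; [exact: cf|exact: cg].
- by apply: derivableD; [exact: df|exact: dg].
- apply: (@Ck_eq _ _ (fun x => 'D_v f x + 'D_v g x)) => //; last exact: IH.
  by move=> x Ux; exact/esym/(deriveD (df x v Ux) (dg x v Ux)).
Qed.

Lemma Ck_mul n U f g : open U -> Ck n U f -> Ck n U g ->
  Ck n U (fun x => f x * g x).
Proof.
move=> oU; elim: n f g => [|n IH] f g Cf Cg.
  by split=> // x Ux; apply: continuousM; [exact: (Cf.1)|exact: (Cg.1)].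
have [[cf df Df] [cg dg Dg]] := ((CkSP _ _ _).1 Cf, (CkSP _ _ _).1 Cg).
apply/CkSP; split=> [x Ux|x v Ux|v].
- by apply: continuousM; [exact: cf|exact: cg].
- by apply: derivableM; [exact: df|exact: dg].
- apply: (@Ck_eq _ _ (fun x => f x * 'D_v g x + g x * 'D_v f x)) => //.
    by move=> x Ux; exact/esym/(deriveM (df x v Ux) (dg x v Ux)).
  by apply: Ck_add => //; apply: IH => //; exact: CkS.
Qed.

Lemma Ck_opp n U f : open U -> Ck n U f -> Ck n U (fun x => - f x).
Proof.
move=> oU Cf; apply: (@Ck_eq _ _ (fun x => (-1) * f x)) => //.
  by move=> x _; rewrite mulN1r.
by apply: Ck_mul => //; exact: Ck_cst.
Qed.

Lemma Ck_sub_fun n U f g : open U -> Ck n U f -> Ck n U g ->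
  Ck n U (fun x => f x - g x).
Proof. by move=> oU Cf Cg; apply: Ck_add => //; exact: Ck_opp. Qed.

Lemma Ck_exp n U f k : open U -> Ck n U f -> Ck n U (fun x => f x ^+ k).
Proof.
move=> oU Cf; elim: k => [|k IH]; first exact: Ck_cst.
apply: (@Ck_eq _ _ (fun x => f x * f x ^+ k)) => //; first by move=> x _; rewrite exprS.
exact: Ck_mul.
Qed.

Lemma Ck_inv n U f : open U -> (forall x, U x -> f x != 0) -> Ck n U f ->
  Ck n U (fun x => (f x)^-1).
Proof.
move=> oU f0; elim: n => [|n IH] Cf.
  by split=> // x Ux; apply: continuousV; [exact: f0|exact: (Cf.1)].
have [cf df Df] := (CkSP _ _ _).1 Cf.
apply/CkSP; split=> [x Ux|x v Ux|v].
- by apply: continuousV; [exact: f0|exact: cf].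
- by apply: derivableV; [exact: f0|exact: df].
apply: (@Ck_eq _ _ (fun x => - ((f x)^-1 * (f x)^-1 * 'D_v f x))) => //.
  move=> x Ux; rewrite [RHS](deriveV (f0 _ Ux) (df x v Ux)).
  by rewrite -exprVn expr2 scaleNr.
apply: Ck_opp => //; apply: Ck_mul => //.
by apply: Ck_mul => //; apply: IH; exact: CkS.
Qed.

Lemma is_derive_comp (h : R -> R) f x v (a b : R) :
  is_derive (f x) 1 h a -> is_derive x v f b ->
  is_derive x v (fun y => h (f y)) (a * b).
Proof.
move=> dh df.
have df0 : derivable (fun t : R => f (t *: v + x)) 0 1.
  exact: (@derivable1P _ _ _ f x v).1 (is_derive_ex df).
have Df0 : 'D_1 (fun t : R => f (t *: v + x)) 0 = b.
  by rewrite -derive_line; exact: is_derive_val df.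
have H : is_derive (0 : R) 1 (h \o (fun t : R => f (t *: v + x))) (a * b).
  apply: is_derive1_comp; last by split.
  by rewrite /= scale0r add0r.
split; first exact: (@derivable1P _ _ _ (fun y => h (f y)) x v).2 (is_derive_ex H).
by rewrite derive_line; exact: is_derive_val H.
Qed.

(** For functions of one variable whose successive derivatives have no closed form
    but stay in a family which is stable under differentiation. *)
Lemma Ck_comp_family (F : set (R -> R)) (A : set R) n U f (h : R -> R) :
  open U ->
  (forall k, F k -> exists2 k', F k' & forall t, A t -> is_derive t 1 k (k' t)) ->
  F h -> (forall x, U x -> A (f x)) -> Ck n U f ->
  Ck n U (fun x => h (f x)).
Proof.
move=> oU HF + fA; elim: n h => [|n IH] h Fh Cf.
  have [h' _ dh] := HF _ Fh.
  split=> // x Ux; apply: continuous_comp; first exact: (Cf.1).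
  by apply/differentiable_continuous/derivable1_diffP; have [] := dh _ (fA _ Ux).
have [h' Fh' dh] := HF _ Fh.
have [cf df Df] := (CkSP _ _ _).1 Cf.
have D x v (Ux : U x) := is_derive_comp (dh _ (fA _ Ux))
  (derivableP (df x v Ux)).
apply/CkSP; split=> [x Ux|x v Ux|v].
- apply: continuous_comp; first exact: cf.
  by apply/differentiable_continuous/derivable1_diffP; have [] := dh _ (fA _ Ux).
- exact: is_derive_ex (D x v Ux).
- apply: (@Ck_eq _ _ (fun x => h' (f x) * 'D_v f x)) => //.
    by move=> x Ux; exact/esym/(is_derive_val (D x v Ux)).
  by apply: Ck_mul => //; apply: IH => //; exact: CkS.
Qed.

Lemma Ck_atan n U f : open U -> Ck n U f -> Ck n U (fun x => atan (f x)).
Proof.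
move=> oU; elim: n => [|n IH] Cf.
  split=> // x Ux; apply: continuous_comp; first exact: (Cf.1).
  exact: continuous_atan.
have [cf df Df] := (CkSP _ _ _).1 Cf.
have D x v (Ux : U x) := is_derive_comp (is_derive1_atan (f x))
  (derivableP (df x v Ux)).
apply/CkSP; split=> [x Ux|x v Ux|v].
- apply: continuous_comp; first exact: cf.
  exact: continuous_atan.
- exact: is_derive_ex (D x v Ux).
apply: (@Ck_eq _ _ (fun x => (1 + f x ^+ 2)^-1 * 'D_v f x)) => //.
  by move=> x Ux; exact/esym/(is_derive_val (D x v Ux)).
apply: Ck_mul => //.
apply: Ck_inv => // [x _|]; first by rewrite lt0r_neq0// ltr_pwDl// sqr_ge0.
by apply: Ck_add => //; [exact: Ck_cst|apply: Ck_exp => //; exact: CkS].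
Qed.

Lemma smoothP f : smooth f <-> Cinf setT f.
Proof.
split=> [sf n|Cf s].
  have H s : Ck n setT (foldr (fun v k x => 'D_v k x) f s); last exact: (H [::]).
  elim: n s => [|n IH] s; first by split=> // x _; exact: (sf s).1.
  apply/CkSP; split=> [x _|x v _|v]; [exact: (sf s).1|exact: (sf s).2|].
  exact: (IH (v :: s)).
have H n : Ck n setT (foldr (fun v k x => 'D_v k x) f s).
  by elim: s n => [n|v s IH n] /=; [exact: Cf|exact: Ck_derive (IH n.+1)].
split=> [x|x v]; first exact: Ck_continuous (H 0%N) x I.
exact: Ck_derivable (H 1%N) x v I.
Qed.

End SmoothCalculus.

Section SmoothStep.
Context {R : realType}.
Implicit Types t : R.

(** With all the powers of 1 / x, the family is stable under differentiation up to
    linear combinations. *)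
Definition flat (k : nat) (x : R) : R :=
  if 0 < x then x^-1 ^+ k * expR (- x^-1) else 0.

Lemma flat_bound k (x : R) : 0 <= flat k x <= k.+1`!%:R * `|x|.
Proof.
rewrite /flat; case: ifPn => x0; last by rewrite lexx mulr_ge0.
have u0 : 0 < x^-1 by rewrite invr_gt0.
rewrite mulr_ge0 ?expR_ge0 ?exprn_ge0 ?(ltW u0)//= gtr0_norm//.
rewrite expRN ler_pdivrMr ?expR_gt0//.
have := expR_ge1Dxn k (ltW u0); set E := expR _ => H.
have fk : 0 < (k.+1`!%:R : R) by rewrite ltr0n fact_gt0.
have {H} H : x^-1 ^+ k.+1 <= k.+1`!%:R * E.
  by rewrite -ler_pdivrMl// mulrC; apply: le_trans H; rewrite lerDr.
rewrite mulrAC -(ler_pM2l u0) -exprS (le_trans H)//.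
by rewrite mulrCA mulVf ?gt_eqF// mulr1.
Qed.

Lemma is_derive_flat k (x : R) :
  is_derive x 1 (flat k) (- k%:R * flat k.+1 x + flat k.+2 x).
Proof.
have [x0|x0|->] := ltgtP x 0.
- have H : \forall y \near x, cst 0 y = flat k y.
    near=> y; rewrite /flat ifF//; apply/negbTE; rewrite -leNgt ltW//.
    by near: y; exact: lt_nbhsl.
  rewrite /flat !ifF; try by apply/negbTE; rewrite -leNgt ltW.
  by rewrite mulr0 addr0; apply: near_eq_is_derive H _.
- have H : \forall y \near x, (fun y : R => y^-1 ^+ k * expR (- y^-1)) y = flat k y.
    near=> y; rewrite /flat ifT//.
    by near: y; exact: lt_nbhsr.
  rewrite /flat !ifT//; apply: near_eq_is_derive H _.
  have dV : is_derive x 1 (fun y : R => y^-1) (- x^-1 ^+ 2).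
    by have := is_deriveV (lt0r_neq0 x0) (is_derive_id x 1); rewrite exprVn scaler1.
  have dE : is_derive x 1 (fun y : R => expR (- y^-1)) (expR (- x^-1) * x^-1 ^+ 2).
    apply: (@is_derive1_comp _ expR (fun y : R => - y^-1)).
    by have := is_deriveN dV; rewrite opprK.
  have dX : is_derive x 1 (fun y : R => y^-1 ^+ k) (k%:R * x^-1 ^+ k.-1 * - x^-1 ^+ 2).
    by have := is_deriveX k dV; rewrite exprfctE.
  apply: (is_derive_eq (is_deriveM dX dE)); rewrite /GRing.scale/=.
  case: k {dX} => [|k] /=; last by rewrite !exprS; ring.
  by rewrite !exprS expr0; ring.
- have f0 j : flat j 0 = 0 by rewrite /flat ltxx.
  rewrite !f0 mulr0 addr0.
  suff H : (fun h : R => h^-1 *: ((flat k \o shift 0) (h *: 1) - flat k 0)) y @[y --> 0^'] --> (0 : R).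
    by split; [apply/cvg_ex; exists 0|apply/cvg_lim].
  rewrite (_ : (fun _ => _) = fun h => flat k.+1 h); last first.
    apply/funext => h /=; rewrite f0 subr0 addr0 [_%:A]mulr1 /flat.
    by case: ifP => // _; rewrite ?scaler0// exprS -mulrA.
  apply: cvg_within_filter; apply/cvgr0Pnorm_lt => e e0.
  near=> h; have /andP[h0 h1] := flat_bound k.+1 h.
  rewrite ger0_norm// (le_lt_trans h1)// -ltr_pdivlMl ?ltr0n ?fact_gt0//.
  near: h; apply: (@nbhs0_lt _ R); rewrite mulr_gt0// invr_gt0 ltr0n fact_gt0//.
Unshelve. all: by end_near. Qed.

(** A quotient rather than the integral of a bump: its smoothness and the bounds on
    its derivative then come from those of [flat]. *)
Definition step t : R := flat 0 t / (flat 0 t + flat 0 (1 - t)).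

Lemma flat_ge0 k t : 0 <= flat k t.
Proof. by have /andP[] := flat_bound k t. Qed.

Lemma flat0_gt0 t : 0 < t -> 0 < flat 0 t.
Proof. by move=> t0; rewrite /flat t0 mulr_gt0 ?expR_gt0. Qed.

Lemma flat_le0 k t : t <= 0 -> flat k t = 0.
Proof. by move=> t0; rewrite /flat ltNge t0. Qed.

Lemma step_denom t : 0 < flat 0 t + flat 0 (1 - t).
Proof.
have [t0|t0] := lerP t 0.
  by rewrite ltr_wpDl ?flat_ge0// flat0_gt0// subr_gt0 (le_lt_trans t0).
by rewrite ltr_pwDl ?flat_ge0// flat0_gt0.
Qed.

Lemma step_le0 t : t <= 0 -> step t = 0.
Proof. by move=> t0; rewrite /step flat_le0// mul0r. Qed.

Lemma step_ge1 t : 1 <= t -> step t = 1.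
Proof.
move=> t1; rewrite /step (@flat_le0 _ (1 - t)) ?subr_le0// addr0 divff//.
by rewrite gt_eqF// flat0_gt0// (lt_le_trans _ t1).
Qed.

Lemma step01 t : 0 <= step t <= 1.
Proof.
rewrite /step divr_ge0 ?flat_ge0 ?(ltW (step_denom t))//= ler_pdivrMr ?step_denom//.
by rewrite mul1r lerDl flat_ge0.
Qed.

Lemma Ck_flat n U k (f : R * R -> R) : open U -> Ck n U f ->
  Ck n U (fun x => flat k (f x)).
Proof.
move=> oU Cf.
pose F : set (R -> R) := [set h | exists s : seq (R * nat),
  h = fun t => \sum_(i <- s) i.1 * flat i.2 t].
apply: (@Ck_comp_family _ F setT) => //; last first.
  exists [:: (1, k)]; apply/funext => t.
  by rewrite big_cons big_nil addr0 mul1r.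
move=> h [s ->].
exists (fun t => \sum_(i <- flatten [seq [:: (- i.1 * i.2%:R, i.2.+1); (i.1, i.2.+2)]
    | i <- s]) i.1 * flat i.2 t); first by eexists.
move=> t _; elim: s => [|[c j] s IH] /=.
  under eq_fun do rewrite big_nil; rewrite big_nil; exact: is_derive_cst.
under eq_fun do rewrite big_cons; rewrite !big_cons/= addrA.
have dZ : is_derive t 1 (fun t => c * flat j t) (c * (- j%:R * flat j.+1 t + flat j.+2 t)).
  exact: (is_deriveZ c (is_derive_flat j t)).
apply: (is_derive_eq (is_deriveD dZ IH)).
by congr (_ + _); ring.
Qed.

Lemma Ck_step n U (f : R * R -> R) : open U -> Ck n U f ->
  Ck n U (fun x => step (f x)).
Proof.
move=> oU Cf; apply: Ck_mul => //; first exact: Ck_flat.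
apply: Ck_inv => // [x _|]; first by rewrite gt_eqF// step_denom.
apply: Ck_add => //; first exact: Ck_flat.
by apply: Ck_flat => //; apply: Ck_sub_fun => //; exact: Ck_cst.
Qed.

End SmoothStep.

(** * Borel sets of the plane and the divergence theorem *)

(** Borel sets and functions of the plane, for the product structure that
    carries [leb2]. *)
Notation plane R := (measurableTypeR R * measurableTypeR R)%type.
Notation mbl := (@measurable _ (plane _)).
Notation mblfun := (@measurable_fun _ _ (plane _) _).

Section PlaneMeasure.
Context {R : realType}.
Implicit Types (f g : R * R -> R) (U D K : set (R * R)) (x y : R * R).

Lemma nbhs_square x U : nbhs x U ->
  exists2 e : R, 0 < e &
    forall y, `|y.1 - x.1| < e -> `|y.2 - x.2| < e -> U y.
Proof.
move=> /nbhs_ballP[e /= e0 xeU]; exists e => // y y1 y2; apply: xeU.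
by split => /=; rewrite /ball/= distrC.
Qed.

Lemma square_nbhs x U (e : R) : 0 < e ->
  (forall y, `|y.1 - x.1| < e -> `|y.2 - x.2| < e -> U y) -> nbhs x U.
Proof.
move=> e0 H; apply/nbhs_ballP; exists e => //= y [/= y1 y2].
by apply: H; rewrite distrC.
Qed.

Definition obox (a b c e : R) : set (R * R) :=
  `]a, b[%classic `*` `]c, e[%classic.
Definition cbox (a b c e : R) : set (R * R) :=
  `[a, b]%classic `*` `[c, e]%classic.

Lemma oboxE a b c e x : obox a b c e x = (a < x.1 < b /\ c < x.2 < e).
Proof. by rewrite /obox /= !in_itv. Qed.

Lemma cboxE a b c e x : cbox a b c e x = (a <= x.1 <= b /\ c <= x.2 <= e).
Proof. by rewrite /cbox /= !in_itv. Qed.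

Lemma measurable_obox a b c e : mbl (obox a b c e).
Proof. by apply: measurableX; exact: measurable_itv. Qed.

Lemma measurable_cbox a b c e : mbl (cbox a b c e).
Proof. by apply: measurableX; exact: measurable_itv. Qed.

Lemma compact_cbox a b c e : compact (cbox a b c e).
Proof. by apply: compact_setX; exact: segment_compact. Qed.

Lemma obox_sub_cbox a b c e : obox a b c e `<=` cbox a b c e.
Proof.
move=> x; rewrite oboxE cboxE => -[/andP[? ?] /andP[? ?]].
by split; apply/andP; split; exact: ltW.
Qed.

Lemma leb2_cbox a b c e : (leb2 (cbox a b c e) < +oo)%E.
Proof.
rewrite [leb2 _]product_measure1E//; [|exact: measurable_itv..].
have H (s t : R) : exists r : R, lebesgue_measure (`[s, t]%classic : set R) = r%:E.
  rewrite lebesgue_measure_itv/=; case: ifP => _; last by exists 0.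
  by exists (t - s); rewrite EFinB.
have [r1 e1E] := H a b; have [r2 e2E] := H c e.
by rewrite [X in (X * _)%E]e1E [X in (_ * X)%E]e2E -EFinM ltry.
Qed.

(** The boxes with rational centres and radii 1 / (n + 1) suffice to cover an open
    set, and they are countably many. *)
Definition rat_box U (q1 q2 : rat) (n : nat) : set (R * R) :=
  let r := n.+1%:R^-1 in let a := ratr q1 in let b := ratr q2 in
  if `[< cbox (a - r) (a + r) (b - r) (b + r) `<=` U >]
  then obox (a - r) (a + r) (b - r) (b + r) else set0.

Lemma bigcup_rat_box U : open U ->
  U = \bigcup_q1 \bigcup_q2 \bigcup_n rat_box U q1 q2 n.
Proof.
move=> oU; apply/seteqP; split=> [x Ux|x [q1 _ [q2 _ [n _]]]]; last first.
  by rewrite /rat_box; case: asboolP => // + /obox_sub_cbox; apply.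
have /nbhs_square[e e0 xeU] : nbhs x U by exact: open_nbhs_nbhs.
have [n ne] : exists n : nat, n.+1%:R^-1 < e / 2.
  have e20 : 0 < e / 2 by rewrite divr_gt0.
  by have [n _ Hn] := near_infty_natSinv_lt (PosNum e20); exists n; exact: (Hn n (leqnn n)).
set r : R := n.+1%:R^-1 in ne *.
have r0 : 0 < r by rewrite invr_gt0.
have [q1 q1x] : exists q : rat, ratr q \in `]x.1 - r, x.1 + r[%R.
  by apply: rat_in_itvoo; rewrite ltrBlDr -addrA ltrDl addr_gt0.
have [q2 q2x] : exists q : rat, ratr q \in `]x.2 - r, x.2 + r[%R.
  by apply: rat_in_itvoo; rewrite ltrBlDr -addrA ltrDl addr_gt0.
exists q1 => //; exists q2 => //; exists n => //.
move: q1x q2x; rewrite !in_itv/= => /andP[? ?] /andP[? ?].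
rewrite /rat_box -/r asboolT; first by rewrite oboxE; lra.
move=> y; rewrite cboxE => -[/andP[? ?] /andP[? ?]].
by apply: xeU; rewrite ltr_norml; lra.
Qed.

Lemma measurable_rat_box U q1 q2 n : mbl (rat_box U q1 q2 n).
Proof. by rewrite /rat_box; case: ifP => // _; exact: measurable_obox. Qed.

Lemma open_measurable_plane U : open U -> mbl U.
Proof.
move=> /bigcup_rat_box ->.
apply: bigcupT_measurable_rat => q1; apply: bigcupT_measurable_rat => q2.
by apply: bigcupT_measurable => n; exact: measurable_rat_box.
Qed.

Lemma open_countable_boxes U : open U -> exists F : nat -> set (R * R),
  U = \bigcup_n F n /\
  forall n, exists a b c e, F n = obox a b c e /\ cbox a b c e `<=` U.
Proof.
move=> oU; exists (fun n => if unpickle n is Some (q1, q2, m) then rat_box U q1 q2 m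
                            else obox 1 0 1 0).
split=> [|n].
  rewrite {1}(bigcup_rat_box oU); apply/seteqP; split=> x.
    by move=> [q1 _ [q2 _ [m _ Ux]]]; exists (pickle (q1, q2, m)); [exact: I|rewrite pickleK].
  move=> [n _]; case: unpickle => [[[q1 q2] m] Ux|]; last by rewrite oboxE; lra.
  by exists q1 => //; exists q2 => //; exists m.
have empty : exists a b c e, obox 1 0 1 0 = obox a b c e /\ cbox a b c e `<=` U.
  by exists 1, 0, 1, 0; split=> // x; rewrite cboxE; lra.
case: unpickle => [[[q1 q2] m]|//]; rewrite /rat_box; case: asboolP => [sub|_].
  by do 4 eexists; split; first reflexivity.
rewrite (_ : set0 = obox 1 0 1 0)//; apply/seteqP; split=> x //.
by rewrite oboxE; lra.
Qed.

Lemma closed_measurable_plane K : closed K -> mbl K.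
Proof.
by move=> /closed_openC/open_measurable_plane/measurableC; rewrite setCK.
Qed.

Lemma hausdorff_plane : hausdorff_space (R * R)%type.
Proof. exact: norm_hausdorff. Qed.

Lemma compact_closed_plane K : compact K -> closed K.
Proof. by apply: compact_closed; exact: hausdorff_plane. Qed.

Lemma compact_measurable_plane K : compact K -> mbl K.
Proof. by move=> /compact_closed_plane/closed_measurable_plane. Qed.

Lemma bounded_sub_cbox K : bounded_set K ->
  exists2 r : R, 0 < r & K `<=` cbox (- r) r (- r) r.
Proof.
move=> [M [_ HM]]; exists (`|M| + 1); first by rewrite ltr_wpDl.
move=> x Kx.
have := HM (`|M| + 1) _ x Kx; rewrite (le_lt_trans (ler_norm _)) ?ltrDl//=.
move=> /(_ erefl) /=; rewrite prod_normE ge_max => /andP[x1 x2].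
by rewrite cboxE -!ler_norml.
Qed.

Lemma compact_sub_cbox K : compact K ->
  exists2 r : R, 0 < r & K `<=` cbox (- r) r (- r) r.
Proof. by move=> /compact_bounded/bounded_sub_cbox. Qed.

Lemma leb2_bounded K : bounded_set K -> mbl K -> (leb2 K < +oo)%E.
Proof.
move=> /bounded_sub_cbox[r _ Kr] mK; apply: le_lt_trans (leb2_cbox (- r) r (- r) r).
by apply: le_measure => //; rewrite inE//; exact: measurable_cbox.
Qed.

Lemma continuous_measurable_plane U f : open U ->
  (forall x, U x -> {for x, continuous f}) -> mblfun U f.
Proof.
move=> oU cf mU; apply: (measurability _ (RGenOpens.measurableE R)) => //.
move=> _ [_ [a [b ->] <-]]; apply: open_measurable_plane.
rewrite openE => z [Uz fz]; apply: filterI; first exact: open_nbhs_nbhs.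
by apply: cf => //; apply: open_nbhs_nbhs; split=> //; exact: interval_open.
Qed.

Lemma continuous_bounded_on K f : (forall x, K x -> {for x, continuous f}) -> compact K ->
  exists2 M : R, 0 <= M & forall x, K x -> `|f x| <= M.
Proof.
move=> cf cK.
have /compact_bounded[M [_ HM]] : compact (f @` K).
  apply: continuous_compact => //; apply: continuous_in_subspaceT => x.
  by rewrite inE; exact: cf.
exists (`|M| + 1) => [|x Kx]; first by rewrite addr_ge0.
by apply: HM; [rewrite (le_lt_trans (ler_norm _)) ?ltrDl|exists x].
Qed.

Lemma integrable_compact_support K f D : compact K ->
  (forall x, {for x, continuous f}) -> (forall x, ~ K x -> f x = 0) ->
  mbl D -> leb2.-integrable D (EFin \o f).
Proof.
move=> cK cf fK mD; have mK := compact_measurable_plane cK.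
apply: (@integrableS _ _ _ _ setT) => //.
have [M M0 HM] := continuous_bounded_on (fun x _ => cf x) cK.
have iK : leb2.-integrable K (EFin \o f).
  apply: measurable_bounded_integrable => //.
  - by apply: leb2_bounded => //; exact: compact_bounded.
  - by apply: measurable_funS (continuous_measurable_plane openT (fun x _ => cf x)).
  - by exists M; split => [|N MN x Kx /=]; rewrite ?num_real ?(le_trans (HM _ Kx))// ltW.
have := (integrable_mkcond _ mK).1 iK; congr (integrable _ _ _).
apply/funext => x; rewrite patchE; case: ifPn => // /negP; rewrite inE => /fK/=.
by move=> ->.
Qed.

Lemma Rintegral_subset D E f : E `<=` D ->
  (forall x, D x -> ~ E x -> f x = 0) ->
  \int[leb2]_(x in D) f x = \int[leb2]_(x in E) f x.
Proof.
move=> ED f0; rewrite Rintegral_mkcond [RHS]Rintegral_mkcond.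
congr (Rintegral _ _ _); apply/funext => x; rewrite !patchE.
case: ifPn => [|/negP]; rewrite inE => Dx; case: ifPn => [|/negP]; rewrite inE => //.
  exact: f0.
by move=> /ED.
Qed.

Lemma derive_e1 f x : 'D_e1 f x = 'D_1 (fun s : R => f (s, x.2)) x.1.
Proof.
rewrite /derive; set g1 := fun h => _; set g2 := fun h => _.
suff -> : g1 = g2 by [].
apply/funext => h; rewrite /g1 /g2 /e1; case: (x) => a b /=.
congr (_ *: (f _ - _)); congr pair.
by rewrite /= scaler0 add0r.
Qed.

Lemma derivable_e1 f x : derivable f x e1 ->
  derivable (fun s : R => f (s, x.2)) x.1 1.
Proof.
rewrite /derivable; set g1 := fun h => _; set g2 := fun h => _.
suff -> : g1 = g2 by [].
apply/funext => h; rewrite /g1 /g2 /e1; case: (x) => a b /=.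
congr (_ *: (f _ - _)); congr pair.
by rewrite /= scaler0 add0r.
Qed.

Lemma derive_e2 f x : 'D_e2 f x = 'D_1 (fun s : R => f (x.1, s)) x.2.
Proof.
rewrite /derive; set g1 := fun h => _; set g2 := fun h => _.
suff -> : g1 = g2 by [].
apply/funext => h; rewrite /g1 /g2 /e2; case: (x) => a b /=.
congr (_ *: (f _ - _)); congr pair.
by rewrite /= scaler0 add0r.
Qed.

Lemma derivable_e2 f x : derivable f x e2 ->
  derivable (fun s : R => f (x.1, s)) x.2 1.
Proof.
rewrite /derivable; set g1 := fun h => _; set g2 := fun h => _.
suff -> : g1 = g2 by [].
apply/funext => h; rewrite /g1 /g2 /e2; case: (x) => a b /=.
congr (_ *: (f _ - _)); congr pair.
by rewrite /= scaler0 add0r.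
Qed.

Lemma integral_derive_line (h h' : R -> R) (r : R) : 0 < r ->
  (forall t : R, is_derive t 1 h (h' t)) -> continuous h' ->
  (forall t, r <= `|t| -> h t = 0) -> (forall t, r <= `|t| -> h' t = 0) ->
  (\int[lebesgue_measure]_t (h' t)%:E = 0)%E.
Proof.
move=> r0 dh ch' h0 h'0.
have ch t : {for t, continuous h}.
  by apply/differentiable_continuous/derivable1_diffP; have [] := dh t.
rewrite [LHS](_ : _ = \int[lebesgue_measure]_(t in `[(- r)%R, r]) (h' t)%:E)%E; last first.
  rewrite [RHS]integral_mkcond; apply: eq_integral => t _.
  rewrite patchE; case: ifPn => //; rewrite notin_setE/= in_itv/= => /negP.
  by rewrite -ler_norml -ltNge => /ltW/h'0 ->.
rewrite (@continuous_FTC2 _ h' h); first by rewrite !h0 ?normrN ?ger0_norm ?(ltW r0)// subee.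
- by rewrite gtrN.
- exact: continuous_subspaceT.
- split=> [t _||]; first exact: is_derive_ex (dh t).
    exact/cvg_at_right_filter/ch.
  exact/cvg_at_left_filter/ch.
- by move=> t _; rewrite derive1E; exact: is_derive_val (dh t).
Qed.

End PlaneMeasure.

Section Divergence.
Context {R : realType}.

Lemma continuous_pairl (a b : R) : {for a, continuous (fun s : R => (s, b))}.
Proof.
move=> U /nbhs_square[e e0 H]; apply/nbhs_ballP; exists e => // s.
by rewrite /ball/= distrC => se; apply: H; rewrite /= ?subrr ?normr0.
Qed.

Lemma continuous_pairr (a b : R) : {for b, continuous (fun s : R => (a, s))}.
Proof.
move=> U /nbhs_square[e e0 H]; apply/nbhs_ballP; exists e => // s.
by rewrite /ball/= distrC => se; apply: H; rewrite /= ?subrr ?normr0.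
Qed.
Implicit Types (f g : R * R -> R) (K : set (R * R)).

Lemma derive_support K f v : compact K -> (forall x, ~ K x -> f x = 0) ->
  forall x, ~ K x -> 'D_v f x = 0.
Proof.
move=> cK fK x Kx.
rewrite (@eq_derive_open _ (~` K) f (fun=> 0)) ?derive_cst//.
by apply/closed_openC; exact: compact_closed_plane.
Qed.

(** The divergence theorem for compactly supported fields: by Fubini, it reduces
    to the fundamental theorem of calculus on lines. *)
Lemma Rintegral_derive_e1 K f : compact K -> Ck 1 setT f ->
  (forall x, ~ K x -> f x = 0) -> \int[leb2]_(x in setT) 'D_e1 f x = 0.
Proof.
move=> cK Cf fK.
have [cf df Df] := (CkSP _ _ _).1 Cf.
have DfK := derive_support e1 cK fK.
have iDf : leb2.-integrable setT (EFin \o 'D_e1 f).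
  by apply: integrable_compact_support cK _ DfK _ => // x; exact: (Df e1).1.
have [r r0 Kr] := compact_sub_cbox cK.
have out (a b : R) : r + 1 <= `|a| -> ~ K (a, b).
  by move=> ra /Kr; rewrite cboxE/= -ler_norml => -[ar _]; lra.
rewrite /Rintegral -integral21_prod_meas1//.
rewrite (eq_integral (fun=> 0%E)) ?integral0//= => y _.
rewrite /fubini_G; apply: (@integral_derive_line _ (fun s => f (s, y)) (fun s => 'D_e1 f (s, y)) (r + 1)).
- by rewrite addr_gt0.
- move=> t; split; first exact: (@derivable_e1 _ f (t, y)) (df _ _ I).
  by rewrite derive_e1.
- move=> t; have := (Df e1).1 (t, y) I; apply: continuous_comp.
  exact: continuous_pairl.
- by move=> t rt; apply: fK; exact: out.
- by move=> t rt; apply: DfK; exact: out.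
Qed.

Lemma Rintegral_derive_e2 K f : compact K -> Ck 1 setT f ->
  (forall x, ~ K x -> f x = 0) -> \int[leb2]_(x in setT) 'D_e2 f x = 0.
Proof.
move=> cK Cf fK.
have [cf df Df] := (CkSP _ _ _).1 Cf.
have DfK := derive_support e2 cK fK.
have iDf : leb2.-integrable setT (EFin \o 'D_e2 f).
  by apply: integrable_compact_support cK _ DfK _ => // x; exact: (Df e2).1.
have [r r0 Kr] := compact_sub_cbox cK.
have out (a b : R) : r + 1 <= `|b| -> ~ K (a, b).
  by move=> ra /Kr; rewrite cboxE/= -!ler_norml => -[_ ar]; lra.
rewrite /Rintegral -integral12_prod_meas1//.
rewrite (eq_integral (fun=> 0%E)) ?integral0//= => y _.
rewrite /fubini_F; apply: (@integral_derive_line _ (fun s => f (y, s)) (fun s => 'D_e2 f (y, s)) (r + 1)).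
- by rewrite addr_gt0.
- move=> t; split; first exact: (@derivable_e2 _ f (y, t)) (df _ _ I).
  by rewrite derive_e2.
- move=> t; have := (Df e2).1 (y, t) I; apply: continuous_comp.
  exact: continuous_pairr.
- by move=> t rt; apply: fK; exact: out.
- by move=> t rt; apply: DfK; exact: out.
Qed.

End Divergence.

(** * The fundamental lemma of the calculus of variations *)

Section WeakNull.
Context {R : realType}.
Implicit Types (f g h : R * R -> R) (U D K E : set (R * R)) (x y : R * R).

Lemma test_funP D f : test_fun D f <->
  Cinf setT f /\
  exists K, [/\ compact K, K `<=` D & forall x, ~ K x -> f x = 0].
Proof. by split=> -[/smoothP sf Kf]; split. Qed.

Let boxes : set (set (R * R)) :=
  [set B | exists a b c e, B = obox a b c e].

(** With [boxes_setI]: the boxes are a pi-system that generates the Borel sets, so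
    that two measures which agree on boxes agree. *)
Lemma measurable_plane_boxes : mbl = <<s boxes >>.
Proof.
apply/seteqP; split; last first.
  apply: smallest_sub; first exact: sigma_algebra_measurable.
  by move=> _ [a [b [c [e ->]]]]; exact: measurable_obox.
rewrite measurable_prod_measurableType.
apply: smallest_sub; first exact: smallest_sigma_algebra.
pose T := g_sigma_algebraType boxes.
have mfst : @measurable_fun _ _ T (measurableTypeR R) setT (fst : T -> _).
  move=> mT; apply: (measurability _ (RGenOpens.measurableE R)) => //.
  move=> _ [_ [a [b ->] <-]]; rewrite setTI.
  rewrite (_ : _ @^-1` _ = \bigcup_n (obox a b (- n%:R) n%:R : set T)).
    by apply: bigcupT_measurable => n; apply: sub_sigma_algebra; exists a, b, (- n%:R), n%:R.
  apply/seteqP; split=> [x /=|x [n _]]; last by rewrite oboxE /= in_itv/= => -[].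
  rewrite in_itv/= => abx; exists (Num.truncn `|x.2|).+1 => //.
  by rewrite oboxE; split=> //; rewrite -ltr_norml Num.Theory.truncnS_gt.
have msnd : @measurable_fun _ _ T (measurableTypeR R) setT (snd : T -> _).
  move=> mT; apply: (measurability _ (RGenOpens.measurableE R)) => //.
  move=> _ [_ [a [b ->] <-]]; rewrite setTI.
  rewrite (_ : _ @^-1` _ = \bigcup_n (obox (- n%:R) n%:R a b : set T)).
    by apply: bigcupT_measurable => n; apply: sub_sigma_algebra; exists (- n%:R), n%:R, a, b.
  apply/seteqP; split=> [x /=|x [n _]]; last by rewrite oboxE /= in_itv/= => -[].
  rewrite in_itv/= => abx; exists (Num.truncn `|x.1|).+1 => //.
  by rewrite oboxE; split=> //; rewrite -ltr_norml Num.Theory.truncnS_gt.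
move=> _ [A mA [B mB <-]].
have -> : A `*` B = (fst @^-1` A) `&` (snd @^-1` B) by [].
have mA' := mfst measurableT A mA; have mB' := msnd measurableT B mB.
rewrite setTI in mA'; rewrite setTI in mB'.
exact: (@measurableI _ T).
Qed.

Lemma obox_setI (a b c e a' b' c' e' : R) :
  obox a b c e `&` obox a' b' c' e' =
  obox (Num.max a a') (Num.min b b') (Num.max c c') (Num.min e e').
Proof.
apply/seteqP; split=> x; rewrite /setI/= !oboxE !gt_max !lt_min.
  by move=> [[/andP[-> ->] /andP[-> ->]] [/andP[-> ->] /andP[-> ->]]].
by move=> [/andP[/andP[-> ->] /andP[-> ->]] /andP[/andP[-> ->] /andP[-> ->]]].
Qed.

Lemma boxes_setI : setI_closed boxes.
Proof.
move=> _ _ [a [b [c [e ->]]]] [a' [b' [c' [e' ->]]]]; rewrite obox_setI.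
by do 4 eexists.
Qed.

(** A smooth approximation from below of the indicator function of ]a, b[. *)
Definition bump (n : nat) (a b t : R) : R :=
  step (n%:R * (t - a)) * step (n%:R * (b - t)).

Lemma bump01 n a b t : 0 <= bump n a b t <= 1.
Proof.
have /andP[s0 s1] := step01 (n%:R * (t - a)).
have /andP[s0' s1'] := step01 (n%:R * (b - t)).
by rewrite /bump mulr_ge0//= mulr_ile1.
Qed.

Lemma bump_out n a b t : ~~ (a < t < b) -> bump n a b t = 0.
Proof.
rewrite negb_and -!leNgt /bump => /orP[ta|bt].
  by rewrite step_le0 ?mul0r// mulr_ge0_le0// subr_le0.
by rewrite mulrC step_le0 ?mul0r// mulr_ge0_le0// subr_le0.
Qed.

Lemma near_bump a b t : a < t < b -> \forall n \near \oo, bump n a b t = 1.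
Proof.
move=> /andP[at_ tb]; near=> n.
rewrite /bump !step_ge1 ?mulr1//.
  by rewrite -ler_pdivrMr ?subr_gt0//; near: n; exact: nbhs_infty_ger.
by rewrite -ler_pdivrMr ?subr_gt0//; near: n; exact: nbhs_infty_ger.
Unshelve. all: by end_near. Qed.

Definition box_bump n (a b c e : R) x : R := bump n a b x.1 * bump n c e x.2.

Lemma Ck_bump n k a b U f : open U -> Ck n U f -> Ck n U (fun x => bump k a b (f x)).
Proof.
move=> oU Cf; apply: Ck_mul => //; apply: Ck_step => //; apply: Ck_mul => //;
  try exact: Ck_cst; apply: Ck_sub_fun => //; exact: Ck_cst.
Qed.

Lemma box_bump_test n a b c e D : cbox a b c e `<=` D ->
  test_fun D (box_bump n a b c e).
Proof.
move=> sub; apply/test_funP; split=> [k|].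
  by apply: Ck_mul; [exact: openT| |]; apply: Ck_bump;
    [exact: openT|exact: Ck_fst|exact: openT|exact: Ck_snd].
exists (cbox a b c e); split=> //; first exact: compact_cbox.
move=> x /(contra_not (@obox_sub_cbox _ _ _ _ _ _)); rewrite oboxE /box_bump.
have [x1|/bump_out->] := boolP (a < x.1 < b); last by rewrite mul0r.
by have [x2|/bump_out->] := boolP (c < x.2 < e); rewrite ?mulr0// => -[].
Qed.

Lemma loc_integrable_cbox D h a b c e : loc_integrable D h ->
  cbox a b c e `<=` D -> leb2.-integrable (cbox a b c e) (EFin \o h).
Proof. by move=> lh sub; apply: lh => //; exact: compact_cbox. Qed.

(** The smooth bumps of a box tend to its indicator function, and the integral
    passes to the limit by dominated convergence. *)
Lemma weak_null_box D h a b c e : mbl D -> loc_integrable D h ->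
  (forall psi, test_fun D psi -> \int[leb2]_(x in D) (h x * psi x) = 0) ->
  cbox a b c e `<=` D -> (\int[leb2]_(x in obox a b c e) (h x)%:E = 0)%E.
Proof.
move=> mD lh h0 sub; have ih := loc_integrable_cbox lh sub.
have mC := measurable_cbox a b c e.
have mh : mblfun (cbox a b c e) h by exact: (measurable_EFinP _ _).1 (measurable_int _ ih).
have mb n : mblfun (cbox a b c e) (box_bump n a b c e).
  apply: (@measurable_funS _ _ _ _ setT) => //.
  apply: (continuous_measurable_plane openT) => x _.
  have /test_funP[sb _] := @box_bump_test n a b c e setT (@subsetT _ _).
  exact: (sb 0%N).1.
pose F (n : nat) x := (h x * box_bump n a b c e x)%:E.
pose F0 x := (h x * \1_(obox a b c e) x)%:E.
have F_cvg x : F n x @[n --> \oo] --> F0 x.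
  apply: cvg_near_cst; rewrite /F /F0 indicE.
  have [xo|xo] := boolP (x \in obox a b c e); last first.
    near=> n; rewrite /box_bump; congr (_ * _)%:E.
    have [x1|/bump_out->] := boolP (a < x.1 < b); last by rewrite mul0r.
    have [x2|/bump_out->] := boolP (c < x.2 < e); last by rewrite mulr0.
    by move: xo; rewrite notin_setE oboxE; case.
  move: xo; rewrite inE oboxE => -[x1 x2].
  near=> n; rewrite /box_bump; congr (_ * _)%:E.
  rewrite (_ : bump n a b x.1 = 1) ?mul1r; first by near: n; exact: near_bump.
  by near: n; exact: near_bump.
have bd x (n : nat) : (`|F n x| <= (`|h x|)%:E)%E.
  rewrite /F lee_fin normrM ler_piMr// /box_bump normrM.
  by have /andP[? ?] := bump01 n a b x.1; have /andP[? ?] := bump01 n c e x.2;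
    rewrite !ger0_norm// mulr_ile1.
have ae1 : {ae leb2, forall x, cbox a b c e x -> F n x @[n --> \oo] --> F0 x}.
  by apply: aeW => x _; exact: F_cvg.
have ae2 : {ae leb2, forall x, forall n : nat, cbox a b c e x -> (`|F n x| <= (`|h x|)%:E)%E}.
  by apply: aeW => x n _; exact: bd.
have [_ _ lim] := @dominated_convergence _ _ _ leb2 _ mC F F0 (EFin \o (fun x => `|h x|))
  (fun n => (measurable_EFinP _ _).2 (measurable_funM mh (mb n)))
  ((measurable_EFinP _ _).2 (measurable_funM mh (measurable_indic (measurable_obox a b c e))))
  ae1 (integrable_norm ih) ae2.
have F_0 n : (\int[leb2]_(x in cbox a b c e) F n x = 0)%E.
  have tb := box_bump_test n sub.
  have := h0 _ tb; rewrite (Rintegral_subset sub).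
    rewrite /Rintegral => /eqP; rewrite fine_eq0 ?(fun E => eqP E)//.
      by move=> /eqP.
    apply: integrable_fin_num => //.
    apply: (le_integrable mC _ _ (integrable_norm ih)).
      exact: (measurable_EFinP _ _).2 (measurable_funM mh (mb n)).
    by move=> x _ /=; rewrite lee_fin normr_id; have := bd x n; rewrite /F lee_fin.
  move=> x _ /(contra_not (@obox_sub_cbox _ _ _ _ _ _)); rewrite oboxE /box_bump.
  have [x1|/bump_out->] := boolP (a < x.1 < b); last by rewrite mul0r mulr0.
  by have [x2|/bump_out->] := boolP (c < x.2 < e); rewrite ?mulr0// => -[].
have F0_0 : (\int[leb2]_(x in cbox a b c e) F0 x = 0)%E.
  have E0 : (fun n => \int[leb2]_(x in cbox a b c e) F n x)%E = (fun=> 0%E) by apply/funext.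
  by move: lim; rewrite E0 => lim; rewrite -(cvg_lim _ lim)// lim_cst.
rewrite -F0_0 -[X in integral _ X](setIidr (@obox_sub_cbox _ a b c e)).
rewrite integral_mkcondr; apply: eq_integral => x _.
by rewrite patchE /F0 indicE; case: ifPn => _; rewrite ?mulr1 ?mulr0.
Unshelve. all: by end_near. Qed.

(** The fundamental lemma of the calculus of variations. The integrals over
    boxes vanish by approximating their indicator functions, those over Borel
    sets by Dynkin's theorem. *)
Lemma weak_null_ae D h : open D -> loc_integrable D h ->
  (forall psi, test_fun D psi -> \int[leb2]_(x in D) (h x * psi x) = 0) ->
  {ae leb2, forall x, D x -> h x = 0}.
Proof.
move=> oD lh h0; have mD := open_measurable_plane oD.
have box a b c e : cbox a b c e `<=` D ->
    {ae leb2, forall x, obox a b c e x -> h x = 0}.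
  move=> sub; set B := obox a b c e.
  have mB : mbl B := measurable_obox a b c e.
  have ih : leb2.-integrable B (EFin \o h).
    apply: (integrableS _ _ _ (loc_integrable_cbox lh sub)) => //.
      exact: measurable_cbox.
    exact: obox_sub_cbox.
  have ihE E : mbl E -> leb2.-integrable (E `&` B) (EFin \o h).
    by move=> mE; apply: (integrableS mB) => //; exact: measurableI.
  have key E : mbl E -> (\int[leb2]_(x in E `&` B) (h x)%:E = 0)%E.
    rewrite measurable_plane_boxes.
    apply: (@dynkin_induction _ _ boxes (fun E => (\int[leb2]_(x in E `&` B) (h x)%:E = 0)%E)
      measurable_plane_boxes boxes_setI).
    - by rewrite setTI; exact: weak_null_box h0 sub.
    - move=> _ [a' [b' [c' [e' ->]]]]; rewrite obox_setI.
      apply: weak_null_box h0 _ => //; apply: subset_trans sub.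
      by move=> x; rewrite !cboxE !ge_max !le_min => -[/andP[/andP[_ ->] /andP[_ ->]]
        /andP[/andP[_ ->] /andP[_ ->]]].
    - move=> S mS S0.
      have : (\int[leb2]_(x in B) (h x)%:E = 0)%E by exact: weak_null_box h0 sub.
      have BE : B = (S `&` B) `|` (~` S `&` B) by rewrite -setIUl setUv setTI.
      rewrite {1}BE integral_setU_EFin.
      + by rewrite S0 add0e.
      + exact: measurableI.
      + by apply: measurableI => //; exact: measurableC.
      + by rewrite -BE; exact: (measurable_EFinP _ _).1 (measurable_int _ ih).
      + by apply/disj_setPS => x [[Sx _] []].
    - move=> F mF tF F0.
      have mFi i : mbl (F i) := mF i.
      rewrite setI_bigcupl integral_bigcup.
      + by rewrite eseries0.
      + exact: trivIset_setIr.
      + by move=> i; exact: measurableI.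
      + by rewrite -setI_bigcupl; apply: ihE; exact: bigcupT_measurable.
  have mC0 : @measurable_fun _ _ (plane R) _ B (cst (0 : \bar R)) by exact: measurable_cst.
  have /= := @integral_ae_eq _ (plane R) _ leb2 B mB (cst 0%E) (EFin \o h) ih mC0 _.
  move=> H; have {H} : ae_eq leb2 B (EFin \o h) (cst 0%E).
    apply: H => E EB mE; have := key E mE; rewrite (setIidl EB) => ->.
    by rewrite integral0.
  by apply: filterS => x Hx Bx; have /= [] := Hx Bx.
have [F [DF Fbox]] := open_countable_boxes oD.
have aeF n : {ae leb2, forall x, F n x -> h x = 0}.
  by have [a [b [c [e [-> /box]]]]] := Fbox n.
have := @ae_foralln _ _ _ leb2 _ aeF.
by apply: filterS => x Fx; rewrite DF => -[n _]; exact: Fx.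
Qed.

End WeakNull.

(** * Weak gradients *)

Notation L1 D f := (leb2.-integrable D (EFin \o f)).

#[global] Instance ae_leb2_filter (R : realType) : Filter (almost_everywhere (@leb2 R)).
Proof. exact: ae_filter_ringOfSetsType. Qed.

Section Integrable.
Context {R : realType}.
Implicit Types (f g h : R * R -> R) (U D K E : set (R * R)) (x : R * R).

Lemma L1_measurable D f : L1 D f -> mblfun D f.
Proof. by move=> i; exact: (measurable_EFinP _ _).1 (measurable_int _ i). Qed.

Lemma L1_add D f g : mbl D -> L1 D f -> L1 D g -> L1 D (fun x => f x + g x).
Proof. by move=> mD; exact: integrableD. Qed.

Lemma L1_scale D (k : R) f : mbl D -> L1 D f -> L1 D (fun x => k * f x).
Proof. by move=> mD; exact: integrableZl. Qed.

Lemma L1_opp D f : mbl D -> L1 D f -> L1 D (fun x => - f x).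
Proof.
move=> mD /(L1_scale (-1) mD); congr (is_true (integrable _ _ _)).
by apply/funext => x /=; rewrite mulN1r.
Qed.

Lemma L1_sub D f g : mbl D -> L1 D f -> L1 D g -> L1 D (fun x => f x - g x).
Proof. by move=> mD i j; apply: L1_add => //; exact: L1_opp. Qed.

Lemma L1_le D f g : mbl D -> mblfun D f -> (forall x, D x -> `|f x| <= g x) ->
  L1 D g -> L1 D f.
Proof.
move=> mD mf fg; apply: le_integrable => //; first exact: (measurable_EFinP _ _).2.
by move=> x Dx; rewrite lee_fin (le_trans (fg _ Dx))// ler_norm.
Qed.

Lemma L1_subset D E f : mbl D -> mbl E -> E `<=` D -> L1 D f -> L1 E f.
Proof. by move=> mD mE ED; exact: integrableS. Qed.

Lemma L1_patch D E f : mbl D -> mbl E -> E `<=` D -> L1 E f -> L1 D (f \_ E).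
Proof.
move=> mD mE ED iE; have := (integrable_restrict leb2 mE mD (EFin \o f)).1.
rewrite setIidr// => /(_ iE); congr (is_true (integrable _ _ _)).
by apply/funext => x; rewrite !patchE /= patchE; case: ifP.
Qed.

Lemma Rintegral_patch D E f : E `<=` D ->
  \int[leb2]_(x in D) (f \_ E) x = \int[leb2]_(x in E) f x.
Proof. by move=> ED; rewrite -Rintegral_mkcondr setIidr. Qed.

Lemma Rintegral_ae D f g : mbl D -> mblfun D f -> mblfun D g ->
  {ae leb2, forall x, D x -> f x = g x} ->
  \int[leb2]_(x in D) f x = \int[leb2]_(x in D) g x.
Proof.
move=> mD mf mg fg; rewrite /Rintegral; congr fine; apply: ae_eq_integral => //.
- exact: (measurable_EFinP _ _).2.
- exact: (measurable_EFinP _ _).2.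
- by apply: filterS fg => x fg Dx; rewrite fg.
Qed.

Lemma L1_Rintegral D f : mbl D -> L1 D f ->
  (\int[leb2]_(x in D) (f x)%:E = (\int[leb2]_(x in D) f x)%:E)%E.
Proof. by move=> mD i; rewrite /Rintegral fineK//; exact: integrable_fin_num. Qed.

Lemma L1_ge0 D f : mbl D -> mblfun D f -> (forall x, D x -> 0 <= f x) ->
  (\int[leb2]_(x in D) (f x)%:E < +oo)%E -> L1 D f.
Proof.
move=> mD mf f0 fi; apply/integrableP; split; first exact: (measurable_EFinP _ _).2.
rewrite [ltLHS](_ : _ = \int[leb2]_(x in D) (f x)%:E)%E//.
apply: eq_integral => x; rewrite inE => Dx /=.
by rewrite ger0_norm ?f0.
Qed.

Lemma Rintegral_mulBl D f g h : mbl D -> L1 D (fun x => f x * h x) ->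
  L1 D (fun x => g x * h x) -> \int[leb2]_(x in D) ((f x - g x) * h x) =
  \int[leb2]_(x in D) (f x * h x) - \int[leb2]_(x in D) (g x * h x).
Proof.
by move=> mD i j; rewrite -RintegralB//; apply: eq_Rintegral => x _; rewrite mulrBl.
Qed.

Lemma ge0_le_Rintegral_subset D E f : mbl D -> mbl E -> E `<=` D -> L1 D f ->
  (forall x, D x -> 0 <= f x) -> \int[leb2]_(x in E) f x <= \int[leb2]_(x in D) f x.
Proof.
move=> mD mE ED iD f0; rewrite -(Rintegral_patch _ ED); apply: le_Rintegral => //.
  by apply: L1_patch => //; exact: L1_subset iD.
by move=> x Dx; rewrite patchE; case: ifP => _ //; exact: f0.
Qed.

Lemma L1_bounded D f (M : R) : mbl D -> (leb2 D < +oo)%E -> mblfun D f ->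
  (forall x, D x -> `|f x| <= M) -> L1 D f.
Proof.
move=> mD fD mf fM; apply: measurable_bounded_integrable => //.
exists M; split => [|N MN x Dx /=]; rewrite ?num_real// (le_trans (fM _ Dx))//.
exact: ltW.
Qed.

Lemma Ck_measurable D f n : open D -> Ck n D f -> mblfun D f.
Proof. by move=> oD /Ck_continuous cf; exact: continuous_measurable_plane. Qed.

Definition L2 D f := mblfun D f /\ L1 D (fun x => f x ^+ 2).

Lemma sqr_mul_le (a b : R) : `|a * b| <= a ^+ 2 + b ^+ 2.
Proof.
rewrite normrM -(real_normK (num_real a)) -(real_normK (num_real b)).
move: `|a| `|b| (normr_ge0 a) (normr_ge0 b) => {}a {}b a0 b0.
by have := sqr_ge0 (a - b); have := sqr_ge0 a; have := sqr_ge0 b; nra.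
Qed.

Lemma L2_mul D f g : mbl D -> L2 D f -> L2 D g -> L1 D (fun x => f x * g x).
Proof.
move=> mD [mf f2] [mg g2]; apply: L1_le (L1_add mD f2 g2) => //.
  exact: measurable_funM.
by move=> x _; exact: sqr_mul_le.
Qed.

Lemma L2_add D f g : mbl D -> L2 D f -> L2 D g -> L2 D (fun x => f x + g x).
Proof.
move=> mD Lf Lg; have [mf f2] := Lf; have [mg g2] := Lg.
have mfg : mblfun D (fun x => f x + g x) by exact: measurable_funD.
split=> //; apply: L1_le (L1_scale 2 mD (L1_add mD f2 g2)) => //.
  exact: measurable_funX.
move=> x _; rewrite ger0_norm ?sqr_ge0//.
by have := sqr_ge0 (f x - g x); nra.
Qed.

Lemma L2_scale D (k : R) f : mbl D -> L2 D f -> L2 D (fun x => k * f x).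
Proof.
move=> mD [mf f2]; split; first by apply: measurable_funM => //; exact: measurable_cst.
have := L1_scale (k ^+ 2) mD f2; congr (is_true (integrable _ _ _)).
by apply/funext => x /=; rewrite exprMn.
Qed.

Lemma L2_opp D f : mbl D -> L2 D f -> L2 D (fun x => - f x).
Proof.
move=> mD /(L2_scale (-1) mD); congr (L2 _ _).
by apply/funext => x /=; rewrite mulN1r.
Qed.

Lemma L2_sub D f g : mbl D -> L2 D f -> L2 D g -> L2 D (fun x => f x - g x).
Proof. by move=> mD i j; apply: L2_add => //; exact: L2_opp. Qed.

Lemma L2_subset D E f : mbl D -> mbl E -> E `<=` D -> L2 D f -> L2 E f.
Proof.
move=> mD mE ED [mf f2]; split; last exact: L1_subset f2.
exact: measurable_funS mf.
Qed.

Lemma L2_patch D E f : mbl D -> mbl E -> E `<=` D -> L2 E f -> L2 D (f \_ E).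
Proof.
move=> mD mE ED [mf f2]; split.
  by apply/(measurable_restrict _ mE mD); rewrite setIidr.
have := L1_patch mD mE ED f2; congr (is_true (integrable _ _ _)).
by apply/funext => x /=; rewrite !patchE; case: ifP => //; rewrite expr0n.
Qed.

Lemma L2_bounded D f (M : R) : mbl D -> (leb2 D < +oo)%E -> mblfun D f ->
  (forall x, D x -> `|f x| <= M) -> L2 D f.
Proof.
move=> mD fD mf fM; split=> //; apply: (L1_bounded (M := M ^+ 2)) => //.
  exact: measurable_funX.
move=> x Dx; rewrite normrX lerXn2r ?nnegrE//; last exact: fM.
exact: le_trans (fM _ Dx).
Qed.

Lemma L2_L1 D f : mbl D -> (leb2 D < +oo)%E -> L2 D f -> L1 D f.
Proof.
move=> mD fD Lf; have [mf _] := Lf.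
have L1' : L2 D (fun=> 1 : R).
  by apply: (L2_bounded (M := 1)) => //; rewrite normr1.
have := L2_mul mD Lf L1'; congr (is_true (integrable _ _ _)).
by apply/funext => x /=; rewrite mulr1.
Qed.

Lemma L1_ae D f g : mbl D -> mblfun D f -> L1 D g ->
  {ae leb2, forall x, D x -> f x = g x} -> L1 D f.
Proof.
move=> mD mf ig fg; have mg := L1_measurable ig.
apply/integrableP; split; first exact: (measurable_EFinP _ _).2.
rewrite (@ae_eq_integral _ _ _ leb2 D (fun x => `|(g x)%:E|)%E)//.
- by have /integrableP[] := ig.
- by apply: measurableT_comp => //; exact: (measurable_EFinP _ _).2.
- by apply: measurableT_comp => //; exact: (measurable_EFinP _ _).2.
- by apply: filterS fg => x fg Dx; rewrite /= fg.
Qed.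

Lemma norm_Rintegral_mul_le D f g (t : R) : mbl D -> 0 < t -> L2 D f -> L2 D g ->
  `|\int[leb2]_(x in D) (f x * g x)| <=
  t^-1 * \int[leb2]_(x in D) (f x ^+ 2) + t * \int[leb2]_(x in D) (g x ^+ 2).
Proof.
move=> mD t0 Lf Lg; have mul := L2_mul mD Lf Lg.
apply: le_trans (le_normr_Rintegral mD mul) _.
have if2 : L1 D (fun x => t^-1 * f x ^+ 2) by apply: L1_scale => //; exact: Lf.2.
have ig2 : L1 D (fun x => t * g x ^+ 2) by apply: L1_scale => //; exact: Lg.2.
rewrite -(RintegralZl _ mD Lf.2) -(RintegralZl _ mD Lg.2).
rewrite -RintegralD//; apply: le_Rintegral => //; [exact: integrable_norm|exact: L1_add|].
move=> x _; have t1 : t^-1 * t = 1 by rewrite mulVf// gt_eqF.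
rewrite normrM -(real_normK (num_real (f x))) -(real_normK (num_real (g x))).
have := normr_ge0 (f x); have := normr_ge0 (g x).
move: `|f x| `|g x| => a b b0 a0.
have : 0 <= t^-1 * (a - t * b) ^+ 2 by rewrite mulr_ge0 ?sqr_ge0// invr_ge0 ltW.
rewrite (_ : t^-1 * _ = t^-1 * a ^+ 2 - 2 * (t^-1 * t) * (a * b) + t^-1 * t * (t * b ^+ 2)); last by ring.
rewrite t1; have : 0 <= a * b by rewrite mulr_ge0.
by lra.
Qed.

(** A weak form of the Cauchy-Schwarz inequality: integrals of products with a
    factor that is arbitrarily small in mean square vanish in the limit. *)
Lemma Rintegral_mul_limit0 D g1 g2 (c : R) : mbl D -> L2 D g1 -> L2 D g2 ->
  (forall e : R, 0 < e -> exists f1 f2, [/\ L2 D f1, L2 D f2,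
     \int[leb2]_(x in D) (f1 x ^+ 2) <= e, \int[leb2]_(x in D) (f2 x ^+ 2) <= e &
     c = \int[leb2]_(x in D) (f1 x * g1 x) + \int[leb2]_(x in D) (f2 x * g2 x)]) ->
  c = 0.
Proof.
move=> mD Lg1 Lg2 H; apply/eqP; rewrite -normr_le0.
set B := \int[leb2]_(x in D) (g1 x ^+ 2) + \int[leb2]_(x in D) (g2 x ^+ 2).
have B0 : 0 <= B by apply: addr_ge0; apply: Rintegral_ge0 => x _; exact: sqr_ge0.
apply/ler_addgt0Pr => e e0; rewrite add0r.
pose t := e / (2 + B); have B2 : 0 < 2 + B by rewrite ltr_pwDl.
have t0 : 0 < t by rewrite divr_gt0.
have [f1 [f2 [Lf1 Lf2 f1t f2t ->]]] := H (t ^+ 2) (exprn_gt0 _ t0).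
apply: le_trans (ler_normD _ _) _.
apply: le_trans (lerD (norm_Rintegral_mul_le mD t0 Lf1 Lg1)
  (norm_Rintegral_mul_le mD t0 Lf2 Lg2)) _.
have tB : t * (2 + B) = e by rewrite /t divfK// gt_eqF.
have tt (a : R) : a <= t ^+ 2 -> t^-1 * a <= t.
  by move=> ha; rewrite ler_pdivrMl// -expr2.
have key (a b c1 c2 : R) : t^-1 * a <= t -> t^-1 * b <= t ->
    t^-1 * a + t * c1 + (t^-1 * b + t * c2) <= t * (2 + (c1 + c2)).
  move: t t^-1 {tB tt t0 f1t f2t} => t t' ha hb.
  by rewrite -subr_ge0 (_ : _ - _ = (t - t' * a) + (t - t' * b));
    [rewrite addr_ge0 ?subr_ge0|ring].
by rewrite -tB; apply: key; exact: tt.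
Qed.

End Integrable.

Section WeakGradient.
Context {R : realType}.
Implicit Types (f g u psi : R * R -> R) (U D K E : set (R * R)) (x : R * R).

Lemma test_fun_Ck D psi n : test_fun D psi -> Ck n setT psi.
Proof. by move=> /test_funP[+ _]; apply. Qed.

Lemma test_fun_add D f g : test_fun D f -> test_fun D g ->
  test_fun D (fun x => f x + g x).
Proof.
move=> /test_funP[Cf [K [cK KD fK]]] /test_funP[Cg [L [cL LD gL]]].
apply/test_funP; split=> [n|]; first by apply: Ck_add => //; exact: openT.
exists (K `|` L); split; first exact: compactU.
  by rewrite subUset.
by move=> x /not_orP[Kx Lx]; rewrite fK// gL// addr0.
Qed.

Lemma test_fun_mull D f g : Cinf setT f -> test_fun D g ->
  test_fun D (fun x => f x * g x).
Proof.
move=> Cf /test_funP[Cg [L [cL LD gL]]].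
apply/test_funP; split=> [n|]; first by apply: Ck_mul => //; exact: openT.
by exists L; split=> // x Lx; rewrite gL// mulr0.
Qed.

Lemma test_fun_opp D f : test_fun D f -> test_fun D (fun x => - f x).
Proof.
move=> tf; have := @test_fun_mull D (fun=> -1) f (fun n => Ck_cst _ _ _) tf.
by congr (test_fun _ _); apply/funext => x; rewrite mulN1r.
Qed.

Lemma test_fun_derive D f v : test_fun D f -> test_fun D ('D_v f).
Proof.
move=> /test_funP[Cf [K [cK KD fK]]]; apply/test_funP; split=> [n|].
  exact: Ck_derive (Cf n.+1).
by exists K; split=> //; exact: derive_support.
Qed.

Lemma test_fun_sub D E f : D `<=` E -> test_fun D f -> test_fun E f.
Proof.
by move=> DE [sf [K [cK KD fK]]]; split=> //; exists K; split=> //; exact: subset_trans DE.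
Qed.

Lemma test_fun_bounded D f : test_fun D f ->
  exists2 M : R, 0 <= M & forall x, `|f x| <= M.
Proof.
move=> tf; have Cf := test_fun_Ck 0 tf; have [_ [K [cK _ fK]]] := tf.
have [M M0 HM] := continuous_bounded_on (fun x _ => Cf.1 x I) cK.
exists M => // x; have [Kx|Kx] := pselect (K x); first exact: HM.
by rewrite fK// normr0.
Qed.

Lemma test_fun_L2 D E f : mbl E -> test_fun D f -> L2 E f.
Proof.
move=> mE tf; have [_ [K [cK _ fK]]] := tf.
have Cf := test_fun_Ck 0 tf.
split; first by apply: (@measurable_funS _ _ (plane R) _ setT) => //;
  exact: Ck_measurable openT Cf.
apply: integrable_compact_support cK _ _ mE => x; last by move=> /fK ->; rewrite expr0n.
exact: (Ck_exp 2 openT Cf).1.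
Qed.

(** An open set is a countable union of boxes with closures inside of it, and the
    function is integrable on each of them. *)
Lemma loc_integrable_measurable D g : open D -> loc_integrable D g -> mblfun D g.
Proof.
move=> oD lg; have [F [DF Fbox]] := open_countable_boxes oD.
rewrite {1}DF; apply/measurable_fun_bigcup => n.
  by have [a [b [c [e [-> _]]]]] := Fbox n; exact: measurable_obox.
have [a [b [c [e [-> sub]]]]] := Fbox n.
apply: (@measurable_funS _ _ (plane R) _ (cbox a b c e)).
- exact: measurable_cbox.
- exact: obox_sub_cbox.
- by apply: L1_measurable; apply: lg => //; exact: compact_cbox.
Qed.

Lemma L1_loc D g : mbl D -> L1 D g -> loc_integrable D g.
Proof.
by move=> mD ig K cK KD; apply: (L1_subset mD) ig => //; exact: compact_measurable_plane.
Qed.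

Lemma loc_integrable_mul D g K psi : mbl D -> loc_integrable D g -> compact K ->
  K `<=` D -> (forall x, {for x, continuous psi}) ->
  (forall x, ~ K x -> psi x = 0) -> L1 D (fun x => g x * psi x).
Proof.
move=> mD lg cK KD cp pK; have mK := compact_measurable_plane cK.
have [M M0 HM] := continuous_bounded_on (fun x _ => cp x) cK.
have ig := lg _ cK KD; have mg := L1_measurable ig.
have iK : L1 K (fun x => g x * psi x).
  apply: (L1_le (g := fun x => M * `|g x|)) => //.
  - apply: measurable_funM => //; apply: (@measurable_funS _ _ (plane R) _ setT) => //.
    exact: continuous_measurable_plane openT (fun x _ => cp x).
  - by move=> x Kx; rewrite normrM mulrC ler_wpM2r// HM.
  - by apply: L1_scale => //; exact: integrable_norm.
have := L1_patch mD mK KD iK; congr (is_true (integrable _ _ _)).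
apply/funext => x /=; rewrite patchE; case: ifPn => //.
by rewrite notin_setE => /pK ->; rewrite mulr0.
Qed.

Lemma loc_integrable_test D g psi : mbl D -> loc_integrable D g ->
  test_fun D psi -> L1 D (fun x => g x * psi x).
Proof.
move=> mD lg tp; have [_ [K [cK KD pK]]] := tp.
by apply: loc_integrable_mul lg cK KD _ pK => // x; exact: (test_fun_Ck 0 tp).1.
Qed.

Lemma loc_integrable_add D f g : loc_integrable D f -> loc_integrable D g ->
  loc_integrable D (fun x => f x + g x).
Proof.
move=> lf lg K cK KD; apply: L1_add; [exact: compact_measurable_plane|exact: lf|exact: lg].
Qed.

Lemma loc_integrable_opp D f : loc_integrable D f -> loc_integrable D (fun x => - f x).
Proof.
by move=> lf K cK KD; apply: L1_opp; [exact: compact_measurable_plane|exact: lf].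
Qed.

(** Outside of the support of g the product is locally zero, whatever f is there. *)
Lemma Ck_mul_support n D K f g : open D -> compact K -> K `<=` D ->
  Ck n D f -> Ck n D g -> (forall x, ~ K x -> g x = 0) ->
  Ck n setT (fun x => f x * g x).
Proof.
move=> oD cK KD Cf Cg gK; apply: Ck_local => x _.
have [Kx|Kx] := pselect (K x).
  by exists D; split=> //; [exact: KD|exact: Ck_mul].
have oK : open (~` K) by apply/closed_openC; exact: compact_closed_plane.
exists (~` K); split=> //; apply: (@Ck_eq _ _ _ (fun=> 0)) => //; last exact: Ck_cst.
by move=> y Ky; rewrite gK// mulr0.
Qed.

Lemma continuous_loc_integrable D f : open D ->
  (forall x, D x -> {for x, continuous f}) -> loc_integrable D f.
Proof.
move=> oD cf K cK KD; have mK := compact_measurable_plane cK.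
have [M M0 HM] := continuous_bounded_on (fun x Kx => cf x (KD _ Kx)) cK.
apply: (L1_bounded (M := M)) => //.
- by apply: leb2_bounded => //; exact: compact_bounded.
- apply: (measurable_funS _ KD); first exact: open_measurable_plane.
  exact: continuous_measurable_plane.
Qed.

(** Integration by parts: the divergence theorem for the product with the test
    function, whose support is compact. *)
Lemma weak_gradient_Ck D f : open D -> Ck 1 D f ->
  weak_gradient D f ('D_e1 f) ('D_e2 f).
Proof.
move=> oD Cf; have mD := open_measurable_plane oD.
have [cf df Df] := (CkSP _ _ _).1 Cf.
split.
- exact: continuous_loc_integrable.
- by apply: continuous_loc_integrable => // x; exact: (Df e1).1.
- by apply: continuous_loc_integrable => // x; exact: (Df e2).1.
move=> psi tp; have [_ [K [cK KD pK]]] := tp.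
have Cp n := test_fun_Ck n tp.
have CpD n : Ck n D psi by apply: Ck_sub (Cp n).
have Cfp := Ck_mul_support oD cK KD Cf (CpD 1%N) pK.
have fpK x : ~ K x -> f x * psi x = 0 by move=> /pK ->; rewrite mulr0.
have parts v : \int[leb2]_(x in setT) 'D_v (fun x => f x * psi x) x = 0 ->
    \int[leb2]_(x in D) (f x * 'D_v psi x) = - \int[leb2]_(x in D) ('D_v f x * psi x).
  rewrite (@Rintegral_subset _ _ D) => [H|//|x _ Dx]; last first.
    by rewrite (derive_support _ cK fpK)// => /KD.
  have i1 : L1 D (fun x => f x * 'D_v psi x).
    apply: loc_integrable_mul cK KD _ (derive_support v cK pK) => //.
      exact: continuous_loc_integrable.
    by move=> x; exact: (Ck_derive v (Cp 1%N)).1.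
  have i2 : L1 D (fun x => 'D_v f x * psi x).
    apply: loc_integrable_mul cK KD _ pK => //.
      by apply: continuous_loc_integrable => // x; exact: (Df v).1.
    by move=> x; exact: (Cp 0%N).1.
  apply/eqP; rewrite -addr_eq0 -RintegralD//; apply/eqP; rewrite -[RHS]H.
  apply: eq_Rintegral => x; rewrite inE => Dx.
  rewrite [RHS](deriveM (df x v Dx) (@Ck_derivable _ _ _ _ (Cp 1%N) x v I)).
  by rewrite /GRing.scale/= [psi x * _]mulrC.
split; apply: parts.
  exact: Rintegral_derive_e1 cK Cfp fpK.
exact: Rintegral_derive_e2 cK Cfp fpK.
Qed.

Lemma weak_gradient_add D u f g1 g2 h1 h2 : open D ->
  weak_gradient D u g1 g2 -> weak_gradient D f h1 h2 ->
  weak_gradient D (fun x => u x + f x) (fun x => g1 x + h1 x) (fun x => g2 x + h2 x).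
Proof.
move=> oD [lu lg1 lg2 Hu] [lf lh1 lh2 Hf]; have mD := open_measurable_plane oD.
split; [exact: loc_integrable_add..|].
move=> psi tp; have [U1 U2] := Hu _ tp; have [F1 F2] := Hf _ tp.
have td v := test_fun_derive v tp.
split.
  under eq_Rintegral do rewrite mulrDl.
  under [in RHS]eq_Rintegral do rewrite mulrDl.
  by rewrite !RintegralD ?U1 ?F1 ?opprD//; exact: loc_integrable_test.
under eq_Rintegral do rewrite mulrDl.
under [in RHS]eq_Rintegral do rewrite mulrDl.
by rewrite !RintegralD ?U2 ?F2 ?opprD//; exact: loc_integrable_test.
Qed.

Lemma weak_gradient_opp D u g1 g2 : open D -> weak_gradient D u g1 g2 ->
  weak_gradient D (fun x => - u x) (fun x => - g1 x) (fun x => - g2 x).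
Proof.
move=> oD [lu lg1 lg2 Hu]; have mD := open_measurable_plane oD.
split; [exact: loc_integrable_opp..|].
move=> psi tp; have [U1 U2] := Hu _ tp; have td v := test_fun_derive v tp.
split.
  under eq_Rintegral do rewrite mulNr -mulN1r.
  under [in RHS]eq_Rintegral do rewrite mulNr -mulN1r.
  by rewrite !RintegralZl// ?U1 ?mulN1r//; exact: loc_integrable_test.
under eq_Rintegral do rewrite mulNr -mulN1r.
under [in RHS]eq_Rintegral do rewrite mulNr -mulN1r.
by rewrite !RintegralZl// ?U2 ?mulN1r//; exact: loc_integrable_test.
Qed.

Lemma weak_gradient_sub D u f g1 g2 h1 h2 : open D ->
  weak_gradient D u g1 g2 -> weak_gradient D f h1 h2 ->
  weak_gradient D (fun x => u x - f x) (fun x => g1 x - h1 x) (fun x => g2 x - h2 x).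
Proof. by move=> oD wu wf; apply: weak_gradient_add => //; exact: weak_gradient_opp. Qed.

Lemma weak_gradient_subset D E u g1 g2 : E `<=` D ->
  weak_gradient D u g1 g2 -> weak_gradient E u g1 g2.
Proof.
move=> ED [lu lg1 lg2 Hu].
have lE f : loc_integrable D f -> loc_integrable E f.
  by move=> lf K cK KE; apply: lf => //; exact: subset_trans ED.
split; [exact: lE..|move=> psi tp].
have [_ [K [cK KE pK]]] := tp.
have R0 (f p : R * R -> R) : (forall x, ~ K x -> p x = 0) ->
    \int[leb2]_(x in D) (f x * p x) = \int[leb2]_(x in E) (f x * p x).
  move=> p0; apply: Rintegral_subset => // x _ Ex.
  by rewrite p0 ?mulr0// => /KE.
have dK v := derive_support v cK pK.
by rewrite -!R0//; first (apply: Hu; exact: test_fun_sub tp); exact: dK.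
Qed.

Lemma weak_gradient_unique D u g1 g2 h1 h2 : open D ->
  weak_gradient D u g1 g2 -> weak_gradient D u h1 h2 ->
  {ae leb2, forall x, D x -> g1 x = h1 x /\ g2 x = h2 x}.
Proof.
move=> oD wu wf; have [_ l1 l2 H] := weak_gradient_sub oD wu wf.
have mD := open_measurable_plane oD.
have z v psi : \int[leb2]_(x in D) ((u x - u x) * 'D_v psi x) = 0.
  under eq_Rintegral do rewrite subrr mul0r.
  by rewrite Rintegral_cst// mul0r.

have {}ae1 : {ae leb2, forall x, D x -> g1 x - h1 x = 0}.
  apply: weak_null_ae => // psi /H[+ _]; rewrite z => /esym/eqP.
  by rewrite oppr_eq0 => /eqP.
have {}ae2 : {ae leb2, forall x, D x -> g2 x - h2 x = 0}.
  apply: weak_null_ae => // psi /H[_ +]; rewrite z => /esym/eqP.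
  by rewrite oppr_eq0 => /eqP.
apply: filterS2 ae1 ae2 => x + + Dx.
by move=> /(_ Dx)/eqP + /(_ Dx)/eqP; rewrite !subr_eq0 => /eqP -> /eqP ->.
Qed.

(** Weak gradients agree almost everywhere, so that the infimum in [grad_normsq] is
    that of a singleton. *)
Lemma grad_normsqE D U u g1 g2 : open D -> mbl U -> U `<=` D ->
  weak_gradient D u g1 g2 ->
  grad_normsq D U u = (\int[leb2]_(x in U) (g1 x ^+ 2 + g2 x ^+ 2)%:E)%E.
Proof.
move=> oD mU UD wu; apply/le_anti/andP; split.
  by apply: ereal_inf_lbound; exists g1, g2.
apply: le_ereal_inf_tmp => _ [h1 [h2 [wh ->]]].
have mD := open_measurable_plane oD.
have m2 f : loc_integrable D f -> mblfun U (fun x => f x ^+ 2).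
  move=> lf; apply: measurable_funX; apply: (measurable_funS mD UD).
  exact: loc_integrable_measurable.
have [[_ lg1 lg2 _] [_ lh1 lh2 _]] := (wu, wh).
rewrite (@ae_eq_integral _ _ _ leb2 U (fun x => (h1 x ^+ 2 + h2 x ^+ 2)%:E)) //.
- by apply/measurable_EFinP; apply: measurable_funD; exact: m2.
- by apply/measurable_EFinP; apply: measurable_funD; exact: m2.
- apply: filterS (weak_gradient_unique oD wu wh) => x H Ux.
  by have [-> ->] := H (UD _ Ux).
Qed.

Lemma grad_normsq_ge0 D U u : (0 <= grad_normsq D U u)%E.
Proof.
apply: le_ereal_inf_tmp => _ [g1 [g2 [_ ->]]]; apply: integral_ge0 => x _.
by rewrite lee_fin addr_ge0 ?sqr_ge0.
Qed.

Lemma grad_normsq_L2 D u : open D -> (grad_normsq D D u < +oo)%E ->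
  exists g1 g2, [/\ weak_gradient D u g1 g2, L2 D g1, L2 D g2 &
    grad_normsq D D u = (\int[leb2]_(x in D) (g1 x ^+ 2 + g2 x ^+ 2))%:E].
Proof.
move=> oD fin; have mD := open_measurable_plane oD.
have [g1 [g2 wg]] : exists g1 g2, weak_gradient D u g1 g2.
  apply: contrapT => no; move: fin; rewrite /grad_normsq.
  rewrite (_ : [set _ | _] = set0) ?ereal_inf0 ?ltxx//.
  by apply/seteqP; split=> // e [g1 [g2 [wg _]]]; apply: no; exists g1, g2.
have E := grad_normsqE oD mD (@subset_refl _ D) wg.
have [_ lg1 lg2 _] := wg.
have mg1 := loc_integrable_measurable oD lg1.
have mg2 := loc_integrable_measurable oD lg2.
have i12 : L1 D (fun x => g1 x ^+ 2 + g2 x ^+ 2).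
  apply: L1_ge0 => //; last by rewrite -E.
    by apply: measurable_funD; exact: measurable_funX.
  by move=> x _; rewrite addr_ge0 ?sqr_ge0.
exists g1, g2; split=> //.
- split=> //; apply: L1_le i12 => //; first exact: measurable_funX.
  by move=> x _; rewrite ger0_norm ?sqr_ge0// lerDl sqr_ge0.
- split=> //; apply: L1_le i12 => //; first exact: measurable_funX.
  by move=> x _; rewrite ger0_norm ?sqr_ge0// lerDr sqr_ge0.
- by rewrite E L1_Rintegral.
Qed.

End WeakGradient.

(** * Energy comparison with a competitor and a calibration *)

Section Poincare.
Context {R : realType}.
Implicit Types (f psi : R * R -> R) (D : set (R * R)).

(** The divergence theorem for [x.1 * psi x ^+ 2] turns the integral of the square
    of psi into that of [- 2 * x.1 * psi x * 'D_e1 psi x]. *)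
Lemma poincare D psi (r : R) : mbl D -> D `<=` cbox (- r) r (- r) r -> test_fun D psi ->
  \int[leb2]_(x in D) (psi x ^+ 2) <=
  4 * r ^+ 2 * \int[leb2]_(x in D) ('D_e1 psi x ^+ 2).
Proof.
move=> mD Dr tp; have [_ [K [cK KD pK]]] := tp.
have Cp n := test_fun_Ck n tp.
have t1 := test_fun_derive e1 tp.
have Lp : L2 D psi by exact: test_fun_L2 tp.
have Lp1 : L2 D ('D_e1 psi) by exact: test_fun_L2 t1.
pose f (x : R * R) := x.1 * psi x ^+ 2.
have Cf : Ck 1 setT f.
  by apply: Ck_mul; [exact: openT|exact: Ck_fst|apply: Ck_exp; [exact: openT|exact: Cp]].
have fK x : ~ K x -> f x = 0 by move=> Kx; rewrite /f pK// expr0n mulr0.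
have Df x : 'D_e1 f x = psi x ^+ 2 + 2 * x.1 * psi x * 'D_e1 psi x.
  have d1 := is_derive_fst x e1.
  have d2 := derivableP (@Ck_derivable _ _ _ _ (Cp 1%N) x e1 I).
  have dm := is_deriveM d1 (is_deriveM d2 d2).
  have -> : f = (@fst R R) * (psi * psi) by apply/funext => y; rewrite /f expr2.
  rewrite (is_derive_val dm) /GRing.scale/= -[(psi * psi) x]/(psi x * psi x).
  by rewrite /e1/=; ring.
have H := Rintegral_derive_e1 cK Cf fK.
have mf : L1 D ('D_e1 f).
  apply: integrable_compact_support cK _ (derive_support e1 cK fK) mD => x.
  exact: (Ck_derive e1 Cf).1.
have {}H : \int[leb2]_(x in D) 'D_e1 f x = 0.
  rewrite -H; apply/esym; apply: Rintegral_subset => // x _ Dx.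
  by apply: (derive_support _ cK fK) => /KD.
have i1 : L1 D (fun x => 4 * r ^+ 2 * 'D_e1 psi x ^+ 2) by apply: L1_scale => //; exact: Lp1.2.
have i2 : L1 D (fun x => 2 * 'D_e1 f x) by exact: L1_scale.
have -> : 4 * r ^+ 2 * \int[leb2]_(x in D) ('D_e1 psi x ^+ 2) =
    \int[leb2]_(x in D) (4 * r ^+ 2 * 'D_e1 psi x ^+ 2 + 2 * 'D_e1 f x).
  by rewrite (RintegralD mD i1 i2) (RintegralZl _ mD mf) (RintegralZl _ mD Lp1.2) H mulr0 addr0.
apply: le_Rintegral => //; [exact: Lp.2|exact: L1_add|].
move=> x /Dr; rewrite cboxE Df => -[/andP[x1 x2] _].
have : (x.1) ^+ 2 <= r ^+ 2 by nra.
move: (x.1) (psi x) ('D_e1 psi x) => a b c ar.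
have : 0 <= (b + 2 * a * c) ^+ 2 by exact: sqr_ge0.
have : 0 <= (r ^+ 2 - a ^+ 2) * c ^+ 2 by rewrite mulr_ge0 ?sqr_ge0 ?subr_ge0.
by nra.
Qed.

(** If P were q, and orthogonal to q + Z, the first term of the right-hand side would
    vanish in the mean and the second one identically. *)
Lemma approximate_projection (q Z P q' Z' P' : R) : q ^+ 2 + q' ^+ 2 <=
  4 * ((q + Z) * P + (q' + Z') * P') + 6 * ((P - q) ^+ 2 + (P' - q') ^+ 2) +
  4 * (Z ^+ 2 + Z' ^+ 2).
Proof.
have key (a b c : R) : a ^+ 2 <= 4 * ((a + b) * c) + 6 * (c - a) ^+ 2 + 4 * b ^+ 2.
  rewrite -subr_ge0 (_ : _ - _ = (c + 2 * b) ^+ 2 + a ^+ 2 + c ^+ 2 + 4 * (c - a) ^+ 2); last by ring.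
  by do !apply: addr_ge0; rewrite ?sqr_ge0// mulr_ge0 ?sqr_ge0.
by have := key q Z P; have := key q' Z' P'; lra.
Qed.

End Poincare.

Section EnergyComparison.
Context {R : realType}.
Implicit Types (f psi : R * R -> R) (D : set (R * R)).
Variables (Omega S : set (R * R)) (u Phi : R * R -> R).
Hypothesis oO : open Omega.
Hypothesis bO : bounded_set Omega.
Hypothesis pot : potential Omega S u.
Hypothesis tPhi : test_fun Omega Phi.
Variable V : set (R * R).
Hypothesis oV : open V.
Hypothesis SV : closure S `<=` V.
Hypothesis PhiV : forall x, V x -> Phi x = 1.

Let F := Omega `\` closure S.

Let oF : open F.
Proof. by apply: openI => //; apply: closed_openC; exact: closed_closure. Qed.

Let FO : F `<=` Omega. Proof. by move=> x []. Qed.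

Let mO : mbl Omega := open_measurable_plane oO.
Let mF : mbl F := open_measurable_plane oF.

Let finO : (leb2 Omega < +oo)%E.
Proof. exact: leb2_bounded. Qed.

(* The function [potential] subtracts from u may be replaced by [Phi], because
   both are 1 near S: their difference is a test function of F. *)
Let approx (e : R) : 0 < e -> exists psi, [/\ test_fun F psi,
  (L2_normsq F (fun x => psi x - (u x - Phi x))%R < e%:E)%E &
  (grad_normsq F F (fun x => psi x - (u x - Phi x))%R < e%:E)%E].
Proof.
move=> e0; have [_ _ [eta [W [teta oW SW etaW [_ [ps [tps lim]]]]]] _] := pot.
have /fine_cvgP[fin /cvgrPdist_lt/(_ _ e0) small] := lim.
pose E n := (L2_normsq F (ps n \- (u \- eta))%R + grad_normsq F F (ps n \- (u \- eta))%R)%E.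
have [n [finn smalln]] : exists n, (E n \is a fin_num)%E /\ (fine (E n) < e).
  near \oo => n; exists n; split; first by near: n.
  have : `|0 - fine (E n)| < e by near: n.
  by rewrite sub0r normrN => /ltr_normlP[].
exists (fun x => ps n x + (eta x - Phi x)).
have pE : (fun x => ps n x + (eta x - Phi x) - (u x - Phi x)) = ps n \- (u \- eta).
  by apply/funext => x /=; ring.
have L0 : (0 <= L2_normsq F (ps n \- (u \- eta))%R)%E.
  by apply: integral_ge0 => x _; rewrite lee_fin sqr_ge0.
have G0 := grad_normsq_ge0 F F (ps n \- (u \- eta)).
have lte : (E n < e%:E)%E by rewrite -[ltLHS]fineK// lte_fin.
split; last by rewrite pE (le_lt_trans _ lte)// leeDr.
  apply: test_fun_add => //.
  have : test_fun Omega (fun x => eta x - Phi x).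
    by apply: test_fun_add => //; exact: test_fun_opp.
  move=> /test_funP[C [K [cK KO etaK]]]; apply/test_funP; split=> //.
  exists (K `&` ~` (W `&` V)); split.
  - apply: compact_closedI => //; rewrite -[~` _]setCK setCK; apply: open_closedC.
    exact: openI.
  - move=> x [Kx WVx]; split; first exact: KO.
    by move=> Sx; apply: WVx; split; [exact: SW|exact: SV].
  - move=> x; rewrite not_andP => -[/etaK //|/contrapT[Wx Vx]].
    by rewrite etaW// PhiV// subrr.
by rewrite pE (le_lt_trans _ lte)// leeDl.
Unshelve. all: by end_near. Qed.

Let mu_O : mblfun Omega u.
Proof. by have [[[m _ _] _] _ _ _] := pot; exact: m. Qed.

Let LPhi v : L2 Omega ('D_v Phi).
Proof. exact: test_fun_L2 mO (test_fun_derive v tPhi). Qed.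

Let mPhi : mblfun Omega Phi.
Proof. by have [] : L2 Omega Phi by exact: test_fun_L2 tPhi. Qed.

Let muF : mblfun F (fun x => u x - Phi x).
Proof.
apply: (measurable_funS mO FO); apply: measurable_funD => //.
exact: measurableT_comp.
Qed.

Let gradient_q : exists q1 q2,
  [/\ weak_gradient F (fun x => u x - Phi x) q1 q2, L2 F q1, L2 F q2,
      L2 F (fun x => u x - Phi x) &
   forall e : R, 0 < e -> exists psi, [/\ test_fun F psi,
     \int[leb2]_(x in F) ((psi x - (u x - Phi x)) ^+ 2) <= e &
     \int[leb2]_(x in F) (('D_e1 psi x - q1 x) ^+ 2 + ('D_e2 psi x - q2 x) ^+ 2) <= e]].
Proof.
have L2w psi : test_fun F psi -> (L2_normsq F (fun x => psi x - (u x - Phi x))%R < +oo)%E ->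
    L2 F (fun x => psi x - (u x - Phi x)).
  move=> tp fin.
  have mp : mblfun F (fun x => psi x - (u x - Phi x)).
    by apply: measurable_funB => //; have [] : L2 F psi by exact: test_fun_L2 tp.
  split=> //; apply: L1_ge0 => //; first exact: measurable_funX.
  by move=> x _; exact: sqr_ge0.
have wpsi psi : test_fun F psi -> weak_gradient F psi ('D_e1 psi) ('D_e2 psi).
  move=> tp; apply: weak_gradient_Ck => //.
  exact: Ck_sub (@subsetT _ _) (test_fun_Ck 1 tp).
have [psi [tp L G]] := approx ltr01.
have [h1 [h2 [wh Lh1 Lh2 _]]] := grad_normsq_L2 oF (lt_trans G (ltry _)).
have Lp : L2 F psi by exact: test_fun_L2 tp.
have Ldp v : L2 F ('D_v psi) by apply: test_fun_L2 mF _; exact: test_fun_derive tp.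
have Lw := L2w _ tp (lt_trans L (ltry _)).
have wE : (fun x => u x - Phi x) = (fun x => psi x - (psi x - (u x - Phi x))).
  by apply/funext => x; ring.
have wq : weak_gradient F (fun x => u x - Phi x) (fun x => 'D_e1 psi x - h1 x)
    (fun x => 'D_e2 psi x - h2 x).
  by rewrite wE; apply: weak_gradient_sub => //; exact: wpsi.
exists (fun x => 'D_e1 psi x - h1 x), (fun x => 'D_e2 psi x - h2 x); split=> //.
- exact: L2_sub.
- exact: L2_sub.
- by rewrite wE; exact: L2_sub.
move=> {wE} e e0; have [psi' [tp' L' G']] := approx e0.
exists psi'; split=> //.
- rewrite -lee_fin -L1_Rintegral//; first exact: ltW.
  exact: (L2w _ tp' (lt_trans L' (ltry _))).2.
- have Ldp' v : L2 F ('D_v psi') by apply: test_fun_L2 mF _; exact: test_fun_derive tp'.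
  have wd := weak_gradient_sub oF (wpsi _ tp') wq.
  rewrite -lee_fin -L1_Rintegral//.
    by rewrite -(grad_normsqE oF mF (@subset_refl _ F) wd) ltW.
  by apply: L1_add => //; apply: (L2_sub mF _ _).2 => //; exact: L2_sub.
Qed.

Variables X1 X2 : R * R -> R.
Hypothesis LX1 : L2 Omega X1.
Hypothesis LX2 : L2 Omega X2.
Hypothesis calib : forall psi, test_fun F psi ->
  \int[leb2]_(x in F) (X1 x * 'D_e1 psi x + X2 x * 'D_e2 psi x) = 0.

Let Z1 x := 'D_e1 Phi x - X1 x.
Let Z2 x := 'D_e2 Phi x - X2 x.

(** The gradient w of u - [Phi] is a limit of gradients of test functions of F.
    Hence it is orthogonal to the divergence free field X, and also to
    grad [Phi] + w because u is harmonic. Subtracting, |w|^2 is the integral of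
    - w.(grad [Phi] - X), and w is bounded by the distance Z between X and the
    gradient of [Phi]. The constants are not sharp: they leave room for test
    functions that are only close to u - [Phi] and spare the Cauchy-Schwarz
    inequality. The last bound is the Poincare inequality. *)
Theorem energy_comparison (r : R) : Omega `<=` cbox (- r) r (- r) r ->
  exists w1 w2, [/\ weak_gradient Omega u (fun x => 'D_e1 Phi x + w1 x)
                                          (fun x => 'D_e2 Phi x + w2 x),
    L2 Omega w1 /\ L2 Omega w2,
    \int[leb2]_(x in Omega) (w1 x ^+ 2 + w2 x ^+ 2) <=
      6 + 4 * \int[leb2]_(x in Omega) (Z1 x ^+ 2 + Z2 x ^+ 2),
    \int[leb2]_(x in Omega) (X1 x * w1 x + X2 x * w2 x) = 0 &
    L1 Omega (fun x => (u x - Phi x) ^+ 2) /\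
    \int[leb2]_(x in Omega) ((u x - Phi x) ^+ 2) <=
      2 + 16 * r ^+ 2 * (7 + 4 * \int[leb2]_(x in Omega) (Z1 x ^+ 2 + Z2 x ^+ 2))].
Proof.
move=> Or.
have [q1 [q2 [wq Lq1 Lq2 Lw app]]] := gradient_q.
have Lu0 : L1 F (fun x => u x - Phi x).
  apply: L2_L1 => //; apply: le_lt_trans finO.
  by apply: le_measure => //; rewrite inE.
have out x : closure S x -> u x = 1 -> u x - Phi x = 0.
  by move=> Sx ->; rewrite PhiV ?subrr//; exact: SV.
have u1 : {ae leb2, forall x, closure S x -> u x = 1} by case: pot.
have aeF : {ae leb2, forall x, Omega x -> u x - Phi x = ((fun x => u x - Phi x) \_ F) x}.
  apply: filterS u1 => x ux Ox; rewrite patchE; case: ifPn => //.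
  rewrite notin_setE => Fx; apply: out => //; first by apply: contrapT => Sx; apply: Fx.
  by apply: ux; apply: contrapT => Sx; apply: Fx.
have Ldp psi v : test_fun F psi -> L2 F ('D_v psi).
  by move=> tp; apply: test_fun_L2 mF _; exact: test_fun_derive tp.
have LX1F : L2 F X1 by exact: L2_subset LX1.
have LX2F : L2 F X2 by exact: L2_subset LX2.
have LPF v : L2 F ('D_v Phi) by exact: L2_subset (LPhi v).
have wPhi : weak_gradient Omega Phi ('D_e1 Phi) ('D_e2 Phi).
  by apply: weak_gradient_Ck => //; exact: Ck_sub (@subsetT _ _) (test_fun_Ck 1 tPhi).
(* On the whole of Omega the weak gradient of u - [Phi] is q extended by zero:
   integrate by parts for test functions of F, then pass to the limit. *)
have parts v q : L2 F q ->
    (forall e : R, 0 < e -> exists psi, [/\ test_fun F psi,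
     \int[leb2]_(x in F) ((psi x - (u x - Phi x)) ^+ 2) <= e &
     \int[leb2]_(x in F) (('D_v psi x - q x) ^+ 2) <= e]) ->
    (forall psi f, test_fun F psi -> test_fun Omega f -> \int[leb2]_(x in F) (psi x * 'D_v f x) =
       - \int[leb2]_(x in F) ('D_v psi x * f x)) ->
    forall f, test_fun Omega f ->
    \int[leb2]_(x in Omega) ((u x - Phi x) * 'D_v f x) =
    - \int[leb2]_(x in Omega) ((q \_ F) x * f x).
  move=> Lq appq byparts f tf.
  have tdf := test_fun_derive v tf.
  have LfF : L2 F f by exact: test_fun_L2 tf.
  have LdfF : L2 F ('D_v f) by exact: test_fun_L2 tdf.
  have LfO : L2 Omega f by exact: test_fun_L2 tf.
  have LdfO : L2 Omega ('D_v f) by exact: test_fun_L2 tdf.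
  have -> : \int[leb2]_(x in Omega) ((u x - Phi x) * 'D_v f x) =
      \int[leb2]_(x in F) ((u x - Phi x) * 'D_v f x).
    rewrite -(Rintegral_patch _ FO); apply: Rintegral_ae => //.
    - apply: measurable_funM; last by case: LdfO.
      by apply: measurable_funB.
    - by apply: L1_measurable; apply: L1_patch => //; exact: L2_mul.
    - apply: filterS aeF => x H Ox; rewrite (H Ox) !patchE.
      by case: ifP => // _; rewrite mul0r.
  have -> : \int[leb2]_(x in Omega) ((q \_ F) x * f x) = \int[leb2]_(x in F) (q x * f x).
    rewrite -(Rintegral_patch _ FO); apply: eq_Rintegral => x _.
    by rewrite !patchE; case: ifP => // _; rewrite mul0r.
  apply/eqP; rewrite -addr_eq0; apply/eqP.
  have i1 := L2_mul mF Lw LdfF; have i2 := L2_mul mF Lq LfF.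
  apply: (@Rintegral_mul_limit0 _ F ('D_v f) f) => // e e0.
  have [psi [tp p1 p2]] := appq e e0.
  have Lp : L2 F psi by exact: test_fun_L2 tp.
  have i3 := L2_mul mF Lp LdfF; have i4 := L2_mul mF (Ldp _ v tp) LfF.
  exists (fun x => (u x - Phi x) - psi x), (fun x => q x - 'D_v psi x); split.
  - exact: L2_sub.
  - by apply: L2_sub => //; exact: Ldp.
  - by under eq_Rintegral do rewrite -sqrrN opprB.
  - by under eq_Rintegral do rewrite -sqrrN opprB.
  rewrite [X in _ = X + _](Rintegral_mulBl mF i1 i3) (Rintegral_mulBl mF i2 i4).
  by rewrite (byparts psi f tp tf) opprK addrACA subrr addr0.
have byparts psi f : test_fun F psi -> test_fun Omega f ->
    \int[leb2]_(x in F) (psi x * 'D_e1 f x) = - (\int[leb2]_(x in F) ('D_e1 psi x * f x)) /\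
    \int[leb2]_(x in F) (psi x * 'D_e2 f x) = - (\int[leb2]_(x in F) ('D_e2 psi x * f x)).
  move=> tp tf.
  have [_ _ _ /(_ _ tp)[H1 H2]] := weak_gradient_Ck oF (Ck_sub (@subsetT _ F) (test_fun_Ck 1 tf)).
  have C (a b : R * R -> R) : \int[leb2]_(x in F) (a x * b x) = \int[leb2]_(x in F) (b x * a x).
    by apply: eq_Rintegral => x _; rewrite mulrC.
  split; first by rewrite (C psi ('D_e1 f)) -[LHS]opprK -H1 (C f ('D_e1 psi)).
  by rewrite (C psi ('D_e2 f)) -[LHS]opprK -H2 (C f ('D_e2 psi)).
have i2 g1 g2 : L2 F g1 -> L2 F g2 -> L1 F (fun x => g1 x ^+ 2 + g2 x ^+ 2).
  by move=> [_ L] [_ L']; exact: L1_add.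
have app1 e : 0 < e -> exists psi, [/\ test_fun F psi,
     \int[leb2]_(x in F) ((psi x - (u x - Phi x)) ^+ 2) <= e,
     \int[leb2]_(x in F) (('D_e1 psi x - q1 x) ^+ 2) <= e &
     \int[leb2]_(x in F) (('D_e2 psi x - q2 x) ^+ 2) <= e].
  move=> e0; have [psi [tp p1 p2]] := app e e0; exists psi; split=> //.
    apply: le_trans p2; apply: le_Rintegral => //.
    - by apply: (L2_sub mF _ _).2 => //; exact: Ldp.
    - by apply: i2; apply: L2_sub => //; exact: Ldp.
    - by move=> x _; rewrite lerDl sqr_ge0.
  apply: le_trans p2; apply: le_Rintegral => //.
  - by apply: (L2_sub mF _ _).2 => //; exact: Ldp.
  - by apply: i2; apply: L2_sub => //; exact: Ldp.
  - by move=> x _; rewrite lerDr sqr_ge0.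
have Lq1O := L2_patch mO mF FO Lq1; have Lq2O := L2_patch mO mF FO Lq2.
have wO : weak_gradient Omega (fun x => u x - Phi x) (q1 \_ F) (q2 \_ F).
  split.
  - apply: L1_loc => //; apply: L1_ae aeF => //; last exact: L1_patch.
    by apply: measurable_funB.
  - by apply: L1_loc => //; exact: L2_L1.
  - by apply: L1_loc => //; exact: L2_L1.
  move=> f tf; split.
    apply: (parts e1) => // [e /app1[psi [? ? ? _]]|psi f' tp tf']; first by exists psi.
    exact: (byparts psi f' tp tf').1.
  apply: (parts e2) => // [e /app1[psi [? ? _ ?]]|psi f' tp tf']; first by exists psi.
  exact: (byparts psi f' tp tf').2.
(* Weak harmonicity, stated with second derivatives of the test function, in
   terms of the weak gradient. *)
have harm psi : test_fun F psi -> \int[leb2]_(x in F)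
    ((q1 x + 'D_e1 Phi x) * 'D_e1 psi x + (q2 x + 'D_e2 Phi x) * 'D_e2 psi x) = 0.
  move=> tp.
  have wu : weak_gradient F u (fun x => q1 x + 'D_e1 Phi x) (fun x => q2 x + 'D_e2 Phi x).
    have := weak_gradient_add oF wq (weak_gradient_subset FO wPhi).
    by congr (weak_gradient _ _ _ _); apply/funext => x; rewrite subrK.
  have [lu l1 l2 Hu] := wu.
  have t1 := test_fun_derive e1 tp; have t2 := test_fun_derive e2 tp.
  have [_ /(_ _ tp) pot0 _ _] := pot.
  have td v w := test_fun_derive v (test_fun_derive w tp).
  have HS : \int[leb2]_(x in F) (u x * ('D_e1 ('D_e1 psi) x + 'D_e2 ('D_e2 psi) x)) =
      \int[leb2]_(x in F) (u x * 'D_e1 ('D_e1 psi) x) +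
      \int[leb2]_(x in F) (u x * 'D_e2 ('D_e2 psi) x).
    rewrite -(RintegralD mF (loc_integrable_test mF lu (td e1 e1))
      (loc_integrable_test mF lu (td e2 e2))).
    by apply: eq_Rintegral => x _; rewrite mulrDr.
  have HG := RintegralD mF (loc_integrable_test mF l1 t1) (loc_integrable_test mF l2 t2).
  have key (a b c d s : R) : s = 0 -> s = a + b -> a = - c -> b = - d -> c + d = 0.
    by move=> s0 sab ac bd; move: sab; rewrite s0 ac bd => /esym/eqP; rewrite -opprD oppr_eq0 => /eqP.
  by apply: (etrans HG); exact: key pot0 HS (Hu _ t1).1 (Hu _ t2).2.
have Xq0 : \int[leb2]_(x in F) (X1 x * q1 x + X2 x * q2 x) = 0.
  rewrite RintegralD//; [|exact: L2_mul..].
  apply: (@Rintegral_mul_limit0 _ F X1 X2) => // e e0.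
  have [psi [tp _ p1 p2]] := app1 e e0.
  exists (fun x => q1 x - 'D_e1 psi x), (fun x => q2 x - 'D_e2 psi x); split.
  - by apply: L2_sub => //; exact: Ldp.
  - by apply: L2_sub => //; exact: Ldp.
  - by under eq_Rintegral do rewrite -sqrrN opprB.
  - by under eq_Rintegral do rewrite -sqrrN opprB.
  have C (a b : R * R -> R) : \int[leb2]_(x in F) (a x * b x) = \int[leb2]_(x in F) (b x * a x).
    by apply: eq_Rintegral => x _; rewrite mulrC.
  have j v X : L2 F X -> L1 F (fun x => 'D_v psi x * X x).
    by move=> LX; apply: L2_mul => //; exact: Ldp.
  have H1 := Rintegral_mulBl mF (L2_mul mF Lq1 LX1F) (j e1 _ LX1F).
  have H2 := Rintegral_mulBl mF (L2_mul mF Lq2 LX2F) (j e2 _ LX2F).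
  have H3 := RintegralD mF (L2_mul mF LX1F (Ldp _ e1 tp)) (L2_mul mF LX2F (Ldp _ e2 tp)).
  have key (a b a' b' c d s : R) : c = a - a' -> d = b - b' -> s = a' + b' -> s = 0 ->
      a + b = c + d.
    by move=> -> -> -> H; rewrite addrACA -opprD H subr0.
  rewrite (C X1 q1) (C X2 q2); apply: (key _ _ _ _ _ _ _ H1 H2 _ (calib tp)).
  by rewrite (C _ X1) (C _ X2).
have LZ1 : L2 F Z1 by exact: L2_sub.
have LZ2 : L2 F Z2 by exact: L2_sub.
have LZ1O : L2 Omega Z1 by exact: L2_sub.
have LZ2O : L2 Omega Z2 by exact: L2_sub.
set EZ := \int[leb2]_(x in Omega) (Z1 x ^+ 2 + Z2 x ^+ 2).
have EZF : \int[leb2]_(x in F) (Z1 x ^+ 2 + Z2 x ^+ 2) <= EZ.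
  apply: ge0_le_Rintegral_subset => //; first by apply: L1_add => //; [exact: LZ1O.2|exact: LZ2O.2].
  by move=> x _; rewrite addr_ge0 ?sqr_ge0.
clearbody EZ.
have [psi [tp p0 p1 p2]] := app1 1 ltr01.
have [psi' [tp' p0' p12]] := app 1 ltr01.
have Eq : \int[leb2]_(x in F) (q1 x ^+ 2 + q2 x ^+ 2) <= 6 + 4 * EZ.
  (* P, the gradient of a test function at distance 1 from u - [Phi], is
     orthogonal to q + Z. *)
  pose P1 := 'D_e1 psi'; pose P2 := 'D_e2 psi'.
  have LP1 : L2 F P1 by exact: Ldp.
  have LP2 : L2 F P2 by exact: Ldp.
  have zero : \int[leb2]_(x in F) ((q1 x + Z1 x) * P1 x + (q2 x + Z2 x) * P2 x) = 0.
    rewrite -[RHS]subr0 -{1}(harm _ tp') -(calib tp') -RintegralB//.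
    - have key (q D X p q' D' X' p' : R) : (q + (D - X)) * p + (q' + (D' - X')) * p' =
          ((q + D) * p + (q' + D') * p') - (X * p + X' * p') by ring.
      by apply: eq_Rintegral => x _; exact: key.
    - exact: L1_add mF (L2_mul mF (L2_add mF Lq1 (LPF e1)) LP1) (L2_mul mF (L2_add mF Lq2 (LPF e2)) LP2).
    - exact: L1_add mF (L2_mul mF LX1F LP1) (L2_mul mF LX2F LP2).
  have izero : L1 F (fun x => (q1 x + Z1 x) * P1 x + (q2 x + Z2 x) * P2 x).
    exact: L1_add mF (L2_mul mF (L2_add mF Lq1 LZ1) LP1) (L2_mul mF (L2_add mF Lq2 LZ2) LP2).
  have iz : L1 F (fun x => 4 * ((q1 x + Z1 x) * P1 x + (q2 x + Z2 x) * P2 x)).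
    exact: (L1_scale 4 mF izero).
  have ih : L1 F (fun x => 6 * ((P1 x - q1 x) ^+ 2 + (P2 x - q2 x) ^+ 2)).
    by apply: L1_scale => //; apply: i2; exact: L2_sub.
  have iZ : L1 F (fun x => 4 * (Z1 x ^+ 2 + Z2 x ^+ 2)).
    by apply: L1_scale => //; exact: i2.
  apply: (@le_trans _ _ (\int[leb2]_(x in F) (4 * ((q1 x + Z1 x) * P1 x + (q2 x + Z2 x) * P2 x) +
     6 * ((P1 x - q1 x) ^+ 2 + (P2 x - q2 x) ^+ 2) + 4 * (Z1 x ^+ 2 + Z2 x ^+ 2)))).
    apply: le_Rintegral => //; first exact: i2.
      by apply: L1_add => //; exact: L1_add.
    by move=> x _; exact: approximate_projection.
  rewrite RintegralD//; last exact: L1_add.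
  rewrite RintegralD// !RintegralZl//; [|exact: i2|by apply: i2; exact: L2_sub].
  rewrite zero mulr0 add0r lerD ?ler_wpM2l//.
  by rewrite -[leRHS]mulr1 ler_wpM2l.
have patch2 (f1 f2 g1 g2 : R * R -> R) :
    (fun x => f1 x * (g1 \_ F) x + f2 x * (g2 \_ F) x) =
    (fun x => f1 x * g1 x + f2 x * g2 x) \_ F.
  by apply/funext => x; rewrite !patchE; case: ifP => // _; rewrite !mulr0 addr0.
have sq2 (g : R * R -> R) : (fun x => (g \_ F) x ^+ 2) = (fun x => g x ^+ 2) \_ F.
  by apply/funext => x; rewrite !patchE; case: ifP => // _; rewrite expr0n.
exists (q1 \_ F), (q2 \_ F); split=> //.
- have := weak_gradient_add oO wPhi wO.
  by congr (weak_gradient _ _ _ _); apply/funext => x; rewrite addrC subrK.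
- rewrite [leLHS](_ : _ = \int[leb2]_(x in Omega) ((fun x => q1 x ^+ 2 + q2 x ^+ 2) \_ F) x).
    by rewrite Rintegral_patch.
  by apply: eq_Rintegral => x _; rewrite !patchE; case: ifP => // _; rewrite expr0n addr0.
- rewrite [LHS](_ : _ = \int[leb2]_(x in Omega) ((fun x => X1 x * q1 x + X2 x * q2 x) \_ F) x).
    by rewrite Rintegral_patch.
  by rewrite -patch2.
have aeF2 : {ae leb2, forall x, Omega x -> (u x - Phi x) ^+ 2 = ((fun x => (u x - Phi x) ^+ 2) \_ F) x}.
  by apply: filterS aeF => x H Ox; rewrite (H Ox) !patchE; case: ifP => // _; rewrite expr0n.
have m2 : mblfun Omega (fun x => (u x - Phi x) ^+ 2).
  by apply: measurable_funX; exact: measurable_funB.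
have i2O : L1 Omega ((fun x => (u x - Phi x) ^+ 2) \_ F) by apply: L1_patch => //; exact: Lw.2.
split; first exact: L1_ae aeF2.
rewrite (Rintegral_ae mO m2 (L1_measurable i2O) aeF2) Rintegral_patch//.
have Lp : L2 F psi by exact: test_fun_L2 tp.
have LD : L2 F ('D_e1 psi) by exact: Ldp.
have Lpw : L2 F (fun x => psi x - (u x - Phi x)) by exact: L2_sub.
have LDq : L2 F (fun x => 'D_e1 psi x - q1 x) by exact: L2_sub.
apply: (@le_trans _ _ (\int[leb2]_(x in F) (2 * (psi x - (u x - Phi x)) ^+ 2 + 2 * psi x ^+ 2))).
  apply: le_Rintegral => //; [exact: Lw.2| |].
    by apply: L1_add => //; apply: L1_scale => //; [exact: Lpw.2|exact: Lp.2].
  move=> x _; move: (psi x) (u x - Phi x) => a b.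
  by rewrite -subr_ge0 (_ : _ - _ = (2 * a - b) ^+ 2); [exact: sqr_ge0|ring].
have DE : \int[leb2]_(x in F) ('D_e1 psi x ^+ 2) <= 2 + 2 * (6 + 4 * EZ).
  apply: (@le_trans _ _ (\int[leb2]_(x in F) (2 * ('D_e1 psi x - q1 x) ^+ 2 + 2 * (q1 x ^+ 2 + q2 x ^+ 2)))).
    apply: le_Rintegral => //; [exact: LD.2| |].
      by apply: L1_add => //; apply: L1_scale => //; [exact: LDq.2|exact: i2].
    have key (a b c : R) : a ^+ 2 <= 2 * (a - b) ^+ 2 + 2 * (b ^+ 2 + c ^+ 2).
      rewrite -subr_ge0 (_ : _ - _ = (a - 2 * b) ^+ 2 + 2 * c ^+ 2); last by ring.
      by apply: addr_ge0; rewrite ?sqr_ge0// mulr_ge0 ?sqr_ge0.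
    by move=> x _; exact: key.
  rewrite RintegralD//; [|by apply: L1_scale => //; exact: LDq.2|by apply: L1_scale => //; exact: i2].
  rewrite !RintegralZl//; [|exact: LDq.2|exact: i2].
  by rewrite lerD// ?ler_wpM2l// -[leRHS]mulr1 ler_wpM2l.
have := poincare mF (subset_trans FO Or) tp.
rewrite RintegralD//; [|by apply: L1_scale => //; exact: Lpw.2|by apply: L1_scale => //; exact: Lp.2].
rewrite !RintegralZl//; [|exact: Lp.2|exact: Lpw.2].
have : 4 * r ^+ 2 * \int[leb2]_(x in F) ('D_e1 psi x ^+ 2) <= 4 * r ^+ 2 * (2 + 2 * (6 + 4 * EZ)).
  by apply: ler_wpM2l => //; rewrite mulr_ge0 ?sqr_ge0.
move=> H Pn; apply: lerD; first by rewrite -[leRHS]mulr1 ler_wpM2l.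
have -> : 16 * r ^+ 2 * (7 + 4 * EZ) = 2 * (4 * r ^+ 2 * (2 + 2 * (6 + 4 * EZ))) by ring.
by rewrite ler_wpM2l// (le_trans Pn).
Qed.

End EnergyComparison.

(** * Truncations and bounds on the arctangent *)

Section Ramp.
Context {R : realType}.
Implicit Types t u : R.

Definition dstep u : R :=
  (flat 2 u * flat 0 (1 - u) + flat 0 u * flat 2 (1 - u)) /
  (flat 0 u + flat 0 (1 - u)) ^+ 2.

Lemma is_derive_affine (a b t : R) : is_derive t (1 : R) (fun t : R => a * t + b) a.
Proof.
have d := is_deriveD (is_deriveZ a (is_derive_id t (1 : R))) (is_derive_cst b t (1 : R)).
rewrite (_ : (fun t => _) = a *: id + cst b); last exact/funext.
by apply: (is_derive_eq d); rewrite addr0 [a *: 1]mulr1.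
Qed.

Lemma is_derive_step u : is_derive u 1 step (dstep u).
Proof.
have d0 t : is_derive t 1 (flat 0) (flat 2 t).
  by apply: (is_derive_eq (is_derive_flat 0 t)); rewrite mulr0n oppr0 mul0r add0r.
have d1 : is_derive u 1 (fun t : R => 1 - t) (-1).
  rewrite (_ : (fun t => _) = (fun t => -1 * t + 1)); first exact: is_derive_affine.
  by apply/funext => t; rewrite mulN1r addrC.
have dg : is_derive u 1 (fun t : R => flat 0 (1 - t)) (flat 2 (1 - u) * -1).
  exact: (@is_derive1_comp _ (flat 0) (fun t : R => 1 - t) u _ _ (d0 (1 - u)) d1).
have dD := is_deriveD (d0 u) dg.
have D0 : (flat 0 + (fun t : R => flat 0 (1 - t))) u != 0.
  by rewrite gt_eqF//; exact: step_denom.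
have dV := is_deriveV D0 dD.
apply: (is_derive_eq (is_deriveM (d0 u) dV)).
rewrite /dstep /GRing.scale/=.
have -> : (flat 0 + (fun t : R => flat 0 (1 - t))) u = flat 0 u + flat 0 (1 - u) by [].
have := step_denom u; move: (flat 0 u) (flat 0 (1 - u)) (flat 2 u) (flat 2 (1 - u)).
by move=> a b c e ab; field; rewrite gt_eqF.
Qed.

Lemma dstep_out u : ~~ (0 < u < 1) -> dstep u = 0.
Proof.
rewrite negb_and -!leNgt /dstep => /orP[u0|u1].
  by rewrite !(@flat_le0 _ _ u)// !mul0r addr0 mul0r.
by rewrite !(@flat_le0 _ _ (1 - u)) ?subr_le0// !mulr0 addr0 mul0r.
Qed.

Lemma step_denom_ge u : expR (- 2) <= flat 0 u + flat 0 (1 - u).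
Proof.
have H t : 1 / 2 <= t -> expR (- 2) <= flat 0 t.
  move=> t2; have t0 : 0 < t by apply: lt_le_trans t2; rewrite divr_gt0.
  rewrite /flat t0 expr0 mul1r ler_expR lerN2.
  by rewrite invf_ple ?posrE//; move: t2; rewrite div1r.
have [u2|u2] := leP (1 / 2) u.
  by apply: (le_trans (H _ u2)); rewrite lerDl flat_ge0.
have u2' : 1 / 2 <= 1 - u by lra.
by apply: (le_trans (H _ u2')); rewrite lerDr flat_ge0.
Qed.

Lemma flat0_le1 u : flat 0 u <= 1.
Proof.
rewrite /flat; case: ifPn => // u0; rewrite expr0 mul1r -expR0 ler_expR oppr_le0.
by rewrite invr_ge0 ltW.
Qed.

(** The numerator of [dstep] is at most 12 by [flat_bound], and its denominator at
    least exp (-4) by [step_denom_ge]. *)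
Definition dstep_bound : R := 12 * expR 4.

Lemma dstep_bound_ge0 : 0 <= dstep_bound.
Proof. by rewrite mulr_ge0 ?expR_ge0. Qed.

Lemma norm_dstep_le u : `|dstep u| <= dstep_bound.
Proof.
have [u01|/dstep_out->] := boolP (0 < u < 1); last by rewrite normr0 dstep_bound_ge0.
have f2 t : 0 <= t <= 1 -> 0 <= flat 2 t <= 6.
  move=> /andP[t0 t1]; have /andP[-> H] := flat_bound 2 t.
  apply: (le_trans H); rewrite ger0_norm//.
  by rewrite -[leRHS]mulr1 ler_wpM2l// ler_nat.
have /andP[a0 a6] : 0 <= flat 2 u <= 6 by apply: f2; lra.
have /andP[b0 b6] : 0 <= flat 2 (1 - u) <= 6 by apply: f2; lra.
have c0 := flat_ge0 0 u; have c1 := flat0_le1 u.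
have e0 := flat_ge0 0 (1 - u); have e1 := flat0_le1 (1 - u).
have D := step_denom u; have DE := step_denom_ge u.
rewrite /dstep ger0_norm; last by rewrite divr_ge0 ?addr_ge0 ?mulr_ge0 ?exprn_ge0 ?(ltW D).
rewrite ler_pdivrMr ?exprn_gt0// /dstep_bound.
have N : flat 2 u * flat 0 (1 - u) + flat 0 u * flat 2 (1 - u) <= 12 by nra.
apply: (le_trans N); rewrite -mulrA -[leLHS]mulr1 ler_wpM2l//.
have E4 : expR 4 * expR (- 2) ^+ 2 = 1 :> R.
  by rewrite -expRM_natl -expRD (_ : 4 + _ = 0) ?expR0//; lra.
by rewrite -[leLHS]E4 ler_wpM2l ?expR_ge0// lerXn2r ?nnegrE ?expR_ge0 ?(ltW D).
Qed.

(** A smooth truncation of the identity of [0, 1]: it is 0 below [delta], 1 above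
    [1 - delta], the identity in between up to layers of width [delta], and its
    slope is bounded independently of [delta]. *)
Definition ramp (delta t : R) : R :=
  t * step (t / delta - 1) * step ((1 - t) / delta - 1)
  + (1 - step ((1 - t) / delta - 1)).

Definition dramp (delta t : R) : R :=
  step (t / delta - 1) * step ((1 - t) / delta - 1)
  + t * (dstep (t / delta - 1) / delta) * step ((1 - t) / delta - 1)
  + (1 - t * step (t / delta - 1)) * (dstep ((1 - t) / delta - 1) / delta).

Variable delta : R.
Hypothesis delta_gt0 : 0 < delta.
Hypothesis delta_le : 4 * delta <= 1.

Let scaled_le0 t : t <= delta -> t / delta - 1 <= 0.
Proof. by move=> h; rewrite subr_le0 ler_pdivrMr// mul1r. Qed.

Let scaled_ge1 t : 2 * delta <= t -> 1 <= t / delta - 1.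
Proof. by move=> h; rewrite lerBrDr ler_pdivlMr//; lra. Qed.

Lemma ramp_low t : t <= delta -> ramp delta t = 0.
Proof.
move=> td; rewrite /ramp (step_le0 (scaled_le0 td)) (@step_ge1 _ ((1 - t) / _ - 1)).
  by rewrite mulr0 mul0r subrr addr0.
by apply: scaled_ge1; have := delta_gt0; have := delta_le; lra.
Qed.

Lemma ramp_high t : 1 - delta <= t -> ramp delta t = 1.
Proof.
move=> td; rewrite /ramp (@step_le0 _ ((1 - t) / _ - 1)) ?mulr0 ?subr0 ?add0r//.
by apply: scaled_le0; lra.
Qed.

Lemma ramp01 t : 0 <= t -> 0 <= ramp delta t <= 1.
Proof.
move=> t0; have [t1|t1] := leP (1 - delta) t; first by rewrite ramp_high// ler01 lexx.
rewrite /ramp; have /andP[] := step01 (t / delta - 1).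
have /andP[] := step01 ((1 - t) / delta - 1).
move: (step _) (step _) => b a b0 b1 a0 a1.
have h0 : 0 <= t * b * a by rewrite !mulr_ge0.
have h1 : t * b * a <= a.
  by rewrite -[leRHS]mul1r ler_wpM2r// mulr_ile1//; have := delta_gt0; lra.
by apply/andP; split; lra.
Qed.

Lemma ramp_le t : 0 <= t -> ramp delta t <= 2 * t.
Proof.
move=> t0; have [t1|t1] := leP (1 / 2) t.
  by have /andP[_ h] := ramp01 t0; apply: le_trans h _; lra.
rewrite /ramp (@step_ge1 _ ((1 - t) / _ - 1)); last first.
  by apply: scaled_ge1; have := delta_gt0; have := delta_le; lra.
have /andP[] := step01 (t / delta - 1).
move: (step _) => a a0 a1; nra.
Qed.

Lemma is_derive_ramp t : is_derive t 1 (ramp delta) (dramp delta t).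
Proof.
have da : is_derive t (1 : R) (fun t : R => t / delta - 1) delta^-1.
  rewrite (_ : (fun t => _) = (fun t => delta^-1 * t + (-1))); first exact: is_derive_affine.
  by apply/funext => u; rewrite mulrC.
have db : is_derive t (1 : R) (fun t : R => (1 - t) / delta - 1) (- delta^-1).
  rewrite (_ : (fun t => _) = (fun t => - delta^-1 * t + (delta^-1 - 1))).
    exact: is_derive_affine.
  by apply/funext => u; ring.
have dA := @is_derive1_comp _ step (fun t : R => t / delta - 1) t _ _
  (is_derive_step (t / delta - 1)) da.
have dB := @is_derive1_comp _ step (fun t : R => (1 - t) / delta - 1) t _ _
  (is_derive_step ((1 - t) / delta - 1)) db.
set A := step \o _ in dA; set B := step \o _ in dB.
have dT := is_deriveM (is_deriveM (is_derive_id t (1 : R)) dA) dB.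
have dD := is_deriveD dT (is_deriveB (is_derive_cst (1 : R) t (1 : R)) dB).
rewrite (_ : ramp delta = id * A * B + (cst 1 - B)); last exact/funext.
apply: (is_derive_eq dD).
rewrite /dramp /GRing.scale /= -[(id * A) t]/(t * A t) -/(A t) -/(B t).
rewrite -[step (t / delta - 1)]/(A t) -[step ((1 - t) / delta - 1)]/(B t).
by ring.
Qed.

Lemma dramp_mid t : 2 * delta <= t <= 1 - 2 * delta -> dramp delta t = 1.
Proof.
move=> /andP[t1 t2]; rewrite /dramp !dstep_out ?mul0r ?mulr0 ?addr0.
- rewrite !step_ge1 ?mulr1 ?mul0r ?addr0//; apply: scaled_ge1 => //; lra.
- by rewrite negb_and -!leNgt scaled_ge1 ?orbT//; lra.
- by rewrite negb_and -!leNgt scaled_ge1 ?orbT//; lra.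
Qed.

Definition dramp_bound : R := 1 + 4 * dstep_bound.

Lemma dramp_bound_ge1 : 1 <= dramp_bound.
Proof. by rewrite lerDl mulr_ge0 ?dstep_bound_ge0. Qed.

Lemma norm_dramp_le t : `|dramp delta t| <= dramp_bound.
Proof.
have S0 := dstep_bound_ge0.
have /andP[a0 a1] := step01 (t / delta - 1).
have /andP[b0 b1] := step01 ((1 - t) / delta - 1).
have A : `|t * (dstep (t / delta - 1) / delta) * step ((1 - t) / delta - 1)| <= 2 * dstep_bound.
  rewrite normrM (ger0_norm b0); have [h|/dstep_out->] := boolP (0 < t / delta - 1 < 1).
    have t12 : delta <= t <= 2 * delta.
      move: h; rewrite subr_gt0 ltr_pdivlMr// mul1r ltrBlDr ltr_pdivrMr//; lra.
    have : `|t * (dstep (t / delta - 1) / delta)| <= 2 * dstep_bound.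
      rewrite mulrCA mulrC normrM; apply: ler_pM => //; last exact: norm_dstep_le.
      by rewrite ger0_norm ?divr_ge0//; [rewrite ler_pdivrMr//; lra|lra|lra].
    by have := normr_ge0 (t * (dstep (t / delta - 1) / delta)); nra.
  by rewrite mul0r mulr0 normr0 mul0r mulr_ge0.
have B : `|(1 - t * step (t / delta - 1)) * (dstep ((1 - t) / delta - 1) / delta)| <= 2 * dstep_bound.
  have [h|/dstep_out->] := boolP (0 < (1 - t) / delta - 1 < 1); last first.
    by rewrite mul0r mulr0 normr0 mulr_ge0.
  have t12 : delta <= 1 - t <= 2 * delta.
    move: h; rewrite subr_gt0 ltr_pdivlMr// mul1r ltrBlDr ltr_pdivrMr//; lra.
  rewrite step_ge1 ?mulr1; last first.
    by apply: scaled_ge1; have := delta_gt0; have := delta_le; lra.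
  rewrite mulrCA mulrC normrM; apply: ler_pM => //; last exact: norm_dstep_le.
  by rewrite ger0_norm ?divr_ge0//; [rewrite ler_pdivrMr//; lra|lra|lra].
have C : `|step (t / delta - 1) * step ((1 - t) / delta - 1)| <= 1.
  by rewrite normrM !ger0_norm// mulr_ile1.
rewrite /dramp /dramp_bound (le_trans (ler_normD _ _))//.
apply: (@le_trans _ _ ((1 + 2 * dstep_bound) + 2 * dstep_bound)); last by lra.
by apply: lerD => //; rewrite (le_trans (ler_normD _ _))// lerD.
Qed.

Lemma Ck_ramp n U (f : R * R -> R) : open U -> Ck n U f ->
  Ck n U (fun x => ramp delta (f x)).
Proof.
move=> oU Cf; have Cs1 : Ck n U (fun x => step (f x / delta - 1)).
  apply: Ck_step => //; apply: Ck_sub_fun => //; last exact: Ck_cst.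
  by apply: Ck_mul => //; exact: Ck_cst.
have Cs2 : Ck n U (fun x => step ((1 - f x) / delta - 1)).
  apply: Ck_step => //; apply: Ck_sub_fun => //; last exact: Ck_cst.
  apply: Ck_mul => //; last exact: Ck_cst.
  by apply: Ck_sub_fun => //; exact: Ck_cst.
apply: Ck_add => //; first by apply: Ck_mul => //; exact: Ck_mul.
by apply: Ck_sub_fun => //; exact: Ck_cst.
Qed.

End Ramp.

Section Atan.
Context {R : realType}.
Implicit Types t q k : R.

Lemma atan_lipschitz (a b : R) : a <= b -> atan b - atan a <= b - a.
Proof.
rewrite le_eqVlt => /predU1P[->|ab]; first by rewrite !subrr.
have [c _ ->] : exists2 c, c \in `]a, b[%R & atan b - atan a = (1 + c ^+ 2)^-1 * (b - a).
  apply: (@MVT _ atan (fun c => (1 + c ^+ 2)^-1)) => //.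
  by apply: continuous_subspaceT => x; exact: continuous_atan.
have ba : 0 <= b - a by rewrite subr_ge0 ltW.
rewrite -[leRHS]mul1r ler_wpM2r// invf_le1 ?lerDl ?sqr_ge0//.
by rewrite ltr_pwDl// sqr_ge0.
Qed.

Lemma atan_expand (a b M : R) : a <= b -> `|a| <= M -> `|b| <= M ->
  (b - a) / (1 + M ^+ 2) <= atan b - atan a.
Proof.
rewrite le_eqVlt => /predU1P[->|ab] aM bM; first by rewrite !subrr mul0r.
have [c + ->] : exists2 c, c \in `]a, b[%R & atan b - atan a = (1 + c ^+ 2)^-1 * (b - a).
  apply: (@MVT _ atan (fun c => (1 + c ^+ 2)^-1)) => //.
  by apply: continuous_subspaceT => x; exact: continuous_atan.
rewrite in_itv/= => /andP[ac cb].
have ba : 0 <= b - a by rewrite subr_ge0 ltW.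
rewrite mulrC ler_wpM2r// lef_pV2 ?posrE ?ltr_pwDl ?sqr_ge0// lerD2l.
have cM : `|c| <= M by move: aM bM; rewrite !ler_norml; lra.
by rewrite -(real_normK (num_real c)) lerXn2r ?nnegrE ?(le_trans _ cM).
Qed.

Lemma atan_inv q : 0 < q -> atan q^-1 = pi / 2 - atan q.
Proof.
move=> q0; have := atan_gtNpi2 q; have := atan_ltpi2 q => a1 a2.
have a0 : 0 < atan q by rewrite -atan0 lt_atan.
rewrite -[RHS]tanK; last by rewrite in_itv/=; lra.
congr atan; rewrite /tan sinB cosB sin_pihalf cos_pihalf !mul0r !mul1r subr0 add0r.
by have := atanK q; rewrite /tan => {1}<-; rewrite invf_div.
Qed.

Lemma ltr_atan_pihalf q : 0 < pi / 2 + atan q.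
Proof. by have := atan_gtNpi2 q; lra. Qed.

Lemma pihalf_atan_le (y t : R) : 0 < t -> y < 0 -> pi / 2 + atan (y / t) <= t / - y.
Proof.
move=> t0 y0; have q0 : 0 < - y / t by rewrite divr_gt0// oppr_gt0.
rewrite -[y / t]opprK -mulNr atanN -atan_inv// invf_div.
have z0 : 0 <= t / - y by rewrite divr_ge0 ?oppr_ge0 ?ltW.
by have := atan_lipschitz z0; rewrite atan0 !subr0.
Qed.

Lemma pihalf_atan_ge (y t e : R) : 0 < e <= 1 -> e <= t -> `|y| <= 1 ->
  e / 2 <= pi / 2 + atan (y / t).
Proof.
move=> /andP[e0 e1] et y1; have t0 : 0 < t by apply: lt_le_trans et.
have h : - e^-1 <= y / t.
  rewrite ler_pdivlMr// mulNr lerNl; apply: (@le_trans _ _ 1).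
    by apply: le_trans y1; rewrite -normrN ler_norm.
  by rewrite mulrC ler_pdivlMr// mul1r.
apply: (@le_trans _ _ (pi / 2 + atan (- e^-1))); last by rewrite lerD2l le_atan.
rewrite atanN -atan_inv ?invr_gt0// invrK.
have := @atan_expand 0 e 1 (ltW e0); rewrite normr0 ler01 ger0_norm ?(ltW e0)//.
by rewrite atan0 !subr0 expr1n => /(_ isT e1).
Qed.

End Atan.

(** * The angular functions of the gap *)

Section Angle.
Context {R : realType}.
Implicit Types (x v : R * R) (s k d : R).

(** The opening angle in ]0, pi[ whose cotangent is k. *)
Definition acot k : R := pi / 2 - atan k.

Lemma acot_gt0 k : 0 < acot k.
Proof. by rewrite /acot subr_gt0 atan_ltpi2. Qed.

Lemma acot_lt4 k : acot k < 4.
Proof.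
have pi4 : pi <= 4 :> R by have := @atan_lipschitz R 0 1 ler01; rewrite atan0 atan1; lra.
have := atan_gtNpi2 k; rewrite /acot.
by move: (atan k) (pi : R) pi4 => a p; lra.
Qed.

Lemma atan_mono_le : {mono @atan R : a b / a <= b}.
Proof. by apply: le_mono => a b; exact: lt_atan. Qed.

(** The first coordinate, oriented by the side s = 1 or s = -1, relative to the
    point where the line of the corresponding side of the tip meets the axis. *)
Definition shifted s k d x : R := s * x.1 - d * k.

(** The position of x with respect to that line: negative in the gap. *)
Definition lam s k d x : R := s * x.1 + k * (x.2 - d).

(** The angle at the vertex of the wedge of the side s, counted from the axis, in
    units of the opening of the wedge: 0 on the axis, 1 on the side of the tip.
    With atan it is smooth on the whole upper half-plane. *)
Definition ang s k d x : R := (pi / 2 + atan (shifted s k d x / x.2)) / acot k.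

Definition rad2 s k d x : R := shifted s k d x ^+ 2 + x.2 ^+ 2.

Definition upper : set (R * R) := [set x | 0 < x.2].

Lemma upper_open : open upper.
Proof.
rewrite (_ : upper = snd @^-1` [set t : R | 0 < t])//.
apply: open_comp; last exact: open_gt.
by move=> [a b] _; exact: cvg_snd.
Qed.

Lemma ang_gt0 s k d x : 0 < ang s k d x.
Proof. by rewrite divr_gt0 ?acot_gt0// ltr_atan_pihalf. Qed.

Lemma ang_ge1 s k d x : 0 < x.2 -> (1 <= ang s k d x) = (0 <= lam s k d x).
Proof.
move=> x2; rewrite /ang ler_pdivlMr ?acot_gt0// mul1r /acot lerD2l -atanN.
rewrite atan_mono_le ler_pdivlMr// -subr_ge0 /lam /shifted; congr (_ <= _); ring.
Qed.

Lemma Ck_shifted n U s k d : open U -> Ck n U (shifted s k d).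
Proof.
move=> oU; apply: Ck_sub_fun => //; last exact: Ck_cst.
by apply: Ck_mul => //; [exact: Ck_cst|exact: Ck_fst].
Qed.

Lemma Ck_lam n U s k d : open U -> Ck n U (lam s k d).
Proof.
move=> oU; apply: Ck_add => //; apply: Ck_mul => //; try exact: Ck_cst; first exact: Ck_fst.
by apply: Ck_sub_fun => //; [exact: Ck_snd|exact: Ck_cst].
Qed.

Lemma Ck_rad2 n U s k d : open U -> Ck n U (rad2 s k d).
Proof.
move=> oU; apply: Ck_add => //; apply: Ck_exp => //; first exact: Ck_shifted.
exact: Ck_snd.
Qed.

Lemma Ck_ang n s k d : Ck n upper (ang s k d).
Proof.
have oU := upper_open.
apply: Ck_mul => //; last exact: Ck_cst.
apply: Ck_add => //; first exact: Ck_cst.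
apply: Ck_atan => //; apply: Ck_mul => //; first exact: Ck_shifted.
by apply: Ck_inv => // [x x2|]; [exact: lt0r_neq0|exact: Ck_snd].
Qed.

Lemma rad2_gt0 s k d x : 0 < x.2 -> 0 < rad2 s k d x.
Proof. by move=> x2; rewrite ltr_wpDl ?sqr_ge0// exprn_gt0. Qed.

Lemma is_derive_ang s k d x v : 0 < x.2 ->
  is_derive x v (ang s k d)
    ((s * v.1 * x.2 - shifted s k d x * v.2) / (rad2 s k d x * acot k)).
Proof.
move=> x2; have dy : is_derive x v (shifted s k d) (s * v.1).
  have dB := is_deriveB (is_deriveZ s (is_derive_fst x v)) (is_derive_cst (d * k) x v).
  rewrite (_ : shifted s k d = s *: (@fst R R) - cst (d * k)); last exact/funext.
  by apply: (is_derive_eq dB); rewrite subr0.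
have x20 := lt0r_neq0 x2.
have dV : is_derive x v (fun y : R * R => y.2^-1) (- x.2 ^- 2 *: v.2).
  have d2 := is_derive_snd x v; split; first exact: derivableV (is_derive_ex d2).
  by rewrite (deriveV x20 (is_derive_ex d2)) (is_derive_val d2).
have dq := is_deriveM dy dV.
have dat := is_derive_comp (is_derive1_atan (shifted s k d x / x.2)) dq.
have dD := is_deriveD (is_derive_cst (pi / 2) x v) dat.
have dZ := is_deriveZ (acot k)^-1 dD.
have E : ang s k d = (acot k)^-1 *: (cst (pi / 2) + (fun y => atan ((shifted s k d * (fun y : R * R => y.2^-1)) y))).
  by apply/funext => y; rewrite /ang mulrC.
rewrite E; apply: (is_derive_eq dZ).
rewrite /GRing.scale/= add0r -exprVn /rad2.
have a0 := lt0r_neq0 (acot_gt0 k).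
have r0 : shifted s k d x ^+ 2 + x.2 ^+ 2 != 0.
  by rewrite gt_eqF//; exact: rad2_gt0.
have r0' : 1 + (shifted s k d x / x.2) ^+ 2 != 0.
  by rewrite gt_eqF// ltr_pwDl// sqr_ge0.
rewrite (_ : 1 + _ = (shifted s k d x ^+ 2 + x.2 ^+ 2) / x.2 ^+ 2); last by field.
by field; rewrite x20 r0 a0.
Qed.

Definition e12 : set (R * R) := [set e1; e2].

(** The gradient of an angle is orthogonal to the rays, and its length is the inverse
    of the distance to the vertex. *)
Lemma derive_ang_le s k d x v (n : R) : s * s = 1 -> e12 v -> 0 < x.2 -> 0 < n ->
  n <= `|shifted s k d x| \/ n <= x.2 -> `|'D_v (ang s k d) x| <= (acot k * n)^-1.
Proof.
move=> ss vE x2 n0 H; rewrite (is_derive_val (is_derive_ang _ _ _ _ x2)).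
have r0 := rad2_gt0 s k d x2; have a0 := acot_gt0 k.
rewrite normrM normfV (gtr0_norm (mulr_gt0 r0 a0)) ler_pdivrMr ?mulr_gt0//.
rewrite (_ : (acot k * n)^-1 * _ = rad2 s k d x / n); last by field; rewrite !gt_eqF.
rewrite ler_pdivlMr// /rad2.
have abs_s : `|s| = 1.
  by apply/eqP; rewrite -sqrp_eq1 ?normr_ge0// real_normK ?num_real// expr2 ss.
set y := shifted s k d x in H *.
rewrite -(real_normK (num_real y)).
have key (p q : R) : 0 <= p -> 0 <= q -> n <= p \/ n <= q -> p * n <= p ^+ 2 + q ^+ 2.
  move=> p0 q0 [h|h].
    have : p * n <= p ^+ 2 by rewrite expr2 ler_wpM2l.
    by have := sqr_ge0 q; lra.
  have : p * n <= p * q by rewrite ler_wpM2l.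
  by have := sqr_ge0 (p - q); have := mulr_ge0 p0 q0; nra.
case: vE => ->; rewrite /= ?mulr1 ?mulr0 ?mul0r ?subr0 ?sub0r ?normrN.
  rewrite normrM abs_s mul1r gtr0_norm// addrC; apply: key => //; first exact: ltW.
  by case: H; [right|left].
by apply: key => //; exact: ltW.
Qed.

Lemma ang_le s k d x : 0 < x.2 -> shifted s k d x < 0 ->
  ang s k d x <= x.2 / - shifted s k d x / acot k.
Proof.
by move=> x2 y0; rewrite /ang ler_wpM2r ?invr_ge0 ?(ltW (acot_gt0 k))// pihalf_atan_le.
Qed.

(** Since [acot] is less than 4, the angle is at most 8 [delta], while at height
    17 [delta] and horizontal distance at most 1 it is at least 17/2 [delta]. *)
Lemma ang_small s k d x (delta : R) : 0 < delta -> 17 * delta <= 1 ->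
  `|shifted s k d x| <= 1 -> 0 < x.2 -> ang s k d x <= 2 * delta -> x.2 <= 17 * delta.
Proof.
move=> d0 d1 y1 x2 h; rewrite leNgt; apply/negP => x2d.
have e01 : 0 < 17 * delta <= 1 by lra.
have := pihalf_atan_ge e01 (ltW x2d) y1.
have : pi / 2 + atan (shifted s k d x / x.2) = ang s k d x * acot k.
  by rewrite /ang divfK// gt_eqF// acot_gt0.
move=> ->; have := acot_lt4 k; have := acot_gt0 k; have := ang_gt0 s k d x.
by move: (ang s k d x) h (acot k) => a h c; nra.
Qed.

(** The distance to the side of the tip, in units of [delta], that an angle within
    2 [delta] of 1 allows: [acot] is less than 4, and the slope of atan is at
    least 1 / (1 + M ^+ 2) on [- M, M] with M = |k| + 1. *)
Definition line_width k : R := 8 * (1 + (`|k| + 1) ^+ 2).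

Lemma ang_near1 s k d x (delta : R) : 0 < delta -> line_width k * delta < 1 ->
  0 < x.2 <= 1 -> ang s k d x < 1 -> 1 - 2 * delta <= ang s k d x ->
  - (line_width k * delta) <= lam s k d x < 0.
Proof.
move=> d0 dw /andP[x2 x21] a1 a2.
have L0 : lam s k d x < 0 by rewrite ltNge -ang_ge1// -ltNge.
rewrite L0 andbT.
set q := shifted s k d x / x.2.
have lamE : lam s k d x = x.2 * (q + k).
  by rewrite /lam /q /shifted; field; rewrite gt_eqF.
have qk : q < - k.
  by move: L0; rewrite lamE pmulr_rlt0// addrC -ltrBrDl sub0r.
have aE : pi / 2 + atan q = ang s k d x * acot k.
  by rewrite /ang divfK// gt_eqF// acot_gt0.
have gap : atan (- k) - atan q <= 8 * delta.
  have -> : atan (- k) - atan q = acot k * (1 - ang s k d x).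
    rewrite mulrBr mulr1 [acot k * _]mulrC -aE /acot atanN.
    by move: (atan k) (atan q) (pi / 2) => ? ? ?; ring.
  have := acot_lt4 k; have := acot_gt0 k.
  by move: (ang s k d x) a1 a2 (acot k) => a a1 a2 c; nra.
set M := `|k| + 1.
have M0 : 0 < 1 + M ^+ 2 by rewrite ltr_pwDl// sqr_ge0.
have kM : `|- k| <= M by rewrite normrN /M lerDl.
have lw : line_width k * delta = 8 * delta * (1 + M ^+ 2) by rewrite /line_width -/M; ring.
have [q1|q1] := leP (- k - 1) q.
  have qM : `|q| <= M.
    have := ler_norm k; have := ler_norm (- k); rewrite normrN /M ler_norml.
    by move: `|k| => K; lra.
  have := le_trans (atan_expand (ltW qk) qM kM) gap.
  rewrite ler_pdivrMr// -lw => h.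
  have key (t w p : R) : 0 < t -> t <= 1 -> - k - p <= w -> p < - k -> - w <= t * (p + k).
    by move=> t0 t1 h1 h2; nra.
  by rewrite lamE; exact: key.
have k1 : - k - 1 <= - k by lra.
have k1M : `|- k - 1| <= M.
  by have := ler_norm k; have := ler_norm (- k); rewrite normrN /M ler_norml; move: `|k| => K; lra.
have := atan_expand k1 k1M kM.
have h : atan q <= atan (- k - 1) by apply: le_atan; exact: ltW.
have -> : - k - (- k - 1) = 1 by ring.
move=> h1; have : 1 / (1 + M ^+ 2) <= 8 * delta.
  by move: h1 gap h; move: (atan _) (atan _) (atan _) (1 / _) => ? ? ? ?; lra.
by rewrite ler_pdivrMr// -lw => h2; move: dw; rewrite ltNge h2.
Qed.

End Angle.

Section Profile.
Context {R : realType}.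
Variables (k : R -> R) (d delta : R).
Hypothesis kk : 0 < k 1 + k (-1).
Hypothesis d_gt0 : 0 < d.
Hypothesis delta_gt0 : 0 < delta.
Hypothesis delta_le : 4 * delta <= 1.
Implicit Types (x v : R * R) (s : R).

Let A s x := ang s (k s) d x.
Let P s x := ramp delta (A s x).

(** The competitor near the tip. Each factor is 1 on the tip and on the other
    side of it; on the axis one of the two factors vanishes. *)
Definition profile x : R := if 0 < x.2 then P 1 x * P (-1) x else 0.

Let P01 s x : 0 <= P s x <= 1.
Proof. by apply: ramp01 => //; exact: ltW (ang_gt0 _ _ _ _). Qed.

Lemma profile01 x : 0 <= profile x <= 1.
Proof.
rewrite /profile; case: ifP => _; last by rewrite lexx ler01.
have /andP[a0 a1] := P01 1 x; have /andP[b0 b1] := P01 (-1) x.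
by rewrite mulr_ge0//= mulr_ile1.
Qed.

Let CkP n s : Ck n upper (P s).
Proof. by apply: Ck_ramp => //; [exact: upper_open|exact: Ck_ang]. Qed.

Lemma Ck_profile_upper n : Ck n upper profile.
Proof.
have oU := @upper_open R.
by apply: (@Ck_eq _ _ _ (fun x => P 1 x * P (-1) x)) => // [x x2|];
  [rewrite /profile x2|exact: Ck_mul].
Qed.

(* The hypothesis says that the angle is at most [delta]. *)
Let P_low s x : s * s = 1 -> 0 < x.2 -> shifted s (k s) d x < 0 ->
  x.2 <= delta * acot (k s) * - shifted s (k s) d x -> P s x = 0.
Proof.
move=> ss x2 y0 h; apply: ramp_low => //; apply: le_trans (ang_le x2 y0) _.
rewrite ler_pdivrMr ?acot_gt0// ler_pdivrMr ?oppr_gt0//.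
Qed.

(** By [kk], a point of the axis is strictly on the outer side of one of the two
    vertices; near it the angle of this side is close to 0, and truncated to 0. *)
Lemma profile_near_axis x : x.2 <= 0 -> \forall y \near x, profile y = 0.
Proof.
move=> x2.
have [s [ss sE y0]] : exists s : R, [/\ s * s = 1, s = 1 \/ s = -1 & shifted s (k s) d x < 0].
  have [h|h] := ltP (shifted 1 (k 1) d x) 0; first by exists 1; rewrite mulr1; split=> //; left.
  exists (-1); rewrite mulrNN mulr1; split=> //; first by right.
  move: h; rewrite /shifted; have := mulr_gt0 d_gt0 kk; lra.
set m := - shifted s (k s) d x; have m0 : 0 < m by rewrite oppr_gt0.
pose e := Num.min (m / 2) (delta * acot (k s) * (m / 2)).
have e0 : 0 < e.
  by rewrite lt_min !mulr_gt0 ?invr_gt0// acot_gt0.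
have abs_s : `|s| = 1 by case: sE => ->; rewrite ?normrN normr1.
apply: (square_nbhs e0) => y y1 y2; rewrite /profile; case: ifPn => // y20.
have ym : m / 2 <= - shifted s (k s) d y.
  have : `|s * (y.1 - x.1)| < m / 2.
    by rewrite normrM abs_s mul1r (lt_le_trans y1)// /e ge_min lexx.
  rewrite ltr_norml /m /shifted; lra.
have Ps : P s y = 0.
  apply: P_low => //; first by rewrite -oppr_gt0 (lt_le_trans _ ym)// divr_gt0.
  apply: (@le_trans _ _ (delta * acot (k s) * (m / 2))); last first.
    by rewrite ler_wpM2l// ltW// mulr_gt0// acot_gt0.
  apply: (@le_trans _ _ e); last by rewrite /e ge_min lexx orbT.
  by move: y2; rewrite ltr_norml => /andP[_ h]; lra.
by case: sE Ps => -> ->; rewrite ?mul0r ?mulr0.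
Qed.

Lemma Cinf_profile : Cinf setT profile.
Proof.
move=> n; apply: Ck_local => x _; have [x2|x2] := ltP 0 x.2.
  by exists upper; split; [exact: upper_open| |exact: Ck_profile_upper].
have := profile_near_axis x2; rewrite /prop_near1 nbhsE/= => -[V [oV Vx] V0].
exists V; split=> //; apply: (@Ck_eq _ _ _ (fun=> 0)) => //; last exact: Ck_cst.
by move=> y /V0 ->.
Qed.

Let P_near1 s x : 0 < x.2 -> 0 <= lam s (k s) d x -> \forall y \near x, P s y = 1.
Proof.
move=> x2 l0; have a1 : 1 - delta < A s x.
  by apply: (@lt_le_trans _ _ 1); [rewrite ltrBlDr ltrDl|rewrite /A ang_ge1].
have cA : {for x, continuous (A s)} := (Ck_ang 0 s (k s) d).1 x x2.
have : \forall y \near x, 1 - delta < A s y.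
  have /cA // : nbhs (A s x) [set t | 1 - delta < t].
  by apply: open_nbhs_nbhs; split=> //; exact: (@open_gt _ (1 - delta)).
by apply: filterS => y h; apply: ramp_high => //; exact: ltW.
Qed.

Lemma profile_near_sector x : 0 < x.2 -> (forall s, s * s = 1 -> 0 <= lam s (k s) d x) ->
  \forall y \near x, profile y = 1.
Proof.
move=> x2 l0.
have n2 : \forall y \near x, upper y by apply: open_nbhs_nbhs; split=> //; exact: upper_open.
have n1 : \forall y \near x, P 1 y = 1 by apply: P_near1 => //; apply: l0; rewrite mulr1.
have n1' : \forall y \near x, P (-1) y = 1 by apply: P_near1 => //; apply: l0; rewrite mulrNN mulr1.
near=> y; rewrite /profile ifT; last by near: y.
rewrite (_ : P 1 y = 1) ?mul1r; last by near: y.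
by near: y.
Unshelve. all: by end_near. Qed.

Lemma derive_profile_mid s x v : s = 1 \/ s = -1 -> 0 < x.2 -> 0 <= lam (- s) (k (- s)) d x ->
  2 * delta <= ang s (k s) d x <= 1 - 2 * delta ->
  'D_v profile x = 'D_v (ang s (k s) d) x.
Proof.
move=> sE x2 l0 mid.
have n2 : \forall y \near x, upper y by apply: open_nbhs_nbhs; split=> //; exact: upper_open.
have n1 : \forall y \near x, P (- s) y = 1 by exact: P_near1.
have E : \forall y \near x, profile y = P s y.
  near=> y; rewrite /profile ifT; last by near: y.
  have : P (- s) y = 1 by near: y.
  by case: sE => ->; rewrite ?opprK => ->; rewrite ?mulr1 ?mul1r.
rewrite (near_eq_derive _ E).
have dA := is_derive_comp (is_derive_ramp delta (A s x)) (is_derive_ang s (k s) d v x2).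
rewrite (is_derive_val dA) (is_derive_val (is_derive_ang s (k s) d v x2)).
by rewrite dramp_mid// mul1r.
Unshelve. all: by end_near. Qed.

Let dP s x v : 0 < x.2 -> is_derive x v (P s) (dramp delta (A s x) * 'D_v (ang s (k s) d) x).
Proof.
move=> x2; have dA := is_derive_comp (is_derive_ramp delta (A s x)) (is_derive_ang s (k s) d v x2).
by rewrite (is_derive_val (is_derive_ang s (k s) d v x2)).
Qed.

Lemma derive_profile x v : 0 < x.2 -> 'D_v profile x =
  dramp delta (A 1 x) * 'D_v (ang 1 (k 1) d) x * P (-1) x +
  dramp delta (A (-1) x) * 'D_v (ang (-1) (k (-1)) d) x * P 1 x.
Proof.
move=> x2; have := eq_derive_open (g := (fun x => P 1 x * P (-1) x)) v (@upper_open R) _ x2.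
move=> ->; last by move=> y y2; rewrite /profile y2.
rewrite (is_derive_val (is_deriveM (dP 1 v x2) (dP (-1) v x2))) /GRing.scale/=.
by rewrite addrC; congr (_ + _); rewrite mulrC.
Qed.

(** In units of d, half of the distance between the vertices of the two wedges: a
    point is at least this far from one of them. *)
Definition half_gap : R := (k 1 + k (-1)) / 2.

Definition profile_bound : R :=
  dramp_bound / half_gap * ((acot (k 1))^-1 * (1 + 2 / acot (k (-1))) +
                            (acot (k (-1)))^-1 * (1 + 2 / acot (k 1))).

Let hg0 : 0 < half_gap. Proof. by rewrite divr_gt0. Qed.

(* Close to the vertex of a wedge the gradient of its angle blows up, but the
   other factor vanishes linearly. *)
Let term_bound s x v : s = 1 \/ s = -1 -> e12 v -> 0 < x.2 ->
  `|dramp delta (A s x) * 'D_v (ang s (k s) d) x * P (- s) x| <=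
  dramp_bound / half_gap * ((acot (k s))^-1 * (1 + 2 / acot (k (- s)))) / d.
Proof.
move=> sE vE x2; have ss : s * s = 1 by case: sE => ->; rewrite ?mulrNN mulr1.
have a0 := acot_gt0 (k s); have b0 := acot_gt0 (k (- s)).
have C1 := @dramp_bound_ge1 R; have C0 : 0 <= dramp_bound :> R by lra.
set n := Num.max `|shifted s (k s) d x| x.2.
have n0 : 0 < n by rewrite lt_max x2 orbT.
have nH : n <= `|shifted s (k s) d x| \/ n <= x.2.
  by rewrite /n; case: (leP `|shifted s (k s) d x| x.2) => _; [right|left].
have D := derive_ang_le ss vE x2 n0 nH.
have H := norm_dramp_le delta_gt0 delta_le (A s x).
have /andP[p0 p1] := P01 (- s) x.
have md0 : 0 < half_gap * d by rewrite mulr_gt0.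
have key : P (- s) x <= (1 + 2 / acot (k (- s))) * n / (half_gap * d).
  rewrite ler_pdivlMr//; have [hn|hn] := leP (half_gap * d) n.
    apply: (@le_trans _ _ n); last by rewrite ler_peMl ?(ltW n0)// lerDl divr_ge0// ltW.
    by apply: (le_trans _ hn); rewrite ler_piMl// ltW.
  have y' : half_gap * d <= - shifted (- s) (k (- s)) d x.
    have : `|shifted s (k s) d x| < half_gap * d by apply: le_lt_trans hn; rewrite /n le_max lexx.
    rewrite ltr_norml /shifted /half_gap; case: sE => ->; rewrite ?opprK; lra.
  have y0 : shifted (- s) (k (- s)) d x < 0 by rewrite -oppr_gt0 (lt_le_trans md0).
  have P2 : P (- s) x <= 2 * (n / (half_gap * d) / acot (k (- s))).
    apply: le_trans (ramp_le delta_gt0 delta_le (ltW (ang_gt0 _ _ _ _))) _.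
    rewrite ler_wpM2l//; apply: le_trans (ang_le x2 y0) _.
    rewrite ler_wpM2r ?invr_ge0 ?(ltW b0)//.
    apply: ler_pM; rewrite ?invr_ge0 ?(ltW x2)//; first by rewrite oppr_ge0 ltW.
      by rewrite /n le_max lexx orbT.
    by rewrite lef_pV2 ?posrE// oppr_gt0.
  apply: (@le_trans _ _ (2 * (n / (half_gap * d) / acot (k (- s))) * (half_gap * d))).
    by rewrite ler_wpM2r// ltW.
  rewrite (_ : 2 * _ * _ = 2 / acot (k (- s)) * n); last first.
    by field; rewrite !gt_eqF.
  by rewrite ler_wpM2r ?(ltW n0)// lerDr.
rewrite !normrM (ger0_norm p0).
apply: (@le_trans _ _ (dramp_bound * (acot (k s) * n)^-1 * ((1 + 2 / acot (k (- s))) * n / (half_gap * d)))).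
  by apply: ler_pM; rewrite ?mulr_ge0//; exact: ler_pM.
rewrite (_ : _ * _ = dramp_bound / half_gap * ((acot (k s))^-1 * (1 + 2 / acot (k (- s)))) / d)//.
by field; rewrite !gt_eqF.
Qed.

Lemma derive_profile_le x v : e12 v -> 0 < x.2 -> `|'D_v profile x| <= profile_bound / d.
Proof.
move=> vE x2; rewrite derive_profile//; apply: le_trans (ler_normD _ _) _.
rewrite /profile_bound [in leRHS]mulrDr [leRHS]mulrDl; apply: lerD.
  by apply: term_bound => //; left.
by have := @term_bound (-1) x v (or_intror erefl) vE x2; rewrite opprK.
Qed.

Lemma derive_profile_far x v (n : R) : e12 v -> 0 < x.2 -> 0 < n ->
  (forall s, s * s = 1 -> n <= `|shifted s (k s) d x| \/ n <= x.2) ->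
  `|'D_v profile x| <= dramp_bound * ((acot (k 1))^-1 + (acot (k (-1)))^-1) / n.
Proof.
move=> vE x2 n0 H; rewrite derive_profile//; apply: le_trans (ler_normD _ _) _.
have T s t : s * s = 1 ->
    `|dramp delta (A s x) * 'D_v (ang s (k s) d) x * P t x| <= dramp_bound * (acot (k s))^-1 / n.
  move=> ss; have /andP[p0 p1] := P01 t x.
  rewrite !normrM (ger0_norm p0) -[leRHS]mulr1; apply: ler_pM; rewrite ?mulr_ge0//.
  rewrite -mulrA -invfM; apply: ler_pM => //; first exact: norm_dramp_le.
  by apply: derive_ang_le => //; exact: H.
by rewrite [in leRHS]mulrDr [leRHS]mulrDl; apply: lerD; apply: T; rewrite ?mulrNN mulr1.
Qed.

End Profile.

(** * The calibrating field *)

Lemma sign_cases {R : realType} (s : R) : s * s = 1 -> s = 1 \/ s = -1.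
Proof. by move=> ss; have /eqP := ss; rewrite -expr2 sqrf_eq1 => /orP[]/eqP; [left|right]. Qed.

Section Calibration.
Context {R : realType}.
Variables (k : R -> R) (d rho : R) (F : set (R * R)).
Hypothesis kk : 0 < k 1 + k (-1).
Hypothesis d_gt0 : 0 < d.
Hypothesis rho_gt0 : 0 < rho.
Hypothesis d_small : forall s, s * s = 1 -> d * `|k s| <= rho.
Hypothesis F_near : forall x, F x -> `|x.1| < 4 * rho -> `|x.2| < 4 * rho ->
  0 < x.2 /\ exists2 s, s * s = 1 & lam s (k s) d x < 0.
Implicit Types (x v : R * R) (s t : R) (psi : R * R -> R).

Definition wedge s : set (R * R) := upper `&` [set x | lam s (k s) d x < 0].

(** The square of the distance from the vertex of the wedge to the tip: only farther
    from the vertex is the line that bounds the wedge a side of the tip. *)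
Definition inner s : R := (1 + k s ^+ 2) * d ^+ 2.

(** A cutoff in the square t of the distance to the vertex. *)
Definition window s t : R :=
  (1 - step (t / rho ^+ 2 - 1)) * step (t / inner s - 1).

(** The derivatives in the direction v of the angular functions, each weighted by a
    radial cutoff that keeps it off the vertex, where it is singular, and off the
    points of the line under the tip, which are inside of the fluid. *)
Definition side_field s v : R * R -> R :=
  (fun x => window s (rad2 s (k s) d x) * 'D_v (ang s (k s) d) x) \_ (wedge s).

Definition tip_field v x : R := side_field 1 v x + side_field (-1) v x.

Lemma inner_gt0 s : 0 < inner s.
Proof. by rewrite mulr_gt0 ?exprn_gt0// ltr_pwDl// sqr_ge0. Qed.

Let r2_gt0 : 0 < rho ^+ 2. Proof. exact: exprn_gt0. Qed.

Lemma window01 s t : 0 <= window s t <= 1.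
Proof.
have /andP[a0 a1] := step01 (t / rho ^+ 2 - 1); have /andP[b0 b1] := step01 (t / inner s - 1).
by rewrite /window mulr_ge0 ?subr_ge0//= mulr_ile1 ?subr_ge0// gerBl.
Qed.

Lemma window_low s t : t <= inner s -> window s t = 0.
Proof.
move=> h; rewrite /window (@step_le0 _ (t / inner s - 1)) ?mulr0//.
by rewrite subr_le0 ler_pdivrMr ?inner_gt0// mul1r.
Qed.

Lemma window_high s t : 2 * rho ^+ 2 <= t -> window s t = 0.
Proof.
move=> h; rewrite /window (@step_ge1 _ (t / rho ^+ 2 - 1)) ?subrr ?mul0r//.
by rewrite lerBrDr ler_pdivlMr.
Qed.

Lemma window_mid s t : 2 * inner s <= t <= rho ^+ 2 -> window s t = 1.
Proof.
move=> /andP[h1 h2]; rewrite /window (@step_le0 _ (t / rho ^+ 2 - 1)); last first.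
  by rewrite subr_le0 ler_pdivrMr// mul1r.
rewrite (@step_ge1 _ (t / inner s - 1)) ?subr0 ?mulr1//.
by rewrite lerBrDr ler_pdivlMr ?inner_gt0.
Qed.

Lemma Ck_window n U s (f : R * R -> R) : open U -> Ck n U f -> Ck n U (fun x => window s (f x)).
Proof.
move=> oU cf.
have H (c : R) : Ck n U (fun x => step (f x / c - 1)).
  apply: Ck_step => //; apply: Ck_sub_fun => //; last exact: Ck_cst.
  by apply: Ck_mul => //; exact: Ck_cst.
by apply: Ck_mul => //; apply: Ck_sub_fun => //; exact: Ck_cst.
Qed.

Lemma open_wedge s : open (wedge s).
Proof.
apply: openI; first exact: upper_open.
have c : continuous (lam s (k s) d).
  by move=> x; apply: (Ck_continuous (Ck_lam 0 s (k s) d openT)).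
rewrite (_ : [set x | _] = lam s (k s) d @^-1` [set t | t < 0])//.
by apply: open_comp; [move=> x _; exact: c|exact: open_lt].
Qed.

Let near_lt x (f : R * R -> R) (c : R) : (forall n, Ck n setT f) -> f x < c ->
  \forall y \near x, f y < c.
Proof.
move=> cf fx; have cx : {for x, continuous f} := Ck_continuous (cf 0%N) I.
have /cx // : nbhs (f x) [set t | t < c].
by apply: open_nbhs_nbhs; split=> //; exact: open_lt.
Qed.

Let near_gt x (f : R * R -> R) (c : R) : (forall n, Ck n setT f) -> c < f x ->
  \forall y \near x, c < f y.
Proof.
move=> cf fx; have cx : {for x, continuous f} := Ck_continuous (cf 0%N) I.
have /cx // : nbhs (f x) [set t | c < t].
by apply: open_nbhs_nbhs; split=> //; exact: open_gt.
Qed.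

Let radial s t : R := window s t / (t * acot (k s)).

Let m s psi : R * R -> R :=
  (fun x => radial s (rad2 s (k s) d x) * psi x) \_ (wedge s).

(* The sides of a wedge that meet the support of its window are on the axis or
   on the boundary of the tip. *)
Let m_near0 s psi x : s * s = 1 -> test_fun F psi -> ~ wedge s x ->
  \forall y \near x, m s psi y = 0.
Proof.
move=> ss [_ [K [cK KF psi0]]] nWx.
have Crad n : Ck n setT (rad2 s (k s) d) := Ck_rad2 n s (k s) d openT.
have Clam n : Ck n setT (lam s (k s) d) := Ck_lam n s (k s) d openT.
have out0 y : ~ wedge s y -> m s psi y = 0 by move=> h; rewrite /m patchE memNset.
have [r1|r1] := ltP (rad2 s (k s) d x) (inner s).
  apply: filterS (near_lt Crad r1) => y h; rewrite /m patchE; case: ifP => // _.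
  by rewrite /radial window_low ?mul0r// ltW.
have [r2|r2] := ltP (2 * rho ^+ 2) (rad2 s (k s) d x).
  apply: filterS (near_gt Crad r2) => y h; rewrite /m patchE; case: ifP => // _.
  by rewrite /radial window_high ?mul0r// ltW.
have psi_near : ~ F x -> \forall y \near x, m s psi y = 0.
  move=> nF; have oK : open (~` K) by apply: closed_openC; exact: compact_closed_plane.
  have : nbhs x (~` K) by apply: open_nbhs_nbhs; split=> // /KF.
  by apply: filterS => y /psi0 p0; rewrite /m patchE p0 mulr0; case: ifP.
have [x1b x2b] : `|x.1| < 4 * rho /\ `|x.2| < 4 * rho.
  have := d_small ss; rewrite -[d * `|_|]ger0_norm ?mulr_ge0 ?(ltW d_gt0)// normrM normr_id -normrM.
  move: r2; rewrite /rad2 /shifted; have r0 := rho_gt0.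
  have key (a b : R) : a ^+ 2 + b ^+ 2 <= 2 * rho ^+ 2 -> `|a| < 2 * rho.
    move=> h; rewrite ltNge; apply/negP => h2.
    have : (2 * rho) ^+ 2 <= `|a| ^+ 2 by rewrite lerXn2r// nnegrE// mulr_ge0// ltW.
    rewrite real_normK ?num_real//; have := sqr_ge0 b; nra.
  move=> h hd; split; last by apply: (@lt_trans _ _ (2 * rho)); [apply: key; rewrite addrC; exact: h|lra].
  have := key _ _ h; rewrite ler_norml in hd; rewrite !ltr_norml.
  by case: (sign_cases ss) hd => -> hd; lra.
have [x2|x2] := leP x.2 0.
  by apply: psi_near => /F_near /(_ x1b x2b)[]; rewrite ltNge x2.
have : 0 <= lam s (k s) d x by rewrite leNgt; apply/negP => h; apply: nWx.
rewrite le_eqVlt => /orP[/eqP l0|l0]; last first.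
  by apply: filterS (near_gt Clam l0) => y h; apply: out0 => -[_ /= h2]; move: h; rewrite ltNge ltW.
apply: psi_near => /F_near /(_ x1b x2b)[_ [t tt]].
have sE := sign_cases ss; have tE := sign_cases tt.
have x2d : d <= x.2.
  have yE : shifted s (k s) d x = - (k s * x.2) by move: l0; rewrite /lam /shifted; lra.
  move: r1; rewrite /rad2 yE /inner sqrrN exprMn.
  rewrite (_ : _ + x.2 ^+ 2 = (1 + k s ^+ 2) * x.2 ^+ 2); last by ring.
  by rewrite ler_pM2l ?ltr_pwDl ?sqr_ge0// ler_pXn2r// nnegrE ltW.
have := mulr_ge0 (ltW kk) (_ : 0 <= x.2 - d); rewrite subr_ge0 => /(_ x2d).
by move: l0; rewrite /lam; case: sE => ->; case: tE => ->; lra.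
Qed.

Let Ck_radial n s : Ck n (wedge s) (fun x => radial s (rad2 s (k s) d x)).
Proof.
have oW := @open_wedge s.
have cr := Ck_rad2 n s (k s) d oW.
apply: Ck_mul => //; first exact: Ck_window.
apply: Ck_inv => //; last by apply: Ck_mul => //; exact: Ck_cst.
by move=> x [x2 _]; rewrite mulf_neq0 ?gt_eqF ?acot_gt0//; exact: rad2_gt0.
Qed.

Let Ck_m n s psi : s * s = 1 -> test_fun F psi -> Ck n setT (m s psi).
Proof.
move=> ss tp; apply: Ck_local => x _; have [Wx|nWx] := pselect (wedge s x).
  exists (wedge s); split=> //; first exact: open_wedge.
  have oW := @open_wedge s.
  apply: (@Ck_eq _ _ _ (fun x => radial s (rad2 s (k s) d x) * psi x)) => //.
    by move=> y Wy; rewrite /m patchE mem_set.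
  by apply: Ck_mul => //; apply: (@Ck_sub _ _ setT) => //; exact: test_fun_Ck tp.
have := m_near0 ss tp nWx; rewrite /prop_near1 nbhsE/= => -[V [oV Vx] V0].
exists V; split=> //; apply: (@Ck_eq _ _ _ (fun=> 0)) => //; last exact: Ck_cst.
by move=> y /V0 ->.
Qed.

Let derivable_radial s t : 0 < t -> derivable (radial s) t 1.
Proof.
move=> t0.
have dst (c : R) : derivable (fun t : R => step (t / c - 1)) t 1.
  have d1 : derivable (fun t : R => t / c - 1) t 1.
    rewrite (_ : (fun _ => _) = (fun t : R => c^-1 * t + -1)).
      exact: is_derive_ex (is_derive_affine c^-1 (-1) t).
    by apply/funext => u; rewrite mulrC.
  have d2 : derivable (@step R) (t / c - 1) 1 := is_derive_ex (is_derive_step _).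
  exact: is_derive_ex (@is_derive1_comp _ (@step R) (fun t : R => t / c - 1) t _ _ (derivableP d2) (derivableP d1)).
apply: derivableM; first apply: derivableM.
- by apply: derivableB => //; exact: derivable_cst.
- exact: dst.
apply: derivableV; first by rewrite mulf_neq0 ?gt_eqF ?acot_gt0.
rewrite (_ : (fun _ => _) = (fun t : R => acot (k s) * t + 0)).
  exact: is_derive_ex (is_derive_affine (acot (k s)) 0 t).
by apply/funext => u; rewrite addr0 mulrC.
Qed.

Let is_derive_shifted s x v : is_derive x v (shifted s (k s) d) (s * v.1).
Proof.
have dB := is_deriveB (is_deriveZ s (is_derive_fst x v)) (is_derive_cst (d * k s) x v).
rewrite (_ : shifted s (k s) d = s *: (@fst R R) - cst (d * k s)); last exact/funext.
by apply: (is_derive_eq dB); rewrite subr0.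
Qed.

Let is_derive_radial s x v : 0 < x.2 ->
  is_derive x v (fun y => radial s (rad2 s (k s) d y))
    ('D_1 (radial s) (rad2 s (k s) d x) *
      (2 * shifted s (k s) d x * s * v.1 + 2 * x.2 * v.2)).
Proof.
move=> x2; have dr := derivableP (@derivable_radial s _ (rad2_gt0 s (k s) d x2)).
have dy := is_derive_shifted s x v; have d2 := is_derive_snd x v.
have dD := is_deriveD (is_deriveM dy dy) (is_deriveM d2 d2).
apply: is_derive_comp dr _.
rewrite (_ : rad2 s (k s) d = shifted s (k s) d * shifted s (k s) d + (@snd R R) * (@snd R R)).
  by apply: (is_derive_eq dD); rewrite /GRing.scale/=; ring.
by apply/funext => y; rewrite /rad2 !expr2.
Qed.

(** The gradient of an angle is a rotation field over the square of the distance to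
    the vertex; a radial weight leaves it divergence free. Hence its product with
    the gradient of [psi] is the divergence of [psi] times the field. *)
Lemma rotation_divergence s psi : s * s = 1 -> test_fun F psi -> exists g,
  [/\ forall x, side_field s e1 x * 'D_e1 psi x + side_field s e2 x * 'D_e2 psi x = g x,
      L1 setT g, \int[leb2]_(x in setT) g x = 0 & forall x, ~ F x -> g x = 0].
Proof.
move=> ss tp.
pose f1 x := s * x.2 * m s psi x; pose f2 x := - shifted s (k s) d x * m s psi x.
have C1 n : Ck n setT f1.
  apply: Ck_mul => //; [exact: openT| |exact: Ck_m].
  by apply: Ck_mul; [exact: openT|exact: Ck_cst|exact: Ck_snd].
have C2 n : Ck n setT f2.
  apply: Ck_mul => //; [exact: openT| |exact: Ck_m].
  by apply: Ck_opp; [exact: openT|apply: Ck_shifted; exact: openT].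
have [_ [K [cK KF psi0]]] := tp.
have m0 x : ~ K x -> m s psi x = 0 by move=> /psi0 p0; rewrite /m patchE p0 mulr0; case: ifP.
have f10 x : ~ K x -> f1 x = 0 by move=> h; rewrite /f1 m0 ?mulr0.
have f20 x : ~ K x -> f2 x = 0 by move=> h; rewrite /f2 m0 ?mulr0.
have i1 : L1 setT ('D_e1 f1).
  apply: (integrable_compact_support cK) => //; last exact: derive_support.
  by move=> x; exact: (Ck_continuous (Ck_derive e1 (C1 1%N))).
have i2 : L1 setT ('D_e2 f2).
  apply: (integrable_compact_support cK) => //; last exact: derive_support.
  by move=> x; exact: (Ck_continuous (Ck_derive e2 (C2 1%N))).
exists (fun x => 'D_e1 f1 x + 'D_e2 f2 x); split; last 3 first.
- by apply: L1_add.
- by rewrite RintegralD// (Rintegral_derive_e1 cK)// (Rintegral_derive_e2 cK)// addr0.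
- move=> x nF; have nK : ~ K x by move=> /KF.
  by rewrite (derive_support _ cK f10)// (derive_support _ cK f20)// addr0.
move=> x; have [Wx|nWx] := pselect (wedge s x); last first.
  have mz := m_near0 ss tp nWx.
  rewrite /side_field !patchE !memNset// !mul0r addr0.
  have z1 : \forall y \near x, f1 y = (fun=> 0) y by apply: filterS mz => y h; rewrite /f1 h mulr0.
  have z2 : \forall y \near x, f2 y = (fun=> 0) y by apply: filterS mz => y h; rewrite /f2 h mulr0.
  by rewrite (near_eq_derive _ z1) (near_eq_derive _ z2) !derive_cst addr0.
have x2 : 0 < x.2 by case: Wx.
have oW := @open_wedge s.
pose h y := radial s (rad2 s (k s) d y) * psi y.
have mE y : wedge s y -> m s psi y = h y by move=> Wy; rewrite /m patchE mem_set.
have dpsi v : is_derive x v psi ('D_v psi x).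
  by apply: derivableP; exact: (Ck_derivable (test_fun_Ck 1 tp)).
have dh v := is_deriveM (is_derive_radial s v x2) (dpsi v).
have d1 := is_deriveM (is_deriveZ s (is_derive_snd x e1)) (dh e1).
have d2 := is_deriveM (is_deriveN (is_derive_shifted s x e2)) (dh e2).
have E1 : 'D_e1 f1 x = 'D_e1 ((s *: (@snd R R)) * h) x.
  by apply: (eq_derive_open _ oW) => // y Wy; rewrite /f1 mE.
have E2 : 'D_e2 f2 x = 'D_e2 ((- shifted s (k s) d) * h) x.
  by apply: (eq_derive_open _ oW) => // y Wy; rewrite /f2 mE.
rewrite E1 E2 (is_derive_val d1) (is_derive_val d2) /side_field !patchE !mem_set//.
rewrite (is_derive_val (is_derive_ang s (k s) d e1 x2)).
rewrite (is_derive_val (is_derive_ang s (k s) d e2 x2)).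
have a0 := lt0r_neq0 (acot_gt0 (k s)); have r0 := lt0r_neq0 (rad2_gt0 s (k s) d x2).
have key (y b p p1 p2 H' w r a : R) : r != 0 -> a != 0 ->
    w * ((s * 1 * b - y * 0) / (r * a)) * p1 + w * ((s * 0 * b - y * 1) / (r * a)) * p2 =
    s * b * (w / (r * a) * p1 + p * (H' * (2 * y * s * 1 + 2 * b * 0))) +
    w / (r * a) * p * (s * 0) +
    (- y * (w / (r * a) * p2 + p * (H' * (2 * y * s * 0 + 2 * b * 1))) +
     w / (r * a) * p * - (s * 0)).
  by move=> rn an; case: (sign_cases ss) => ->; field; rewrite rn an.
exact: key.
Qed.

(** The field is normal to the boundary of the fluid, but there is no boundary term
    because [psi] vanishes there. *)
Lemma calibration psi : test_fun F psi ->
  \int[leb2]_(x in F) (tip_field e1 x * 'D_e1 psi x + tip_field e2 x * 'D_e2 psi x) = 0.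
Proof.
move=> tp.
have [g [gE ig g0 gF]] := rotation_divergence (mulr1 1) tp.
have [h [hE ih h0 hF]] := rotation_divergence (etrans (mulrNN 1 1) (mulr1 1)) tp.
have E : (fun x => tip_field e1 x * 'D_e1 psi x + tip_field e2 x * 'D_e2 psi x) = (fun x => g x + h x).
  have key (a b a' b' p q : R) : (a + b) * p + (a' + b') * q = (a * p + a' * q) + (b * p + b' * q).
    by ring.
  by apply/funext => x; rewrite -gE -hE; exact: key.
rewrite E -(@Rintegral_subset _ _ _ (fun x => g x + h x) (@subsetT _ F)); last first.
  by move=> x _ nF; rewrite gF// hF// addr0.
by rewrite (RintegralD measurableT ig ih) g0 h0 addr0.
Qed.

End Calibration.

(** * The competitor *)

Section Cutoff.
Context {R : realType}.
Variable rho : R.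
Hypothesis rho_gt0 : 0 < rho.
Implicit Types (x v : R * R).

Definition cutoff (t : R) : R := 1 - step (t ^+ 2 / rho ^+ 2 - 1).

Definition chi x : R := cutoff x.1 * cutoff x.2.

Let r2 : 0 < rho ^+ 2. Proof. exact: exprn_gt0. Qed.

Lemma cutoff01 t : 0 <= cutoff t <= 1.
Proof. by have /andP[a b] := step01 (t ^+ 2 / rho ^+ 2 - 1); rewrite /cutoff; lra. Qed.

Lemma chi01 x : 0 <= chi x <= 1.
Proof.
have /andP[a b] := cutoff01 x.1; have /andP[a' b'] := cutoff01 x.2.
by rewrite /chi mulr_ge0//= mulr_ile1.
Qed.

Lemma cutoff_low t : `|t| <= rho -> cutoff t = 1.
Proof.
move=> h; rewrite /cutoff step_le0 ?subr0// subr_le0 ler_pdivrMr// mul1r.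
by rewrite -(real_normK (num_real t)) lerXn2r// nnegrE// ltW.
Qed.

Lemma cutoff_high t : 2 * rho <= `|t| -> cutoff t = 0.
Proof.
move=> h; rewrite /cutoff step_ge1 ?subrr// lerBrDr ler_pdivlMr//.
rewrite -(real_normK (num_real t)).
have : (2 * rho) ^+ 2 <= `|t| ^+ 2 by rewrite lerXn2r// nnegrE// mulr_ge0// ltW.
by have := r2; move: (`|t| ^+ 2) => T; nra.
Qed.

Lemma chi_low x : `|x.1| <= rho -> `|x.2| <= rho -> chi x = 1.
Proof. by move=> h1 h2; rewrite /chi !cutoff_low// mulr1. Qed.

Lemma chi_neq0 x : chi x != 0 -> `|x.1| < 2 * rho /\ `|x.2| < 2 * rho.
Proof.
move=> h; split; rewrite ltNge; apply: contra h => h; rewrite /chi (cutoff_high h) ?mul0r//.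
by rewrite mulr0.
Qed.

Lemma test_chi : test_fun setT chi.
Proof.
apply/test_funP; split=> [n|].
  apply: Ck_mul => //; first exact: openT.
    apply: Ck_sub_fun; [exact: openT|exact: Ck_cst|apply: Ck_step; first exact: openT].
    apply: Ck_sub_fun; [exact: openT| |exact: Ck_cst].
    apply: Ck_mul; [exact: openT| |exact: Ck_cst].
    by apply: Ck_exp; [exact: openT|exact: Ck_fst].
  apply: Ck_sub_fun; [exact: openT|exact: Ck_cst|apply: Ck_step; first exact: openT].
  apply: Ck_sub_fun; [exact: openT| |exact: Ck_cst].
  apply: Ck_mul; [exact: openT| |exact: Ck_cst].
  by apply: Ck_exp; [exact: openT|exact: Ck_snd].
exists (cbox (- (2 * rho)) (2 * rho) (- (2 * rho)) (2 * rho)); split=> //; first exact: compact_cbox.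
move=> x nK; apply: contrapT => /eqP /chi_neq0[h1 h2]; apply: nK.
by rewrite cboxE -!ler_norml !ltW.
Qed.

End Cutoff.

Section Competitor.
Context {R : realType}.
Variables (k : R -> R) (rho K : R) (eta : R * R -> R).
Hypothesis kk : 0 < k 1 + k (-1).
Hypothesis rho_gt0 : 0 < rho.
Hypothesis rho_le1 : rho <= 1.
Hypothesis K_ge1 : 1 <= K.
Hypothesis kK : forall s, s * s = 1 -> `|k s| <= K.
Hypothesis Ceta : Cinf setT eta.
Hypothesis eta01 : forall x, 0 <= eta x <= 1.
Variables M0 Mc : R.
Hypothesis D_eta : forall x v, e12 v -> `|'D_v eta x| <= M0.
Hypothesis D_chi : forall x v, e12 v -> `|'D_v (chi rho) x| <= Mc.
Variable d : R.
Hypothesis d_gt0 : 0 < d.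
Hypothesis d_le1 : d <= 1.
Hypothesis d_rho : 16 * (K * d) <= rho.
Hypothesis d_17 : 17 * d ^+ 2 <= 1.
Hypothesis d_width : forall s, s * s = 1 -> line_width (k s) * d ^+ 2 < 1.
Variable Omega : set (R * R).
Hypothesis O_near : forall x, Omega x -> `|x.1| < 4 * rho -> `|x.2| < 4 * rho -> 0 < x.2.
Implicit Types (x v : R * R) (s : R).

Let delta := d ^+ 2.
Let delta_gt0 : 0 < delta. Proof. exact: exprn_gt0. Qed.
Let delta_le : 4 * delta <= 1. Proof. by have := delta_gt0; have := d_17; rewrite -/delta; lra. Qed.

Definition competitor x : R := chi rho x * profile k d (d ^+ 2) x + (1 - chi rho x) * eta x.

Let Cchi : Cinf setT (chi rho).
Proof. by have /test_funP[] := test_chi rho_gt0. Qed.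

Let Cprof : Cinf setT (profile k d (d ^+ 2)).
Proof. exact: Cinf_profile. Qed.

Lemma Cinf_competitor : Cinf setT competitor.
Proof.
move=> n; apply: Ck_add; first exact: openT.
  by apply: Ck_mul; [exact: openT|exact: Cchi|exact: Cprof].
apply: Ck_mul; [exact: openT| |exact: Ceta].
by apply: Ck_sub_fun; [exact: openT|exact: Ck_cst|exact: Cchi].
Qed.

Lemma competitor01 x : 0 <= competitor x <= 1.
Proof.
have /andP[a b] := chi01 rho x; have /andP[a1 b1] := eta01 x.
have /andP[a2 b2] : 0 <= profile k d (d ^+ 2) x <= 1 by apply: profile01.
rewrite /competitor; move: (chi rho x) a b (eta x) a1 b1 (profile _ _ _ _) a2 b2 => c a b e a1 b1 p a2 b2.
by apply/andP; split; nra.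
Qed.

Lemma derive_competitor x v : 'D_v competitor x =
  chi rho x * 'D_v (profile k d (d ^+ 2)) x + 'D_v (chi rho) x * (profile k d (d ^+ 2) x - eta x)
  + (1 - chi rho x) * 'D_v eta x.
Proof.
have D f : Cinf setT f -> is_derive x v f ('D_v f x).
  by move=> cf; apply: derivableP; exact: (Ck_derivable (cf 1%N)).
have d1 := is_deriveM (D _ Cchi) (D _ Cprof).
have d2 := is_deriveM (is_deriveB (is_derive_cst (1 : R) x v) (D _ Cchi)) (D _ Ceta).
have -> : competitor = chi rho * profile k d (d ^+ 2) + (cst 1 - chi rho) * eta by exact/funext.
rewrite (is_derive_val (is_deriveD d1 d2)) /GRing.scale/= sub0r.
rewrite (_ : (cst 1 - chi rho) x = 1 - chi rho x)//.
move: ('D_v _ x) ('D_v _ x) ('D_v _ x) (chi rho x) (profile _ _ _ x) (eta x) => *; ring.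
Qed.

Definition inv_angles : R := (acot (k 1))^-1 + (acot (k (-1)))^-1.

Lemma inv_angle_le s : s * s = 1 -> (acot (k s))^-1 <= inv_angles.
Proof.
have a1 : 0 <= (acot (k 1))^-1 by rewrite invr_ge0 ltW// acot_gt0.
have a2 : 0 <= (acot (k (-1)))^-1 by rewrite invr_ge0 ltW// acot_gt0.
by case/sign_cases => ->; rewrite ?lerDl ?lerDr.
Qed.

Lemma inv_angles_ge0 : 0 <= inv_angles.
Proof. by rewrite addr_ge0// invr_ge0 ltW// acot_gt0. Qed.

(** Bounds for all the gradients in play: [tame_bound] at a distance from the tip,
    and [wild_bound], in units of 1 / d, everywhere. *)
Definition tame_bound : R := 2 * Mc + M0 + 8 * (dramp_bound * inv_angles / rho).

Definition wild_bound : R := 2 * Mc + M0 + profile_bound k + 8 * inv_angles.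

Let M0_ge0 : 0 <= M0.
Proof. by apply: le_trans (normr_ge0 _) (@D_eta 0 e1 _); left. Qed.

Let Mc_ge0 : 0 <= Mc.
Proof. by apply: le_trans (normr_ge0 _) (@D_chi 0 e1 _); left. Qed.

Let competitor_bound x v (M : R) : e12 v -> 0 <= M ->
  (chi rho x != 0 -> `|'D_v (profile k d (d ^+ 2)) x| <= M) ->
  `|'D_v competitor x| <= 2 * Mc + M0 + M.
Proof.
move=> vE M_ge0 H; rewrite derive_competitor.
have /andP[c0 c1] := chi01 rho x; have /andP[e0 e1'] := eta01 x.
have /andP[p0 p1] : 0 <= profile k d (d ^+ 2) x <= 1 by apply: profile01.
have He := D_eta x vE; have Hc := D_chi x vE.
have T1 : `|chi rho x * 'D_v (profile k d (d ^+ 2)) x| <= M.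
  have [->|cn0] := eqVneq (chi rho x) 0; first by rewrite mul0r normr0.
  rewrite normrM (ger0_norm c0); have := H cn0.
  by move: `|_| => t ht; have := mulr_ge0 c0 M_ge0; nra.
have T2 : `|'D_v (chi rho) x * (profile k d (d ^+ 2) x - eta x)| <= 2 * Mc.
  rewrite normrM mulrC; apply: ler_pM => //.
  rewrite ler_norml; move: p0 p1 e0 e1'; rewrite /delta; lra.
have T3 : `|(1 - chi rho x) * 'D_v eta x| <= M0.
  rewrite normrM ger0_norm ?subr_ge0//; apply: le_trans He.
  by rewrite ler_piMl// gerBl.
apply: le_trans (ler_normD _ _) _; rewrite addrC.
apply: (@le_trans _ _ (M0 + (M + 2 * Mc))); last by lra.
by apply: lerD T3 _; apply: le_trans (ler_normD _ _) _; exact: lerD.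
Qed.

Let O_upper x : Omega x -> chi rho x != 0 -> 0 < x.2.
Proof. by move=> Ox /(chi_neq0 rho_gt0)[h1 h2]; apply: O_near => //; have := rho_gt0; lra. Qed.

Let profile_bound_ge0 : 0 <= profile_bound k.
Proof.
have := derive_profile_le kk d_gt0 delta_gt0 delta_le (x := (0, 1)) (or_introl erefl : e12 e1) ltr01.
by move/(le_trans (normr_ge0 _)); rewrite pmulr_lge0// invr_gt0.
Qed.

Lemma competitor_wild x v : e12 v -> Omega x -> `|'D_v competitor x| <= wild_bound / d.
Proof.
move=> vE Ox; apply: (@le_trans _ _ (2 * Mc + M0 + profile_bound k / d)).
  apply: competitor_bound => //; first by rewrite divr_ge0// ltW.
  by move=> /(O_upper Ox) x2; apply: (derive_profile_le kk d_gt0 delta_gt0 delta_le).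
rewrite ler_pdivlMr// mulrDl divfK ?gt_eqF// /wild_bound.
have := inv_angles_ge0; have := Mc_ge0; have := M0_ge0; have := d_le1; have := d_gt0.
by move: (profile_bound k) inv_angles => p i; nra.
Qed.

Notation X := (tip_field k d rho).
Notation Xs := (side_field k d rho).
Notation wedge := (wedge k d).

Let kd s : s * s = 1 -> d * `|k s| <= rho / 16.
Proof.
move=> ss; apply: (@le_trans _ _ (d * K)); first by rewrite ler_pM2l// kK.
by rewrite ler_pdivlMr//; move: d_rho; lra.
Qed.

Let kd_norm s : s * s = 1 -> `|d * k s| <= rho / 16.
Proof. by move=> ss; rewrite normrM (gtr0_norm d_gt0) kd. Qed.

Lemma side_field_le s v x (n : R) : s * s = 1 -> e12 v -> 0 < n ->
  n <= `|shifted s (k s) d x| \/ n <= x.2 -> `|Xs s v x| <= inv_angles / n.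
Proof.
move=> ss vE n0 H; rewrite /Xs patchE; case: ifPn => [|_]; last first.
  by rewrite normr0 divr_ge0 ?inv_angles_ge0// ltW.
move=> /set_mem[x2 _]; rewrite normrM.
have /andP[w0 w1] := window01 k d rho s (rad2 s (k s) d x).
rewrite (ger0_norm w0); apply: (@le_trans _ _ `|'D_v (ang s (k s) d) x|).
  by rewrite ler_piMl.
apply: le_trans (derive_ang_le ss vE x2 n0 H) _.
by rewrite invfM ler_wpM2r ?invr_ge0 ?(ltW n0)// inv_angle_le.
Qed.

Lemma side_field_wild s v x : s * s = 1 -> e12 v -> `|Xs s v x| <= 2 * inv_angles / d.
Proof.
move=> ss vE.
have [h|h] := leP (rad2 s (k s) d x) (inner k d s).
  rewrite /Xs patchE; case: ifP => _.
    by rewrite window_low// mul0r normr0 divr_ge0 ?mulr_ge0 ?inv_angles_ge0// ltW.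
  by rewrite normr0 divr_ge0 ?mulr_ge0 ?inv_angles_ge0// ltW.
have [x2|x2] := leP x.2 0.
  rewrite /Xs patchE memNset; last by move=> -[]; rewrite /upper/= ltNge x2.
  by rewrite normr0 divr_ge0 ?mulr_ge0 ?inv_angles_ge0// ltW.
have d2 : 0 < d / 2 by rewrite divr_gt0.
apply: (@le_trans _ _ (inv_angles / (d / 2))); last by rewrite invf_div mulrA [inv_angles * 2]mulrC.
apply: side_field_le => //; have [h2|h2] := leP (d / 2) x.2; [by right|left].
rewrite leNgt; apply/negP => h1; move: h; rewrite ltNge => /negP; apply.
have a1 : shifted s (k s) d x ^+ 2 <= (d / 2) ^+ 2.
  by rewrite -(real_normK (num_real (shifted _ _ _ _))) lerXn2r// ?nnegrE ltW.
have a2 : x.2 ^+ 2 <= (d / 2) ^+ 2 by rewrite lerXn2r// ?nnegrE ltW.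
apply: le_trans (lerD a1 a2) _; rewrite /inner.
have := sqr_ge0 d; have := mulr_ge0 (sqr_ge0 (k s)) (sqr_ge0 d); rewrite exprMn; lra.
Qed.

Let ss1 : (1 : R) * 1 = 1. Proof. exact: mulr1. Qed.
Let ssN1 : (-1 : R) * -1 = 1. Proof. by rewrite mulrNN mulr1. Qed.

Lemma tip_field_wild v x : e12 v -> `|X v x| <= wild_bound / d.
Proof.
move=> vE; apply: le_trans (ler_normD _ _) _.
apply: (@le_trans _ _ (2 * inv_angles / d + 2 * inv_angles / d)).
  by apply: lerD; exact: side_field_wild.
rewrite -mulrDl ler_wpM2r ?invr_ge0 ?(ltW d_gt0)// /wild_bound.
by have := inv_angles_ge0; have := Mc_ge0; have := M0_ge0; have := profile_bound_ge0; lra.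
Qed.

Definition strip s : set (R * R) :=
  [set x | 0 <= x.2 <= 1 /\ - (line_width (k s) * d ^+ 2) <= lam s (k s) d x <= 0].

(** The parts are the gap under the tip, and then the layers along the axis and the
    sides of the tip where one of the two angles is truncated. The area is of order
    d ^+ 2, which compensates the size 1 / d of the gradients. *)
Definition bad : set (R * R) :=
  cbox (- (4 * K * d)) (4 * K * d) (- (4 * K * d)) (4 * K * d) `|`
  cbox (- rho) rho 0 (17 * d ^+ 2) `|` strip 1 `|` strip (-1).

Lemma off_bad_far x v s : e12 v -> Omega x -> s * s = 1 -> rho / 2 < `|x.1| \/ rho / 2 < `|x.2| ->
  [/\ `|'D_v competitor x| <= tame_bound, `|X v x| <= tame_bound &
      wedge s x -> `|'D_v (ang s (k s) d) x| <= tame_bound].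
Proof.
move=> vE Ox ss far.
have r4 : 0 < rho / 4 by rewrite divr_gt0.
have C1 := @dramp_bound_ge1 R; have i0 := inv_angles_ge0.
have bnd : inv_angles / (rho / 4) <= 4 * (dramp_bound * inv_angles / rho).
  rewrite invf_div mulrCA ler_wpM2l// -mulrA ler_peMl// divr_ge0// ltW//.
have tame0 : 8 * (dramp_bound * inv_angles / rho) <= tame_bound.
  by rewrite /tame_bound lerDr addr_ge0// mulr_ge0.
have q0 : 0 <= dramp_bound * inv_angles / rho.
  by rewrite divr_ge0 ?(ltW rho_gt0)// mulr_ge0// (le_trans _ C1).
have dist t : t * t = 1 -> 0 < x.2 -> rho / 4 <= `|shifted t (k t) d x| \/ rho / 4 <= x.2.
  move=> tt x2; case: far => h; last first.
    by right; move: h; rewrite (gtr0_norm x2); have := rho_gt0; lra.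
  left; have := kd_norm tt; rewrite /shifted => h2.
  have : `|t * x.1| <= `|t * x.1 - d * k t| + `|d * k t|.
    by apply: le_trans (ler_normD _ _); rewrite subrK.
  have -> : `|t * x.1| = `|x.1| by rewrite normrM; case: (sign_cases tt) => ->; rewrite ?normrN normr1 mul1r.
  by move: h h2; move: `|_| `|_| `|_| => a b c; have := rho_gt0; lra.
split.
- rewrite /tame_bound; apply: competitor_bound => //; first by rewrite mulr_ge0.
  move=> /(O_upper Ox) x2.
  have dist' t : t * t = 1 -> rho / 4 <= `|shifted t (k t) d x| \/ rho / 4 <= x.2.
    by move=> tt; exact: dist.
  apply: (@le_trans _ _ (dramp_bound * inv_angles / (rho / 4))).
    by apply: derive_profile_far.
  rewrite invf_div mulrCA; move: q0; move: (_ / rho) => q; lra.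
- apply: le_trans tame0; have [x2|x2] := leP x.2 0.
    have nW t : ~ wedge t x by move=> -[]; rewrite /upper/= ltNge x2.
    by rewrite /X /Xs !patchE !memNset// addr0 normr0 mulr_ge0.
  apply: le_trans (ler_normD _ _) _.
  apply: (@le_trans _ _ (inv_angles / (rho / 4) + inv_angles / (rho / 4))); last by lra.
  by apply: lerD; apply: side_field_le => //; exact: dist.
- move=> [x2 _]; apply: le_trans tame0.
  apply: le_trans (derive_ang_le ss vE x2 r4 (dist _ ss x2)) _.
  rewrite invfM; apply: (@le_trans _ _ (inv_angles / (rho / 4))); last by lra.
  by rewrite ler_wpM2r ?invr_ge0 ?(ltW r4)// inv_angle_le.
Qed.

(** Above the height d the sum of the two linear forms is nonnegative; below it x.1 is
    large in comparison with d, and its sign decides. *)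
Lemma wedge_disjoint s x : s * s = 1 -> 0 < x.2 ->
  ~~ ((`|x.1| <= 4 * K * d) && (`|x.2| <= 4 * K * d)) ->
  lam s (k s) d x < 0 -> 0 <= lam (- s) (k (- s)) d x.
Proof.
have K1 := K_ge1; have d0 := d_gt0.
have Kd : 0 < K * d by rewrite mulr_gt0//; lra.
move=> ss x2 x1b l0; rewrite leNgt; apply/negP => l0'.
have x2d : x.2 < d.
  have : (k 1 + k (-1)) * (x.2 - d) < 0.
    by case: (sign_cases ss) l0 l0' => ->; rewrite ?opprK /lam; lra.
  by rewrite pmulr_rlt0// subr_lt0.
have key (t : R) : t * t = 1 -> lam t (k t) d x < 0 -> t * x.1 < K * d.
  move=> tt; rewrite /lam; have := kK tt; rewrite ler_norml => /andP[q1 q2] q3.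
  have : k t * (d - x.2) <= K * d by apply: (@le_trans _ _ (K * (d - x.2))); nra.
  by lra.
have ss' : - s * - s = 1 by rewrite mulrNN.
have b := key _ ss l0; have a := key _ ss' l0'; move/negP: x1b; apply.
apply/andP; split; last by rewrite gtr0_norm//; nra.
by case: (sign_cases ss) a b => ->; rewrite ler_norml; lra.
Qed.

Lemma window_near s x : s * s = 1 -> `|x.1| <= rho / 2 -> `|x.2| <= rho / 2 ->
  ~~ ((`|x.1| <= 4 * K * d) && (`|x.2| <= 4 * K * d)) ->
  window k d rho s (rad2 s (k s) d x) = 1.
Proof.
have r0 := rho_gt0; have K1 := K_ge1; have d0 := d_gt0.
have Kd : 0 < K * d by rewrite mulr_gt0//; lra.
move=> ss h1 h2 x1b; apply: window_mid => //; apply/andP; split.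
  have kb : k s ^+ 2 <= K ^+ 2.
    by rewrite -(real_normK (num_real (k s))) lerXn2r// ?nnegrE ?kK//; lra.
  apply: (@le_trans _ _ (9 * (K * d) ^+ 2)).
    rewrite /inner exprMn; have := sqr_ge0 d; have : 1 <= K ^+ 2 by rewrite expr2; nra.
    move: kb; move: (d ^+ 2) (K ^+ 2) (k s ^+ 2) => D K2 k2 kb K21 D0.
    have : k2 * D <= K2 * D by rewrite ler_wpM2r.
    have : 1 * D <= K2 * D by rewrite ler_wpM2r.
    by lra.
  move: x1b; rewrite negb_and -!ltNge => /orP[p|p].
    have : 3 * (K * d) <= `|shifted s (k s) d x|.
      have q : d * `|k s| <= K * d by rewrite mulrC ler_pM2r// kK.
      have : `|s * x.1| <= `|s * x.1 - d * k s| + `|d * k s|.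
        by apply: le_trans (ler_normD _ _); rewrite subrK.
      have -> : `|s * x.1| = `|x.1|.
        by rewrite normrM; case: (sign_cases ss) => ->; rewrite ?normrN normr1 mul1r.
      rewrite [`|d * _|]normrM (gtr0_norm d0) /shifted.
      by move: p q; move: `|_| `|_| (d * `|_|) => a b c; lra.
    move=> q; have : (3 * (K * d)) ^+ 2 <= `|shifted s (k s) d x| ^+ 2.
      by rewrite lerXn2r// nnegrE// mulr_ge0// ltW.
    rewrite real_normK ?num_real// /rad2; have := sqr_ge0 x.2.
    by move: (x.2 ^+ 2) (shifted _ _ _ _ ^+ 2) => a b; rewrite exprMn; lra.
  have : (4 * K * d) ^+ 2 <= `|x.2| ^+ 2.
    by rewrite lerXn2r// ?nnegrE//; [rewrite -mulrA mulr_ge0// ltW|exact: ltW].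
  rewrite real_normK ?num_real// /rad2; have := sqr_ge0 (shifted s (k s) d x).
  have := sqr_ge0 (K * d).
  by move: (x.2 ^+ 2) (shifted _ _ _ _ ^+ 2) => a b; rewrite -mulrA exprMn; lra.
have y1 : `|shifted s (k s) d x| <= 9 / 16 * rho.
  apply: le_trans (ler_normB _ _) _; have := kd_norm ss.
  have -> : `|s * x.1| = `|x.1|.
    by rewrite normrM; case: (sign_cases ss) => ->; rewrite ?normrN normr1 mul1r.
  by move: h1; move: `|_| `|_| => a b; lra.
have a1 : shifted s (k s) d x ^+ 2 <= (9 / 16 * rho) ^+ 2.
  by rewrite -(real_normK (num_real (shifted _ _ _ _))) lerXn2r// ?nnegrE// mulr_ge0//; lra.
have a2 : x.2 ^+ 2 <= (rho / 2) ^+ 2.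
  by rewrite -(real_normK (num_real x.2)) lerXn2r// ?nnegrE// divr_ge0//; lra.
apply: le_trans (lerD a1 a2) _; rewrite !exprMn; have := sqr_ge0 rho; lra.
Qed.

(** Off the bad set the cutoffs are constant, and at most one of the two factors of
    the profile varies; where it does, its angle is not truncated. *)
Lemma off_bad_near x v : Omega x -> ~ bad x -> `|x.1| <= rho / 2 -> `|x.2| <= rho / 2 ->
  'D_v competitor x = X v x /\ forall s, s * s = 1 -> wedge s x -> 'D_v (ang s (k s) d) x = X v x.
Proof.
move=> Ox nB h1 h2; have r0 := rho_gt0; have r1 := rho_le1; have K1 := K_ge1; have d0 := d_gt0.
have x2 : 0 < x.2 by apply: O_near => //; lra.
have Kd : 0 < K * d by rewrite mulr_gt0//; lra.
have x1b : ~~ ((`|x.1| <= 4 * K * d) && (`|x.2| <= 4 * K * d)).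
  apply/negP => /andP[p1 p2]; apply: nB; do 3 left.
  by rewrite cboxE -!ler_norml.
have x2b : 17 * d ^+ 2 < x.2.
  rewrite ltNge; apply/negP => p; apply: nB; do 2 left; right.
  by rewrite cboxE -ler_norml (ltW x2) p; split=> //; apply: le_trans h1 _; lra.
have x21 : 0 <= x.2 <= 1 by rewrite ltW//=; move: h2; rewrite gtr0_norm//; lra.
have strips s : s * s = 1 -> lam s (k s) d x < - (line_width (k s) * d ^+ 2) \/ 0 < lam s (k s) d x.
  move=> ss; have nS : ~ strip s x.
    by case: (sign_cases ss) => -> p; apply: nB; [left; right|right].
  have [?|a] := ltP (lam s (k s) d x) (- (line_width (k s) * d ^+ 2)); first by left.
  have [|b] := ltP 0 (lam s (k s) d x); first by right.
  by case: nS; split=> //; rewrite a b.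
have near_prof : 'D_v competitor x = 'D_v (profile k d (d ^+ 2)) x.
  apply: near_eq_derive.
  apply: (@square_nbhs _ _ _ (rho / 2)) => [|y p1 p2]; first by rewrite divr_gt0.
  rewrite /competitor chi_low ?subrr ?mul1r ?mul0r ?addr0//.
    by have := ler_normD (y.1 - x.1) x.1; rewrite subrK; lra.
  by have := ler_normD (y.2 - x.2) x.2; rewrite subrK; lra.
rewrite near_prof.
have XsE s : s * s = 1 -> wedge s x -> Xs s v x = 'D_v (ang s (k s) d) x.
  by move=> ss Ws; rewrite /Xs patchE mem_set// window_near// mul1r.
have Xs0 s : ~ wedge s x -> Xs s v x = 0 by move=> h; rewrite /Xs patchE memNset.
have wedge_s s : s * s = 1 -> wedge s x ->
    'D_v (profile k d (d ^+ 2)) x = 'D_v (ang s (k s) d) x /\ X v x = 'D_v (ang s (k s) d) x.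
  move=> ss Ws; have [_ /= l0] := Ws; have l0' := wedge_disjoint ss x2 x1b l0; split.
    apply: derive_profile_mid => //; first exact: sign_cases.
    have y1 : `|shifted s (k s) d x| <= 1.
      apply: le_trans (ler_normB _ _) _; have := kd_norm ss.
      have -> : `|s * x.1| = `|x.1|.
        by rewrite normrM; case: (sign_cases ss) => ->; rewrite ?normrN normr1 mul1r.
      by move: h1; move: `|_| `|_| => a b; lra.
    apply/andP; split; rewrite leNgt; apply/negP => p.
      by have := ang_small delta_gt0 d_17 y1 x2 (ltW p); rewrite leNgt x2b.
    have a1 : ang s (k s) d x < 1 by rewrite ltNge ang_ge1// -ltNge.
    have x21' : 0 < x.2 <= 1 by rewrite x2; case/andP: x21.
    have /andP[q _] := ang_near1 delta_gt0 (d_width ss) x21' a1 (ltW p).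
    case: (strips s ss) => h; first by move: q; rewrite leNgt h.
    by move: l0; rewrite ltNge ltW.
  have nW : ~ wedge (- s) x by move=> -[_ /=]; rewrite ltNge l0'.
  rewrite /X -(XsE _ ss Ws); case: (sign_cases ss) nW => ->; rewrite ?opprK => nW.
    by rewrite [Xs (-1) v x]Xs0// addr0.
  by rewrite [Xs 1 v x]Xs0// add0r.
split=> [|s ss Ws]; last by have [_ ->] := wedge_s s ss Ws.
have [W1|nW1] := pselect (wedge 1 x); first by have [-> ->] := wedge_s 1 ss1 W1.
have [W2|nW2] := pselect (wedge (-1) x); first by have [-> ->] := wedge_s (-1) ssN1 W2.
rewrite /X !Xs0// addr0.
have E : \forall y \near x, profile k d (d ^+ 2) y = (fun=> 1) y.
  apply: profile_near_sector => // s ss; rewrite leNgt; apply/negP => l0.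
  by case: (sign_cases ss) l0 => -> l0; [apply: nW1|apply: nW2].
by rewrite (near_eq_derive _ E) derive_cst.
Qed.

End Competitor.

(** * Integrals over horizontal slices *)

Section LineIntegrals.
Context {R : realType}.
Implicit Types (b c h x y : R).
Local Notation mu := (@lebesgue_measure R).

(** The Poisson kernel of the half-plane, up to the factor pi. *)
Definition kernel c h x : R := h / ((x - c) ^+ 2 + h ^+ 2).

Lemma kernel_denom c h x : 0 < h -> 0 < (x - c) ^+ 2 + h ^+ 2.
Proof. by move=> h0; rewrite ltr_wpDl ?sqr_ge0// exprn_gt0. Qed.

Lemma kernel_ge0 c h x : 0 < h -> 0 <= kernel c h x.
Proof. by move=> h0; rewrite divr_ge0// ltW// kernel_denom. Qed.

Lemma is_derive_kernel c h x : 0 < h ->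
  is_derive x 1 (fun x => atan ((x - c) / h)) (kernel c h x).
Proof.
move=> h0; have d1 := is_derive_affine h^-1 (- c / h) x.
rewrite (_ : (fun x => atan ((x - c) / h)) = (@atan R) \o (fun t => h^-1 * t + - c / h)); last first.
  by apply/funext => t /=; congr atan; rewrite mulrBl mulrC mulNr.
have := @is_derive1_comp _ (@atan R) (fun t : R => h^-1 * t + - c / h) x _ _ (is_derive1_atan (h^-1 * x + - c / h)) d1.
move=> dd; apply: (is_derive_eq dd); rewrite /kernel.
have -> : h^-1 * x + - c / h = (x - c) / h by rewrite mulrBl mulrC mulNr.
have n0 := lt0r_neq0 (kernel_denom c x h0); have h0' := lt0r_neq0 h0.
have n1 : 1 + ((x - c) / h) ^+ 2 != 0 by rewrite gt_eqF// ltr_pwDl// sqr_ge0.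
rewrite (_ : 1 + _ = ((x - c) ^+ 2 + h ^+ 2) / h ^+ 2); last by field.
by field; rewrite n0 h0'.
Qed.

Lemma continuous_kernel c h : 0 < h -> continuous (kernel c h).
Proof.
move=> h0 x; apply: cvgM; first exact: cvg_cst.
apply: cvgV; first exact: lt0r_neq0 (kernel_denom c x h0).
apply: cvgD; last exact: cvg_cst.
apply: (@continuous_comp _ _ _ (fun t : R => t - c) (fun t : R => t ^+ 2)); last exact: exprn_continuous.
by apply: cvgB => //; exact: cvg_cst.
Qed.

Lemma kernel_right c h b : 0 < h ->
  (\int[mu]_(x in `[b, +oo[) (kernel c h x)%:E = (pi / 2 - atan ((b - c) / h))%:E)%E.
Proof.
move=> h0; rewrite EFinB.
apply: (@ge0_continuous_FTC2y _ (kernel c h) (fun x => atan ((x - c) / h)) b (pi / 2)).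
- by move=> x _; exact: kernel_ge0.
- by apply: continuous_subspaceT; exact: continuous_kernel.
- apply: (cvg_comp _ _ _ (@cvgy_atan R)).
  apply/cvgryPge => A; near=> x.
  rewrite ler_pdivlMr// lerBrDr; near: x.
  by apply: nbhs_pinfty_ge; rewrite num_real.
- by move=> x _; exact: is_derive_ex (is_derive_kernel c x h0).
- apply: cvg_at_right_filter.
  have /derivable1_diffP/differentiable_continuous := is_derive_ex (is_derive_kernel c b h0).
  exact.
- by move=> x _; rewrite derive1E (is_derive_val (is_derive_kernel c x h0)).
Unshelve. all: by end_near. Qed.

Lemma kernel_left c h b : 0 < h ->
  (\int[mu]_(x in `]-oo, b]) (kernel c h x)%:E = (pi / 2 + atan ((b - c) / h))%:E)%E.
Proof.
move=> h0; have := @ge0_integration_by_substitutionNy R (kernel c h) (- b).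
rewrite opprK => ->; last 2 first.
- by apply: continuous_subspaceT; exact: continuous_kernel.
- by move=> x _; exact: kernel_ge0.
transitivity (\int[mu]_(x in `[(- b)%R, +oo[) (kernel (- c) h x)%:E)%E.
  apply: eq_integral => x _ /=; congr EFin; rewrite /kernel opprK.
  by congr (_ / (_ + _)); ring.
rewrite kernel_right//; congr EFin.
by rewrite (_ : (- b - - c) / h = - ((b - c) / h)) ?atanN ?opprK//; ring.
Qed.

Lemma kernel_total h : 0 < h -> (\int[mu]_x (kernel 0 h x)%:E = pi%:E)%E.
Proof.
move=> h0; rewrite ge0_symfun_integralT.
- rewrite -set_itvcy kernel_right// subr0 mul0r atan0 subr0 -EFinM mulrC divfK//.
- by move=> x; exact: kernel_ge0.
- exact: continuous_kernel.
- by move=> x; rewrite /kernel/= !subr0 sqrrN.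
Qed.

Lemma kernel_left_open c h b : 0 < h ->
  (\int[mu]_(x in `]-oo, b[) (kernel c h x)%:E = (pi / 2 + atan ((b - c) / h))%:E)%E.
Proof.
move=> h0; rewrite -kernel_left// integral_itv_bndo_bndc//.
apply/measurable_EFinP; apply: measurable_funTS; apply: continuous_measurable_fun.
exact: continuous_kernel.
Qed.

Lemma kernel_right_open c h b : 0 < h ->
  (\int[mu]_(x in `]b, +oo[) (kernel c h x)%:E = (pi / 2 - atan ((b - c) / h))%:E)%E.
Proof.
move=> h0; rewrite -kernel_right// integral_itv_obnd_cbnd//.
apply/measurable_EFinP; apply: measurable_funTS; apply: continuous_measurable_fun.
exact: continuous_kernel.
Qed.

Lemma integral_inv (d : R) : 0 < d < 1 ->
  (\int[mu]_(y in `]d, 1%R[) (y^-1)%:E = `|ln d|%:E)%E.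
Proof.
move=> /andP[d0 d1].
have cinv (x : R) : 0 < x -> {for x, continuous (fun y : R => y^-1)}.
  by move=> x0; apply: inv_continuous; exact: lt0r_neq0.
have mi : measurable_fun `]d, 1[ (EFin \o (fun y : R => y^-1)).
  apply/measurable_EFinP; apply: open_continuous_measurable_fun; first exact: interval_open.
  by move=> x; rewrite inE/= in_itv/= => /andP[dx _]; apply: cinv; exact: lt_trans dx.
rewrite -(@integral_itv_bndoo R d 1 (fun y => (y^-1)%:E) true false mi).
apply: etrans (@continuous_FTC2 R (fun y => y^-1) (@ln R) d 1 d1 _ _ _) _.
- apply: continuous_in_subspaceT => x; rewrite inE/= in_itv/= => /andP[dx _].
  by apply: cinv; exact: lt_le_trans dx.
- split.
  + move=> x; rewrite in_itv/= => /andP[dx _]; apply: ex_derive.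
    exact: is_derive1_ln (lt_trans d0 dx).
  + by apply: cvg_at_right_filter; exact: continuous_ln.
  + by apply: cvg_at_left_filter; apply: continuous_ln; exact: ltr01.
- move=> x; rewrite in_itv/= => /andP[dx _]; rewrite derive1E.
  exact: (is_derive_val (is_derive1_ln (lt_trans d0 dx))).
- by rewrite ln1 sub0e -EFinN ltr0_norm// ln_lt0// d0.
Qed.

End LineIntegrals.

Section PlaneIntegrals.
Context {R : realType}.
Implicit Types (f g : R * R -> R) (x : R * R) (M N c : R) (B : set (R * R)).
Local Notation mu := (@lebesgue_measure R).

(** Tonelli's theorem, in the order which suits slices at constant height. *)
Lemma integral_slices f (I : set R) (g : R -> R) : mblfun setT f -> (forall x, 0 <= f x) ->
  measurable I -> (forall y, I y -> \int[mu]_x (f (x, y))%:E = (g y)%:E)%E ->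
  (forall x, ~ I x.2 -> f x = 0) ->
  (\int[leb2]_x (f x)%:E = \int[mu]_(y in I) (g y)%:E)%E.
Proof.
move=> mf f0 mI gE fI.
have mEf : measurable_fun setT (EFin \o f : plane R -> \bar R) by exact: (measurable_EFinP _ _).2.
have f0' (z : plane R) : (0 <= (EFin \o f) z)%E by rewrite /= lee_fin.
apply: etrans (@fubini_tonelli2 _ _ _ _ R mu mu _ mEf f0') _.
rewrite [RHS]integral_mkcond; apply: eq_integral => y _.
rewrite /fubini_G patchE; case: ifPn => [/set_mem Iy|/negP nIy]; first exact: gE.
rewrite integral0_eq// => x _; rewrite /= fI//= => Iy; apply: nIy; exact: mem_set.
Qed.

(** The form in which majorants are combined: all the integrals to be bounded are
    dominated by sums of multiples of indicator functions and of [slab_weight]. *)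
Definition int_le f M : Prop :=
  [/\ mblfun setT f, forall x, 0 <= f x & (\int[leb2]_x (f x)%:E <= M%:E)%E].

Lemma int_le_add f g M N : int_le f M -> int_le g N -> int_le (fun x => f x + g x) (M + N).
Proof.
move=> [mf f0 fM] [mg g0 gN]; split.
- exact: measurable_funD.
- by move=> x; rewrite addr_ge0.
- under eq_integral do rewrite EFinD.
  rewrite ge0_integralD//; last 4 first.
  + by move=> x _; rewrite lee_fin.
  + exact: (measurable_EFinP _ _).2.
  + by move=> x _; rewrite lee_fin.
  + exact: (measurable_EFinP _ _).2.
  by rewrite EFinD leeD.
Qed.

Lemma int_le_scale f M c : 0 <= c -> int_le f M -> int_le (fun x => c * f x) (c * M).
Proof.
move=> c0 [mf f0 fM]; split.
- by apply: measurable_funM => //; exact: measurable_cst.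
- by move=> x; rewrite mulr_ge0.
- under eq_integral do rewrite EFinM.
  rewrite ge0_integralZl//; last 2 first.
  + exact: (measurable_EFinP _ _).2.
  + by move=> x _; rewrite lee_fin.
  by rewrite EFinM lee_wpmul2l// lee_fin.
Qed.

Lemma int_le_indic B M : mbl B -> (leb2 B <= M%:E)%E -> int_le \1_B M.
Proof.
move=> mB BM; split.
- exact: measurable_indic.
- by move=> x; rewrite indicE ler0n.
- by rewrite integral_indic// setIT.
Qed.

Lemma int_le_L1 f M : int_le f M -> L1 setT f /\ \int[leb2]_(x in setT) f x <= M.
Proof.
move=> [mf f0 fM]; have i : L1 setT f.
  by apply: L1_ge0 => //; exact: le_lt_trans fM (ltry _).
by split=> //; rewrite -lee_fin -L1_Rintegral.
Qed.

Definition slab h : set (R * R) := [set x | 0 < x.2 <= h].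

Lemma measurable_slab h : mbl (slab h).
Proof.
rewrite (_ : slab h = setT `*` `]0, h]%classic); first exact: measurableX.
by apply/seteqP; split=> x; rewrite /slab/= in_itv//= => -[].
Qed.

(** The integral is pi for every h: an inverse square of the distance costs O(1) on the
    thin slab below the height of the tip as well as on the one of height 1. *)
Definition slab_weight h : R * R -> R := (fun x => (x.1 ^+ 2 + h ^+ 2)^-1) \_ (slab h).

Lemma slab_weightE h x : 0 < x.2 <= h -> slab_weight h x = (x.1 ^+ 2 + h ^+ 2)^-1.
Proof. by move=> H; rewrite /slab_weight patchE mem_set. Qed.

Lemma int_le_slab h : 0 < h -> int_le (slab_weight h) pi.
Proof.
move=> h0.
have p0 t : 0 < t ^+ 2 + h ^+ 2 by rewrite ltr_wpDl ?sqr_ge0// exprn_gt0.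
have mw : mblfun setT (slab_weight h).
  apply: (measurable_restrictT _ (measurable_slab h)).1.
  apply: (@measurable_funS _ _ (plane R) _ setT) => //.
  apply: (@Ck_measurable _ _ _ 0 openT); apply: Ck_inv; first exact: openT.
    by move=> x _; rewrite gt_eqF.
  apply: Ck_add; [exact: openT| |exact: Ck_cst].
  by apply: Ck_exp; [exact: openT|exact: Ck_fst].
have w0 x : 0 <= slab_weight h x.
  by rewrite /slab_weight patchE; case: ifP => // _; rewrite invr_ge0 ltW.
split=> //.
rewrite (@integral_slices _ `]0, h]%classic (fun=> pi / h)) //; last 2 first.
- move=> y; rewrite /= in_itv/= => Iy.
  transitivity (\int[mu]_x ((h^-1)%:E * (kernel 0 h x)%:E))%E.
    apply: eq_integral => x _; rewrite slab_weightE// /kernel subr0 -EFinM; congr EFin.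
    by rewrite mulrA mulVf ?mul1r// gt_eqF.
  rewrite ge0_integralZl//; last 3 first.
  + apply/measurable_EFinP; apply: continuous_measurable_fun; exact: continuous_kernel.
  + by move=> x _; rewrite lee_fin kernel_ge0.
  + by rewrite lee_fin invr_ge0 ltW.
  by rewrite kernel_total// -EFinM mulrC.
- by move=> x nI; rewrite /slab_weight patchE memNset.
have muI : mu (`]0, h]%classic : set R) = h%:E.
  by rewrite lebesgue_measure_itv/= lte_fin h0 oppr0 adde0.
by rewrite integral_cst// [X in (_ * X)%E]muI -EFinM divfK ?gt_eqF.
Qed.

End PlaneIntegrals.

Section TipIntegrals.
Context {R : realType}.
Variables (k : R -> R) (d : R).
Hypothesis d01 : 0 < d < 1.
Implicit Types (x : R * R) (s : R).
Local Notation mu := (@lebesgue_measure R).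

Let d_gt0 : 0 < d. Proof. by case/andP: d01. Qed.

Definition wedge_band s : set (R * R) := wedge k d s `&` [set x | d < x.2 < 1].

Definition angle_energy s x : R := (acot (k s) ^+ 2 * rad2 s (k s) d x)^-1.

Lemma open_wedge_band s : open (wedge_band s).
Proof.
apply: openI; first exact: open_wedge.
rewrite (_ : [set x | _] = snd @^-1` `]d, 1[%classic); last by apply/seteqP; split=> x/=; rewrite in_itv.
by apply: open_comp; [move=> [a b] _; exact: cvg_snd|exact: interval_open].
Qed.

Lemma Ck_angle_energy n s U : open U -> U `<=` upper -> Ck n U (angle_energy s).
Proof.
move=> oU Uu; apply: Ck_inv => //.
  move=> x /Uu x2; rewrite mulf_neq0 ?expf_neq0 ?gt_eqF ?acot_gt0//.
  exact: rad2_gt0.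
by apply: Ck_mul => //; [exact: Ck_cst|exact: Ck_rad2].
Qed.

Definition band_energy s : R * R -> R := angle_energy s \_ (wedge_band s).

Lemma band_energy_ge0 s x : 0 <= band_energy s x.
Proof.
rewrite /band_energy patchE; case: ifP => // _; rewrite invr_ge0 mulr_ge0 ?sqr_ge0//.
by rewrite addr_ge0 ?sqr_ge0.
Qed.

Lemma measurable_band_energy s : mblfun setT (band_energy s).
Proof.
have oW := @open_wedge_band s.
apply: (measurable_restrictT _ (open_measurable_plane oW)).1.
by apply: (@Ck_measurable _ _ _ 0 oW); apply: Ck_angle_energy => // x [[]].
Qed.

(** On the slice at height y the energy density of the angular function has
    integral 1 / (theta y), where theta is the angle of the wedge. *)
Lemma integral_band_energy s : s * s = 1 ->
  (\int[leb2]_x (band_energy s x)%:E = ((acot (k s))^-1 * `|ln d|)%:E)%E.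
Proof.
move=> ss; set a := acot (k s); have a0 : 0 < a := acot_gt0 _.
rewrite (@integral_slices _ _ `]d, 1[%classic (fun y => a^-1 * y^-1)) //.
- transitivity (\int[mu]_(y in `]d, 1%R[) ((a^-1)%:E * (y^-1)%:E))%E.
    by apply: eq_integral => y _; rewrite EFinM.
  rewrite ge0_integralZl//; first by rewrite integral_inv// EFinM.
  + apply/measurable_EFinP; apply: open_continuous_measurable_fun; first exact: interval_open.
    move=> x; rewrite inE/= in_itv/= => /andP[dx _].
    by apply: inv_continuous; rewrite gt_eqF// (lt_trans d_gt0).
  + by move=> y; rewrite /= in_itv/= => /andP[dy _]; rewrite lee_fin invr_ge0 ltW// (lt_trans d_gt0).
  + by rewrite lee_fin invr_ge0 ltW.
- exact: measurable_band_energy.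
- exact: band_energy_ge0.
- move=> y; rewrite /= in_itv/= => Iy; have y0 : 0 < y by case/andP: Iy => dy _; exact: lt_trans dy.
  pose b := k s * (y - d).
  pose J : set R := [set x | s * x + b < 0].
  have E t : ((band_energy s (t, y))%:E = (fun t => (a ^- 2 / y)%:E * (kernel (s * (d * k s)) y t)%:E) \_ J t)%E.
    rewrite /band_energy !patchE.
    have -> : ((t, y) \in wedge_band s) = (t \in J).
      apply/idP/idP => /set_mem H; apply/mem_set; first by case: H => -[_].
      by split=> //; split.
    case: ifP => // _; rewrite -EFinM; congr EFin.
    rewrite /angle_energy -/a /kernel /rad2 /shifted/=.
    have n0 : (t - s * (d * k s)) ^+ 2 + y ^+ 2 != 0 by rewrite gt_eqF// kernel_denom.
    have -> : (s * t - d * k s) ^+ 2 + y ^+ 2 = (t - s * (d * k s)) ^+ 2 + y ^+ 2.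
      by case: (sign_cases ss) => ->; ring.
    by field; rewrite n0 !gt_eqF.
  transitivity (\int[mu]_(t in J) ((a ^- 2 / y)%:E * (kernel (s * (d * k s)) y t)%:E))%E.
    by rewrite [RHS]integral_mkcond; apply: eq_integral => t _; rewrite E.
  have mK (D : set R) : measurable_fun D (fun t => (kernel (s * (d * k s)) y t)%:E).
    apply/measurable_EFinP; apply: measurable_funTS; apply: continuous_measurable_fun.
    exact: continuous_kernel.
  have val (p : R) : p = a -> a ^- 2 / y * p = a^-1 * y^-1.
    by move=> ->; field; rewrite !gt_eqF.
  have J1 : s = 1 -> J = `]-oo, (- b)[%classic.
    by move=> s1; apply/seteqP; split=> x; rewrite /J/= in_itv/= s1 mul1r -ltrBrDr sub0r.
  have J2 : s = -1 -> J = `]b, +oo[%classic.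
    by move=> s1; apply/seteqP; split=> x; rewrite /J/= in_itv/= andbT s1 mulN1r addrC subr_lt0.
  have mJ : measurable J by case: (sign_cases ss) => [/J1|/J2] ->.
  rewrite ge0_integralZl//; last 3 first.
  + exact: mK.
  + by move=> x _; rewrite lee_fin kernel_ge0.
  + by rewrite lee_fin mulr_ge0 ?invr_ge0 ?exprn_ge0 ?ltW.
  case: (sign_cases ss) => s1.
    rewrite (J1 s1) kernel_left_open// -EFinM; congr EFin; apply: val.
    rewrite /a /acot -atanN; congr (_ + atan _); rewrite /b s1 mul1r.
    by field; rewrite gt_eqF.
  rewrite (J2 s1) kernel_right_open// -EFinM; congr EFin; apply: val.
  rewrite /a /acot; congr (_ - atan _); rewrite /b s1.
  by field; rewrite gt_eqF.
- move=> x nI; rewrite /band_energy patchE memNset// => -[_ /= h].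
  by apply: nI; rewrite /= in_itv.
Qed.

Lemma measurable_strip s : mbl (strip k d s).
Proof.
apply: closed_measurable_plane.
have cl : continuous (lam s (k s) d).
  by move=> x; apply: (Ck_continuous (Ck_lam 0 s (k s) d openT)).
rewrite (_ : strip k d s = (snd @^-1` `[0, 1]%classic) `&`
    (lam s (k s) d @^-1` `[(- (line_width (k s) * d ^+ 2)), 0]%classic)).
  apply: closedI; apply: preimage_closed => //; try exact: interval_closed.
  by move=> [p q] _; exact: cvg_snd.
by apply/seteqP; split=> x; rewrite /strip/= !in_itv.
Qed.

Lemma line_width_gt0 (c : R) : 0 < line_width c.
Proof. by rewrite mulr_gt0// ltr_pwDl// sqr_ge0. Qed.

(** Horizontal slices of the strip are segments of length its width. *)
Lemma leb2_strip s : s * s = 1 -> (leb2 (strip k d s) <= (line_width (k s) * d ^+ 2)%:E)%E.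
Proof.
move=> ss; set w := line_width (k s) * d ^+ 2.
have w0 : 0 < w by rewrite mulr_gt0 ?line_width_gt0 ?exprn_gt0.
have mS := measurable_strip s.
apply: (@le_trans _ _ (\int[leb2]_x (\1_(strip k d s) x)%:E)%E).
  by rewrite integral_indic// setIT.
rewrite (@integral_slices _ _ `[0, 1]%classic (fun=> w)) //.
- have muI : mu (`[0, 1]%classic : set R) = 1%:E.
    by rewrite lebesgue_measure_itv/= lte_fin ltr01 oppr0 adde0.
  by rewrite integral_cst// [X in (_ * X)%E]muI mule1.
- move=> y; rewrite /= in_itv/= => Iy; pose b := k s * (y - d).
  have [c cE] : exists c, forall t, strip k d s (t, y) = `[c, (c + w)]%classic t.
    case: (sign_cases ss) => s1.
      exists (- b - w) => x; rewrite /strip/= in_itv/= Iy /lam/= -/b -/w s1 mul1r.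
      by apply/propext; split=> [[_ /andP[p q]]|/andP[p q]]; [|split=> //]; apply/andP; split; lra.
    exists b => x; rewrite /strip/= in_itv/= Iy /lam/= -/b -/w s1 mulN1r.
    by apply/propext; split=> [[_ /andP[p q]]|/andP[p q]]; [|split=> //]; apply/andP; split; lra.
  transitivity (\int[mu]_t (\1_(`[c, (c + w)]%classic : set R) t)%:E)%E.
    apply: eq_integral => x _; rewrite !indicE; congr ((nat_of_bool _)%:R)%:E.
    by apply/idP/idP => /set_mem h; apply/mem_set; move: h; rewrite cE.
  have muI : mu (`[c, (c + w)]%classic : set R) = w%:E.
    by rewrite lebesgue_measure_itv/= lte_fin ltrDl w0 -EFinB addrAC subrr add0r.
  by rewrite integral_indic// setIT; exact: muI.
- move=> x nI; rewrite indicE memNset// => -[h _].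
  by apply: nI; rewrite /= in_itv.
Qed.

Lemma leb2_cboxE (a b c e : R) : a <= b -> c <= e ->
  leb2 (cbox a b c e) = ((b - a) * (e - c))%:E.
Proof.
move=> ab ce; rewrite [leb2 _]product_measure1E//.
have H (p q : R) : p <= q -> lebesgue_measure (`[p, q]%classic : set R) = (q - p)%:E.
  move=> pq; rewrite lebesgue_measure_itv/= lte_fin; case: ltP => [_|qp]; first by rewrite EFinB.
  by rewrite (@le_anti _ _ p q) ?subrr// pq.
by rewrite [X in (X * _)%E]H// [X in (_ * X)%E]H// EFinM.
Qed.

End TipIntegrals.

(** * The energy of the calibrating field *)

Section TipEnergy.
Context {R : realType}.
Variables (k : R -> R) (rho K : R) (eta : R * R -> R).
Hypothesis kk : 0 < k 1 + k (-1).
Hypothesis rho_gt0 : 0 < rho.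
Hypothesis rho_le1 : rho <= 1.
Hypothesis K_ge1 : 1 <= K.
Hypothesis kK : forall s, s * s = 1 -> `|k s| <= K.
Hypothesis Ceta : Cinf setT eta.
Hypothesis eta01 : forall x, 0 <= eta x <= 1.
Variables M0 Mc : R.
Hypothesis D_eta : forall x v, e12 v -> `|'D_v eta x| <= M0.
Hypothesis D_chi : forall x v, e12 v -> `|'D_v (chi rho) x| <= Mc.
Variable d : R.
Hypothesis d_gt0 : 0 < d.
Hypothesis d_lt1 : d < 1.
Hypothesis d_rho : 16 * (K * d) <= rho.
Hypothesis d_17 : 17 * d ^+ 2 <= 1.
Hypothesis d_width : forall s, s * s = 1 -> line_width (k s) * d ^+ 2 < 1.
Variables (Omega : set (R * R)) (VO : R).
Hypothesis O_near : forall x, `|x.1| < 4 * rho -> `|x.2| < 4 * rho -> (Omega x <-> 0 < x.2).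
Hypothesis oO : open Omega.
Hypothesis O_area : (leb2 Omega <= VO%:E)%E.
Implicit Types (x v : R * R) (s : R).

Let d_le1 : d <= 1. Proof. exact: ltW. Qed.
Let O_near1 x : Omega x -> `|x.1| < 4 * rho -> `|x.2| < 4 * rho -> 0 < x.2.
Proof. by move=> Ox h1 h2; apply/(O_near h1 h2). Qed.

Let mO : mbl Omega := open_measurable_plane oO.
Let finO : (leb2 Omega < +oo)%E.
Proof. exact: le_lt_trans O_area (ltry _). Qed.

Let VO_ge0 : 0 <= VO.
Proof. by rewrite -lee_fin; apply: le_trans O_area; exact: measure_ge0. Qed.

Notation Phi := (competitor k rho eta d).
Notation X := (tip_field k d rho).
Notation Xs := (side_field k d rho).
Notation wedge := (wedge k d).
Notation A s := (ang s (k s) d).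
Notation wild := (wild_bound k M0 Mc).
Notation tame := (tame_bound k rho M0 Mc).
Notation B := (bad k rho K d).
Notation inv := (inv_angles k).

Let ss1 : (1 : R) * 1 = 1. Proof. exact: mulr1. Qed.
Let ssN1 : (-1 : R) * -1 = 1. Proof. by rewrite mulrNN mulr1. Qed.

Definition bad_area : R :=
  (8 * K) ^+ 2 + 34 * rho + line_width (k 1) + line_width (k (-1)).

Let d01 : 0 < d < 1. Proof. by rewrite d_gt0. Qed.

Let mB : mbl B.
Proof.
have m1 := measurable_strip k d.
by apply: measurableU => //; apply: measurableU => //; apply: measurableU; exact: measurable_cbox.
Qed.

Let leb2_bad : (leb2 B <= (bad_area * d ^+ 2)%:E)%E.
Proof.
have m1 := measurable_strip k d.
have K1 := K_ge1; have d0 := d_gt0; have r0 := rho_gt0.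
have Kd : 0 <= 4 * K * d by rewrite -mulrA mulr_ge0// mulr_ge0//; lra.
have b1 := @leb2_cboxE R (- (4 * K * d)) (4 * K * d) (- (4 * K * d)) (4 * K * d).
have b2 := @leb2_cboxE R (- rho) rho 0 (17 * d ^+ 2).
have d2 : 0 <= 17 * d ^+ 2 by rewrite mulr_ge0// sqr_ge0.
have U (A1 A2 : set (R * R)) : mbl A1 -> mbl A2 -> (leb2 (A1 `|` A2) <= leb2 A1 + leb2 A2)%E.
  by move=> ? ?; apply: measureU2.
apply: le_trans (U _ _ _ (m1 _)) _.
  by apply: measurableU => //; apply: measurableU; exact: measurable_cbox.
apply: (@le_trans _ _ ((((8 * K) ^+ 2 * d ^+ 2 + 34 * rho * d ^+ 2) + line_width (k 1) * d ^+ 2)%:E +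
   (line_width (k (-1)) * d ^+ 2)%:E)%E); last by rewrite -EFinD lee_fin /bad_area; lra.
apply: leeD; last exact: leb2_strip.
apply: le_trans (U _ _ _ (m1 _)) _; first by apply: measurableU; exact: measurable_cbox.
rewrite EFinD; apply: leeD; last exact: leb2_strip.
apply: le_trans (U _ _ _ _) _; [exact: measurable_cbox|exact: measurable_cbox|].
rewrite EFinD; apply: leeD.
  by rewrite b1 ?lee_fin; [rewrite le_eqVlt; apply/orP; left; apply/eqP; ring|lra|lra].
by rewrite b2 ?lee_fin; [rewrite le_eqVlt; apply/orP; left; apply/eqP; ring|lra|].
Qed.

(** It dominates every product and difference of gradients that has to be integrated,
    and its integral is bounded independently of d since the area of the bad set is
    of order d ^+ 2. *)
Definition majorant x : R := 8 * (wild / d) ^+ 2 * \1_B x + 8 * tame ^+ 2 * \1_Omega x.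

Definition majorant_mass : R := 8 * wild ^+ 2 * bad_area + 8 * tame ^+ 2 * VO.

Lemma int_le_majorant : int_le majorant majorant_mass.
Proof.
rewrite /majorant_mass; apply: int_le_add.
- have -> : 8 * wild ^+ 2 * bad_area = 8 * (wild / d) ^+ 2 * (bad_area * d ^+ 2).
    by rewrite exprMn exprVn; field; rewrite gt_eqF.
  by apply: int_le_scale; [rewrite mulr_ge0 ?sqr_ge0|exact: int_le_indic].
- by apply: int_le_scale; [rewrite mulr_ge0 ?sqr_ge0|exact: int_le_indic].
Qed.

(** The alternative on which all the comparisons of gradients rest: they coincide,
    or the point is bad, or it is at a distance from the tip. *)
Definition close_gradients (a1 a2 b1 b2 : R) x : Prop :=
  [\/ a1 = b1 /\ a2 = b2,
      B x /\ [/\ `|a1| <= wild / d, `|a2| <= wild / d, `|b1| <= wild / d & `|b2| <= wild / d] |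
      [/\ `|a1| <= tame, `|a2| <= tame, `|b1| <= tame & `|b2| <= tame]].

Lemma close_bounds a1 a2 b1 b2 x : Omega x -> close_gradients a1 a2 b1 b2 x ->
  [/\ (a1 - b1) ^+ 2 + (a2 - b2) ^+ 2 <= majorant x,
      `|b1 * (a1 - b1) + b2 * (a2 - b2)| <= majorant x &
      `|(a1 ^+ 2 + a2 ^+ 2) - (b1 ^+ 2 + b2 ^+ 2)| <= majorant x].
Proof.
move=> Ox.
have O1 : \1_Omega x = 1 :> R by rewrite indicE mem_set.
have m0 : 0 <= majorant x.
  by rewrite addr_ge0// mulr_ge0// ?indicE ?ler0n// mulr_ge0// sqr_ge0.
have key (m : R) : `|a1| <= m -> `|a2| <= m -> `|b1| <= m -> `|b2| <= m ->
   [/\ (a1 - b1) ^+ 2 + (a2 - b2) ^+ 2 <= 8 * m ^+ 2,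
      `|b1 * (a1 - b1) + b2 * (a2 - b2)| <= 8 * m ^+ 2 &
      `|(a1 ^+ 2 + a2 ^+ 2) - (b1 ^+ 2 + b2 ^+ 2)| <= 8 * m ^+ 2].
  rewrite !ler_norml => /andP[? ?] /andP[? ?] /andP[? ?] /andP[? ?].
  have sq (t : R) : - m <= t -> t <= m -> t ^+ 2 <= m ^+ 2 by move=> ? ?; nra.
  have pr (t u : R) : - m <= t -> t <= m -> - m <= u -> u <= m -> - m ^+ 2 <= t * u <= m ^+ 2.
    by move=> ? ? ? ?; apply/andP; split; nra.
  have ? : a1 ^+ 2 <= m ^+ 2 by exact: sq.
  have ? : a2 ^+ 2 <= m ^+ 2 by exact: sq.
  have ? : b1 ^+ 2 <= m ^+ 2 by exact: sq.
  have ? : b2 ^+ 2 <= m ^+ 2 by exact: sq.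
  have /andP[? ?] : - m ^+ 2 <= b1 * a1 <= m ^+ 2 by exact: pr.
  have /andP[? ?] : - m ^+ 2 <= b2 * a2 <= m ^+ 2 by exact: pr.
  have ? := sqr_ge0 a1; have ? := sqr_ge0 a2; have ? := sqr_ge0 b1; have ? := sqr_ge0 b2.
  by split; [|apply/andP; split..]; lra.
have up (m : R) : 8 * m ^+ 2 <= majorant x ->
   [/\ (a1 - b1) ^+ 2 + (a2 - b2) ^+ 2 <= 8 * m ^+ 2,
      `|b1 * (a1 - b1) + b2 * (a2 - b2)| <= 8 * m ^+ 2 &
      `|(a1 ^+ 2 + a2 ^+ 2) - (b1 ^+ 2 + b2 ^+ 2)| <= 8 * m ^+ 2] ->
  [/\ (a1 - b1) ^+ 2 + (a2 - b2) ^+ 2 <= majorant x,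
      `|b1 * (a1 - b1) + b2 * (a2 - b2)| <= majorant x &
      `|(a1 ^+ 2 + a2 ^+ 2) - (b1 ^+ 2 + b2 ^+ 2)| <= majorant x].
  by move=> mm [h1 h2 h3]; split; apply: le_trans mm.
case=> [[-> ->]|[Bx [? ? ? ?]]|[? ? ? ?]].
- by rewrite !subrr !mulr0 expr0n/= !addr0 normr0.
- apply: up (key (wild / d) _ _ _ _) => //; rewrite /majorant indicE mem_set// mulr1 lerDl.
  by rewrite O1 mulr1 mulr_ge0// sqr_ge0.
- apply: up (key tame _ _ _ _) => //; rewrite /majorant O1 mulr1 lerDr.
  by rewrite mulr_ge0 ?indicE ?ler0n// mulr_ge0// sqr_ge0.
Qed.

Let ev1 : @e12 R e1. Proof. by left. Qed.
Let ev2 : @e12 R e2. Proof. by right. Qed.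

Let Dwild x v : e12 v -> Omega x -> `|'D_v Phi x| <= wild / d.
Proof.
move=> vE Ox.
exact: (competitor_wild kk rho_gt0 Ceta eta01 D_eta D_chi d_gt0 d_le1 d_17 O_near1 vE Ox).
Qed.

Let Xwild x v : e12 v -> `|X v x| <= wild / d.
Proof. exact: (tip_field_wild kk D_eta D_chi d_gt0 d_17). Qed.

Let far_bound x v s : e12 v -> Omega x -> s * s = 1 -> rho / 2 < `|x.1| \/ rho / 2 < `|x.2| ->
  [/\ `|'D_v Phi x| <= tame, `|X v x| <= tame & wedge s x -> `|'D_v (A s) x| <= tame].
Proof.
move=> vE Ox ss.
exact: (off_bad_far kk rho_gt0 kK Ceta eta01 D_eta D_chi d_gt0 d_rho d_17 O_near1 vE Ox ss).
Qed.

Let near_eq x v : Omega x -> ~ B x -> `|x.1| <= rho / 2 -> `|x.2| <= rho / 2 ->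
  'D_v Phi x = X v x /\ forall s, s * s = 1 -> wedge s x -> 'D_v (A s) x = X v x.
Proof.
exact: (off_bad_near eta kk rho_gt0 rho_le1 K_ge1 kK d_gt0 d_rho d_17 d_width O_near1).
Qed.

Let split_far x : rho / 2 < `|x.1| \/ rho / 2 < `|x.2| \/ (`|x.1| <= rho / 2 /\ `|x.2| <= rho / 2).
Proof.
have [h1|h1] := ltP (rho / 2) `|x.1|; first by left.
by have [h2|h2] := ltP (rho / 2) `|x.2|; [right; left|right; right].
Qed.

Lemma close_competitor x : Omega x ->
  close_gradients ('D_e1 Phi x) ('D_e2 Phi x) (X e1 x) (X e2 x) x.
Proof.
move=> Ox; have [Bx|nB] := pselect (B x).
  by apply: Or32; split=> //; split; [exact: Dwild|exact: Dwild|exact: Xwild|exact: Xwild].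
have far : rho / 2 < `|x.1| \/ rho / 2 < `|x.2| -> close_gradients ('D_e1 Phi x) ('D_e2 Phi x) (X e1 x) (X e2 x) x.
  move=> h; have [p1 q1 _] := far_bound ev1 Ox ss1 h; have [p2 q2 _] := far_bound ev2 Ox ss1 h.
  exact: Or33.
case: (split_far x) => [h|[h|[h1 h2]]]; [by apply: far; left|by apply: far; right|].
have [p _] := near_eq e1 Ox nB h1 h2; have [q _] := near_eq e2 Ox nB h1 h2.
exact: Or31.
Qed.

Lemma close_ang s x : s * s = 1 -> Omega x -> wedge s x ->
  d / 2 <= `|shifted s (k s) d x| \/ d / 2 <= x.2 ->
  close_gradients ('D_e1 (A s) x) ('D_e2 (A s) x) (X e1 x) (X e2 x) x.
Proof.
move=> ss Ox Ws dist; have [Bx|nB] := pselect (B x).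
  have d2 : 0 < d / 2 by rewrite divr_gt0.
  have Awild v : e12 v -> `|'D_v (A s) x| <= wild / d.
    move=> vE; have [x2 _] := Ws.
    apply: le_trans (derive_ang_le ss vE x2 d2 dist) _.
    rewrite invfM invf_div mulrA ler_wpM2r ?invr_ge0 ?(ltW d_gt0)//.
    have := inv_angle_le k ss; have := inv_angles_ge0 k.
    have : 0 <= M0 by apply: le_trans (normr_ge0 _) (@D_eta 0 e1 ev1).
    have : 0 <= Mc by apply: le_trans (normr_ge0 _) (@D_chi 0 e1 ev1).
    have : 0 <= profile_bound k.
      have p4 : 4 * (1/4) <= 1 :> R by lra.
      have p0 : 0 < 1/4 :> R by lra.
      have := derive_profile_le kk ltr01 p0 p4 (x := (0, 1)) ev1 ltr01.
      by move/(le_trans (normr_ge0 _)); rewrite divr1.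
    by rewrite /wild_bound; move: (profile_bound k) (inv_angles k) (acot _)^-1 => p i a; lra.
  by apply: Or32; split=> //; split; [exact: Awild|exact: Awild|exact: Xwild|exact: Xwild].
have far : rho / 2 < `|x.1| \/ rho / 2 < `|x.2| -> close_gradients ('D_e1 (A s) x) ('D_e2 (A s) x) (X e1 x) (X e2 x) x.
  move=> h; have [_ q1 p1] := far_bound ev1 Ox ss h; have [_ q2 p2] := far_bound ev2 Ox ss h.
  by apply: Or33; split=> //; [exact: p1|exact: p2].
case: (split_far x) => [h|[h|[h1 h2]]]; [by apply: far; left|by apply: far; right|].
have [_ p] := near_eq e1 Ox nB h1 h2; have [_ q] := near_eq e2 Ox nB h1 h2.
by apply: Or31; rewrite p// q.
Qed.

Let no_wedge x v : (forall s, s * s = 1 -> ~ wedge s x) -> X v x = 0.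
Proof.
move=> nW; rewrite /tip_field /side_field !patchE !memNset ?addr0//; [exact: nW ssN1|exact: nW ss1].
Qed.

Lemma tip_field_outside x : Omega x ->
  (`|x.1| <= rho / 2 -> `|x.2| <= rho / 2 ->
   ~~ ((`|x.1| <= 4 * K * d) && (`|x.2| <= 4 * K * d)) -> forall s, s * s = 1 -> ~ wedge s x) ->
  X e1 x ^+ 2 + X e2 x ^+ 2 <= majorant x.
Proof.
move=> Ox H.
have w0 : 0 <= wild / d := le_trans (normr_ge0 _) (Xwild x ev1).
have c : close_gradients 0 0 (X e1 x) (X e2 x) x; last first.
  have [h _ _] := close_bounds Ox c.
  have key (a b n : R) : (0 - a) ^+ 2 + (0 - b) ^+ 2 <= n -> a ^+ 2 + b ^+ 2 <= n.
    by rewrite !sub0r !sqrrN.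
  exact: key h.
have [Bx|nB] := pselect (B x).
  by apply: Or32; split=> //; rewrite normr0; split=> //; exact: Xwild.
have far : rho / 2 < `|x.1| \/ rho / 2 < `|x.2| -> close_gradients 0 0 (X e1 x) (X e2 x) x.
  move=> h; have [p1 q1 _] := far_bound ev1 Ox ss1 h; have [p2 q2 _] := far_bound ev2 Ox ss1 h.
  by apply: Or33; rewrite normr0; split=> //; exact: le_trans (normr_ge0 _) p1.
case: (split_far x) => [h|[h|[h1 h2]]]; [by apply: far; left|by apply: far; right|].
have nbox : ~~ ((`|x.1| <= 4 * K * d) && (`|x.2| <= 4 * K * d)).
  by apply/negP => /andP[p q]; apply: nB; do 3 left; rewrite cboxE -!ler_norml.
by apply: Or31; rewrite !(no_wedge _ (H h1 h2 nbox)).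
Qed.

Lemma measurable_tip_field v : mblfun setT (X v).
Proof.
have m s : mblfun setT (Xs s v).
  have oW := @open_wedge R k d s.
  apply: (measurable_restrictT _ (open_measurable_plane oW)).1.
  apply: (@Ck_measurable _ _ _ 0 oW); apply: Ck_mul => //.
    by apply: Ck_window => //; exact: Ck_rad2.
  by apply: (@Ck_sub _ _ upper); [move=> x []|exact: Ck_derive (Ck_ang 1 s (k s) d)].
exact: measurable_funD.
Qed.

Lemma L2_tip_field v : e12 v -> L2 Omega (X v).
Proof.
move=> vE; apply: (@L2_bounded _ _ _ (wild / d)) => //.
  by apply: (@measurable_funS _ _ (plane R) _ setT) => //; exact: measurable_tip_field.
by move=> x _; exact: Xwild.
Qed.

Let grad_ang_sq s x : s * s = 1 -> 0 < x.2 ->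
  'D_e1 (A s) x ^+ 2 + 'D_e2 (A s) x ^+ 2 = angle_energy k d s x.
Proof.
move=> ss x2; rewrite !(is_derive_val (is_derive_ang _ _ _ _ x2)) /angle_energy/=.
have r0 := rad2_gt0 s (k s) d x2; have a0 := acot_gt0 (k s).
have rE : rad2 s (k s) d x = shifted s (k s) d x ^+ 2 + x.2 ^+ 2 by [].
move: (shifted s (k s) d x) (rad2 s (k s) d x) r0 rE (acot (k s)) a0 => y r r0 rE a a0.
have key : (s * 1 * x.2 - y * 0) ^+ 2 + (s * 0 * x.2 - y * 1) ^+ 2 = r -> 
   ((s * 1 * x.2 - y * 0) / (r * a)) ^+ 2 + ((s * 0 * x.2 - y * 1) / (r * a)) ^+ 2 = (a ^+ 2 * r)^-1.
  by move=> e; rewrite !exprMn -mulrDl e exprVn; field; rewrite !gt_eqF.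
have e : (s * 1 * x.2 - y * 0) ^+ 2 + (s * 0 * x.2 - y * 1) ^+ 2 = r.
  by rewrite rE; case: (sign_cases ss) => ->; ring.
exact: key e.
Qed.

(** Large enough for each of the regions of [density_near_band]. *)
Definition energy_bound : R :=
  2 * wild ^+ 2 + 2 * inv ^+ 2 + 2 * tame ^+ 2 + 16 * (inv / rho) ^+ 2 + 4 * inv ^+ 2.

(** In order, the terms serve under the tip; at a distance from the tip, inside of the
    domain and on the band, which leaves the domain; below the height of the tip. *)
Definition energy_majorant x : R :=
  energy_bound / d ^+ 2 * \1_(cbox (- (4 * K * d)) (4 * K * d) (- (4 * K * d)) (4 * K * d)) x
  + energy_bound * \1_Omega x + energy_bound * slab_weight 1 x + energy_bound * slab_weight d x.

Definition energy_mass : R :=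
  energy_bound * ((8 * K) ^+ 2) + energy_bound * VO + energy_bound * pi + energy_bound * pi.

Let C0 : 0 <= energy_bound.
Proof. by rewrite /energy_bound !addr_ge0// mulr_ge0// sqr_ge0. Qed.

Lemma int_le_energy_majorant : int_le energy_majorant energy_mass.
Proof.
have K1 := K_ge1; have d0 := d_gt0.
have Kd : 0 <= 4 * K * d by rewrite -mulrA mulr_ge0// mulr_ge0//; lra.
apply: int_le_add; last by apply: int_le_scale => //; exact: int_le_slab.
apply: int_le_add; last by apply: int_le_scale => //; apply: int_le_slab; exact: ltr01.
apply: int_le_add; last by apply: int_le_scale => //; exact: int_le_indic.
rewrite (_ : energy_bound * (8 * K) ^+ 2 = energy_bound / d ^+ 2 * ((8 * K) ^+ 2 * d ^+ 2)); last first.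
  by field; rewrite gt_eqF.
apply: int_le_scale; first by rewrite divr_ge0// sqr_ge0.
apply: int_le_indic; first exact: measurable_cbox.
rewrite leb2_cboxE ?lee_fin; [rewrite le_eqVlt; apply/orP; left; apply/eqP; ring|lra|lra].
Qed.

Definition energy_density : R * R -> R := (fun x => X e1 x ^+ 2 + X e2 x ^+ 2) \_ Omega.

Notation T s := (band_energy k d s).

Let angle_energy_le s x (n : R) : s * s = 1 -> 0 < n -> n <= rad2 s (k s) d x ->
  angle_energy k d s x <= inv ^+ 2 / n.
Proof.
move=> ss n0 h; have a0 := acot_gt0 (k s); have r0 := lt_le_trans n0 h.
rewrite /angle_energy invfM -exprVn; apply: ler_pM.
- by rewrite sqr_ge0.
- by rewrite invr_ge0 ltW.
- by rewrite lerXn2r ?nnegrE ?invr_ge0 ?(ltW a0) ?inv_angles_ge0 ?inv_angle_le.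
- by rewrite lef_pV2.
Qed.

Let T_le s x (n : R) : s * s = 1 -> 0 < n -> (wedge_band k d s x -> n <= rad2 s (k s) d x) ->
  0 <= T s x <= inv ^+ 2 / n.
Proof.
move=> ss n0 h; rewrite band_energy_ge0/=.
have z : 0 <= inv ^+ 2 / n by rewrite divr_ge0 ?sqr_ge0// ltW.
rewrite /band_energy patchE; case: ifP => // /set_mem W.
by apply: angle_energy_le => //; exact: h.
Qed.

Let band_disjoint s x : s * s = 1 -> wedge s x -> d < x.2 -> ~ wedge (- s) x.
Proof.
move=> ss [_ /= l0] dx [_ /= l0'].
have : 0 < (k 1 + k (-1)) * (x.2 - d) by rewrite mulr_gt0// subr_gt0.
by case: (sign_cases ss) l0 l0' => ->; rewrite ?opprK /lam; lra.
Qed.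

Let maj_box x : 0 <= \1_(cbox (- (4 * K * d)) (4 * K * d) (- (4 * K * d)) (4 * K * d)) x :> R.
Proof. by rewrite indicE ler0n. Qed.

Let slab_ge0 h x : 0 <= slab_weight h x.
Proof.
rewrite /slab_weight patchE; case: ifP => // _; rewrite invr_ge0 addr_ge0// sqr_ge0//.
Qed.

Let parts x : [/\ energy_bound / d ^+ 2 * \1_(cbox (- (4 * K * d)) (4 * K * d) (- (4 * K * d)) (4 * K * d)) x <= energy_majorant x,
  energy_bound * \1_Omega x + energy_bound * slab_weight 1 x <= energy_majorant x &
  energy_bound * slab_weight d x <= energy_majorant x].
Proof.
have b1 := maj_box x; have b2 : 0 <= \1_Omega x :> R by rewrite indicE ler0n.
have b3 := slab_ge0 1 x; have b4 := slab_ge0 d x.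
have q0 : 0 <= energy_bound / d ^+ 2 by rewrite divr_ge0// sqr_ge0.
have := mulr_ge0 q0 b1; have := mulr_ge0 C0 b2; have := mulr_ge0 C0 b3; have := mulr_ge0 C0 b4.
rewrite /energy_majorant; move: (_ * slab_weight 1 x) (_ * slab_weight d x) (energy_bound * _) (_ / _ * _) => p1 p2 p3 p4.
by move=> ? ? ? ?; split; lra.
Qed.

Let density_ge0 x : 0 <= energy_density x.
Proof. by rewrite /energy_density patchE; case: ifP => // _; rewrite addr_ge0// sqr_ge0. Qed.

Let diff_le x (m n : R) : energy_density x <= m -> 0 <= T 1 x + T (-1) x <= n ->
  `|energy_density x - (T 1 x + T (-1) x)| <= m + n.
Proof.
move=> h1 /andP[h2 h3]; have := density_ge0 x; rewrite ler_norml.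
by move: (energy_density x) h1 (T 1 x + T (-1) x) h2 h3 => e h1 t h2 h3 e0; apply/andP; split; lra.
Qed.

Let C_wild : 2 * wild ^+ 2 + 2 * inv ^+ 2 <= energy_bound.
Proof.
rewrite /energy_bound; have := sqr_ge0 tame; have := sqr_ge0 (inv / rho); have := sqr_ge0 inv.
by move: (tame ^+ 2) (inv ^+ 2) ((inv / rho) ^+ 2) (wild ^+ 2) => a b c w; lra.
Qed.

Let C_tame : 2 * tame ^+ 2 <= energy_bound.
Proof.
rewrite /energy_bound; have := sqr_ge0 wild; have := sqr_ge0 (inv / rho); have := sqr_ge0 inv.
by move: (tame ^+ 2) (inv ^+ 2) ((inv / rho) ^+ 2) (wild ^+ 2) => a b c w; lra.
Qed.

Let C_rho : 16 * (inv / rho) ^+ 2 <= energy_bound.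
Proof.
rewrite /energy_bound; have := sqr_ge0 wild; have := sqr_ge0 tame; have := sqr_ge0 inv.
by move: (tame ^+ 2) (inv ^+ 2) ((inv / rho) ^+ 2) (wild ^+ 2) => a b c w; lra.
Qed.

Let C_inv : 4 * inv ^+ 2 <= energy_bound.
Proof.
rewrite /energy_bound; have := sqr_ge0 wild; have := sqr_ge0 (inv / rho); have := sqr_ge0 tame.
have := sqr_ge0 inv.
by move: (tame ^+ 2) (inv ^+ 2) ((inv / rho) ^+ 2) (wild ^+ 2) => a b c w; lra.
Qed.

Let sq_le (a m : R) : `|a| <= m -> a ^+ 2 <= m ^+ 2.
Proof.
move=> h; rewrite -(real_normK (num_real a)) lerXn2r// nnegrE//.
exact: le_trans (normr_ge0 _) h.
Qed.

Let shifted_ge s x : s * s = 1 -> `|x.1| <= `|shifted s (k s) d x| + K * d.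
Proof.
move=> ss; have : `|s * x.1| <= `|s * x.1 - d * k s| + `|d * k s|.
  by apply: le_trans (ler_normD _ _); rewrite subrK.
have -> : `|s * x.1| = `|x.1|.
  by rewrite normrM; case: (sign_cases ss) => ->; rewrite ?normrN normr1 mul1r.
move=> h; apply: (le_trans h); rewrite lerD2l normrM (gtr0_norm d_gt0) mulrC ler_pM2r//.
exact: kK.
Qed.

Let tip_field_ang s x v : s * s = 1 -> `|x.1| <= rho / 2 -> `|x.2| <= rho / 2 ->
  ~~ ((`|x.1| <= 4 * K * d) && (`|x.2| <= 4 * K * d)) -> wedge s x -> ~ wedge (- s) x ->
  X v x = 'D_v (A s) x.
Proof.
move=> ss h1 h2 nbox Ws nW; have -> : X v x = Xs s v x.
  rewrite /tip_field; case: (sign_cases ss) nW => ->; rewrite ?opprK => nW.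
    by rewrite [side_field _ _ _ (-1) _ _]patchE memNset// addr0.
  by rewrite [side_field _ _ _ 1 _ _]patchE memNset// add0r.
by rewrite /side_field patchE mem_set// (window_near rho_gt0 K_ge1 kK d_gt0 d_rho ss h1 h2 nbox) mul1r.
Qed.

(** At a height between d and 1 and near the tip the two densities coincide. The
    other regions contribute O(1): under the tip both are O(d ^- 2) on an area
    O(d ^+ 2), and elsewhere inverse squares of distances are integrable. *)
Lemma density_near_band x : `|energy_density x - (T 1 x + T (-1) x)| <= energy_majorant x.
Proof.
have r0 := rho_gt0; have r1 := rho_le1; have K1 := K_ge1; have d0 := d_gt0.
have Kd : 0 < K * d by rewrite mulr_gt0//; lra.
have dK : d <= K * d by rewrite ler_peMl// ltW.
have sqr_lb (a : R) : rho / 2 < `|a| -> (rho / 2) ^+ 2 <= a ^+ 2.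
  move=> h; rewrite -(real_normK (num_real a)) lerXn2r ?nnegrE ?divr_ge0 ?(ltW r0)//.
  exact: ltW.
have [p1 p2 p3] := parts x.
have [/andP[h1 h2]|nbox] := boolP ((`|x.1| <= 4 * K * d) && (`|x.2| <= 4 * K * d)).
  apply: le_trans p1; rewrite indicE mem_set ?mulr1; last by rewrite cboxE -!ler_norml.
  apply: (@le_trans _ _ (2 * (wild / d) ^+ 2 + (inv ^+ 2 / d ^+ 2 + inv ^+ 2 / d ^+ 2))).
    apply: diff_le.
      rewrite /energy_density patchE; case: ifP => _; last by rewrite mulr_ge0// sqr_ge0.
      by rewrite mulr_natl mulr2n; apply: lerD; apply: sq_le; exact: Xwild.
    have b s : s * s = 1 -> 0 <= T s x <= inv ^+ 2 / d ^+ 2.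
      move=> ss; apply: T_le => //; first exact: exprn_gt0.
      move=> [_ /= /andP[dx _]]; apply: (@le_trans _ _ (x.2 ^+ 2)); last by rewrite lerDr sqr_ge0.
      by rewrite lerXn2r ?nnegrE ?(ltW d0) ?(ltW dx)// ltW// (lt_trans d0).
    have /andP[a1 a2] := b 1 ss1; have /andP[a3 a4] := b (-1) ssN1.
    by rewrite addr_ge0//= lerD.
  rewrite exprMn exprVn -mulrDl mulrA -mulrDl ler_wpM2r ?invr_ge0 ?sqr_ge0//.
  by apply: le_trans C_wild; lra.
(* Far from the tip the density is bounded; the band extends to infinity, and
   there the distance to the vertex is compared with that to (0, 1). *)
have far : rho / 2 < `|x.1| \/ rho / 2 < `|x.2| ->
    `|energy_density x - (T 1 x + T (-1) x)| <= energy_majorant x.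
  move=> h; apply: le_trans p2; apply: diff_le.
    rewrite /energy_density patchE; case: ifP => Ox; last by rewrite mulr_ge0// indicE ler0n.
    rewrite indicE Ox mulr1; apply: le_trans C_tame; rewrite mulr_natl mulr2n.
    have [_ q1 _] := far_bound ev1 (set_mem Ox) ss1 h; have [_ q2 _] := far_bound ev2 (set_mem Ox) ss1 h.
    by apply: lerD; exact: sq_le.
  have b s : s * s = 1 -> 0 <= T s x <= 8 * (inv / rho) ^+ 2 * slab_weight 1 x.
    move=> ss; rewrite band_energy_ge0/= /band_energy patchE; case: ifP => [/set_mem W|_]; last first.
      by rewrite mulr_ge0// mulr_ge0// sqr_ge0.
    have [_ /= /andP[dx x1]] := W; have x2 : 0 < x.2 := lt_trans d0 dx.
    rewrite slab_weightE; last by rewrite x2 ltW.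
    rewrite expr1n.
    have q0 : 0 < x.1 ^+ 2 + 1 by rewrite ltr_wpDl ?sqr_ge0.
    have n0 : 0 < rho ^+ 2 / 8 * (x.1 ^+ 2 + 1) by rewrite mulr_gt0// divr_gt0// exprn_gt0.
    apply: (@le_trans _ _ (inv ^+ 2 / (rho ^+ 2 / 8 * (x.1 ^+ 2 + 1)))); last first.
      rewrite le_eqVlt; apply/orP; left; apply/eqP; rewrite exprMn exprVn.
      by field; rewrite !gt_eqF.
    apply: angle_energy_le => //; rewrite /rad2.
    have y0 := sqr_ge0 (shifted s (k s) d x); have z0 := sqr_ge0 x.2.
    have rr : rho ^+ 2 <= 1 by rewrite expr_le1// ltW.
    have [h1|h1] := ltP (rho / 2) `|x.1|.
      have : (7 / 8 * `|x.1|) ^+ 2 <= `|shifted s (k s) d x| ^+ 2.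
        rewrite lerXn2r ?nnegrE ?mulr_ge0//.
        by have := shifted_ge x ss; move: d_rho h1; move: `|_| `|_| => a b; lra.
      rewrite exprMn !real_normK ?num_real// => g.
      have := sqr_lb _ h1; rewrite exprMn.
      move: (rho ^+ 2) rr (x.1 ^+ 2) (sqr_ge0 x.1) g y0 z0 => r rr p p0 g y0 z0 h3.
      have : r * p <= 1 * p by rewrite ler_wpM2r.
      by move: (shifted _ _ _ _ ^+ 2) (x.2 ^+ 2) g y0 z0 => ? ? ? ? ?; lra.
    case: h => [h|h]; first by move: h; rewrite ltNge h1.
    have := sqr_lb _ h; have : x.1 ^+ 2 <= (rho / 2) ^+ 2 by exact: sq_le.
    rewrite exprMn; move: (rho ^+ 2) (exprn_gt0 2 r0) rr (x.1 ^+ 2) (sqr_ge0 x.1) => r r00 rr p p0 h2 h3.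
    have : r * p <= 1 * p by rewrite ler_wpM2r.
    have : p * r <= 1 * r by rewrite ler_wpM2r ?(ltW r00)//; lra.
    by move: (shifted _ _ _ _ ^+ 2) (x.2 ^+ 2) y0 z0 h3 => ? ? ? ? ?; lra.
  have /andP[a1 a2] := b 1 ss1; have /andP[a3 a4] := b (-1) ssN1.
  rewrite addr_ge0//=; apply: le_trans (lerD a2 a4) _; rewrite -mulrDl.
  by rewrite ler_wpM2r//; apply: le_trans C_rho; lra.
case: (split_far x) => [h|[h|[h1 h2]]]; [by apply: far; left|by apply: far; right|].
have b1 : `|x.1| < 4 * rho by lra.
have b2 : `|x.2| < 4 * rho by lra.
have m0 : 0 <= energy_majorant x by apply: le_trans p3; rewrite mulr_ge0.
have [x2|x2] := leP x.2 0.
  have nW s : ~ wedge s x by move=> [+ _]; rewrite /upper/= ltNge x2.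
  have nT s : T s x = 0 by rewrite /band_energy patchE memNset// => -[/nW].
  rewrite !nT addr0 subr0 /energy_density patchE memNset ?normr0//.
  by move=> /(O_near b1 b2); rewrite ltNge x2.
have Ox : Omega x by apply/(O_near b1 b2).
(* Below the height of the tip and out of the box, the distance to the vertex is
   comparable with x.1. *)
have [dx|dx] := ltP d x.2; last first.
  have nT s : T s x = 0.
    by rewrite /band_energy patchE memNset// => -[_ /= /andP[+ _]]; rewrite ltNge dx.
  rewrite !nT addr0 subr0 ger0_norm//; apply: le_trans p3.
  rewrite /energy_density patchE mem_set//.
  have q0 : 0 < x.1 ^+ 2 + d ^+ 2 by rewrite ltr_wpDl ?sqr_ge0// exprn_gt0.
  have E s : s * s = 1 -> wedge s x -> X e1 x ^+ 2 + X e2 x ^+ 2 <= energy_bound * slab_weight d x.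
    move=> ss Ws; have [_ /= l0] := Ws.
    have l0' : 0 <= lam (- s) (k (- s)) d x := wedge_disjoint kk K_ge1 kK d_gt0 ss x2 nbox l0.
    have nW : ~ wedge (- s) x by move=> -[_ /=]; rewrite ltNge l0'.
    rewrite !(tip_field_ang _ ss h1 h2 nbox Ws nW) grad_ang_sq// slab_weightE ?x2//.
    apply: (@le_trans _ _ (inv ^+ 2 / ((x.1 ^+ 2 + d ^+ 2) / 4))); last first.
      by rewrite invf_div mulrA ler_wpM2r ?invr_ge0 ?(ltW q0)// mulrC.
    apply: angle_energy_le => //; first by rewrite divr_gt0.
    have h3 : 4 * (K * d) < `|x.1|.
      move: nbox; rewrite negb_and -!ltNge -!mulrA => /orP[//|]; rewrite gtr0_norm//; lra.
    have g : (3 / 4 * `|x.1|) ^+ 2 <= `|shifted s (k s) d x| ^+ 2.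
      rewrite lerXn2r ?nnegrE ?mulr_ge0//.
      by have := shifted_ge x ss; move: h3; move: `|_| `|_| => a b; lra.
    have g2 : (4 * d) ^+ 2 <= `|x.1| ^+ 2.
      by rewrite lerXn2r ?nnegrE ?mulr_ge0 ?(ltW d0)//; lra.
    move: g g2; rewrite !exprMn !real_normK ?num_real// /rad2; have := sqr_ge0 x.2; have := sqr_ge0 d.
    by move: (x.2 ^+ 2) (shifted _ _ _ _ ^+ 2) (x.1 ^+ 2) (d ^+ 2) => *; lra.
  have [W1|nW1] := pselect (wedge 1 x); first exact: E W1.
  have [W2|nW2] := pselect (wedge (-1) x); first exact: E W2.
  rewrite !no_wedge ?expr0n/= ?addr0 ?mulr_ge0// => s ss; by case: (sign_cases ss) => ->.
rewrite /energy_density patchE mem_set//.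
have TE s : wedge s x -> T s x = angle_energy k d s x.
  move=> Ws; rewrite /band_energy patchE mem_set//; split=> //=; rewrite dx/=.
  by apply: le_lt_trans (ler_norm _) _; lra.
have T0 s : ~ wedge s x -> T s x = 0 by move=> nW; rewrite /band_energy patchE memNset// => -[/nW].
have E s : s * s = 1 -> wedge s x -> X e1 x ^+ 2 + X e2 x ^+ 2 = T s x /\ T (- s) x = 0.
  move=> ss Ws; have nW := band_disjoint ss Ws dx; split; last exact: T0.
  by rewrite !(tip_field_ang _ ss h1 h2 nbox Ws nW) grad_ang_sq// TE.
have [W1|nW1] := pselect (wedge 1 x).
  by have [-> ->] := E 1 ss1 W1; rewrite addr0 subrr normr0.
have [W2|nW2] := pselect (wedge (-1) x).
  by have [->] := E (-1) ssN1 W2; rewrite opprK => ->; rewrite add0r subrr normr0.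
rewrite !T0// !no_wedge ?expr0n/= ?addr0 ?subrr ?normr0// => s ss; by case: (sign_cases ss) => ->.
Qed.

(** The logarithm comes from the two angular functions on the horizontal band between
    the heights d and 1, where it is computed exactly. *)
Theorem energy_tip_field :
  `|\int[leb2]_(x in Omega) (X e1 x ^+ 2 + X e2 x ^+ 2) - inv * `|ln d| | <= energy_mass.
Proof.
have [iM M] := int_le_L1 int_le_energy_majorant.
have L1X : L1 Omega (fun x => X e1 x ^+ 2 + X e2 x ^+ 2).
  by apply: L1_add => //; [exact: (L2_tip_field ev1).2|exact: (L2_tip_field ev2).2].
have iD : L1 setT energy_density by apply: L1_patch.
have [iT1 T1] : L1 setT (T 1) /\ \int[leb2]_(x in setT) T 1 x = (acot (k 1))^-1 * `|ln d|.
  have i : L1 setT (T 1).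
    apply: L1_ge0 => //; first exact: measurable_band_energy.
    by move=> x _; exact: band_energy_ge0.
    by rewrite (integral_band_energy k d01 ss1) ltry.
  by split=> //; rewrite /Rintegral (integral_band_energy k d01 ss1).
have [iT2 T2] : L1 setT (T (-1)) /\ \int[leb2]_(x in setT) T (-1) x = (acot (k (-1)))^-1 * `|ln d|.
  have i : L1 setT (T (-1)).
    apply: L1_ge0 => //; first exact: measurable_band_energy.
    by move=> x _; exact: band_energy_ge0.
    by rewrite (integral_band_energy k d01 ssN1) ltry.
  by split=> //; rewrite /Rintegral (integral_band_energy k d01 ssN1).
have iT : L1 setT (fun x => T 1 x + T (-1) x) by exact: L1_add.
rewrite -(Rintegral_patch _ (@subsetT _ Omega)) -/energy_density.
have -> : inv * `|ln d| = \int[leb2]_(x in setT) (T 1 x + T (-1) x).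
  by rewrite RintegralD// T1 T2 -mulrDl.
rewrite -RintegralB//; apply: le_trans M.
apply: le_trans (le_normr_Rintegral _ _) _ => //; first exact: L1_sub.
apply: le_Rintegral => //; last by move=> x _; exact: density_near_band.
by have := integrable_abse (L1_sub measurableT iD iT).
Qed.

End TipEnergy.

(** * Sectors and cutoff functions *)

Section Trigonometry.
Context {R : realType}.
Implicit Types (t q : R) (x : R * R).

Lemma atan_cot t : 0 < t < pi -> atan (cot t) = pi / 2 - t.
Proof.
move=> /andP[t0 tpi].
have -> : cot t = tan (pi / 2 - t).
  rewrite /tan sinB cosB sin_pihalf cos_pihalf /cot.
  by congr (_ / _); ring.
rewrite tanK// in_itv/=; move: tpi; move: (pi : R) => p tpi.
by apply/andP; split; lra.
Qed.

Lemma acot_cot t : 0 < t < pi -> acot (cot t) = t.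
Proof. by move=> ht; rewrite /acot atan_cot// subKr. Qed.

Lemma enorm_sqr x : enorm x ^+ 2 = x.1 ^+ 2 + x.2 ^+ 2.
Proof. by rewrite /enorm sqr_sqrtr// addr_ge0// sqr_ge0. Qed.

Lemma enorm_ge0 x : 0 <= enorm x.
Proof. exact: sqrtr_ge0. Qed.

Lemma enorm_upper x : 0 < x.2 -> 0 < enorm x.
Proof. by move=> x2; rewrite sqrtr_gt0 ltr_wpDl ?sqr_ge0// exprn_gt0. Qed.

Lemma norm_fst_le x : `|x.1| <= enorm x.
Proof. by rewrite -sqrtr_sqr ler_wsqrtr// lerDl sqr_ge0. Qed.

Lemma norm_snd_le x : `|x.2| <= enorm x.
Proof. by rewrite -sqrtr_sqr ler_wsqrtr// lerDr sqr_ge0. Qed.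

Lemma enorm_lt x (e : R) : `|x.1| < e / 2 -> `|x.2| < e / 2 -> enorm x < e.
Proof.
move=> h1 h2; have e0 : 0 < e by have := le_lt_trans (normr_ge0 _) h1; rewrite pmulr_lgt0.
have e2 : 0 <= e / 2 by rewrite divr_ge0// ltW.
have sq (a : R) : `|a| < e / 2 -> a ^+ 2 <= (e / 2) ^+ 2.
  by move=> h; rewrite -(real_normK (num_real a)) lerXn2r ?nnegrE// ltW.
rewrite -(ltr_pXn2r (n := 2)) ?nnegrE ?enorm_ge0 ?(ltW e0)// enorm_sqr.
apply: le_lt_trans (lerD (sq _ h1) (sq _ h2)) _; rewrite exprMn.
by have := exprn_gt0 2 e0; lra.
Qed.

Lemma polar_arg x : 0 < x.2 ->
  [/\ 0 < arg x < pi, cos (arg x) = x.1 / enorm x & sin (arg x) = x.2 / enorm x].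
Proof.
move=> x2; have n0 := enorm_upper x2.
have b : -1 < x.1 / enorm x < 1.
  rewrite -ltr_norml normrM normfV (gtr0_norm n0) ltr_pdivrMr// mul1r.
  rewrite -(ltr_pXn2r (n := 2)) ?nnegrE ?(ltW n0)// real_normK ?num_real// enorm_sqr.
  by rewrite ltrDl exprn_gt0.
have /andP[b1 b2] := b.
have c : cos (arg x) = x.1 / enorm x by rewrite acosK// in_itv/= !ltW.
have a : 0 < arg x < pi by rewrite acos_gt0 ?acos_ltpi ?b1 ?b2 ?ltW.
split=> //; have s0 := sin_gt0_pi a.
apply/eqP; rewrite -(eqrXn2 (n := 2)) ?(ltW s0) ?divr_ge0 ?(ltW x2) ?(ltW n0)//.
rewrite sin2cos2 c !exprMn exprVn enorm_sqr.
have q0 : x.1 ^+ 2 + x.2 ^+ 2 != 0 by rewrite -enorm_sqr gt_eqF// exprn_gt0.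
by apply/eqP; field.
Qed.

Lemma arg_atan x : 0 < x.2 -> arg x = pi / 2 - atan (x.1 / x.2).
Proof.
move=> x2; have [a c s] := polar_arg x2; have n0 := enorm_upper x2.
have := atan_cot a; rewrite /cot c s => E.
have -> : x.1 / x.2 = x.1 / enorm x / (x.2 / enorm x) by field; rewrite !gt_eqF.
by rewrite E subKr.
Qed.

End Trigonometry.

Section Sector.
Context {R : realType}.
Variables (tL tR : R).
Hypothesis tL_bounds : 0 < tL < pi.
Hypothesis tR_bounds : 0 < tR < pi.
Hypothesis tip : tR < pi - tL.
Implicit Types (s r t : R) (x : R * R).

(** The cotangents of the two angles, indexed by the side: 1 is the left, -1 the
    right. *)
Definition slope s : R := if s == 1 then cot tL else cot tR.

Lemma slope1 : slope 1 = cot tL. Proof. by rewrite /slope eqxx. Qed.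

Lemma slopeN1 : slope (-1) = cot tR.
Proof. by rewrite /slope; case: eqP => // /eqP; rewrite -subr_eq0; lra || (rewrite lt_eqF//; lra). Qed.

Let sL0 : 0 < sin tL. Proof. exact: sin_gt0_pi. Qed.
Let sR0 : 0 < sin tR. Proof. exact: sin_gt0_pi. Qed.

Lemma slope_sum : 0 < slope 1 + slope (-1).
Proof.
rewrite slope1 slopeN1 /cot.
have -> : cos tL / sin tL + cos tR / sin tR = sin (tL + tR) / (sin tL * sin tR).
  by rewrite sinD; field; rewrite !gt_eqF.
rewrite divr_gt0 ?mulr_gt0// sin_gt0_pi//.
by move: tL_bounds tR_bounds tip; move: (pi : R) => p; lra.
Qed.

Let lam_polar r t : lam 1 (slope 1) 0 (polar r t) = r * sin (t + tL) / sin tL /\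
  lam (-1) (slope (-1)) 0 (polar r t) = r * sin (t - tR) / sin tR.
Proof.
by rewrite slope1 slopeN1 /lam /polar /cot sinD sinB/=; split; field; rewrite gt_eqF.
Qed.

(** In polar coordinates the two linear forms are r sin (t + tL) / sin tL and
    r sin (t - tR) / sin tR. *)
Lemma sectorP x : sector tL tR x <-> forall s, s * s = 1 -> 0 <= lam s (slope s) 0 x.
Proof.
split.
  move=> [r [t [r0 /andP[t1 t2] ->]]] s ss; have [E1 E2] := lam_polar r t.
  case: (sign_cases ss) => ->; rewrite ?E1 ?E2; apply: divr_ge0; rewrite ?(ltW sL0) ?(ltW sR0)//;
    apply: mulr_ge0 => //; apply: sin_ge0_pi;
    by move: tL_bounds tR_bounds tip t1 t2; move: (pi : R) => p; lra.
move=> H; have H1 := H 1 (mulr1 1); have H2 := H (-1) (etrans (mulrNN 1 1) (mulr1 1)).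
have x2 : 0 <= x.2.
  have := addr_ge0 H1 H2; rewrite /lam => h.
  by rewrite -(pmulr_rge0 _ slope_sum); move: h; rewrite subr0; lra.
move: x2; rewrite le_eqVlt => /orP[/eqP x2|x2].
  exists 0, tR; split=> //; first by rewrite lexx ltW.
  rewrite /polar !mul0r; case: x {H} H1 H2 x2 => a b/=; rewrite /lam/= => H1 H2 b0.
  by move: H1 H2; rewrite -b0 !subr0 !mulr0 !addr0 => H1 H2; congr (_, _); lra.
have [/andP[a0 api] c s] := polar_arg x2; have n0 := enorm_upper x2.
have xE : x = polar (enorm x) (arg x).
  by rewrite /polar c s; case: x {H H1 H2 a0 api c s x2} n0 => a b n0 /=; congr (_, _); field; rewrite gt_eqF.
exists (enorm x), (arg x); split=> //; first exact: ltW.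
have [E1 E2] := lam_polar (enorm x) (arg x); move: H1 H2; rewrite xE E1 E2 -xE.
rewrite -!mulrA !(pmulr_rge0 _ n0) !ler_pdivlMr// !mul0r => H1 H2.
apply/andP; split; rewrite leNgt; apply/negP => h.
  have : 0 < sin (tR - arg x).
    by apply: sin_gt0_pi; move: tR_bounds a0 h; move: (pi : R) => p; lra.
  by rewrite -opprB sinN oppr_gt0 ltNge H2.
have : 0 < sin (arg x + tL - pi).
  by apply: sin_gt0_pi; move: tL_bounds api h; move: (pi : R) => p; lra.
by rewrite sinB sinpi cospi mulr0 subr0 mulrN1 oppr_gt0 ltNge H1.
Qed.

Lemma open_sectorP x : open_sector tL tR x <-> forall s, s * s = 1 -> 0 < lam s (slope s) 0 x.
Proof.
split.
  move=> [r [t [r0 /andP[t1 t2] ->]]] s ss; have [E1 E2] := lam_polar r t.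
  case: (sign_cases ss) => ->; rewrite ?E1 ?E2; apply: divr_gt0 => //;
    apply: mulr_gt0 => //; apply: sin_gt0_pi;
    by move: tL_bounds tR_bounds tip t1 t2; move: (pi : R) => p; lra.
move=> H; have H1 := H 1 (mulr1 1); have H2 := H (-1) (etrans (mulrNN 1 1) (mulr1 1)).
have x2 : 0 < x.2.
  have := addr_gt0 H1 H2; rewrite /lam => h.
  by rewrite -(pmulr_rgt0 _ slope_sum); move: h; rewrite subr0; lra.
have [/andP[a0 api] c s] := polar_arg x2; have n0 := enorm_upper x2.
have xE : x = polar (enorm x) (arg x).
  by rewrite /polar c s; case: x {H H1 H2 a0 api c s x2} n0 => a b n0 /=; congr (_, _); field; rewrite gt_eqF.
exists (enorm x), (arg x); split=> //.
have [E1 E2] := lam_polar (enorm x) (arg x); move: H1 H2; rewrite xE E1 E2 -xE.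
rewrite -!mulrA !(pmulr_rgt0 _ n0) !ltr_pdivlMr// !mul0r => H1 H2.
apply/andP; split; rewrite ltNge; apply/negP => h.
  have : 0 <= sin (tR - arg x).
    by apply: sin_ge0_pi; move: tR_bounds a0 h; move: (pi : R) => p; lra.
  by rewrite -opprB sinN oppr_ge0 leNgt H2.
have : 0 <= sin (arg x + tL - pi).
  by apply: sin_ge0_pi; move: tL_bounds api h; move: (pi : R) => p; lra.
by rewrite sinB sinpi cospi mulr0 subr0 mulrN1 oppr_ge0 leNgt H1.
Qed.

Lemma lam_raise s d x : lam s (slope s) d x = lam s (slope s) 0 (x.1, x.2 - d).
Proof. by rewrite /lam/= subr0. Qed.

Lemma raiseP d (D : set (R * R)) x : raise d D x <-> D (x.1, x.2 - d).
Proof.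
split; first by move=> [y Dy <-]/=; rewrite addrK; case: y Dy.
by move=> Dx; exists (x.1, x.2 - d) => //=; rewrite subrK; case: x Dx.
Qed.

Lemma raise_sectorP d x : raise d (sector tL tR) x <->
  forall s, s * s = 1 -> 0 <= lam s (slope s) d x.
Proof.
rewrite raiseP sectorP; split=> H s ss; first by rewrite lam_raise; exact: H.
by rewrite -lam_raise; exact: H.
Qed.

End Sector.

Section PlaneTopology.
Context {R : realType}.
Implicit Types (x y : R * R) (D K : set (R * R)).

Lemma closure_squareP D x : closure D x <->
  forall e : R, 0 < e -> exists y, [/\ D y, `|y.1 - x.1| < e & `|y.2 - x.2| < e].
Proof.
split=> [cl e e0|H B /nbhs_square[e e0 sub]].
  have : nbhs x [set y | `|y.1 - x.1| < e /\ `|y.2 - x.2| < e].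
    by apply: (square_nbhs e0) => y.
  by move=> /cl[y [Dy [h1 h2]]]; exists y.
by have [y [Dy h1 h2]] := H e e0; exists y; split=> //; exact: sub.
Qed.

Lemma closure_raise d D x : closure (raise d D) x <-> closure D (x.1, x.2 - d).
Proof.
rewrite !closure_squareP; split=> H e e0; have [y [Dy h1 h2]] := H e e0.
  exists (y.1, y.2 - d); split=> //=; first exact/raiseP.
  by rewrite (_ : y.2 - d - _ = y.2 - x.2)//; ring.
exists (y.1, y.2 + d); split=> //=; first by apply/raiseP; rewrite /= addrK; case: y Dy {h1 h2}.
by move: h2 => /=; rewrite (_ : y.2 + d - _ = y.2 - (x.2 - d))//; ring.
Qed.

(** One minus the product of the complements of finitely many bumps, of boxes that
    cover the compact set. *)
Lemma smooth_cutoff D K : open D -> compact K -> K `<=` D -> exists eta,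
  [/\ test_fun D eta, forall x, 0 <= eta x <= 1 &
   exists2 e : R, 0 < e & forall x, K x -> forall y, `|y.1 - x.1| < e -> `|y.2 - x.2| < e ->
     eta y = 1].
Proof.
move=> oD cK KD.
have [B [DB Bbox]] := open_countable_boxes oD.
have H n : exists q : (R * R) * (R * R),
    B n = obox q.1.1 q.1.2 q.2.1 q.2.2 /\ cbox q.1.1 q.1.2 q.2.1 q.2.2 `<=` D.
  by have [a [b [c [e]]]] := Bbox n; exists ((a, b), (c, e)).
have [q qP] := choice H.
pose b N i := box_bump N (q i).1.1 (q i).1.2 (q i).2.1 (q i).2.2.
have tb N i : test_fun D (b N i) by apply: box_bump_test; have [] := qP i.
have b01 N i y : 0 <= b N i y <= 1.
  have /andP[p1 p2] := bump01 N (q i).1.1 (q i).1.2 y.1.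
  have /andP[q1 q2] := bump01 N (q i).2.1 (q i).2.2 y.2.
  by rewrite /b /box_bump mulr_ge0//= mulr_ile1.
(* N plays three parts: the number of boxes, the steepness of the bumps and the
   inverse of the width of the neighbourhood of K where the cutoff is 1. *)
pose P N y := forall z, `|z.1 - y.1| < N.+1%:R^-1 -> `|z.2 - y.2| < N.+1%:R^-1 ->
  exists2 i, (i < N)%N & b N i z = 1.
have : \forall N \near \oo, K `<=` P N.
  move/compact_near_coveringP: cK; apply => x Kx.
  have [i _ Bx] : (\bigcup_n B n) x by rewrite -DB; exact: KD.
  move: Bx; rewrite (qP i).1 oboxE => -[/andP[a1 a2] /andP[b1 b2]].
  set m := Num.min (Num.min (x.1 - (q i).1.1) ((q i).1.2 - x.1))
                   (Num.min (x.2 - (q i).2.1) ((q i).2.2 - x.2)).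
  have m0 : 0 < m by rewrite !lt_min !subr_gt0 a1 a2 b1 b2.
  have [m1 m2 m3 m4] : [/\ m <= x.1 - (q i).1.1, m <= (q i).1.2 - x.1,
      m <= x.2 - (q i).2.1 & m <= (q i).2.2 - x.2].
    by rewrite /m; split; rewrite !ge_min lexx ?orbT.
  have m4_gt0 : 0 < m / 4 by rewrite divr_gt0.
  exists ([set y | `|y.1 - x.1| < m / 4 /\ `|y.2 - x.2| < m / 4],
          [set N : nat | (maxn i.+1 (Num.truncn (m / 4)^-1).+1 <= N)%N]).
    by split; [apply: (square_nbhs m4_gt0) => y|exact: nbhs_infty_ge].
  move=> [y N] /= [[y1 y2]]; rewrite geq_max => /andP[iN nN] z z1 z2.
  exists i => //.
  have Nm : 1 <= N%:R * (m / 4).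
    rewrite -ler_pdivrMr// div1r; apply: le_trans (ltW (truncnS_gt _)) _; rewrite ler_nat//.
  have N1 : N.+1%:R^-1 <= m / 4.
    rewrite -[leRHS]invrK lef_pV2 ?posrE ?invr_gt0//.
    by rewrite -div1r ler_pdivrMr//; apply: le_trans Nm _; rewrite ler_wpM2r ?(ltW m4_gt0)// ler_nat.
  have key (t : R) : m / 4 <= t -> step (N%:R * t) = 1.
    by move=> h; rewrite step_ge1//; apply: le_trans Nm _; rewrite ler_wpM2l.
  rewrite /b /box_bump /bump.
  have lo (l e a c t u : R) : 0 < l -> e <= l / 4 ->
      `|t - c| < l / 4 -> `|u - t| < e -> l <= c - a -> l / 4 <= u - a.
    by rewrite !ltr_norml => ? ? /andP[? ?] /andP[? ?] ?; lra.
  have hi (l e a c t u : R) : 0 < l -> e <= l / 4 ->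
      `|t - c| < l / 4 -> `|u - t| < e -> l <= a - c -> l / 4 <= a - u.
    by rewrite !ltr_norml => ? ? /andP[? ?] /andP[? ?] ?; lra.
  rewrite (key _ (lo _ _ _ _ _ _ m0 N1 y1 z1 m1)) (key _ (hi _ _ _ _ _ _ m0 N1 y1 z1 m2)).
  by rewrite (key _ (lo _ _ _ _ _ _ m0 N1 y2 z2 m3)) (key _ (hi _ _ _ _ _ _ m0 N1 y2 z2 m4)) !mulr1.
move=> [N _ /(_ N (leqnn N)) KP].
pose eta (s : seq nat) y := 1 - \prod_(i <- s) (1 - b N i y).
have Q s : test_fun D (eta s) /\ forall y, 0 <= eta s y <= 1.
  elim: s => [|i s [ts s01]].
    split; last by move=> y; rewrite /eta big_nil subrr lexx ler01.
    rewrite (_ : eta [::] = fun=> 0); last by apply/funext => y; rewrite /eta big_nil subrr.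
    apply/test_funP; split; first by move=> m; exact: Ck_cst.
    by exists set0; split=> //; exact: compact0.
  have E : eta (i :: s) = fun y => b N i y + (fun y => - (b N i y * eta s y)) y + eta s y.
    by apply/funext => y; rewrite /eta big_cons; ring.
  split.
    rewrite E; apply: test_fun_add => //; apply: test_fun_add; first exact: tb.
    apply: test_fun_opp; apply: test_fun_mull => //.
    by have /test_funP[] := tb N i.
  move=> y; rewrite E; have /andP[p1 p2] := b01 N i y; have /andP[q1 q2] := s01 y.
  by move: (b N i y) (eta s y) p1 p2 q1 q2 => p r *; apply/andP; split; nra.
have [te e01] := Q (iota 0 N); exists (eta (iota 0 N)); split=> //.
exists N.+1%:R^-1 => // x /KP Px y y1 y2; have [i iN bi] := Px y y1 y2.
by rewrite /eta (big_rem i) ?mem_iota//= bi subrr mul0r subr0.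
Qed.

End PlaneTopology.

(** * The domain near the tip *)

Section TipGeometry.
Context {R : realType}.
Variables (tL tR : R) (Omega S0 : set (R * R)).
Hypothesis Sg : setting tL tR Omega S0.
Implicit Types (x y : R * R) (s d c : R).

Notation k := (slope tL tR).

Let bL := thetaL_bounds Sg.
Let bR := thetaR_bounds Sg.
Let kk : 0 < k 1 + k (-1) := slope_sum bL bR (tip_angle Sg).

Let near_lam s d x (P : R -> Prop) : open [set t | P t] -> P (lam s (k s) d x) ->
  exists2 e : R, 0 < e & forall y, `|y.1 - x.1| < e -> `|y.2 - x.2| < e -> P (lam s (k s) d y).
Proof.
move=> oP Px; have cx : {for x, continuous (lam s (k s) d)} := Ck_continuous (Ck_lam 0 s (k s) d openT) I.
have : nbhs x [set y | P (lam s (k s) d y)].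
  by apply: cx; apply: open_nbhs_nbhs; split.
exact: nbhs_square.
Qed.

(** A point of the closed sector is a limit of points of the open sector: move it
    upwards along a direction which increases both linear forms. *)
Lemma closure_tip : exists2 c, 0 < c & forall x, `|x.1| < c -> `|x.2| < c ->
  (closure S0 x <-> forall s, s * s = 1 -> 0 <= lam s (k s) 0 x).
Proof.
have [eps e0 tip] := S0_tip Sg.
have in_tip y : `|y.1| < eps / 2 -> `|y.2| < eps / 2 ->
    (S0 y <-> forall s, s * s = 1 -> 0 < lam s (k s) 0 y).
  move=> h1 h2; have dy : disc eps y := enorm_lt h1 h2.
  rewrite -(open_sectorP bL bR (tip_angle Sg)).
  split=> h.
    by have : (S0 `&` disc eps) y by []; rewrite tip => -[].
  by have : (open_sector tL tR `&` disc eps) y by []; rewrite -tip => -[].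
exists (eps / 4); first by rewrite divr_gt0.
move=> x h1 h2; split=> [/closure_squareP cl s ss|H].
  rewrite leNgt; apply/negP => l0.
  have [e ee0 He] := @near_lam s 0 x (fun t => t < 0) (@open_lt _ 0) l0.
  have m0 : 0 < Num.min e (eps / 4) by rewrite lt_min ee0 divr_gt0.
  have [y [Sy y1 y2]] := cl _ m0; move: y1 y2; rewrite !lt_min => /andP[y1 y1'] /andP[y2 y2'].
  have : 0 < lam s (k s) 0 y.
    apply: (in_tip y _ _).1 => //.
      by have := ler_normD (y.1 - x.1) x.1; rewrite subrK; lra.
    by have := ler_normD (y.2 - x.2) x.2; rewrite subrK; lra.
  by rewrite ltNge ltW// He.
apply/closure_squareP => e ee0.
pose u := (k (-1) - k 1) / 2; pose m := Num.min e (eps / 4); pose h := m / (2 * (1 + `|u|)).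
have m0 : 0 < m by rewrite lt_min ee0 divr_gt0.
have u0 : 0 < 2 * (1 + `|u|) by rewrite mulr_gt0// ltr_pwDl.
have h0 : 0 < h by rewrite divr_gt0.
have hm : h * (1 + `|u|) = m / 2 by rewrite /h; field; rewrite gt_eqF// ltr_pwDl.
have hu : h * `|u| < m by have := mulr_ge0 (ltW h0) (normr_ge0 u); move: hm m0 h0; rewrite mulrDr mulr1; lra.
have hm' : h < m by have := mulr_ge0 (ltW h0) (normr_ge0 u); move: hm m0 h0; rewrite mulrDr mulr1; lra.
have me : m <= e by rewrite /m ge_min lexx.
have me4 : m <= eps / 4 by rewrite /m ge_min lexx orbT.
exists (x.1 + h * u, x.2 + h) => /=.
have E1 : `|x.1 + h * u - x.1| < m by rewrite addrAC subrr add0r normrM (gtr0_norm h0).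
have E2 : `|x.2 + h - x.2| < m by rewrite addrAC subrr add0r gtr0_norm.
split; [|exact: lt_le_trans E1 me|exact: lt_le_trans E2 me].
apply/in_tip => /=.
- by have := ler_normD (x.1 + h * u - x.1) x.1; rewrite subrK; lra.
- by have := ler_normD (x.2 + h - x.2) x.2; rewrite subrK; lra.
move=> s ss; rewrite (_ : lam _ _ _ _ = lam s (k s) 0 x + h * (s * u + k s)); last first.
  by rewrite /lam/=; ring.
rewrite ltr_wpDl ?H// mulr_gt0// /u; move: kk.
by case: (sign_cases ss) => ->; lra.
Qed.

Lemma small_d (P : R -> Prop) c : 0 < c -> (\forall d \near 0^'+, P d) -> exists d, [/\ P d, 0 < d & d < c].
Proof.
move=> c0 nP.
have : \forall d \near 0^'+, [/\ P d, 0 < d & d < c].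
  near=> d; split; [by near: d|by near: d; exact: nbhs_right_gt|by near: d; exact: nbhs_right_lt].
by move=> H; exact: (@filter_ex _ (0^'+) _ _ H).
Unshelve. all: by end_near. Qed.

(** Fix a small d. A point of the upper half-plane near the origin is in the raised
    inclusion or in the gap, and both are contained in the domain. *)
Lemma flat_bottom : exists2 c, 0 < c & forall x, `|x.1| < c -> `|x.2| < c -> (Omega x <-> 0 < x.2).
Proof.
have [c1 c10 tip] := closure_tip; have [eps e0 above] := Omega_above Sg.
have c2 : 0 < c1 / 2 by rewrite divr_gt0.
have [d [[Sd Gd] d0 dc]] := small_d c2 (filterI (Sd_inside Sg) (gap_inside Sg)).
pose c := Num.min (c1 / 2) (Num.min (eps / 2) 1).
have c0 : 0 < c by rewrite !lt_min c2 divr_gt0//=.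
have [cc1 ce cc] : [/\ c <= c1 / 2, c <= eps / 2 & c <= 1].
  by rewrite /c; split; rewrite !ge_min ?lexx ?orbT.
exists c => // x h1 h2; split=> [Ox|x2].
  by apply: above; split=> //; apply: enorm_lt; [exact: lt_le_trans ce|exact: lt_le_trans ce].
have [rx|nrx] := pselect (raise d (sector tL tR) x).
  apply: Sd; apply/closure_raise; apply/tip => /=.
  - by apply: (lt_le_trans h1); apply: (le_trans cc1); lra.
  - by have := ler_normB x.2 d; rewrite (gtr0_norm d0); lra.
  - by move=> s ss; rewrite -lam_raise; exact: (raise_sectorP bL bR (tip_angle Sg) d x).1.
have two : 0 < (2 : R) <= 2 by rewrite ltr0n lexx.
have [sub _ _] := Gd 2 two; apply: (sub x _).1; split=> //; split=> //.
by apply: (@enorm_lt _ _ 2); rewrite divff//; exact: lt_le_trans cc.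
Qed.

(** Raised by an arbitrarily small d the point is in the domain, so it is adherent
    to the domain, and only the tip touches the boundary. *)
Lemma closure_S0_inside x : closure S0 x -> x != (0, 0) -> Omega x.
Proof.
move=> Sx x0; apply: contrapT => nO.
have cO : closure Omega x.
  apply/closure_squareP => e e0; have [d [Sd d0 de]] := small_d e0 (Sd_inside Sg).
  exists (x.1, x.2 + d); split=> /=; last by rewrite addrAC subrr add0r gtr0_norm.
    by apply: Sd; apply/closure_raise; rewrite /= addrK; case: x Sx {x0 nO}.
  by rewrite subrr normr0.
have : (closure S0 `&` frontier Omega) x.
  split=> //; split=> //; move=> /interior_subset; exact: nO.
by rewrite (S0_contact Sg) => /= xE; move: x0; rewrite xE eqxx.
Qed.

(** Everything that the estimates use of the geometry. The cutoff [eta] is the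
    competitor away from the tip: it is 1 around every small translate of the
    inclusion. *)
Lemma tip_geometry : exists rho eta, [/\ 0 < rho, 5 * rho <= 1,
  forall x, `|x.1| < 4 * rho -> `|x.2| < 4 * rho -> (Omega x <-> 0 < x.2),
  forall x, `|x.1| < 5 * rho -> `|x.2| < 5 * rho ->
    (closure S0 x <-> forall s, s * s = 1 -> 0 <= lam s (k s) 0 x) &
  [/\ test_fun Omega eta, forall x, 0 <= eta x <= 1 &
  exists2 e : R, 0 < e & forall x, closure S0 x -> ~ (`|x.1| < rho / 2 /\ `|x.2| < rho / 2) ->
    forall y, `|y.1 - x.1| < e -> `|y.2 - x.2| < e -> eta y = 1]].
Proof.
have [c1 c10 P1] := closure_tip; have [c2 c20 P2] := flat_bottom.
pose rho := Num.min c1 (Num.min c2 1) / 5.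
have m0 : 0 < Num.min c1 (Num.min c2 1) by rewrite !lt_min c10 c20/=.
have [m1 m2 m3] : [/\ Num.min c1 (Num.min c2 1) <= c1, Num.min c1 (Num.min c2 1) <= c2 &
    Num.min c1 (Num.min c2 1) <= 1].
  by split; rewrite !ge_min ?lexx ?orbT.
have r0 : 0 < rho by rewrite divr_gt0.
have r5 : 5 * rho = Num.min c1 (Num.min c2 1) by rewrite /rho mulrC divfK.
have r1 : 5 * rho <= 1 by rewrite r5.
pose K := closure S0 `&` ~` obox (- (rho / 2)) (rho / 2) (- (rho / 2)) (rho / 2).
have oB : open (obox (- (rho / 2)) (rho / 2) (- (rho / 2)) (rho / 2)).
  rewrite (_ : obox _ _ _ _ = fst @^-1` `]- (rho / 2), (rho / 2)[%classic `&`
    snd @^-1` `]- (rho / 2), (rho / 2)[%classic)//.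
  by apply: openI; apply: open_comp; try exact: interval_open;
    move=> [p q] _; [exact: cvg_fst|exact: cvg_snd].
have cK : compact K.
  have [r rr0 Sr] := bounded_sub_cbox (S0_bounded Sg).
  apply: (@subclosed_compact _ _ (cbox (- r) r (- r) r)); last 2 first.
  - exact: compact_cbox.
  - move=> x [/(closureS Sr) + _].
    by rewrite -((closure_id _).1 (compact_closed_plane (@compact_cbox R (- r) r (- r) r))).
  by apply: closedI; [exact: closed_closure|exact: open_closedC].
have KO : K `<=` Omega.
  move=> x [Sx nB]; apply: closure_S0_inside => //; apply/eqP => xE; apply: nB.
  by rewrite xE oboxE/= oppr_lt0 divr_gt0.
have [eta [te e01 [e e0 He]]] := smooth_cutoff (Omega_open Sg) cK KO.
exists rho, eta; split=> //.
- by move=> x h1 h2; apply: P2; apply: lt_le_trans m2; rewrite -r5; lra.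
- by move=> x h1 h2; apply: P1; apply: lt_le_trans m1; rewrite -r5.
- split=> //; exists e => // x Sx nB; apply: He; split=> //.
  by rewrite /= oboxE -!ltr_norml.
Qed.

End TipGeometry.

Section CompetitorInDomain.
Context {R : realType}.
Variables (k : R -> R) (Omega S0 : set (R * R)) (rho d e : R) (eta : R * R -> R).
Hypothesis kk : 0 < k 1 + k (-1).
Hypothesis rho_gt0 : 0 < rho.
Hypothesis O_near : forall x, `|x.1| < 4 * rho -> `|x.2| < 4 * rho -> (Omega x <-> 0 < x.2).
Hypothesis S_near : forall x, `|x.1| < 5 * rho -> `|x.2| < 5 * rho ->
    (closure S0 x <-> forall s, s * s = 1 -> 0 <= lam s (k s) 0 x).
Hypothesis t_eta : test_fun Omega eta.
Hypothesis eta_near : forall x, closure S0 x -> ~ (`|x.1| < rho / 2 /\ `|x.2| < rho / 2) ->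
    forall y, `|y.1 - x.1| < e -> `|y.2 - x.2| < e -> eta y = 1.
Hypothesis oO : open Omega.
Hypothesis d_gt0 : 0 < d.
Hypothesis d_e : 2 * d < e.
Hypothesis d_rho : 2 * d < rho.
Hypothesis d_17 : 17 * d ^+ 2 <= 1.
Hypothesis S_inside : closure (raise d S0) `<=` Omega.
Implicit Types (x y : R * R) (s : R).

Notation Phi := (competitor k rho eta d).
Notation S := (raise d S0).

Lemma raised_tip x : `|x.1| < 4 * rho -> `|x.2| < 4 * rho ->
  (closure S x <-> forall s, s * s = 1 -> 0 <= lam s (k s) d x).
Proof.
move=> h1 h2; rewrite closure_raise S_near/=; last 2 first.
- by have := rho_gt0; lra.
- by have := ler_normB x.2 d; rewrite (gtr0_norm d_gt0); have := rho_gt0; move: d_rho; lra.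
have E s : lam s (k s) 0 (x.1, x.2 - d) = lam s (k s) d x by rewrite /lam/= subr0.
by split=> H s ss; [rewrite -E|rewrite E]; exact: H.
Qed.

Lemma fluid_near x : (Omega `\` closure S) x -> `|x.1| < 4 * rho -> `|x.2| < 4 * rho ->
  0 < x.2 /\ exists2 s, s * s = 1 & lam s (k s) d x < 0.
Proof.
move=> [Ox nS] h1 h2; split; first by apply/(O_near h1 h2).
apply: contrapT => H; apply: nS; apply/(raised_tip h1 h2) => s ss.
by rewrite leNgt; apply/negP => l0; apply: H; exists s.
Qed.

Let delta_gt0 : 0 < d ^+ 2. Proof. exact: exprn_gt0. Qed.
Let delta_le : 4 * d ^+ 2 <= 1. Proof. by have := delta_gt0; have := d_17; lra. Qed.

(** The profile vanishes near the axis, so that its support is compact in the domain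
    once it is multiplied by the cutoff. *)
Lemma test_competitor : test_fun Omega Phi.
Proof.
have /test_funP[Ce [Ke [cKe KeO eta0]]] := t_eta.
apply/test_funP; split; first exact: Cinf_competitor.
pose P := [set x | profile k d (d ^+ 2) x != 0].
pose B := cbox (- (2 * rho)) (2 * rho) (- (2 * rho)) (2 * rho).
have cB : compact B by exact: compact_cbox.
exists (Ke `|` (B `&` closure P)); split.
- apply: compactU => //; apply: (subclosed_compact _ cB) => //.
  by apply: closedI; [exact: compact_closed_plane|exact: closed_closure].
- move=> x [/KeO//|[Bx Px]].
  have [h1 h2] : `|x.1| < 4 * rho /\ `|x.2| < 4 * rho.
    by move: Bx; rewrite /B cboxE -!ler_norml => -[? ?]; have := rho_gt0; split; lra.
  apply/(O_near h1 h2); rewrite ltNge; apply/negP => x2.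
  have := profile_near_axis kk d_gt0 delta_gt0 delta_le x2.
  by move=> /Px[y [/= /eqP yP]].
- move=> x /not_orP[nK nB]; rewrite /competitor (eta0 _ nK) mulr0 addr0.
  have [->|c0] := eqVneq (chi rho x) 0; first by rewrite mul0r.
  have [h1 h2] := chi_neq0 rho_gt0 c0.
  have -> : profile k d (d ^+ 2) x = 0; last by rewrite mulr0.
  apply: contrapT => /eqP p0; apply: nB; split; last exact: subset_closure.
  by rewrite /B cboxE -!ler_norml !ltW.
Qed.

Lemma competitor_near1 : exists V, [/\ open V, closure S `<=` V & forall x, V x -> Phi x = 1].
Proof.
exists (interior [set x | Phi x = 1]); split.
- exact: open_interior.
- move=> x Sx.
  have far1 : ~ (`|x.1| < rho /\ `|x.2| < rho) -> \forall y \near x, eta y = 1.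
    move=> nB; have d2 : 0 < e / 2 by move: d_gt0 d_e; lra.
    apply: (square_nbhs d2) => y y1 y2.
    apply: (@eta_near (x.1, x.2 - d)) => /=.
    + exact/closure_raise.
    + move=> [p1 p2]; apply: nB; have := rho_gt0; split; first lra.
      by have := ler_normD (x.2 - d) d; rewrite subrK (gtr0_norm d_gt0); move: d_rho; lra.
    + by move: y1 d2; lra.
    + have := ler_normD (y.2 - x.2) d; rewrite (gtr0_norm d_gt0).
      by rewrite (_ : y.2 - (x.2 - d) = y.2 - x.2 + d); [move: d_e; lra|ring].
  have [[h1 h2]|nB] := pselect (`|x.1| < 4 * rho /\ `|x.2| < 4 * rho); last first.
    have n1 : \forall y \near x, eta y = 1.
      by apply: far1 => -[? ?]; apply: nB; have := rho_gt0; split; lra.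
    apply: filterS2 n1 (_ : nbhs x [set y | chi rho y = 0]).
      by move=> y ey /= cy; rewrite /competitor ey cy mul0r add0r subr0 mul1r.
    apply: (square_nbhs rho_gt0) => y y1 y2; apply: contrapT => /eqP /(chi_neq0 rho_gt0)[p1 p2].
    apply: nB; have := ler_normD (x.1 - y.1) y.1; have := ler_normD (x.2 - y.2) y.2.
    by rewrite !subrK [`|x.1 - y.1|]distrC [`|x.2 - y.2|]distrC; have := rho_gt0; split; lra.
  have x2 : 0 < x.2 by apply/(O_near h1 h2); exact: S_inside.
  have n1 : \forall y \near x, profile k d (d ^+ 2) y = 1.
    by apply: profile_near_sector => //; exact: (raised_tip h1 h2).1.
  have [[g1 g2]|nB] := pselect (`|x.1| < rho /\ `|x.2| < rho); last first.
    apply: filterS2 n1 (far1 nB) => y p1 p2.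
    by rewrite /= /competitor p1 p2 !mulr1 subrKC.
  have m0 : 0 < Num.min (rho - `|x.1|) (rho - `|x.2|) by rewrite lt_min !subr_gt0 g1.
  apply: filterS2 n1 (_ : nbhs x [set y | chi rho y = 1]).
    by move=> y p1 /= cy; rewrite /competitor p1 cy subrr mul0r addr0 mul1r.
  apply: (square_nbhs m0) => y; rewrite !lt_min => /andP[y1 y1'] /andP[y2 y2'].
  apply: chi_low => //.
    by have := ler_normD (y.1 - x.1) x.1; rewrite subrK; lra.
  by have := ler_normD (y.2 - x.2) x.2; rewrite subrK; lra.
- by move=> x /interior_subset.
Qed.

End CompetitorInDomain.

(** * The two components of the region *)

Section TransverseRegion.
Context {R : realType}.
Variables (tL tR : R) (d : R).
Hypothesis bL : 0 < tL < pi.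
Hypothesis bR : 0 < tR < pi.
Hypothesis tip : tR < pi - tL.
Hypothesis d_gt0 : 0 < d.
Implicit Types (x y p q : R * R) (s t : R).

Notation k := (slope tL tR).

(** Also half of the inner radius of the region, in units of d. *)
Definition slope_bound : R := Num.max 1 (Num.max `|cot tL| `|cot tR|).

Notation K := slope_bound.

Hypothesis d_small : 16 * (K * d) <= 1.
Hypothesis d_smaller : 64 * (K ^+ 3 * d) <= 1.

Let kk : 0 < k 1 + k (-1) := slope_sum bL bR tip.

Lemma slope_bound_ge1 : 1 <= K.
Proof. by rewrite /K le_max lexx. Qed.

Lemma slope_le s : s * s = 1 -> `|k s| <= K.
Proof.
by move=> ss; case: (sign_cases ss) => ->; rewrite ?slope1 ?slopeN1 /K !le_max lexx !orbT.
Qed.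

Lemma r0E : r0 tL tR = 2 * K. Proof. by []. Qed.

Notation A := (Atr tL tR d).
Notation W s := (wedge k d s).

Let K0 : 0 < K. Proof. exact: lt_le_trans ltr01 slope_bound_ge1. Qed.
Let Kd0 : 0 < K * d. Proof. exact: mulr_gt0. Qed.

Let gapE r x : gap tL tR d r x <-> [/\ enorm x < r, 0 < x.2 & exists2 s, s * s = 1 & lam s (k s) d x < 0].
Proof.
rewrite /gap /disc; split=> [[[h1 h2] nr]|[h1 h2 [s ss l0]]].
  split=> //; apply: contrapT => H; apply: nr; apply/(raise_sectorP bL bR tip) => s ss.
  by rewrite leNgt; apply/negP => l0; apply: H; exists s.
by split=> // /(raise_sectorP bL bR tip)/(_ s ss); rewrite leNgt l0.
Qed.

Let continuous_enorm : continuous (@enorm R).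
Proof.
move=> x; apply: (@continuous_comp _ _ _ (fun y : R * R => y.1 ^+ 2 + y.2 ^+ 2) Num.sqrt).
  have C : Ck 0 setT (fun y : R * R => y.1 ^+ 2 + y.2 ^+ 2).
    by apply: Ck_add; [exact: openT|apply: Ck_exp; [exact: openT|exact: Ck_fst]|
      apply: Ck_exp; [exact: openT|exact: Ck_snd]].
  exact: (Ck_continuous C).
exact: sqrt_continuous.
Qed.

(** The inner boundary needs care: the points of the gap at the distance of the inner
    radius are adherent to the small gap. *)
Lemma AtrP x : A x <->
  [/\ d * r0 tL tR < enorm x, enorm x < 1, 0 < x.2 & exists2 s, s * s = 1 & W s x].
Proof.
have rE : d * r0 tL tR = 2 * (K * d) by rewrite r0E; ring.
rewrite /Atr /annulus; split=> [[/gapE[h1 h2 [s ss l0]] nc]|[h1 h2 x2 [s ss [_ l0]]]].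
  split=> //; last by exists s.
  rewrite ltNge; apply/negP => h; apply: nc; apply/closure_squareP => e e0.
  have n0 := enorm_upper h2.
  (* Scaled towards the origin, the point enters the small gap. *)
  pose c := Num.min (1/2) (Num.min (e / (2 * enorm x)) (- lam s (k s) d x / (2 * (enorm x + K * enorm x)))).
  have nK : 0 < 2 * (enorm x + K * enorm x) by rewrite mulr_gt0// addr_gt0// mulr_gt0.
  have c0 : 0 < c.
    rewrite !lt_min; apply/and3P; split; first by rewrite divr_gt0.
      by rewrite divr_gt0// mulr_gt0.
    by rewrite divr_gt0// oppr_gt0.
  have [c1 c2 c3] : [/\ c <= 1/2, c * (2 * enorm x) <= e & c * (2 * (enorm x + K * enorm x)) <= - lam s (k s) d x].
    have n2 : 0 < 2 * enorm x by rewrite mulr_gt0.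
    rewrite -(ler_pdivlMr _ _ n2) -(ler_pdivlMr _ _ nK).
    by rewrite /c; split; rewrite !ge_min ?lexx ?orbT.
  have a1 := norm_fst_le x; have a2 := norm_snd_le x.
  exists ((1 - c) * x.1, (1 - c) * x.2); split=> /=; last first.
  + rewrite (_ : _ - x.2 = - (c * x.2)); last by ring.
    rewrite normrN normrM (gtr0_norm c0); have : c * `|x.2| <= c * enorm x by rewrite ler_wpM2l// ltW.
    by have := mulr_gt0 c0 n0; lra.
  + rewrite (_ : _ - x.1 = - (c * x.1)); last by ring.
    rewrite normrN normrM (gtr0_norm c0); have : c * `|x.1| <= c * enorm x by rewrite ler_wpM2l// ltW.
    by have := mulr_gt0 c0 n0; lra.
  + apply/gapE; split=> /=.
    * have -> : enorm ((1 - c) * x.1, (1 - c) * x.2) = (1 - c) * enorm x.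
        rewrite /enorm/= !exprMn -mulrDr sqrtrM ?sqr_ge0// sqrtr_sqr ger0_norm//; lra.
      by apply: lt_le_trans h; rewrite mulrBl mul1r gtrBl mulr_gt0.
    * by rewrite mulr_gt0//; lra.
    * exists s => //; rewrite (_ : lam _ _ _ _ = lam s (k s) d x - c * (s * x.1 + k s * x.2)).
        have : `|c * (s * x.1 + k s * x.2)| <= c * (enorm x + K * enorm x).
          rewrite normrM (gtr0_norm c0) ler_wpM2l ?(ltW c0)//; apply: le_trans (ler_normD _ _) _.
          apply: lerD; last by rewrite normrM; apply: ler_pM => //; exact: slope_le.
          by rewrite normrM; case: (sign_cases ss) => ->; rewrite ?normrN normr1 mul1r.
        rewrite ler_norml => /andP[b1 b2]; move: c3 l0; lra.
      by rewrite /lam/=; ring.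
split; first by apply/gapE; split=> //; exists s.
move=> cl; have /continuous_enorm/cl : nbhs (enorm x) [set t | d * r0 tL tR < t].
  by apply: open_nbhs_nbhs; split=> //; exact: open_gt.
by move=> [y [/gapE[+ _ _] /=]] => h /(lt_trans h); rewrite ltxx.
Qed.

Lemma open_Atr : open A.
Proof.
rewrite (_ : A = [set x | d * r0 tL tR < enorm x] `&` [set x | enorm x < 1] `&` (W 1 `|` W (-1))).
  have oe := continuous_enorm.
  apply: openI; last by apply: openU; exact: open_wedge.
  apply: openI.
    rewrite (_ : [set x | _] = @enorm R @^-1` [set t | d * r0 tL tR < t])//.
    by apply: open_comp; [move=> x _; exact: oe|exact: open_gt].
  rewrite (_ : [set x | _] = @enorm R @^-1` [set t | t < 1])//.
  by apply: open_comp; [move=> x _; exact: oe|exact: open_lt].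
apply/seteqP; split=> x.
  by move=> /AtrP[h1 h2 x2 [s ss Ws]]; split=> //; case: (sign_cases ss) Ws => -> Ws; [left|right].
move=> [[h1 h2] [Ws|Ws]]; apply/AtrP; split=> //.
- by have [] := Ws.
- by exists 1; rewrite ?mulr1.
- by have [] := Ws.
- by exists (-1); rewrite ?mulrNN ?mulr1.
Qed.

Lemma Atr_dist x : A x -> 2 * (K * d) < enorm x.
Proof. by move=> /AtrP[+ _ _ _]; rewrite r0E; congr (_ < _); ring. Qed.

Lemma Atr_disjoint s x : s * s = 1 -> A x -> W s x -> ~ W (- s) x.
Proof.
move=> ss Ax [x2 /= l0] [_ /= l0'].
have x2d : x.2 < d.
  have : (k 1 + k (-1)) * (x.2 - d) < 0.
    by case: (sign_cases ss) l0 l0' => ->; rewrite ?opprK /lam; lra.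
  by rewrite pmulr_rlt0// subr_lt0.
have key (t : R) : t * t = 1 -> lam t (k t) d x < 0 -> t * x.1 < K * d.
  move=> tt; rewrite /lam; have := slope_le tt; rewrite ler_norml => /andP[q1 q2] q3.
  have : k t * (d - x.2) <= K * d.
    have x2' : 0 < x.2 := x2.
    by apply: (@le_trans _ _ (K * (d - x.2))); have := K0; nra.
  by lra.
have ss' : - s * - s = 1 by rewrite mulrNN.
have b := key _ ss l0; have a := key _ ss' l0'.
have x1 : `|x.1| < K * d by case: (sign_cases ss) a b => ->; rewrite ltr_norml; lra.
have x2' : `|x.2| < K * d.
  by rewrite gtr0_norm//; apply: lt_le_trans x2d _; rewrite ler_peMl ?slope_bound_ge1// ltW.
have := Atr_dist Ax; rewrite ltNge => /negP; apply; apply: ltW; apply: enorm_lt; lra.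
Qed.

Let segment p q t : R * R := ((1 - t) * p.1 + t * q.1, (1 - t) * p.2 + t * q.2).

Let segment_component p q : (forall t, 0 <= t <= 1 -> A (segment p q t)) ->
  connected_component A p q.
Proof.
move=> H; exists (segment p q @` `[0, 1]); last first.
  by exists 1; [rewrite /= in_itv/= lexx ler01|rewrite /segment subrr !mul0r !mul1r !add0r; case: q {H}].
split.
- by exists 0; [rewrite /= in_itv/= lexx ler01|rewrite /segment subr0 !mul0r !mul1r !addr0; case: p {H}].
- by move=> _ [t + <-]; rewrite /= in_itv/=; exact: H.
- apply: connected_continuous_connected; first exact: segment_connected.
  apply: continuous_subspaceT => t.
  have lin (a b : R) : {for t, continuous (fun t : R => (1 - t) * a + t * b)}.
    apply: cvgD; apply: cvgM; try exact: cvg_cst; try exact: cvg_id.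
    by apply: cvgB; [exact: cvg_cst|exact: cvg_id].
  exact: (cvg_pair (lin _ _) (lin _ _)).
Qed.

Let segment_wedge s p q t : W s p -> W s q -> 0 <= t <= 1 -> W s (segment p q t).
Proof.
move=> [p2 /= lp] [q2 /= lq] /andP[t0 t1]; rewrite /upper/= in p2 q2.
have key (a b : R) : 0 < a -> 0 < b -> 0 < (1 - t) * a + t * b.
  move=> a0 b0; move: t0; rewrite le_eqVlt => /orP[/eqP <-|t0].
    by rewrite subr0 mul1r mul0r addr0.
  by rewrite ltr_wpDl ?mulr_gt0// mulr_ge0 ?subr_ge0// ltW.
split; first exact: key.
change (lam s (k s) d (segment p q t) < 0).
rewrite -oppr_gt0 (_ : - _ = (1 - t) * - lam s (k s) d p + t * - lam s (k s) d q).
  by apply: key; rewrite oppr_gt0.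
by rewrite /lam/=; ring.
Qed.

Let enorm_sq_lt p (c : R) : 0 <= c -> (enorm p < c) = (p.1 ^+ 2 + p.2 ^+ 2 < c ^+ 2).
Proof. by move=> c0; rewrite -enorm_sqr ltr_pXn2r// nnegrE enorm_ge0. Qed.

Let enorm_sq_gt p (c : R) : 0 <= c -> (c < enorm p) = (c ^+ 2 < p.1 ^+ 2 + p.2 ^+ 2).
Proof. by move=> c0; rewrite -enorm_sqr ltr_pXn2r// nnegrE enorm_ge0. Qed.

Let segment_disc p q t : enorm p < 1 -> enorm q < 1 -> 0 <= t <= 1 -> enorm (segment p q t) < 1.
Proof.
rewrite !enorm_sq_lt// expr1n /segment/= => hp hq /andP[t0 t1].
have := sqr_ge0 (p.1 - q.1); have := sqr_ge0 (p.2 - q.2).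
have u0 : 0 <= t * (1 - t) by rewrite mulr_ge0// subr_ge0.
have E (a b : R) : ((1 - t) * a + t * b) ^+ 2 = (1 - t) * a ^+ 2 + t * b ^+ 2 - t * (1 - t) * (a - b) ^+ 2.
  by ring.
rewrite !E => h1 h2; have := mulr_ge0 u0 h1; have := mulr_ge0 u0 h2.
move: (p.1 ^+ 2) (p.2 ^+ 2) (q.1 ^+ 2) (q.2 ^+ 2) hp hq => a b c e hp hq.
move: (t * (1 - t) * _) (t * (1 - t) * _) => r r' *.
have : (1 - t) * (a + b) + t * (c + e) < 1.
  move: t0; rewrite le_eqVlt => /orP[/eqP <-|t0]; first by rewrite subr0 mul1r mul0r addr0.
  have : t * (c + e) < t * 1 by rewrite ltr_pM2l.
  have : (1 - t) * (a + b) <= (1 - t) * 1 by rewrite ler_wpM2l ?subr_ge0// ltW.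
  by lra.
by lra.
Qed.

(* On the wedge of the side s this is comparable with the distance to the vertex;
   being linear, it stays large along a segment whose ends are far from it. *)
Let height s p : R := - (s * p.1 - d * k s) + (K + 1) * p.2.

Let height_ge s p : s * s = 1 -> W s p ->
  `|s * p.1 - d * k s| <= K * height s p /\ p.2 <= height s p.
Proof.
move=> ss [p2 /= l0]; rewrite /upper/= in p2.
have := slope_le ss; rewrite ler_norml => /andP[k1 k2]; have K1 := slope_bound_ge1.
set a := - (s * p.1 - d * k s).
have ha : - (K * p.2) <= a.
  have : k s * p.2 <= K * p.2 by rewrite ler_wpM2r// ltW.
  have : - (K * p.2) <= k s * p.2 by rewrite -mulNr ler_wpM2r// ltW.
  by move: l0; rewrite /lam /a; lra.
rewrite -normrN -/a /height -/a; split; last by lra.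
have Kp := mulr_gt0 K0 p2.
have h2 : p.2 <= a + (K + 1) * p.2 by lra.
rewrite ler_norml; apply/andP; split.
  have : K * p.2 <= K * (a + (K + 1) * p.2) by rewrite ler_wpM2l// ltW.
  by lra.
have : 1 * (a + (K + 1) * p.2) <= K * (a + (K + 1) * p.2) by rewrite ler_wpM2r//; lra.
by lra.
Qed.

Let height_far s p : s * s = 1 -> W s p -> 1 / 2 <= enorm p -> 3 / (16 * K) <= height s p.
Proof.
move=> ss Wp hp; have [h1 h2] := height_ge ss Wp; have K1 := slope_bound_ge1.
have [p2 _] := Wp; rewrite /upper/= in p2.
have Kh : p.2 <= K * height s p by apply: (le_trans h2); rewrite ler_peMl// (le_trans (ltW p2)).
rewrite ler_pdivrMr ?mulr_gt0// leNgt; apply/negP => lt.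
have p1 : `|p.1| < 1 / 2 / 2.
  have : `|s * p.1| <= `|s * p.1 - d * k s| + `|d * k s|.
    by apply: le_trans (ler_normD _ _); rewrite subrK.
  have -> : `|s * p.1| = `|p.1|.
    by rewrite normrM; case: (sign_cases ss) => ->; rewrite ?normrN normr1 mul1r.
  have : `|d * k s| <= K * d by rewrite normrM (gtr0_norm d_gt0) mulrC ler_pM2r// slope_le.
  by move: h1 lt d_small; move: `|_| `|_| `|_| => a b c; lra.
have p2' : `|p.2| < 1 / 2 / 2 by rewrite gtr0_norm//; lra.
by move: hp; rewrite leNgt (enorm_lt p1 p2').
Qed.

Let segment_far s p q t : s * s = 1 -> W s p -> W s q -> 1 / 2 <= enorm p -> 1 / 2 <= enorm q ->
  0 <= t <= 1 -> 2 * (K * d) < enorm (segment p q t).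
Proof.
move=> ss Wp Wq hp hq tI; have Wt := segment_wedge Wp Wq tI; have /andP[t0 t1] := tI.
have hE : height s (segment p q t) = (1 - t) * height s p + t * height s q.
  by rewrite /height /segment/=; ring.
have ht : 3 / (16 * K) <= height s (segment p q t).
  have a1 := height_far ss Wp hp; have a2 := height_far ss Wq hq; rewrite hE.
  have : (1 - t) * (3 / (16 * K)) <= (1 - t) * height s p by rewrite ler_wpM2l// subr_ge0.
  have : t * (3 / (16 * K)) <= t * height s q by rewrite ler_wpM2l.
  by lra.
rewrite ltNge; apply/negP => h.
have K1 := slope_bound_ge1.
have b1 := le_trans (norm_fst_le (segment p q t)) h; have b2 := le_trans (norm_snd_le (segment p q t)) h.
move: (segment p q t) {hE Wt h} ht b1 b2 => z ht b1 b2.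
have s1 : `|s * z.1| = `|z.1|.
  by rewrite normrM; case: (sign_cases ss) => ->; rewrite ?normrN normr1 mul1r.
have dk : `|d * k s| <= K * d by rewrite normrM (gtr0_norm d_gt0) mulrC ler_pM2r// slope_le.
have : height s z <= 3 * (K * d) + (K + 1) * (2 * (K * d)).
  rewrite /height; apply: lerD.
    move: dk; rewrite ler_norml; move: b1; rewrite -s1 ler_norml; lra.
  by rewrite ler_wpM2l//; [lra|exact: le_trans (ler_norm _) b2].
move=> /(le_trans ht); rewrite ler_pdivrMr ?mulr_gt0// => h3.
have : (3 * (K * d) + (K + 1) * (2 * (K * d))) * (16 * K) <= 7 * (K ^+ 2 * d) * (16 * K).
  rewrite ler_wpM2r ?mulr_ge0 ?(ltW K0)// expr2.
  have : 1 * (K * d) <= K * (K * d) by rewrite ler_wpM2r// ltW.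
  by lra.
move: d_smaller h3; rewrite (_ : 7 * (K ^+ 2 * d) * (16 * K) = 112 * (K ^+ 3 * d)); last by ring.
by move: (K ^+ 3 * d) (_ * (16 * K)) => a b; lra.
Qed.

(* Beyond p the distance to the origin increases along the ray from the vertex,
   because p is at least twice as far from the origin as the vertex. *)
Let outward s p : s * s = 1 -> A p -> W s p -> exists q,
  [/\ connected_component A p q, W s q & 1 / 2 <= enorm q < 1].
Proof.
move=> ss Ap Wp; have [h1 h2 p2 _] := (AtrP p).1 Ap.
have [hp|hp] := leP (1 / 2) (enorm p).
  by exists p; split=> //; [exact: connected_component_refl|rewrite hp].
pose v : R * R := (s * (d * k s), 0).
pose w : R * R := (p.1 - v.1, p.2 - v.2).
pose ray t : R * R := (v.1 + t * w.1, v.2 + t * w.2).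
have ray1 : ray 1 = p by rewrite /ray !mul1r /w/= !subrKC; case: p {Ap Wp h1 h2 p2 hp w ray}.
have vn : v.1 ^+ 2 + v.2 ^+ 2 <= (K * d) ^+ 2.
  rewrite expr0n/= addr0 /v/= !exprMn (expr2 s) ss mul1r mulrC ler_wpM2r ?sqr_ge0//.
  by rewrite -(real_normK (num_real (k s))) lerXn2r ?nnegrE ?(ltW K0)// slope_le.
have pn : (2 * (K * d)) ^+ 2 < p.1 ^+ 2 + p.2 ^+ 2.
  by rewrite -enorm_sq_gt; [exact: Atr_dist|rewrite mulr_ge0// ltW].
have Kd2 : 0 < (K * d) ^+ 2 by rewrite exprn_gt0.
(* f is the square of the distance to the origin along the ray, minus that of p *)
pose a := w.1 ^+ 2 + w.2 ^+ 2; pose b := v.1 * w.1 + v.2 * w.2.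
have fE t : (ray t).1 ^+ 2 + (ray t).2 ^+ 2 = p.1 ^+ 2 + p.2 ^+ 2 + (t - 1) * ((t + 1) * a + 2 * b).
  by rewrite -[in RHS]ray1 /a /b /ray/=; ring.
have ab : 0 < a + b.
  have : 2 * (a + b) = a + (p.1 ^+ 2 + p.2 ^+ 2) - (v.1 ^+ 2 + v.2 ^+ 2).
    by rewrite /a /b /w/=; ring.
  have : 0 <= a by rewrite addr_ge0// sqr_ge0.
  by move: pn vn; rewrite exprMn; lra.
have a0 : 0 <= a by rewrite addr_ge0// sqr_ge0.
have mono t : 1 <= t -> p.1 ^+ 2 + p.2 ^+ 2 <= (ray t).1 ^+ 2 + (ray t).2 ^+ 2.
  move=> t1; rewrite fE lerDl mulr_ge0 ?subr_ge0//.
  have : 2 * a <= (t + 1) * a by rewrite ler_wpM2r//; lra.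
  by lra.
pose c := 1 / 2 : R.
have [T T1 TE] : exists2 T, 1 <= T & (ray T).1 ^+ 2 + (ray T).2 ^+ 2 = c ^+ 2.
  have cont : {within `[1, 1 + (a + b)^-1], continuous (fun t => (ray t).1 ^+ 2 + (ray t).2 ^+ 2)}.
    apply: continuous_subspaceT => t.
    have lin (x y : R) : {for t, continuous (fun t : R => x + t * y)}.
      by apply: cvgD; [exact: cvg_cst|apply: cvgM; [exact: cvg_id|exact: cvg_cst]].
    have sqc (x y : R) : {for t, continuous (fun t : R => (x + t * y) ^+ 2)}.
      apply: (@continuous_comp _ _ _ (fun t : R => x + t * y) (fun u : R => u ^+ 2)); first exact: lin.
      exact: exprn_continuous.
    exact: (cvgD (sqc _ _) (sqc _ _)).
  have i0 : 0 < (a + b)^-1 by rewrite invr_gt0.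
  have le1 : 1 <= 1 + (a + b)^-1 by rewrite lerDl ltW.
  suff /(IVT le1 cont)[T Tin TE] : Num.min ((ray 1).1 ^+ 2 + (ray 1).2 ^+ 2)
      ((ray (1 + (a + b)^-1)).1 ^+ 2 + (ray (1 + (a + b)^-1)).2 ^+ 2) <= c ^+ 2 <=
      Num.max ((ray 1).1 ^+ 2 + (ray 1).2 ^+ 2)
      ((ray (1 + (a + b)^-1)).1 ^+ 2 + (ray (1 + (a + b)^-1)).2 ^+ 2).
    by exists T => //; move: Tin; rewrite in_itv/= => /andP[].
  have f1 : (ray 1).1 ^+ 2 + (ray 1).2 ^+ 2 < c ^+ 2.
    by rewrite ray1 -enorm_sq_lt// /c divr_ge0.
  have f2 : c ^+ 2 <= (ray (1 + (a + b)^-1)).1 ^+ 2 + (ray (1 + (a + b)^-1)).2 ^+ 2.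
    rewrite fE (_ : 1 + (a + b)^-1 - 1 = (a + b)^-1); last by rewrite addrAC subrr add0r.
    set i := (a + b)^-1.
    have ii : i * (a + b) = 1 by rewrite /i mulVf// gt_eqF.
    have : i * ((1 + i + 1) * a + 2 * b) = 2 * (i * (a + b)) + i * i * a by ring.
    move=> ->; rewrite ii; have : 0 <= i * i * a by rewrite mulr_ge0// mulr_ge0// ltW.
    have := sqr_ge0 p.1; have := sqr_ge0 p.2; rewrite /c.
    by move: (p.1 ^+ 2) (p.2 ^+ 2) (i * i * a) => ? ? ? ? ? ?; rewrite expr2; lra.
  by rewrite ge_min (ltW f1)/= le_max f2 orbT.
exists (ray T).
have nT : enorm (ray T) = 1 / 2.
  apply/eqP; rewrite -(eqrXn2 (n := 2)) ?enorm_ge0// enorm_sqr; exact/eqP.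
have T0 : 0 < T by apply: lt_le_trans T1.
have Wray t : 1 <= t -> W s (ray t).
  move=> t1; have t0 : 0 < t by apply: lt_le_trans t1.
  split; first by rewrite /upper/= /v/= add0r subr0 mulr_gt0.
  rewrite /= (_ : lam _ _ _ _ = t * lam s (k s) d p).
    by rewrite pmulr_rlt0//; have [] := Wp.
  rewrite /lam /ray /w /v/=.
  rewrite (_ : s * _ + _ = s * s * (d * k s) + t * (s * p.1 - s * s * (d * k s)) + k s * (t * p.2 - d)).
    by rewrite ss; ring.
  by ring.
split=> //; last by rewrite nT lexx; lra.
  apply: segment_component => u /andP[u0 u1].
  have E : segment p (ray T) u = ray (1 + u * (T - 1)).
    by rewrite -[in LHS]ray1 /segment /ray/=; congr (_, _); ring.
  have t1 : 1 <= 1 + u * (T - 1) by rewrite lerDl mulr_ge0// subr_ge0.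
  apply/AtrP; split.
  - rewrite E; apply: (lt_le_trans h1); rewrite -(ler_pXn2r (n := 2)) ?nnegrE ?enorm_ge0//.
    by rewrite !enorm_sqr mono.
  - by apply: segment_disc; rewrite ?h2 ?nT ?u0//; lra.
  - by have [] := segment_wedge Wp (Wray _ T1) (introT andP (conj u0 u1)).
  - by exists s => //; rewrite E; exact: Wray.
exact: Wray.
Qed.

Let end_point s : R * R := (- s, 0).

Let near_end s (e : R) : s * s = 1 -> 0 < e -> e <= 1 / 4 -> exists q,
  [/\ W s q, 1 / 2 <= enorm q < 1, `|q.1 - (end_point s).1| <= e & `|q.2 - (end_point s).2| <= e].
Proof.
move=> ss e0 e1; have K1 := slope_bound_ge1.
pose h := e / (4 * K); have h0 : 0 < h by rewrite divr_gt0// mulr_gt0.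
have Kh : K * h = e / 4 by rewrite /h; field; rewrite gt_eqF.
have he : h <= e / 4 by rewrite -Kh ler_peMl// ltW.
exists (- s * (1 - e), h); split=> /=.
- split; first by rewrite /upper/=.
  rewrite /lam/=; have -> : s * (- s * (1 - e)) = - (1 - e) by rewrite mulrA mulrN ss mulN1r.
  have := slope_le ss; rewrite ler_norml => /andP[k1 k2].
  have : k s * h <= K * h by rewrite ler_wpM2r// ltW.
  have : - (K * d) <= k s * d by rewrite -mulNr ler_wpM2r// ltW.
  by move: d_small; rewrite mulrBr; lra.
- have E : enorm (- s * (1 - e), h) ^+ 2 = (1 - e) ^+ 2 + h ^+ 2.
    by rewrite enorm_sqr/= exprMn sqrrN (expr2 s) ss mul1r.
  apply/andP; split.
    rewrite -(ler_pXn2r (n := 2)) ?nnegrE ?enorm_ge0 ?divr_ge0// E.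
    have : (1 / 2) ^+ 2 <= (1 - e) ^+ 2 by rewrite lerXn2r ?nnegrE; lra.
    by have := sqr_ge0 h; lra.
  rewrite -(ltr_pXn2r (n := 2)) ?nnegrE ?enorm_ge0// E expr1n.
  have : h ^+ 2 <= e ^+ 2 by rewrite lerXn2r ?nnegrE ?(ltW h0) ?(ltW e0)//; lra.
  by rewrite !expr2; nra.
- rewrite (_ : _ - - s = s * e); last by ring.
  by rewrite normrM (gtr0_norm e0); case: (sign_cases ss) => ->; rewrite ?normrN normr1 mul1r.
- by rewrite subr0 gtr0_norm//; lra.
Qed.

(** From x one goes away from the vertex along a ray up to the distance 1/2 from the
    origin, and then straight to a point near (- s, 0): at such distances the
    segments of the wedge avoid the inner disc. *)
Lemma component_end s x : s * s = 1 -> A x -> W s x ->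
  closure (connected_component A x) (- s, 0).
Proof.
move=> ss Ax Wx; apply/closure_squareP => e e0.
have m0 : 0 < Num.min (e / 2) (1 / 4) by rewrite lt_min !divr_gt0.
have [m1 m2] : Num.min (e / 2) (1 / 4) <= e / 2 /\ Num.min (e / 2) (1 / 4) <= 1 / 4.
  by rewrite !ge_min !lexx orbT.
have [q [Wq qn q1 q2]] := near_end ss m0 m2.
have [p [xp Wp /andP[pn pn1]]] := outward ss Ax Wx.
have /andP[qn1 qn2] := qn.
exists q; split; last 2 first.
- by apply: le_lt_trans q1 _; lra.
- by apply: le_lt_trans q2 _; lra.
apply: connected_component_trans xp _; apply: segment_component => t tI.
apply/AtrP; split.
- by rewrite r0E (_ : d * (2 * K) = 2 * (K * d)); [exact: segment_far ss Wp Wq pn qn1 tI|ring].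
- exact: segment_disc.
- by have [] := segment_wedge Wp Wq tI.
- by exists s => //; exact: segment_wedge.
Qed.

(** A component lies in one of the two wedges, which are disjoint in the region, and
    the point (s, 0) is not adherent to the wedge of s. *)
Lemma component_other_end s x : s * s = 1 -> A x -> W s x ->
  ~ closure (connected_component A x) (s, 0).
Proof.
move=> ss Ax Wx.
have ss' : - s * - s = 1 by rewrite mulrNN.
have AU : A `<=` W s `|` W (- s).
  move=> y /AtrP[_ _ _ [t tt Wt]].
  case: (sign_cases ss) (sign_cases tt) Wt => -> [] ->; rewrite ?opprK => Wt;
    by [left|right].
have sub : connected_component A x `<=` W s.
  pose C := connected_component A x.
  have Cc : connected C by exact: component_connected.
  have CA : C `<=` A := @connected_component_sub _ A x.
  have E : C `&` W s = C.
    apply: Cc.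
    - by exists x; split=> //; exact: connected_component_refl.
    - by exists (W s); [exact: open_wedge|].
    - exists (~` W (- s)); first by apply: open_closedC; exact: open_wedge.
      apply/seteqP; split=> y [Cy]; first by move=> Wy; split=> //; exact: Atr_disjoint (CA _ Cy) Wy.
      by move=> nW; split=> //; case: (AU _ (CA _ Cy)) => // /nW.
  move=> y Cy; have : (C `&` W s) y by rewrite E.
  by move=> [].
move=> cl.
have l0 : 0 < lam s (k s) d (s, 0).
  rewrite /lam/= ss sub0r mulrN; have := slope_le ss; rewrite ler_norml => /andP[k1 k2].
  have : k s * d <= K * d by rewrite ler_wpM2r// ltW.
  by move: d_small; lra.
have cx : {for (s, 0), continuous (lam s (k s) d)} := Ck_continuous (Ck_lam 0 s (k s) d openT) I.
have /cx/cl : nbhs (lam s (k s) d (s, 0)) [set t | 0 < t].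
  by apply: open_nbhs_nbhs; split=> //; exact: (@open_gt _ 0).
by move=> [y [/sub[_ /= h1] /= h2]]; move: h1; rewrite ltNge ltW.
Qed.

(** [phit] tells the components of the region apart by the points adherent to them, and
    for the component of a point of the wedge of s this is (- s, 0). *)
Lemma phit_ang s x : s * s = 1 -> A x -> W s x -> phit tL tR d x = ang s (k s) d x.
Proof.
move=> ss Ax Wx; have [x2 _] := Wx; rewrite /upper/= in x2.
have cl := component_end ss Ax Wx; have ncl := component_other_end ss Ax Wx.
rewrite /phit; case: (sign_cases ss) cl ncl => ->; rewrite ?opprK => cl ncl.
  rewrite asboolT; last by split.
  have -> : ang 1 (k 1) d x = ang 1 (cot tL) d x by congr (ang _ _ _ _); exact: slope1.
  have z2 : 0 < (x - xL tL d).2 by rewrite /= subr0.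
  rewrite (arg_atan z2) /ang acot_cot//= subr0.
  by congr (_ / _); rewrite /shifted /xL/= mul1r; move: (atan _) (pi : R) => a p; lra.
rewrite asboolF; last by case.
rewrite asboolT; last by split.
have -> : ang (-1) (k (-1)) d x = ang (-1) (cot tR) d x by congr (ang _ _ _ _); exact: slopeN1.
have z2 : 0 < (x - xR tR d).2 by rewrite /= subr0.
rewrite (arg_atan z2) /ang acot_cot//= subr0; congr (_ / _); rewrite -atanN; congr (_ + atan _).
by rewrite /shifted /xR/= -mulNr; congr (_ / _); ring.
Qed.

End TransverseRegion.

(** * Energy estimates *)

Section IntegralBookkeeping.
Context {R : realType}.
Implicit Types (f g h : R * R -> R) (U D E : set (R * R)) (x : R * R) (m c : R).

Lemma Rintegral_split D E f : mbl D -> mbl E -> E `<=` D -> L1 D f ->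
  \int[leb2]_(x in D) f x = \int[leb2]_(x in E) f x + \int[leb2]_(x in D `\` E) f x.
Proof.
move=> mD mE ED iD; have mDE : mbl (D `\` E) by exact: measurableD.
have sDE : D `\` E `<=` D by move=> x [].
have i1 : L1 D (f \_ E) by apply: L1_patch => //; exact: L1_subset iD.
have i2 : L1 D (f \_ (D `\` E)) by apply: L1_patch => //; exact: L1_subset iD.
rewrite -(Rintegral_patch f ED) -(Rintegral_patch f sDE) -RintegralD//.
apply: eq_Rintegral => x /set_mem Dx; rewrite !patchE.
have [Ex|nEx] := pselect (E x).
  by rewrite mem_set// memNset ?addr0// => -[].
by rewrite memNset// mem_set// add0r.
Qed.

Lemma int_le_dominated U f h m : int_le h m -> mbl U -> mblfun U f ->
  (forall x, U x -> `|f x| <= h x) -> L1 U f /\ `|\int[leb2]_(x in U) f x| <= m.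
Proof.
move=> H mU mf fh; have [ih hm] := int_le_L1 H; have [_ h0 _] := H.
have ihU : L1 U h by exact: L1_subset ih.
have i : L1 U f by exact: L1_le ihU.
have hU : \int[leb2]_(x in U) h x <= m.
  by apply: le_trans hm; apply: ge0_le_Rintegral_subset.
split=> //; rewrite ler_norml; apply/andP; split; last first.
  by apply: le_trans hU; apply: le_Rintegral => // x Ux; apply: le_trans (ler_norm _) (fh x Ux).
rewrite lerNl.
rewrite -(_ : \int[leb2]_(x in U) (- f x) = - \int[leb2]_(x in U) f x); last first.
  by rewrite -mulN1r -RintegralZl//; apply: eq_Rintegral => x _; rewrite mulN1r.
apply: le_trans hU; apply: le_Rintegral => //; first exact: L1_opp.
by move=> x Ux; apply: le_trans (ler_norm _) _; rewrite normrN fh.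
Qed.

Lemma Rintegral_bounded U f g c : mbl U -> mblfun U f -> L1 U g ->
  (forall x, U x -> 0 <= f x <= g x) -> \int[leb2]_(x in U) g x <= c ->
  L1 U f /\ \int[leb2]_(x in U) f x <= c.
Proof.
move=> mU mf ig H gc; have i : L1 U f.
  by apply: L1_le ig => // x /H/andP[f0 fg]; rewrite ger0_norm.
split=> //; apply: le_trans gc; apply: le_Rintegral => // x /H/andP[]//.
Qed.

Lemma sqrB_swap (a b a' b' m : R) :
  (a - b) ^+ 2 + (a' - b') ^+ 2 <= m -> (b - a) ^+ 2 + (b' - a') ^+ 2 <= m.
Proof. by rewrite -[b - a]opprB -[b' - a']opprB !sqrrN. Qed.

Lemma two_squares (a b a' b' : R) :
  (a + b) ^+ 2 + (a' + b') ^+ 2 <= 2 * (a ^+ 2 + a' ^+ 2) + 2 * (b ^+ 2 + b' ^+ 2).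
Proof. by have := sqr_ge0 (a - b); have := sqr_ge0 (a' - b'); nra. Qed.

Lemma three_small (a b c a' b' c' m : R) : b ^+ 2 + b' ^+ 2 <= m -> c ^+ 2 + c' ^+ 2 <= m ->
  (a + b + c) ^+ 2 + (a' + b' + c') ^+ 2 <= 3 * (a ^+ 2 + a' ^+ 2) + 6 * m.
Proof.
have three (p q s : R) : (p + q + s) ^+ 2 <= 3 * p ^+ 2 + 3 * q ^+ 2 + 3 * s ^+ 2.
  by have := sqr_ge0 (p - q); have := sqr_ge0 (q - s); have := sqr_ge0 (p - s); nra.
by have := three a b c; have := three a' b' c'; lra.
Qed.

Lemma part_bound (a b c f o p q1 q2 : R) : a = b + c -> f = b + o -> 0 <= o -> o <= q2 ->
  `|c| <= q2 -> `|f - p| <= q1 -> `|a - p| <= 2 * q2 + q1.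
Proof.
move=> -> -> ? ?; rewrite !ler_norml => /andP[? ?] /andP[? ?].
by apply/andP; split; lra.
Qed.

Lemma difference_split (p w X0 q : R) : p + w - q = w + (p - X0) + (X0 - q).
Proof. by ring. Qed.

Lemma total_bound (a b c p q1 q2 : R) : 0 <= q2 -> `|a - p| <= q1 -> `|b| <= q2 -> 0 <= c ->
  c <= 2 * q2 + 2 * (6 + 4 * q2) -> `|a + (2 * b + c) - p| <= q1 + 2 * q2 + 2 * (6 + 5 * q2).
Proof. by rewrite !ler_norml => ? /andP[? ?] /andP[? ?] ? ?; apply/andP; split; lra. Qed.

End IntegralBookkeeping.

Section FinalEstimates.
Context {R : realType}.
Variables (tL tR : R) (Omega S0 : set (R * R)) (rho e M0 Mc VO r d : R) (eta u : R * R -> R).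
Notation k := (slope tL tR).
Notation K := (slope_bound tL tR).
Hypothesis bL : 0 < tL < pi.
Hypothesis bR : 0 < tR < pi.
Hypothesis tip : tR < pi - tL.
Hypothesis oO : open Omega.
Hypothesis bO : bounded_set Omega.
Hypothesis Or : Omega `<=` cbox (- r) r (- r) r.
Hypothesis O_area : (leb2 Omega <= VO%:E)%E.
Hypothesis rho_gt0 : 0 < rho.
Hypothesis rho_le : 5 * rho <= 1.
Hypothesis O_near : forall x : R * R, `|x.1| < 4 * rho -> `|x.2| < 4 * rho -> (Omega x <-> 0 < x.2).
Hypothesis S_near : forall x : R * R, `|x.1| < 5 * rho -> `|x.2| < 5 * rho ->
    (closure S0 x <-> forall s, s * s = 1 -> 0 <= lam s (k s) 0 x).
Hypothesis t_eta : test_fun Omega eta.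
Hypothesis eta01 : forall x, 0 <= eta x <= 1.
Hypothesis eta_near : forall x : R * R, closure S0 x -> ~ (`|x.1| < rho / 2 /\ `|x.2| < rho / 2) ->
    forall y : R * R, `|y.1 - x.1| < e -> `|y.2 - x.2| < e -> eta y = 1.
Hypothesis D_eta : forall x v : R * R, e12 v -> `|'D_v eta x| <= M0.
Hypothesis D_chi : forall x v : R * R, e12 v -> `|'D_v (chi rho) x| <= Mc.
Hypothesis d_gt0 : 0 < d.
Hypothesis d_lt1 : d < 1.
Hypothesis d_e : 2 * d < e.
Hypothesis d_rho : 16 * (K * d) <= rho.
Hypothesis d_K : 64 * (K ^+ 3 * d) <= 1.
Hypothesis d_17 : 17 * d ^+ 2 <= 1.
Hypothesis d_width : forall s, s * s = 1 -> line_width (k s) * d ^+ 2 < 1.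
Hypothesis S_inside : closure (raise d S0) `<=` Omega.
Hypothesis A_inside : gap tL tR d 1 `<=` Omega.
Hypothesis pot : potential Omega (raise d S0) u.

Notation A := (Atr tL tR d).
Notation S := (raise d S0).
Notation Phi := (competitor k rho eta d).
Notation X := (tip_field k d rho).
Notation Phit := (phit tL tR d).
Notation beta := (majorant k rho K M0 Mc d Omega).
Notation m := (majorant_mass k rho K M0 Mc VO).
Notation E := (energy_mass k rho K M0 Mc VO).
Notation main := ((tL^-1 + tR^-1) * `|ln d|).

Let kk : 0 < k 1 + k (-1) := slope_sum bL bR tip.
Let K1 : 1 <= K := slope_bound_ge1 tL tR.
Let kK s : s * s = 1 -> `|k s| <= K := @slope_le R tL tR s.
Let rho1 : rho <= 1. Proof. by move: rho_gt0 rho_le; lra. Qed.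
Let K0 : 0 < K. Proof. exact: lt_le_trans ltr01 K1. Qed.
Let dK : d <= K * d. Proof. by rewrite ler_peMl// ltW. Qed.
Let d_small : 16 * (K * d) <= 1. Proof. exact: le_trans d_rho rho1. Qed.
Let d_rho2 : 2 * d < rho. Proof. by move: d_rho dK d_gt0; lra. Qed.
Let Ceta : Cinf setT eta. Proof. by have /test_funP[] := t_eta. Qed.
Let mO : mbl Omega := open_measurable_plane oO.
Let ev1 : @e12 R e1. Proof. by left. Qed.
Let ev2 : @e12 R e2. Proof. by right. Qed.
Let oA : open A := open_Atr bL bR tip.
Let mA : mbl A := open_measurable_plane oA.
Let AO : A `<=` Omega. Proof. by move=> x [/A_inside]. Qed.
Let mOA : mbl (Omega `\` A). Proof. exact: measurableD. Qed.
Let OAO : Omega `\` A `<=` Omega. Proof. by move=> x []. Qed.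
Let finO : (leb2 Omega < +oo)%E. Proof. exact: le_lt_trans O_area (ltry _). Qed.

Let tPhi : test_fun Omega Phi.
Proof. exact: test_competitor. Qed.

Let IM : int_le beta m.
Proof. exact: int_le_majorant. Qed.

Let XL v : e12 v -> L2 Omega (X v).
Proof. exact: (L2_tip_field kk D_eta D_chi d_gt0 d_17 oO O_area). Qed.

Let m0 : 0 <= m.
Proof.
have [_ b0 bm] := IM; rewrite -lee_fin; apply: le_trans bm; apply: integral_ge0 => x _.
by rewrite lee_fin.
Qed.

Let Z v x := 'D_v Phi x - X v x.

Let LZ v : e12 v -> L2 Omega (Z v).
Proof.
move=> vE; apply: L2_sub => //; last exact: XL.
by apply: (test_fun_L2 (D := Omega)) => //; exact: test_fun_derive.
Qed.

Let Zb x : Omega x -> [/\ Z e1 x ^+ 2 + Z e2 x ^+ 2 <= beta x,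
  `|X e1 x * Z e1 x + X e2 x * Z e2 x| <= beta x & True].
Proof.
move=> Ox; have c : close_gradients k rho K M0 Mc d ('D_e1 Phi x) ('D_e2 Phi x) (X e1 x) (X e2 x) x.
  exact: (close_competitor kk rho_gt0 rho1 K1 kK Ceta eta01 D_eta D_chi d_gt0 d_lt1 d_rho d_17 d_width O_near Ox).
by have [h1 h2 _] := close_bounds Ox c.
Qed.

Let int_Z : L1 Omega (fun x => Z e1 x ^+ 2 + Z e2 x ^+ 2) /\
  \int[leb2]_(x in Omega) (Z e1 x ^+ 2 + Z e2 x ^+ 2) <= m.
Proof.
have i : L1 Omega (fun x => Z e1 x ^+ 2 + Z e2 x ^+ 2).
  by apply: L1_add => //; [exact: (LZ ev1).2|exact: (LZ ev2).2].
split=> //; apply: le_trans (ler_norm _) _.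
apply: (int_le_dominated IM mO _ _).2; first exact: L1_measurable.
by move=> x Ox; have [h _ _] := Zb Ox; rewrite ger0_norm// addr_ge0// sqr_ge0.
Qed.

Let int_XZ : L1 Omega (fun x => X e1 x * Z e1 x + X e2 x * Z e2 x) /\
  `|\int[leb2]_(x in Omega) (X e1 x * Z e1 x + X e2 x * Z e2 x)| <= m.
Proof.
have i : L1 Omega (fun x => X e1 x * Z e1 x + X e2 x * Z e2 x).
  by apply: L1_add => //; apply: L2_mul => //; try exact: XL; exact: LZ.
split=> //; apply: (int_le_dominated IM mO _ _).2; first exact: L1_measurable.
by move=> x Ox; have [_ h _] := Zb Ox.
Qed.

Let comparison : exists w1 w2, [/\ weak_gradient Omega u (fun x => 'D_e1 Phi x + w1 x)
                                          (fun x => 'D_e2 Phi x + w2 x),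
    L2 Omega w1 /\ L2 Omega w2,
    \int[leb2]_(x in Omega) (w1 x ^+ 2 + w2 x ^+ 2) <= 6 + 4 * m,
    \int[leb2]_(x in Omega) (X e1 x * w1 x + X e2 x * w2 x) = 0 &
    L1 Omega (fun x => (u x - Phi x) ^+ 2) /\
    \int[leb2]_(x in Omega) ((u x - Phi x) ^+ 2) <= 2 + 16 * r ^+ 2 * (7 + 4 * m)].
Proof.
have [V [oV SV PhiV]] : exists V, [/\ open V, closure S `<=` V & forall x, V x -> Phi x = 1].
  exact: (competitor_near1 rho_gt0 O_near S_near eta_near d_gt0 d_e d_rho2 S_inside).
have cal psi : test_fun (Omega `\` closure S) psi ->
    \int[leb2]_(x in Omega `\` closure S) (X e1 x * 'D_e1 psi x + X e2 x * 'D_e2 psi x) = 0.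
  apply: calibration => //.
    move=> s ss; apply: (@le_trans _ _ (K * d)); first by rewrite mulrC ler_pM2r// kK.
    by move: d_rho K0 d_gt0; have := mulr_gt0 K0 d_gt0; lra.
  exact: (fluid_near rho_gt0 O_near S_near d_gt0 d_rho2).
have [w1 [w2 [H1 H2 H3 H4 [H5 H6]]]] := energy_comparison oO bO pot tPhi oV SV PhiV (XL ev1) (XL ev2) cal Or.
have [_ Zm] := int_Z; rewrite -/(Z e1) -/(Z e2) in H3 H6.
exists w1, w2; split=> //.
  by apply: le_trans H3 _; apply: lerD => //; rewrite ler_wpM2l.
split=> //; apply: le_trans H6 _; apply: lerD => //; apply: ler_wpM2l; first by rewrite mulr_ge0 ?sqr_ge0.
by apply: lerD => //; rewrite ler_wpM2l.
Qed.

Let phit_local x : A x -> exists s, [/\ s * s = 1, wedge k d s x, open (A `&` wedge k d s) &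
  forall y, (A `&` wedge k d s) y -> Phit y = ang s (k s) d y].
Proof.
move=> Ax; have [_ _ _ [s ss Ws]] := (AtrP d bL bR tip x).1 Ax.
exists s; split=> //; first by apply: openI => //; exact: open_wedge.
by move=> y [Ay Wy]; apply: phit_ang.
Qed.

Let Ck_phit n : Ck n A Phit.
Proof.
apply: Ck_local => x Ax; have [s [ss Ws oU phE]] := phit_local Ax.
exists (A `&` wedge k d s); split=> //.
apply: (@Ck_eq _ _ _ (ang s (k s) d)) => //; first by move=> y /phE ->.
by apply: (@Ck_sub _ _ upper); [move=> y [_ []]|exact: Ck_ang].
Qed.

Let D_phit_bounds x : A x ->
  [/\ ('D_e1 Phit x - X e1 x) ^+ 2 + ('D_e2 Phit x - X e2 x) ^+ 2 <= beta x &
   `|('D_e1 Phit x ^+ 2 + 'D_e2 Phit x ^+ 2) - (X e1 x ^+ 2 + X e2 x ^+ 2)| <= beta x].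
Proof.
move=> Ax; have [s [ss Ws oU phE]] := phit_local Ax.
have DE v : 'D_v Phit x = 'D_v (ang s (k s) d) x by apply: (eq_derive_open v oU phE).
have dist : d / 2 <= `|shifted s (k s) d x| \/ d / 2 <= x.2.
  have [h|h] := leP (d / 2) x.2; [by right|left]; rewrite leNgt; apply/negP => h2.
  have [x2 _] := Ws; rewrite /upper/= in x2.
  have x1 : `|x.1| <= 3 / 2 * (K * d).
    have : `|s * x.1| <= `|s * x.1 - d * k s| + `|d * k s|.
      by apply: le_trans (ler_normD _ _); rewrite subrK.
    have -> : `|s * x.1| = `|x.1|.
      by rewrite normrM; case: (sign_cases ss) => ->; rewrite ?normrN normr1 mul1r.
    have : `|d * k s| <= K * d by rewrite normrM (gtr0_norm d_gt0) mulrC ler_pM2r// kK.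
    by move: h2 dK; rewrite /shifted; move: `|_| `|_| `|_| => a b c; lra.
  have x1s : x.1 ^+ 2 <= (3 / 2 * (K * d)) ^+ 2.
    by rewrite -(real_normK (num_real x.1)) lerXn2r ?nnegrE// (le_trans _ x1).
  have x2s : x.2 ^+ 2 <= (1 / 2 * (K * d)) ^+ 2.
    by rewrite lerXn2r ?nnegrE ?(ltW x2)//; move: h dK d_gt0; lra.
  have := Atr_dist bL bR tip Ax.
  rewrite ltNge => /negP; apply.
  rewrite -(ler_pXn2r (n := 2)) ?nnegrE ?enorm_ge0 ?mulr_ge0 ?(ltW d_gt0) ?(ltW K0)// enorm_sqr.
  apply: le_trans (lerD x1s x2s) _; rewrite !exprMn -!exprMn; have := sqr_ge0 (K * d).
  by rewrite !exprMn; move: (K ^+ 2 * d ^+ 2) => a; lra.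
have c : close_gradients k rho K M0 Mc d ('D_e1 Phit x) ('D_e2 Phit x) (X e1 x) (X e2 x) x.
  by rewrite !DE; apply: (close_ang kk rho_gt0 rho1 K1 kK Ceta eta01 D_eta D_chi d_gt0 d_rho d_17 d_width O_near) => //; exact: AO.
by have [h1 _ h3] := close_bounds (AO Ax) c.
Qed.

Let mDphit v : mblfun A ('D_v Phit).
Proof. exact: Ck_measurable oA (Ck_derive v (Ck_phit 1)). Qed.

Let mXA v : e12 v -> mblfun A (X v).
Proof.
by move=> vE; apply: (@measurable_funS _ _ (plane R) _ Omega) => //; case: (XL vE).
Qed.

Let LX : L1 Omega (fun x => X e1 x ^+ 2 + X e2 x ^+ 2).
Proof. by apply: L1_add => //; [exact: (XL ev1).2|exact: (XL ev2).2]. Qed.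

Let X_out x : (Omega `\` A) x -> X e1 x ^+ 2 + X e2 x ^+ 2 <= beta x.
Proof.
move=> [Ox nA]; apply: (tip_field_outside kk rho_gt0 kK Ceta eta01 D_eta D_chi) => // h1 h2 nbox s ss Ws; apply: nA; apply/(AtrP d bL bR tip).
have Kd := mulr_gt0 K0 d_gt0.
split; [|by apply: enorm_lt; move: rho_le rho_gt0 h1 h2; lra|by case: Ws|by exists s].
rewrite r0E (_ : d * (2 * K) = 2 * (K * d)); last by ring.
move: nbox; rewrite negb_and -!ltNge => /orP[p|p].
  by apply: lt_le_trans (norm_fst_le x); apply: lt_trans p; rewrite -mulrA; lra.
by apply: lt_le_trans (norm_snd_le x); apply: lt_trans p; rewrite -mulrA; lra.
Qed.

Let int_X_out : 0 <= \int[leb2]_(x in Omega `\` A) (X e1 x ^+ 2 + X e2 x ^+ 2) <= m.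
Proof.
apply/andP; split; first by apply: Rintegral_ge0 => x _; rewrite addr_ge0// sqr_ge0.
apply: le_trans (ler_norm _) _; apply: (int_le_dominated IM mOA _ _).2.
  by apply: L1_measurable => //; exact: (L1_subset mO mOA OAO LX).
by move=> x Ux; rewrite ger0_norm ?addr_ge0 ?sqr_ge0//; exact: X_out.
Qed.

Let energy : `|\int[leb2]_(x in Omega) (X e1 x ^+ 2 + X e2 x ^+ 2) - main| <= E.
Proof.
have -> : main = inv_angles k * `|ln d|.
  by rewrite /inv_angles slope1 slopeN1 (acot_cot bL) (acot_cot bR).
exact: (energy_tip_field kk rho_gt0 rho1 K1 kK Ceta eta01 D_eta D_chi).
Qed.

Lemma energy_phit : (`|grad_normsq A A Phit - main%:E| <= (2 * m + E)%:E)%E.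
Proof.
rewrite (grad_normsqE oA mA (@subset_refl _ A) (weak_gradient_Ck oA (Ck_phit 1))).
have mD : mblfun A (fun x => 'D_e1 Phit x ^+ 2 + 'D_e2 Phit x ^+ 2).
  by apply: measurable_funD; apply: measurable_funX; exact: mDphit.
have LXA : L1 A (fun x => X e1 x ^+ 2 + X e2 x ^+ 2) by exact: L1_subset LX.
have [iD bD] := int_le_dominated IM mA (measurable_funB mD (L1_measurable LXA))
  (fun x Ax => (D_phit_bounds Ax).2).
have iP : L1 A (fun x => 'D_e1 Phit x ^+ 2 + 'D_e2 Phit x ^+ 2).
  have := L1_add mA iD LXA; congr (is_true (integrable _ _ _)).
  by apply/funext => x /=; rewrite subrK.
rewrite (L1_Rintegral mA iP) -EFinB lee_fin.
have sp := Rintegral_split mO mA AO LX; have /andP[out_ge0 out_le] := int_X_out.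
have e1E : \int[leb2]_(x in A) ('D_e1 Phit x ^+ 2 + 'D_e2 Phit x ^+ 2) =
  \int[leb2]_(x in A) (X e1 x ^+ 2 + X e2 x ^+ 2) +
  \int[leb2]_(x in A) ('D_e1 Phit x ^+ 2 + 'D_e2 Phit x ^+ 2 - (X e1 x ^+ 2 + X e2 x ^+ 2)).
  by rewrite -RintegralD//; apply: eq_Rintegral => x _; rewrite subrKC.
exact: part_bound e1E sp out_ge0 out_le bD energy.
Qed.



(* The gradient of u minus X is w + Z, of bounded energy. On a part U of the
   domain it is completed by y, which is X outside of the region of the angles and
   the difference between X and the gradient of the angle on it. *)
Let gradient_on U (w1 w2 y1 y2 : R * R -> R) : mbl U -> U `<=` Omega -> L2 Omega w1 -> L2 Omega w2 ->
  \int[leb2]_(x in Omega) (w1 x ^+ 2 + w2 x ^+ 2) <= 6 + 4 * m ->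
  mblfun U y1 -> mblfun U y2 -> (forall x, U x -> y1 x ^+ 2 + y2 x ^+ 2 <= beta x) ->
  (\int[leb2]_(x in U) ((w1 x + Z e1 x + y1 x) ^+ 2 + (w2 x + Z e2 x + y2 x) ^+ 2)%:E
   <= (3 * (6 + 4 * m) + 6 * m)%:E)%E.
Proof.
move=> mU UO Lw1 Lw2 wm my1 my2 yb.
have LwO : L1 Omega (fun x => w1 x ^+ 2 + w2 x ^+ 2).
  by apply: L1_add => //; [exact: Lw1.2|exact: Lw2.2].
have LwU : L1 U (fun x => w1 x ^+ 2 + w2 x ^+ 2) by exact: L1_subset LwO.
have [ib bm] := int_le_L1 IM; have [_ b0 _] := IM.
have ibU : L1 U beta by exact: L1_subset ib.
have bU : \int[leb2]_(x in U) beta x <= m.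
  by apply: le_trans bm; apply: ge0_le_Rintegral_subset.
have wU : \int[leb2]_(x in U) (w1 x ^+ 2 + w2 x ^+ 2) <= 6 + 4 * m.
  apply: le_trans wm; apply: ge0_le_Rintegral_subset => // x _.
  by rewrite addr_ge0// sqr_ge0.
have ig : L1 U (fun x => 3 * (w1 x ^+ 2 + w2 x ^+ 2) + 6 * beta x).
  by apply: L1_add => //; apply: L1_scale.
have gc : \int[leb2]_(x in U) (3 * (w1 x ^+ 2 + w2 x ^+ 2) + 6 * beta x) <= 3 * (6 + 4 * m) + 6 * m.
  rewrite RintegralD//; try exact: L1_scale.
  by rewrite !RintegralZl//; apply: lerD; rewrite ler_wpM2l.
have sub f : mblfun Omega f -> mblfun U f by apply: measurable_funS.
have mf : mblfun U (fun x => (w1 x + Z e1 x + y1 x) ^+ 2 + (w2 x + Z e2 x + y2 x) ^+ 2).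
  apply: measurable_funD; apply: measurable_funX; apply: measurable_funD => //;
    apply: measurable_funD; apply: sub;
    [exact: Lw1.1|exact: (LZ ev1).1|exact: Lw2.1|exact: (LZ ev2).1].
have [|i b] := Rintegral_bounded mU mf ig _ gc; last by rewrite (L1_Rintegral mU i) lee_fin.
move=> x Ux; rewrite addr_ge0 ?sqr_ge0//=; have [zb _ _] := Zb (UO _ Ux).
exact: three_small zb (yb x Ux).
Qed.

Lemma energy_difference :
  (grad_normsq A A (fun x => u x - Phit x)%R <= (3 * (6 + 4 * m) + 6 * m)%:E)%E.
Proof.
have [w1 [w2 [wg [L1w L2w] wm _ _]]] := comparison.
have wA := weak_gradient_sub oA (weak_gradient_subset AO wg) (weak_gradient_Ck oA (Ck_phit 1)).
rewrite (grad_normsqE oA mA (@subset_refl _ A) wA).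
apply: le_trans (gradient_on (y1 := fun x => X e1 x - 'D_e1 Phit x)
  (y2 := fun x => X e2 x - 'D_e2 Phit x) mA AO L1w L2w wm _ _ _).
- rewrite le_eqVlt; apply/orP; left; apply/eqP; apply: eq_integral => x _; congr EFin.
  congr (_ ^+ 2 + _ ^+ 2); exact: difference_split.
- by apply: measurable_funB; [exact: mXA|exact: mDphit].
- by apply: measurable_funB; [exact: mXA|exact: mDphit].
- move=> x Ax; have [h _] := D_phit_bounds Ax.
  exact: sqrB_swap h.
Qed.

Lemma energy_outside :
  (grad_normsq Omega (Omega `\` A) u <= (3 * (6 + 4 * m) + 6 * m)%:E)%E.
Proof.
have [w1 [w2 [wg [L1w L2w] wm _ _]]] := comparison.
rewrite (grad_normsqE oO mOA OAO wg).
apply: le_trans (gradient_on (y1 := X e1) (y2 := X e2) mOA OAO L1w L2w wm _ _ _).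
- rewrite le_eqVlt; apply/orP; left; apply/eqP; apply: eq_integral => x _; congr EFin.
  have key (p w X0 : R) : p + w = w + (p - X0) + X0 by rewrite -addrA subrK addrC.
  congr (_ ^+ 2 + _ ^+ 2); exact: key.
- by apply: (@measurable_funS _ _ (plane R) _ Omega) => //; case: (XL ev1).
- by apply: (@measurable_funS _ _ (plane R) _ Omega) => //; case: (XL ev2).
- exact: X_out.
Qed.

(** Here X enters through its product with w + Z, of which a Cauchy-Schwarz bound
    would be of order the square root of the logarithm. But X is orthogonal to w,
    and its product with Z is dominated by the majorant. *)
Lemma energy_total :
  (`|grad_normsq Omega Omega u - main%:E| <= (E + 2 * m + 2 * (6 + 5 * m))%:E)%E.
Proof.
have [w1 [w2 [wg [L1w L2w] wm wX _]]] := comparison.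
rewrite (grad_normsqE oO mO (@subset_refl _ Omega) wg).
have [iZ Zm] := int_Z; have [iXZ XZm] := int_XZ.
have iw : L1 Omega (fun x => w1 x ^+ 2 + w2 x ^+ 2).
  by apply: L1_add => //; [exact: L1w.2|exact: L2w.2].
have iXw : L1 Omega (fun x => X e1 x * w1 x + X e2 x * w2 x).
  by apply: L1_add => //; apply: L2_mul => //; exact: XL.
pose q x := (Z e1 x + w1 x) ^+ 2 + (Z e2 x + w2 x) ^+ 2.
have mq : mblfun Omega q.
  apply: measurable_funD; apply: measurable_funX; apply: measurable_funD;
    [exact: (LZ ev1).1|exact: L1w.1|exact: (LZ ev2).1|exact: L2w.1].
have ig : L1 Omega (fun x => 2 * (Z e1 x ^+ 2 + Z e2 x ^+ 2) + 2 * (w1 x ^+ 2 + w2 x ^+ 2)).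
  by apply: L1_add => //; apply: L1_scale.
have gc : \int[leb2]_(x in Omega) (2 * (Z e1 x ^+ 2 + Z e2 x ^+ 2) + 2 * (w1 x ^+ 2 + w2 x ^+ 2))
    <= 2 * m + 2 * (6 + 4 * m).
  rewrite RintegralD//; try exact: L1_scale.
  by rewrite !RintegralZl//; apply: lerD; rewrite ler_wpM2l.
have [iq qm] : L1 Omega q /\ \int[leb2]_(x in Omega) q x <= 2 * m + 2 * (6 + 4 * m).
  apply: Rintegral_bounded gc => // x _; rewrite /q addr_ge0 ?sqr_ge0//=.
  exact: two_squares.
have q0 : 0 <= \int[leb2]_(x in Omega) q x.
  by apply: Rintegral_ge0 => x _; rewrite /q addr_ge0// sqr_ge0.
have GE x : ('D_e1 Phi x + w1 x) ^+ 2 + ('D_e2 Phi x + w2 x) ^+ 2 =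
    (X e1 x ^+ 2 + X e2 x ^+ 2) + (2 * (X e1 x * Z e1 x + X e2 x * Z e2 x) +
    (2 * (X e1 x * w1 x + X e2 x * w2 x) + q x)).
  have key (p X0 w p' X0' w' : R) : (p + w) ^+ 2 + (p' + w') ^+ 2 = X0 ^+ 2 + X0' ^+ 2 +
    (2 * (X0 * (p - X0) + X0' * (p' - X0')) + (2 * (X0 * w + X0' * w') +
     ((p - X0 + w) ^+ 2 + (p' - X0' + w') ^+ 2))) by ring.
  exact: key.
have i2 := L1_scale 2 mO iXZ; have i3 := L1_scale 2 mO iXw.
have i34 := L1_add mO i3 iq; have i234 := L1_add mO i2 i34; have iG := L1_add mO LX i234.
have -> : (\int[leb2]_(x in Omega) (('D_e1 Phi x + w1 x) ^+ 2 + ('D_e2 Phi x + w2 x) ^+ 2)%:E =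
    (\int[leb2]_(x in Omega) (X e1 x ^+ 2 + X e2 x ^+ 2) +
     (2 * \int[leb2]_(x in Omega) (X e1 x * Z e1 x + X e2 x * Z e2 x) +
     (2 * 0 + \int[leb2]_(x in Omega) q x))%R)%:E)%E.
  rewrite -wX -(RintegralZl _ mO iXw) -(RintegralD mO i3 iq) -(RintegralZl _ mO iXZ).
  rewrite -(RintegralD mO i2 i34) -(RintegralD mO LX i234) -(L1_Rintegral mO iG).
  by apply: eq_integral => x _; rewrite GE.
rewrite -EFinB lee_fin mulr0 add0r.
exact: total_bound m0 energy XZm q0 qm.
Qed.

(** The competitor is bounded by 1, and its distance to the potential is controlled by
    the Poincare inequality. *)
Lemma mass_total :
  (L2_normsq Omega u <= (2 * (2 + 16 * r ^+ 2 * (7 + 4 * m)) + 2 * VO)%:E)%E.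
Proof.
have [w1 [w2 [_ _ _ _ [iq qm]]]] := comparison.
have mu : mblfun Omega u by have [[[]]] := pot.
have i1 : L1 Omega (fun=> 1).
  by apply: (@L1_bounded _ _ _ 1) => // x _; rewrite normr1.
have ig : L1 Omega (fun x => 2 * (u x - Phi x) ^+ 2 + 2 * 1).
  by apply: L1_add => //; apply: L1_scale.
have gc : \int[leb2]_(x in Omega) (2 * (u x - Phi x) ^+ 2 + 2 * 1) <=
    2 * (2 + 16 * r ^+ 2 * (7 + 4 * m)) + 2 * VO.
  rewrite RintegralD//; try exact: L1_scale.
  rewrite !RintegralZl//; apply: lerD; rewrite ler_wpM2l//.
  rewrite -lee_fin -L1_Rintegral//; apply: le_trans O_area.
  by rewrite integral_cst// mul1e.
have m2 : mblfun Omega (fun x => u x ^+ 2) by exact: measurable_funX.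
have [|i b] := Rintegral_bounded mO m2 ig _ gc; last by rewrite /L2_normsq (L1_Rintegral mO i) lee_fin.
move=> x _; rewrite sqr_ge0/=.
have /andP[p0 p1] : 0 <= Phi x <= 1.
  exact: (competitor01 k rho eta01 d_gt0 x).
have := sqr_ge0 (u x - 2 * Phi x).
by move: (u x) (Phi x) p0 p1 => a p *; nra.
Qed.

End FinalEstimates.

(** * Asymptotics *)

Section Smallness.
Context {R : realType}.
Implicit Types (a b d : R).

Lemma near_scaled_lt a b : 0 < a -> 0 < b -> \forall d \near 0^'+, a * d < b.
Proof.
move=> a0 b0; have c0 : 0 < b / a by exact: divr_gt0.
near=> d; rewrite mulrC -ltr_pdivlMr//; near: d; exact: nbhs_right_lt.
Unshelve. all: by end_near.
Qed.

Lemma gradient_bound (D : set (R * R)) (f : R * R -> R) : test_fun D f ->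
  exists M, forall x v : R * R, e12 v -> `|'D_v f x| <= M.
Proof.
move=> tf; have [M1 _ H1] := test_fun_bounded (test_fun_derive e1 tf).
have [M2 _ H2] := test_fun_bounded (test_fun_derive e2 tf).
by exists (Num.max M1 M2) => x v [->|->]; [apply: le_trans (H1 x) _|apply: le_trans (H2 x) _];
  rewrite le_max lexx ?orbT.
Qed.

End Smallness.

Theorem theorem1 (R : realType) (Omega S0 : set (R * R)) (thetaL thetaR : R)
    (phi : R -> R * R -> R) :
  setting thetaL thetaR Omega S0 ->
  (\forall d \near 0^'+, potential Omega (raise d S0) (phi d)) ->
  let A := Atr thetaL thetaR in
  let phit := phit thetaL thetaR in
  let main := fun d : R => (thetaL^-1 + thetaR^-1) * `|ln d| in
  [/\ bigO1 (fun d => grad_normsq (A d) (A d) (phit d) - (main d)%:E)%E,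
      bigO1 (fun d => grad_normsq (A d) (A d) (phi d \- phit d)),
      bigO1 (fun d => grad_normsq Omega (Omega `\` A d) (phi d)),
      bigO1 (fun d => grad_normsq Omega Omega (phi d) - (main d)%:E)%E &
      bigO1 (fun d => L2_normsq Omega (phi d))].
Proof.
move=> Sg pot A tphi main.
have [rho [eta [rho_gt0 rho_le O_near S_near [t_eta eta01 [e e_gt0 eta_near]]]]] := tip_geometry Sg.
have bL := thetaL_bounds Sg; have bR := thetaR_bounds Sg; have tip := tip_angle Sg.
have oO := Omega_open Sg; have bO := Omega_bounded Sg.
have [M0 D_eta] := gradient_bound t_eta.
have [Mc D_chi] := gradient_bound (test_chi rho_gt0).
have [r _ Or] := bounded_sub_cbox bO.
have finO := leb2_bounded bO (open_measurable_plane oO).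
pose VO := fine (leb2 Omega).
have O_area : (leb2 Omega <= VO%:E)%E by rewrite fineK// ge0_fin_numE.
pose K := slope_bound thetaL thetaR.
have K_gt0 : 0 < K := lt_le_trans ltr01 (slope_bound_ge1 _ _).
pose w := line_width (slope thetaL thetaR 1) + line_width (slope thetaL thetaR (-1)).
have w_gt0 : 0 < w by rewrite addr_gt0 ?line_width_gt0.
have [m [E all5]] : exists m E : R, \forall d \near 0^'+,
   [/\ (`|grad_normsq (A d) (A d) (tphi d) - (main d)%:E| <= (2 * m + E)%:E)%E,
       (grad_normsq (A d) (A d) (phi d \- tphi d)%R <= (3 * (6 + 4 * m) + 6 * m)%:E)%E,
       (grad_normsq Omega (Omega `\` A d) (phi d) <= (3 * (6 + 4 * m) + 6 * m)%:E)%E,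
       (`|grad_normsq Omega Omega (phi d) - (main d)%:E| <= (E + 2 * m + 2 * (6 + 5 * m))%:E)%E &
       (L2_normsq Omega (phi d) <= (2 * (2 + 16 * r ^+ 2 * (7 + 4 * m)) + 2 * VO)%:E)%E].
  exists (majorant_mass (slope thetaL thetaR) rho K M0 Mc VO),
         (energy_mass (slope thetaL thetaR) rho K M0 Mc VO).
  near=> d.
  have d_gt0 : 0 < d by near: d; exact: nbhs_right_gt.
  have d_lt1 : d < 1 by near: d; exact: nbhs_right_lt.
  have d_e : 2 * d < e by near: d; exact: near_scaled_lt.
  have d_rho : 16 * (K * d) <= rho.
    by rewrite mulrA ltW//; near: d; apply: near_scaled_lt => //; rewrite mulr_gt0.
  have d_K : 64 * (K ^+ 3 * d) <= 1.
    by rewrite mulrA ltW//; near: d; apply: near_scaled_lt => //; rewrite mulr_gt0 ?exprn_gt0.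
  have d_sq : d ^+ 2 <= d := ler_piMl (ltW d_gt0) (ltW d_lt1).
  have d_17 : 17 * d ^+ 2 <= 1.
    have d17 : 17 * d < 1 by near: d; exact: near_scaled_lt.
    exact: le_trans (ler_wpM2l (ler0n _ 17) d_sq) (ltW d17).
  have d_width s : s * s = 1 -> line_width (slope thetaL thetaR s) * d ^+ 2 < 1.
    have wd : w * d < 1 by near: d; exact: near_scaled_lt.
    move=> ss; apply: le_lt_trans wd; apply: ler_pM => //; rewrite ?sqr_ge0 ?ltW ?line_width_gt0//.
    by case: (sign_cases ss) => ->; [rewrite ltrDl|rewrite ltrDr]; exact: line_width_gt0.
  have S_inside : closure (raise d S0) `<=` Omega by near: d; exact: Sd_inside Sg.
  have A_inside : gap thetaL thetaR d 1 `<=` Omega.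
    have G : forall q : R, 0 < q <= 2 ->
      [/\ gap thetaL thetaR d q `<=` Omega `\` closure (raise d S0),
        frontier (gap thetaL thetaR d q) `&` disc q `&` [set x | 0 < x.2]
          `<=` frontier (raise d S0) &
        frontier (gap thetaL thetaR d q) `&` disc q `&` [set x | x.2 = 0]
          `<=` frontier Omega] by near: d; exact: gap_inside Sg.
    have [|+ _ _] := G 1; first by rewrite ltr01/= ler1n.
    by move=> G1 x /G1[].
  have pd : potential Omega (raise d S0) (phi d) by near: d; exact: pot.
  split.
  - exact: (energy_phit bL bR tip oO O_area rho_gt0 rho_le O_near t_eta eta01 D_eta D_chi d_gt0
      d_lt1 d_rho d_K d_17 d_width A_inside).
  - exact: (energy_difference bL bR tip oO bO Or O_area rho_gt0 rho_le O_near S_near t_eta eta01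
      eta_near D_eta D_chi d_gt0 d_lt1 d_e d_rho d_K d_17 d_width S_inside A_inside pd).
  - exact: (energy_outside bL bR tip oO bO Or O_area rho_gt0 rho_le O_near S_near t_eta eta01
      eta_near D_eta D_chi d_gt0 d_lt1 d_e d_rho d_17 d_width S_inside pd).
  - exact: (energy_total bL bR tip oO bO Or O_area rho_gt0 rho_le O_near S_near t_eta eta01
      eta_near D_eta D_chi d_gt0 d_lt1 d_e d_rho d_17 d_width S_inside pd).
  - exact: (mass_total bL bR tip oO bO Or O_area rho_gt0 rho_le O_near S_near t_eta eta01
      eta_near D_eta D_chi d_gt0 d_lt1 d_e d_rho d_17 d_width S_inside pd).
split; eexists; apply: filterS all5 => d [h1 h2 h3 h4 h5].
- exact: h1.
- by rewrite gee0_abs; [exact: h2|exact: grad_normsq_ge0].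
- by rewrite gee0_abs; [exact: h3|exact: grad_normsq_ge0].
- exact: h4.
- rewrite gee0_abs; [exact: h5|].
  by apply: integral_ge0 => x _; rewrite lee_fin sqr_ge0.
Unshelve. all: by end_near.
Qed.
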